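(* Let $\Omega$, $A$, $d$, $r$, $H$ be as in the context. Assume that (i) $b:\mathbb{R}\to\mathbb{R}$ is locally Lipschitz and bounded, i.e. there exists a constant $C_b$ such that $|b(w)|\le C_b$ for all $w\in\mathbb{R}$; (ii) $f:\Omega-\Omega\to\mathbb{R}$ is bounded; (iii) $\eta:H\to[0,r]$ is locally Lipschitz, i.e. for any $M>0$ there exists $L_{\eta,M}$ such that for all $(v^i,\psi^i)\in H$ with $\|v^i\|^2+\int_{-r}^0\|\psi^i(s)\|^2ds\le M^2$, $i=1,2$, one has $$|\eta(v^1,\psi^1)-\eta(v^2,\psi^2)|\le L_{\eta,M}\Big(\|v^1-v^2\|^2+\int_{-r}^0\|\psi^1(s)-\psi^2(s)\|^2ds\Big)^{1/2}.$$ Then for any $(u^0,\varphi)\in H$ and every $T>0$, the discrete state-dependent delay problem $$\frac{\partial}{\partial t}u(t,x)+Au(t,x)+du(t,x)=\int_\Omega b\big(u(t-\eta(u(t),u_t),y)\big)f(x-y)\,dy,\quad x\in\Omega,$$ $$u(0+)=u^0,\qquad u|_{(-r,0)}=\varphi,$$ has a weak limiting solution $u$ on $[0,T]$, and it satisfies $u\in C([0,T];L^2(\Omega))$.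
   Context: Setting. $\Omega\subset\mathbb{R}^{n_0}$ is a smooth bounded domain, $\Omega-\Omega=\{x-y:x,y\in\Omega\}$; $\|\cdot\|$ and $\langle\cdot,\cdot\rangle$ are the norm and inner product of $L^2(\Omega)$ (also used for the corresponding duality pairing). $A$ is a densely defined self-adjoint positive linear operator with domain $D(A)\subset L^2(\Omega)$ and compact resolvent; $\{e_k\}_{k\ge1}$ is an orthonormal basis of $L^2(\Omega)$ with $Ae_k=\lambda_ke_k$, the $\lambda_k>0$ in increasing order and tending to $+\infty$. $D(A^\alpha)$ denotes the domain of the power $A^\alpha$ (for $\alpha<0$ the completion of $L^2(\Omega)$ in the norm $\|A^\alpha\cdot\|$). $d>0$ and $r>0$ are constants. $H=L^2(\Omega)\times L^2(-r,0;L^2(\Omega))$. For $u$ defined on $(-r,T)$ and $t\in[0,T)$, $u_t(\theta)=u(t+\theta)$, $\theta\in(-r,0)$. Approximating distributed delays. Fix a sequence $\varepsilon_n>0$, $\varepsilon_n\to0$, and define $\xi^n:[-r,0]\times H\to\mathbb{R}$ by $\xi^n(\theta,a,\varphi)=1/\varepsilon_n$ if $\theta\in[-\eta(a,\varphi)-\varepsilon_n,-\eta(a,\varphi)]$ and $\xi^n(\theta,a,\varphi)=0$ otherwise. Put $$\big(F_n(u_t)\big)(x)=\int_{-r}^0\Big\{\int_\Omega b(u(t+\theta,y))f(x-y)\,dy\Big\}\,\xi^n(\theta,u(t),u_t)\,d\theta .$$ Galerkin approximate solutions. For $(u^0,\varphi)\in H$ and $n,m\in\mathbb{N}$, the Galerkin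 approximate solution $u^{n,m}$ of order $m$ is the function $u^{n,m}(t,x)=\sum_{k=1}^mg_{k,m}(t)e_k(x)$, with $g_{k,m}\in C^1(0,T;\mathbb{R})\cap L^2(-r,T;\mathbb{R})$ absolutely continuous on $[0,T]$, such that for all $k=1,\dots,m$ $$\langle\dot u^{n,m}+Au^{n,m}+du^{n,m}-F_n(u^{n,m}_t),e_k\rangle=0\ \text{ for } t\in(0,T),$$ $$\langle u^{n,m}(0+),e_k\rangle=\langle u^0,e_k\rangle,\qquad \langle u^{n,m}(\theta),e_k\rangle=\langle\varphi(\theta),e_k\rangle,\ \theta\in(-r,0).$$ Space $X_T$. $X_T=\big(L^\infty(0,T;L^2(\Omega))\cap L^2(0,T;D(A^{1/2}))\big)\times L^2(0,T;D(A^{-1/2}))$; *-weak convergence $(u^k;\dot u^k)\to(u;\dot u)$ in $X_T$ means: $u^k\to u$ weak-* in $L^\infty(0,T;L^2(\Omega))$ and weakly in $L^2(0,T;D(A^{1/2}))$, and $\dot u^k\to\dot u$ weakly in $L^2(0,T;D(A^{-1/2}))$. Weak limiting solution. A function $u$ is a weak limiting solution of the discrete delay problem with initial data $(u^0,\varphi)$ on $[0,T]$ if $u\in L^\infty(0,T;L^2(\Omega))\cap L^2(-r,T;L^2(\Omega))\cap L^2(0,T;D(A^{1/2}))$, $\dot u\in L^2(0,T;D(A^{-1/2}))$, $u(\theta)=\varphi(\theta)$ for $\theta\in(-r,0)$, and there is a sequence of pairs $(n_i,m_i)\in\mathbb{N}^2$ with $\min\{n_i,m_i\}\to\infty$ such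 that $(u^{n_i,m_i};\dot u^{n_i,m_i})$ converges *-weakly to $(u;\dot u)$ in $X_T$, where $u^{n,m}$ are the Galerkin approximate solutions with the same initial data $(u^0,\varphi)$. *)

(* Defs.v *)
From HB Require Import structures.
From mathcomp Require Import all_boot all_order all_algebra.
From mathcomp Require Import all_classical all_reals all_analysis.
From mathcomp Require Import lra.

Set Implicit Arguments.
Unset Strict Implicit.
Unset Printing Implicit Defensive.
Import Order.TTheory GRing.Theory Num.Theory numFieldNormedType.Exports.
Local Open Scope classical_set_scope.
Local Open Scope ring_scope.

(* The Borel sets of R^n: generated by the coordinates (they contain the open
   sets, open_measurable_rV). *)
Definition rV_display : measure_display. Proof. exact: default_measure_display. Qed.

Section rV_measurable.
Variables (R : realType) (n : nat).

Definition rV_coord (i : 'I_n) (x : 'rV[R]_n) : measurableTypeR R := x 0 i.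

Let rV0 : g_sigma_preimage rV_coord set0.
Proof. exact: sigma_algebra0. Qed.
Let rVC A : g_sigma_preimage rV_coord A -> g_sigma_preimage rV_coord (~` A).
Proof. exact: sigma_algebraC. Qed.
Let rVU (F : (set 'rV[R]_n)^nat) : (forall i, g_sigma_preimage rV_coord (F i)) ->
  g_sigma_preimage rV_coord (\bigcup_i F i).
Proof. exact: sigma_algebra_bigcup. Qed.

HB.instance Definition _ := @isMeasurable.Build rV_display 'rV[R]_n
  (g_sigma_preimage rV_coord) rV0 rVC rVU.

Lemma measurable_rV_coord (i : 'I_n) : measurable_fun setT (rV_coord i).
Proof.
move=> _ Y mY; rewrite setTI; apply: sub_sigma_algebra => /=.
rewrite -bigcup_seq/=; exists i => /=; first by rewrite mem_index_enum.
by exists Y => //; rewrite setTI.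
Qed.

Lemma measurable_fun_rVP d (T : measurableType d) (f : T -> 'rV[R]_n) :
  measurable_fun setT f <-> forall i, measurable_fun setT (rV_coord i \o f).
Proof.
split=> [mf i|mf].
  by apply: measurableT_comp => //; exact: measurable_rV_coord.
move=> _ A mA; rewrite setTI.
suff : g_sigma_preimage rV_coord `<=` [set B | measurable (f @^-1` B)] by exact.
apply: smallest_sub.
  split=> /=.
  - by rewrite preimage_set0.
  - by move=> B mB; rewrite setTD preimage_setC; exact: measurableC.
  - by move=> F mF; rewrite preimage_bigcup; exact: bigcup_measurable.
rewrite -bigcup_seq => B [i _ [C mC <-]] /=.
rewrite setTI; have := mf i measurableT C mC.
by rewrite setTI.
Qed.

End rV_measurable.

Section lebesgue_rV.
Variable R : realType.

Definition rV_cons n (p : measurableTypeR R * 'rV[R]_n) : 'rV[R]_n.+1 :=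
  row_mx (const_mx p.1 : 'rV_1) p.2.

Lemma rV_cons0 n p : @rV_cons n p 0 0 = p.1.
Proof.
rewrite /rV_cons; have -> : (0 : 'I_n.+1) = lshift n (0 : 'I_1) by exact/val_inj.
by rewrite (@row_mxEl R 1 1 n) mxE.
Qed.

Lemma rV_cons_lift n p (j : 'I_n) : rV_cons p 0 (lift ord0 j) = p.2 0 j.
Proof.
rewrite /rV_cons; have -> : lift ord0 j = rshift 1 j by exact/val_inj.
by rewrite (@row_mxEr R 1 1 n).
Qed.

Lemma measurable_rV_cons n : measurable_fun setT (@rV_cons n).
Proof.
apply/measurable_fun_rVP => i; have [j ->|->] := unliftP ord0 i.
  apply: (eq_measurable_fun (rV_coord j \o snd)) => [p _|].
    by rewrite /rV_coord /= rV_cons_lift.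
  by apply: measurableT_comp; [exact: measurable_rV_coord|exact: measurable_snd].
apply: (eq_measurable_fun fst) => [p _|]; last exact: measurable_fst.
by rewrite /rV_coord /= rV_cons0.
Qed.

Section rV_lebesgue_step.
Variables (n : nat) (mu : {sigma_finite_measure set 'rV[R]_n -> \bar R}).

Definition rV_lebesgue_step : set 'rV[R]_n.+1 -> \bar R :=
  pushforward (lebesgue_measure \x mu)%E (@rV_cons n).

Let step0 : rV_lebesgue_step set0 = 0%E.
Proof. by rewrite /rV_lebesgue_step /pushforward preimage_set0 measure0. Qed.

Let step_ge0 A : (0 <= rV_lebesgue_step A)%E.
Proof. by rewrite /rV_lebesgue_step /pushforward; apply: integral_ge0 => x _. Qed.

Let step_sigma_additive : semi_sigma_additive rV_lebesgue_step.
Proof.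
move=> F mF tF mUF; rewrite /rV_lebesgue_step /pushforward preimage_bigcup.
apply: measure_semi_sigma_additive.
- by move=> k; rewrite -[X in measurable X]setTI; exact: measurable_rV_cons.
- apply/trivIsetP => /= i j _ _ ij; rewrite -preimage_setI.
  by move/trivIsetP : tF => /(_ _ _ _ _ ij) ->//; rewrite preimage_set0.
- by rewrite -preimage_bigcup -[X in measurable X]setTI;
    exact: measurable_rV_cons.
Qed.

HB.instance Definition _ := isMeasure.Build _ _ _ rV_lebesgue_step
  step0 step_ge0 step_sigma_additive.

Lemma rV_lebesgue_stepE (A : set R) (B : set 'rV[R]_n) :
  measurable (A : set (measurableTypeR R)) -> measurable B ->
  rV_lebesgue_step [set x : 'rV[R]_n.+1 | A (x 0 0) /\ B (\row_j x 0 (lift ord0 j))] =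
  (lebesgue_measure A * mu B)%E.
Proof.
move=> mA mB; rewrite /rV_lebesgue_step /pushforward.
rewrite -(product_measure1E lebesgue_measure mu mA mB); congr (_ _).
have rowE p : \row_j rV_cons p 0 (lift ord0 j) = p.2 :> 'rV[R]_n.
  by apply/rowP => j; rewrite mxE rV_cons_lift.
by apply/seteqP; split=> [[x v]|[x v]] /=; rewrite rV_cons0 rowE.
Qed.

Let step_sigma_finite : sigma_finite setT rV_lebesgue_step.
Proof.
have /sigma_finiteP[F [TF ndF Foo]] := sigma_finiteT (@lebesgue_measure R).
have /sigma_finiteP[G [TG ndG Goo]] := sigma_finiteT mu.
exists (fun k => [set x : 'rV[R]_n.+1 | F k (x 0 0) /\ G k (\row_j x 0 (lift ord0 j))]).
  rewrite predeqE => x; split=> // _.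
  have [i _ Fi] : (\bigcup_i F i) (x 0 0) by rewrite -TF.
  have [j _ Gj] : (\bigcup_i G i) (\row_j x 0 (lift ord0 j)) by rewrite -TG.
  exists (maxn i j) => //; split.
    by move: Fi; exact/subsetPset/ndF/leq_maxl.
  by move: Gj; exact/subsetPset/ndG/leq_maxr.
move=> k; have [? ?] := Foo k; have [? ?] := Goo k; split; last first.
  by rewrite rV_lebesgue_stepE// lte_mul_pinfty// ge0_fin_numE.
apply: measurableI; rewrite -[X in measurable X]setTI.
  exact: (@measurable_rV_coord R n.+1 ord0).
have mt : measurable_fun setT (fun x : 'rV[R]_n.+1 =>
    (\row_j x 0 (lift ord0 j)) : 'rV[R]_n).
  apply/measurable_fun_rVP => j; apply: (eq_measurable_fun (rV_coord (lift ord0 j))).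
    by move=> x _; rewrite /rV_coord /= mxE.
  exact: measurable_rV_coord.
exact: mt.
Qed.

HB.instance Definition _ :=
  Measure_isSigmaFinite.Build _ _ _ rV_lebesgue_step step_sigma_finite.

End rV_lebesgue_step.

(* n-dimensional Lebesgue measure, as an iterated product; see rV_lebesgue_box. *)
Fixpoint rV_lebesgue n : {sigma_finite_measure set 'rV[R]_n -> \bar R} :=
  match n with
  | 0 => \d_(0 : 'rV[R]_0)
  | k.+1 => rV_lebesgue_step (rV_lebesgue k)
  end.

Lemma rV_lebesgue_box n (a b : 'rV[R]_n) : (forall i, a 0 i <= b 0 i) ->
  rV_lebesgue n [set x | forall i, a 0 i <= x 0 i <= b 0 i] =
  (\prod_(i < n) (b 0 i - a 0 i))%:E.
Proof.
elim: n a b => [|n IH] a b ab.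
  rewrite big_ord0 /= diracE mem_set//=; by case.
set a' : 'rV[R]_n := \row_j a 0 (lift ord0 j).
set b' : 'rV[R]_n := \row_j b 0 (lift ord0 j).
have ab' i : a' 0 i <= b' 0 i by rewrite !mxE.
pose B := [set y : 'rV[R]_n | forall i, a' 0 i <= y 0 i <= b' 0 i].
have mB : measurable B.
  rewrite (_ : B = \bigcap_(i in [set: 'I_n])
     ((@rV_coord R n i) @^-1` `[a' 0 i, b' 0 i]%classic)).
    apply: fin_bigcap_measurable; first exact: finite_finset.
    by move=> i _; rewrite -[X in measurable X]setTI; exact: measurable_rV_coord.
  apply/seteqP; split=> x /= h i; first by move=> _; rewrite /rV_coord /= in_itv/= h.
  by have := h i Logic.I; rewrite /rV_coord /= in_itv.
transitivity (rV_lebesgue_step (rV_lebesgue n)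
    [set x : 'rV[R]_n.+1 | `[a 0 0, b 0 0]%classic (x 0 0) /\
       B (\row_j x 0 (lift ord0 j))]).
  congr (rV_lebesgue_step _ _); apply/seteqP; split=> x /=.
    by move=> h; rewrite in_itv/= h; split=> // i; rewrite !mxE.
  move=> [+ h] i; rewrite in_itv/= => h0; have [j ->|->//] := unliftP ord0 i.
  by have := h j; rewrite !mxE.
rewrite rV_lebesgue_stepE// [X in (_ * X)%E]IH// big_ord_recl EFinM.
rewrite lebesgue_measure_itv/= lte_fin; congr (_ * _)%E.
  by have := ab 0; rewrite le_eqVlt => /orP[/eqP->|->]; rewrite ?ltxx ?subrr.
by congr EFin; apply: eq_bigr => i _; rewrite !mxE.
Qed.

Lemma open_measurable_rV n (U : set 'rV[R]_n) : open U -> measurable U.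
Proof.
move=> oU.
pose box (q : 'rV[rat]_n * rat) : set 'rV[R]_n :=
  [set x | forall i, `|x 0 i - ratr (q.1 0 i)| < (ratr q.2 : R)].
have mbox q : measurable (box q).
  rewrite (_ : box q = \bigcap_(i in [set: 'I_n]) ((@rV_coord R n i) @^-1`
     `]ratr (q.1 0 i) - ratr q.2, ratr (q.1 0 i) + ratr q.2[%classic)).
    apply: fin_bigcap_measurable; first exact: finite_finset.
    by move=> i _; rewrite -[X in measurable X]setTI; exact: measurable_rV_coord.
  apply/seteqP; split=> x /= h i.
    by move=> _; rewrite /rV_coord /= in_itv/= -ltr_distl.
  by have := h i Logic.I; rewrite /rV_coord /= in_itv/= -ltr_distl.
rewrite (_ : U = \bigcup_(q in [set q | box q `<=` U]) box q).
  rewrite bigcup_mkcond; apply: countable_bigcupT_measurable => [|q].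
    exact: countableP.
  by case: ifP => _; [exact: mbox|exact: measurable0].
apply/seteqP; split=> [x Ux|x [q qU qx]]; last exact: qU.
have /nbhs_ballP[e e0 eU] : nbhs x U by apply: open_nbhs_nbhs; split.
have [s /andP[s0 se]] : exists s : rat, 0 < (ratr s : R) < e / 2.
  have /rat_in_itvoo[s] : 0 < e / 2 by rewrite divr_gt0.
  by rewrite in_itv; exists s.
have qP i : exists q : rat, `|x 0 i - ratr q| < (ratr s : R).
  have /rat_in_itvoo[q] : x 0 i - ratr s < x 0 i + ratr s by lra.
  by rewrite in_itv/= -ltr_distl distrC; exists q.
pose c : 'rV[rat]_n := \row_i projT1 (cid (qP i)).
have cP i : `|x 0 i - ratr (c 0 i)| < ratr s by rewrite mxE; case: cid.
exists (c, s) => //= y yc; apply: eU; split=> // k i; rewrite (ord1 k).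
rewrite /ball/=; apply: (le_lt_trans (ler_distD (ratr (c 0 i)) _ _)).
by rewrite (splitr e) ltrD// ?(lt_trans (cP i))// distrC (lt_trans (yc i)).
Qed.

End lebesgue_rV.

Section domains.
Variables (R : realType) (n : nat).
Implicit Types (Om U : set 'rV[R]_n).

Definition iter_partial (s : seq 'I_n) (f : 'rV[R]_n -> R) : 'rV[R]_n -> R :=
  foldr (fun i h x => 'D_(delta_mx 0 i) h x) f s.

(* f is C^infinity on the open set U *)
Definition smooth_on U (f : 'rV[R]_n -> R) :=
  forall (s : seq 'I_n) x, U x ->
    {for x, continuous (iter_partial s f)} /\
    forall i, derivable (iter_partial s f) x (delta_mx 0 i).

(* the boundary is locally the regular zero set of a smooth function which is
   negative exactly inside the domain *)
Definition smooth_boundary Om :=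
  forall p, (closure Om `\` Om) p ->
    exists U (rho : 'rV[R]_n -> R),
      [/\ open U, U p, smooth_on U rho,
          exists i, 'D_(delta_mx 0 i) rho p != 0 &
          Om `&` U = [set x | U x /\ rho x < 0]].

Definition smooth_bounded_domain Om :=
  [/\ open Om, connected Om, Om !=set0, bounded_set Om & smooth_boundary Om].

Definition difference_set Om : set 'rV[R]_n := [set x - y | x in Om & y in Om].

(* measurability for the completed (Lebesgue) sigma-algebra *)
Definition lebesgue_measurable_on (D : set 'rV[R]_n) (f : 'rV[R]_n -> R) :=
  exists2 h : 'rV[R]_n -> R, measurable_fun setT h &
    (rV_lebesgue R n).-negligible [set z | D z /\ f z != h z].

End domains.

(* Spaces of classes of functions are handled through representatives: a
   prehilbert is a vector space of representatives, the set of those that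
   belong to the space, and a semi-inner product; two representatives of the
   same element are at phnorm-distance 0.  The record is pure data. *)
Record prehilbert (R : realType) := Prehilbert {
  ph_sort :> lmodType R ;
  ph_mem : set ph_sort ;
  ph_ip : ph_sort -> ph_sort -> R }.

Section prehilbert_theory.
Variables (R : realType) (E : prehilbert R).

Definition phnorm (x : E) : R := Num.sqrt (ph_ip x x).

Definition pheq (x y : E) := phnorm (x - y) = 0.

Definition ph_cauchy (s : nat -> E) :=
  (forall i, ph_mem (s i)) /\
  forall eps : R, 0 < eps -> exists N : nat, forall i j : nat,
    (N <= i)%N -> (N <= j)%N -> phnorm (s i - s j) < eps.

(* The completion: Cauchy sequences, the inner product being the limit of the
   inner products; E embeds by constant sequences. *)
Definition completion : prehilbert R :=
  @Prehilbert R (nat -> E) ph_cauchy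
    (fun s s' => limn (fun j => ph_ip (s j) (s' j))).

Definition completion_inj (x : E) : completion := fun=> x.

End prehilbert_theory.

Section Bochner.
Variables (R : realType) (E : prehilbert R).
Implicit Types (I : set R) (u v : R -> E).

Let mu := @lebesgue_measure R.

Definition simple_vfun (s : R -> E) :=
  exists (k : nat) (B : 'I_k -> set (measurableTypeR R)) (x : 'I_k -> E),
    (forall i, measurable (B i) /\ ph_mem (x i)) /\
    s = (fun t => \sum_(i < k) \1_(B i) t *: x i).

Definition strongly_measurable I u :=
  exists s : nat -> R -> E, (forall j, simple_vfun (s j)) /\
    {ae mu, forall t, I t -> ph_mem (u t) /\
              phnorm (s j t - u t) @[j --> \oo] --> (0 : R)}.

Definition bochner_L1 I u :=
  strongly_measurable I u /\ (\int[mu]_(t in I) (phnorm (u t))%:E < +oo)%E.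

Definition bochner_L2 I u :=
  strongly_measurable I u /\
  (\int[mu]_(t in I) (phnorm (u t) ^+ 2)%:E < +oo)%E.

Definition bochner_Linfty I u :=
  strongly_measurable I u /\
  exists C : R, {ae mu, forall t, I t -> phnorm (u t) <= C}.

Definition bochner_ip I u v : R := \int[mu]_(t in I) ph_ip (u t) (v t).

Definition weak_cvg_L2 I (us : nat -> R -> E) u :=
  forall v, bochner_L2 I v ->
    bochner_ip I (us i) v @[i --> \oo] --> bochner_ip I u v.

(* L^infty(I; E) is seen as the dual of L^1(I; E) *)
Definition weakstar_cvg_Linfty I (us : nat -> R -> E) u :=
  forall v, bochner_L1 I v ->
    bochner_ip I (us i) v @[i --> \oo] --> bochner_ip I u v.

Definition continuous_on_segment (a b : R) u :=
  forall t, t \in `[a, b] -> ph_mem (u t) /\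
    phnorm (u s - u t) @[s --> within `[a, b]%classic (nbhs t)] --> (0 : R).

End Bochner.

Section real_functions.
Variable R : realType.

Definition absolutely_continuous (a b : R) (g : R -> R) :=
  forall eps : R, 0 < eps -> exists2 del : R, 0 < del &
    forall l : seq (R * R),
      all (fun p => (a <= p.1) && (p.1 <= p.2) && (p.2 <= b)) l ->
      pairwise (fun p q => (p.2 <= q.1) || (q.2 <= p.1)) l ->
      \sum_(p <- l) (p.2 - p.1) < del ->
      \sum_(p <- l) `|g p.2 - g p.1| < eps.

Definition C1_on (a b : R) (g : R -> R) :=
  forall t, t \in `]a, b[ -> derivable g t 1 /\ {for t, continuous (derive1 g)}.

(* psi belongs to C_c^infinity(a, b) *)
Definition test_function (a b : R) (psi : R -> R) :=
  (forall k t, derivable (derive1n k psi) t 1) /\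
  exists c c' : R, [/\ a < c, c' < b & forall t, t \notin `[c, c'] -> psi t = 0].

End real_functions.

Section L2_space.
Variables (R : realType) (n : nat) (Om : set 'rV[R]_n).

Definition L2 : prehilbert R :=
  @Prehilbert R ('rV[R]_n -> R)
    [set g | (g \_ Om) \in Lfun (rV_lebesgue R n) 2%:E]
    (fun g h => \int[rV_lebesgue R n]_(x in Om) (g x * h x)).

(* An operator is a function A together with its domain DA; both act on
   representatives. *)
Variables (DA : set L2) (A : L2 -> L2).

Definition linear_operator :=
  [/\ DA `<=` @ph_mem R L2,
      forall u, DA u -> ph_mem (A u),
      DA 0,
      forall (a : R) u v, DA u -> DA v -> DA (a *: u + v) &
      forall (a : R) u v, DA u -> DA v -> pheq (A (a *: u + v)) (a *: A u + A v)].

Definition densely_defined :=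
  forall v : L2, ph_mem v -> forall eps : R, 0 < eps ->
    exists2 u, DA u & phnorm (v - u) < eps.

(* (v, w) is in the graph of A iff it is in the graph of the adjoint of A *)
Definition self_adjoint :=
  forall v w : L2, ph_mem v -> ph_mem w ->
    (DA v /\ pheq (A v) w) <-> (forall u, DA u -> ph_ip (A u) v = ph_ip u w).

Definition positive_operator := forall u, DA u -> 0 <= ph_ip (A u) u.

Definition compact_operator (K : L2 -> L2) :=
  forall v : nat -> L2, (forall j, ph_mem (v j)) ->
    (exists C : R, forall j, phnorm (v j) <= C) ->
    exists sigma : nat -> nat, {homo sigma : i j / (i < j)%N} /\
      exists2 w : L2, ph_mem w &
        phnorm (K (v (sigma j)) - w) @[j --> \oo] --> (0 : R).

Definition compact_resolvent :=
  exists (zeta : R) (K : L2 -> L2),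
    [/\ forall v, ph_mem v -> DA (K v) /\ pheq (A (K v) - zeta *: K v) v,
        forall u, DA u -> pheq (K (A u - zeta *: u)) u &
        compact_operator K].

Definition orthonormal_basis (e : nat -> L2) :=
  [/\ forall k, ph_mem (e k),
      forall k l, ph_ip (e k) (e l) = (k == l)%:R &
      forall v : L2, ph_mem v ->
        phnorm (v - \sum_(k < m) ph_ip v (e k) *: e k) @[m --> \oo] --> (0 : R)].

Definition eigenpairs (e : nat -> L2) (lam : nat -> R) :=
  forall k, DA (e k) /\ pheq (A (e k)) (lam k *: e k).

Section powers.
Variables (e : nat -> L2) (lam : nat -> R).

(* w = A^alpha v = \sum_k lam_k^alpha <v, e_k> e_k *)
Definition is_power (alpha : R) (v w : L2) :=
  [/\ ph_mem v, ph_mem w &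
    phnorm (\sum_(k < m) (lam k `^ alpha * ph_ip v (e k)) *: e k - w)
      @[m --> \oo] --> (0 : R)].

Definition powerA (alpha : R) (v : L2) : L2 := xget 0 [set w | is_power alpha v w].

(* The domain of A^alpha with the norm ||A^alpha v|| *)
Definition D_power (alpha : R) : prehilbert R :=
  @Prehilbert R L2 [set v | exists w, is_power alpha v w]
    (fun u v => ph_ip (powerA alpha u) (powerA alpha v)).

(* D(A^alpha) for alpha < 0; then D_power alpha is the whole of L2 under
   ||A^alpha v||. *)
Definition D_negpower (alpha : R) : prehilbert R := completion (D_power alpha).

(* The pairing of D(A^{-1/2}) and D(A^{1/2}) extending the inner product. *)
Definition duality (w : D_negpower (- 2^-1)) (v : L2) : R :=
  limn (fun j => ph_ip (w j : L2) v).

(* du is the derivative of u in the sense of D(A^{-1/2})-valued distributions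
   on (0, T) *)
Definition time_derivative (T : R) (u : R -> L2) (du : R -> D_negpower (- 2^-1)) :=
  forall (v : L2) (psi : R -> R),
    @ph_mem R (D_power 2^-1) v -> test_function 0 T psi ->
    \int[@lebesgue_measure R]_(t in `]0, T[) (ph_ip (u t) v * derive1 psi t) =
    - \int[@lebesgue_measure R]_(t in `]0, T[) (duality (du t) v * psi t).

Definition in_XT (T : R) (u : R -> L2) (du : R -> D_negpower (- 2^-1)) :=
  [/\ bochner_Linfty `]0, T[%classic u,
      @bochner_L2 R (D_power 2^-1) `]0, T[%classic u &
      bochner_L2 `]0, T[%classic du].

Definition XT_weakstar_cvg (T : R)
    (us : nat -> R -> L2) (dus : nat -> R -> D_negpower (- 2^-1))
    (u : R -> L2) (du : R -> D_negpower (- 2^-1)) :=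
  [/\ weakstar_cvg_Linfty `]0, T[%classic us u,
      @weak_cvg_L2 R (D_power 2^-1) `]0, T[%classic us u &
      weak_cvg_L2 `]0, T[%classic dus du].

End powers.

Section delay.
Variable r : R.

Definition in_H (v : L2) (psi : R -> L2) :=
  ph_mem v /\ bochner_L2 `]- r, 0[%classic psi.

Definition normH2 (v : L2) (psi : R -> L2) : R :=
  phnorm v ^+ 2 +
  \int[@lebesgue_measure R]_(s in `]- r, 0[) (phnorm (psi s) ^+ 2).

(* As the distance vanishes between representatives of the same point of H,
   this forces eta to be a function of the classes. *)
Definition locally_lipschitz_H (eta : L2 -> (R -> L2) -> R) :=
  forall M : R, 0 < M -> exists L : R,
    forall v1 psi1 v2 psi2, in_H v1 psi1 -> in_H v2 psi2 ->
      normH2 v1 psi1 <= M ^+ 2 -> normH2 v2 psi2 <= M ^+ 2 ->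
      `|eta v1 psi1 - eta v2 psi2| <=
        L * Num.sqrt (normH2 (v1 - v2) (fun s => psi1 s - psi2 s)).

Definition history (u : R -> L2) (t : R) : R -> L2 := fun theta => u (t + theta).

Variables (eps : nat -> R) (b : R -> R) (f : 'rV[R]_n -> R).
Variable eta : L2 -> (R -> L2) -> R.

Definition xi (N : nat) (theta : R) (v : L2) (psi : R -> L2) : R :=
  if - eta v psi - eps N <= theta <= - eta v psi then (eps N)^-1 else 0.

(* F N u t is F_N(u_t) *)
Definition F (N : nat) (u : R -> L2) (t : R) : L2 := fun x =>
  \int[@lebesgue_measure R]_(theta in `[- r, 0])
    ((\int[rV_lebesgue R n]_(y in Om) (b (u (t + theta) y) * f (x - y))) *
     xi N theta (u t) (history u t)).

Variables (e : nat -> L2) (lam : nat -> R) (d : R).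

Definition galerkin_fun (m : nat) (g : nat -> R -> R) (t : R) : L2 :=
  \sum_(k < m) g k t *: e k.

(* the coefficients g of a Galerkin approximate solution of order m, for the
   delay of index N *)
Definition galerkin_solution (T : R) (u0 : L2) (phi : R -> L2) (N m : nat)
    (g : nat -> R -> R) :=
  let u := galerkin_fun m g in
  let du := galerkin_fun m (fun k => derive1 (g k)) in
  forall k : nat, (k < m)%N ->
  [/\ [/\ C1_on 0 T (g k),
          (g k \_ `]- r, T[%classic) \in Lfun (@lebesgue_measure R) 2%:E &
          absolutely_continuous 0 T (g k)],
      forall t, t \in `]0, T[ ->
        ph_ip (du t + A (u t) + d *: u t - F N u t) (e k) = 0,
      ph_ip (u t) (e k) @[t --> 0^'+] --> ph_ip u0 (e k) &
      {ae @lebesgue_measure R, forall theta, theta \in `]- r, 0[ ->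
        ph_ip (u theta) (e k) = ph_ip (phi theta) (e k)}].

Definition weak_limiting_solution (T : R) (u0 : L2) (phi : R -> L2)
    (u : R -> L2) :=
  exists du : R -> D_negpower e lam (- 2^-1),
  [/\ in_XT T u du /\ bochner_L2 `]- r, T[%classic u,
      time_derivative T u du,
      {ae @lebesgue_measure R, forall theta, theta \in `]- r, 0[ ->
        pheq (u theta) (phi theta)} &
      exists (N m : nat -> nat) (g : nat -> nat -> R -> R),
      [/\ minn (N i) (m i) @[i --> \oo] --> \oo,
          forall i, galerkin_solution T u0 phi (N i) (m i) (g i),
          forall i, in_XT T (galerkin_fun (m i) (g i))
            (fun t => completion_inj
               (galerkin_fun (m i) (fun k => derive1 (g i k)) t
                  : D_power e lam (- 2^-1))) &
          XT_weakstar_cvg T (fun i => galerkin_fun (m i) (g i))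
            (fun i t => completion_inj
               (galerkin_fun (m i) (fun k => derive1 (g i k)) t
                  : D_power e lam (- 2^-1)))
            u du]].

End delay.

End L2_space.

(* Main.v *)
Require Import Defs.
From HB Require Import structures.
From mathcomp Require Import all_boot all_order all_algebra.
From mathcomp Require Import all_classical all_reals all_analysis.
From mathcomp Require Import measurable_realfun.
From mathcomp Require Import ring lra.

(** In the eigenbasis the Galerkin system reads c_k' = - (lam_k + d) c_k + G_k, where
G_k is the k-th coordinate of F_n(u_t).  Because F_n averages the delayed values over
a window of length eps_n, G is continuous along bounded, pointwise convergent
families of coefficients, whatever the regularity of the initial history.  Hence
Tonelli's scheme (delay the source by del, let del tend to 0) solves the mild form of
the system: the sources are bounded, so they converge weakly in L^2(0,T) along a
subsequence, and weak convergence of the sources is pointwise convergence of the modes.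

As |b| <= C_b, the sum of the G_k^2 is bounded by a constant K^2 that depends neither
on n nor on m.  Testing the k-th equation with c_k gives the bounds in X_T and the
estimate sum_(k >= m) c_k(t)^2 <= sum_(k >= m) <u0, e_k>^2 + K^2 T / lam_m.  The same
compactness argument, applied to the sources with n = m, gives the weak limit; its
modes are continuous and obey the tail estimate, whence continuity in L^2. *)

Set Implicit Arguments.
Unset Strict Implicit.
Unset Printing Implicit Defensive.
Import Order.TTheory GRing.Theory Num.Theory numFieldNormedType.Exports.
Local Open Scope classical_set_scope.
Local Open Scope ring_scope.

(** The obstacle is that every datum of the delay term is rough: the history is only square
    integrable in time, [eta] is Lipschitz only for the norm of H, and the delayed value sits at a
    moving point. Three facts restore continuity: translations are continuous in L^2, so [eta] is
    continuous along the histories; after the substitution s = t + theta, time enters only through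
    the ends of the window; and those ends form a null set. No Lipschitz estimate for the field is
    at hand, hence Tonelli's scheme, which asks for causality, a bound and continuity.

    All modes k are solved for, also those with k >= m: they are driven by the same source but do
    not act on it. Duhamel's formula being linear in the source, weak limits are taken mode by mode,
    in place of a compactness theorem of Aubin-Lions type; in the final passage the source stays an
    abstract weak limit [z].

    Members of the spaces are representatives and the Borel sigma-algebras are not complete, so
    measurability, norms and weak convergence are all read off Borel coordinates in the orthonormal
    bases lam_k^(-al) e_k of D(A^al). *)

(** * Subsequences *)

Section diagonal_extraction.
Variable R : realType.

Lemma increasing_seq_ge (s : nat -> nat) :
  {homo s : i j / (i < j)%N} -> forall i, (i <= s i)%N.
Proof.
by move=> hs; elim=> // i IH; apply: (leq_ltn_trans IH); exact: hs.
Qed.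

Lemma increasing_seq_cvg (s : nat -> nat) :
  {homo s : i j / (i < j)%N} -> s i @[i --> \oo] --> \oo.
Proof.
move=> hs A [N _ NA]; exists N => // i /= Ni; apply: NA => /=.
exact: (leq_trans Ni (increasing_seq_ge hs i)).
Qed.

Lemma increasing_seq_of_frequently (P : nat -> nat -> Prop) :
  (forall n N, exists2 i, (N <= i)%N & P n i) ->
  exists2 s : nat -> nat, {homo s : i j / (i < j)%N} & forall n, P n (s n).
Proof.
move=> hP; pose nxt n N := projT1 (cid2 (hP n N)).
have nxtP n N : (N <= nxt n N)%N /\ P n (nxt n N).
  by rewrite /nxt; case: (cid2 _).
pose s := fix s n := if n is p.+1 then nxt n (s p).+1 else nxt 0%N 0%N.
exists s; last by case=> [|n] /=; apply: (nxtP _ _).2.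
apply: homo_ltn; first exact: ltn_trans.
by move=> n /=; exact: (nxtP n.+1 (s n).+1).1.
Qed.

(* The limits along a free ultrafilter of nat are approached simultaneously by
   infinitely many terms. *)
Lemma diagonal_subsequence (a : nat -> nat -> R) (C : nat -> R) :
  (forall k i, `|a k i| <= C k) ->
  exists2 s : nat -> nat, {homo s : i j / (i < j)%N} &
    forall k, cvgn (fun i => a k (s i)).
Proof.
move=> aC.
have [U [UU sU]] := ultraFilterLemma (eventually_filter : ProperFilter (\oo : set_system nat)).
have hl k : exists l : R, a k @ U --> l.
  have aUC : (a k @ U) `[- C k, C k]%classic.
    by apply: (@filterS _ U) (@filterT _ U _) => i _ /=; rewrite in_itv /= -ler_norml.
  have [l [_ cl]] := @segment_compact R (- C k) (C k) (a k @ U) _ aUC.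
  (* A cluster point of an ultrafilter is a limit: were the complement of a neighbourhood of [l] in
     the image of [U], it would have to meet that neighbourhood. *)
  exists l => B Bl; rewrite /= /nbhs /=.
  have [//|UnB] := in_ultra_setVsetC (a k @^-1` B) UU.
  have [x [/= nBx Bx]] := cl (~` B) B UnB Bl; by [].
pose l k := projT1 (cid (hl k)).
have lP k : a k @ U --> l k by rewrite /l; case: cid.
have [s hs sP] : exists2 s : nat -> nat, {homo s : i j / (i < j)%N} &
    forall n, forall k, (k < n)%N -> `|a k (s n) - l k| < n.+1%:R^-1.
  apply: (@increasing_seq_of_frequently
    (fun n i => forall k, (k < n)%N -> `|a k i - l k| < n.+1%:R^-1)) => n N.
  have : U ([set i | (N <= i)%N] `&`
      \bigcap_(k in [set k | (k < n)%N]) [set i | `|a k i - l k| < n.+1%:R^-1]).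
    apply: filterI; first by apply: sU; exists N.
    elim: {1}n => [|p IH].
      by apply: filterS (@filterT _ U _) => i _ k.
    have Up : U [set i | `|a p i - l p| < n.+1%:R^-1].
      by have /cvgr_distC_lt := lP p; apply; rewrite invr_gt0.
    apply: filterS (filterI IH Up) => i [/= h1 h2] k /=.
    by rewrite ltnS leq_eqVlt => /orP[/eqP ->|/h1].
  by move=> /filter_ex[i [Ni iP]]; exists i => // k kn; exact: iP.
exists s => // k; apply/cvg_ex; exists (l k).
apply/cvgrPdistC_lt => e e0.
have [N Ne] : exists N : nat, (N.+1%:R^-1 : R) < e.
  have := near_infty_natSinv_lt (PosNum e0) => -[N _ /(_ N (leqnn _))]; by exists N.
exists (maxn k.+1 N) => // i /=; rewrite geq_max => /andP[ki Ni].
apply: (lt_trans (sP i k ki)); apply: le_lt_trans Ne.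
by rewrite lef_pV2 ?posrE ?ltr0n// ler_nat.
Qed.

End diagonal_extraction.

(** The laws are asked of members only: on other representatives [ph_ip] has no meaning, for
    instance it may be the integral of a product that is not integrable. *)
Record prehilbert_axioms (R : realType) (E : prehilbert R) : Prop := {
  ph_mem0 : @ph_mem R E 0 ;
  ph_memP : forall (a : R) (x y : E), ph_mem x -> ph_mem y -> ph_mem (a *: x + y) ;
  ph_ipC : forall x y : E, ph_mem x -> ph_mem y -> ph_ip x y = ph_ip y x ;
  ph_ipP : forall (a : R) (x y z : E), ph_mem x -> ph_mem y -> ph_mem z ->
    ph_ip (a *: x + y) z = a * ph_ip x z + ph_ip y z ;
  ph_ip_ge0 : forall x : E, ph_mem x -> 0 <= ph_ip x x }.

(** * Spaces with a semi-inner product *)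

Section prehilbert_lemmas.
Variables (R : realType) (E : prehilbert R).
Hypothesis hE : prehilbert_axioms E.
Implicit Types x y z : E.

Lemma ph_memZ (a : R) x : ph_mem x -> ph_mem (a *: x).
Proof. by move=> mx; rewrite -[_ *: _]addr0; apply: (ph_memP hE) => //; exact: ph_mem0. Qed.

Lemma ph_memD x y : ph_mem x -> ph_mem y -> ph_mem (x + y).
Proof. by move=> mx my; rewrite -[x]scale1r; exact: (ph_memP hE). Qed.

Lemma ph_memN x : ph_mem x -> ph_mem (- x).
Proof. by move=> mx; rewrite -scaleN1r; exact: ph_memZ. Qed.

Lemma ph_memB x y : ph_mem x -> ph_mem y -> ph_mem (x - y).
Proof. by move=> mx my; apply: ph_memD => //; exact: ph_memN. Qed.

Lemma ph_mem_sum (I : Type) (s : seq I) (P : pred I) (f : I -> E) :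
  (forall i, P i -> ph_mem (f i)) -> ph_mem (\sum_(i <- s | P i) f i).
Proof.
move=> h; elim/big_ind: _ => //; [exact: ph_mem0|exact: ph_memD].
Qed.

Lemma ph_ip0l z : ph_mem z -> ph_ip 0 z = 0.
Proof.
move=> mz; have m0 := ph_mem0 hE.
have := ph_ipP hE 1 m0 m0 mz; rewrite scaler0 addr0 mul1r.
by move=> /eqP; rewrite -subr_eq subrr => /eqP.
Qed.

Lemma ph_ipZl (a : R) x z : ph_mem x -> ph_mem z -> ph_ip (a *: x) z = a * ph_ip x z.
Proof.
move=> mx mz; rewrite -[_ *: _]addr0 (ph_ipP hE)//; last exact: ph_mem0.
by rewrite ph_ip0l// addr0.
Qed.

Lemma ph_ipDl x y z : ph_mem x -> ph_mem y -> ph_mem z ->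
  ph_ip (x + y) z = ph_ip x z + ph_ip y z.
Proof. by move=> mx my mz; rewrite -[x in LHS]scale1r (ph_ipP hE)// mul1r. Qed.

Lemma ph_ipBl x y z : ph_mem x -> ph_mem y -> ph_mem z ->
  ph_ip (x - y) z = ph_ip x z - ph_ip y z.
Proof.
move=> mx my mz; rewrite ph_ipDl//; last exact: ph_memN.
by rewrite -scaleN1r ph_ipZl// mulN1r.
Qed.

Lemma ph_ip_suml (I : Type) (s : seq I) (P : pred I) (f : I -> E) z :
  (forall i, P i -> ph_mem (f i)) -> ph_mem z ->
  ph_ip (\sum_(i <- s | P i) f i) z = \sum_(i <- s | P i) ph_ip (f i) z.
Proof.
move=> h mz; elim: s => [|i s IH]; first by rewrite !big_nil ph_ip0l.
rewrite !big_cons; case: ifP => // Pi.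
by rewrite ph_ipDl ?IH//; [exact: h|exact: ph_mem_sum].
Qed.

Lemma ph_ip0r z : ph_mem z -> ph_ip z 0 = 0.
Proof. by move=> mz; rewrite (ph_ipC hE)// ?ph_ip0l//; exact: ph_mem0. Qed.

Lemma ph_ipZr (a : R) x z : ph_mem x -> ph_mem z -> ph_ip z (a *: x) = a * ph_ip z x.
Proof.
by move=> mx mz; rewrite (ph_ipC hE)// ?ph_ipZl// 1?(ph_ipC hE)//; exact: ph_memZ.
Qed.

Lemma ph_ipDr x y z : ph_mem x -> ph_mem y -> ph_mem z ->
  ph_ip z (x + y) = ph_ip z x + ph_ip z y.
Proof.
move=> mx my mz; rewrite (ph_ipC hE)//; last exact: ph_memD.
by rewrite ph_ipDl// (ph_ipC hE mz mx) (ph_ipC hE mz my).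
Qed.

Lemma ph_ipBr x y z : ph_mem x -> ph_mem y -> ph_mem z ->
  ph_ip z (x - y) = ph_ip z x - ph_ip z y.
Proof.
move=> mx my mz; rewrite (ph_ipC hE)//; last exact: ph_memB.
by rewrite ph_ipBl// (ph_ipC hE mz mx) (ph_ipC hE mz my).
Qed.

Lemma phnorm_ge0 x : 0 <= phnorm x.
Proof. exact: sqrtr_ge0. Qed.

Lemma phnorm_sqr x : ph_mem x -> phnorm x ^+ 2 = ph_ip x x.
Proof. by move=> mx; rewrite sqr_sqrtr//; exact: (ph_ip_ge0 hE). Qed.

Lemma phnorm0 : phnorm (0 : E) = 0.
Proof. by rewrite /phnorm ph_ip0l ?sqrtr0//; exact: ph_mem0. Qed.

Lemma ph_sqrD (a : R) x y : ph_mem x -> ph_mem y ->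
  ph_ip (a *: x + y) (a *: x + y) =
  a ^+ 2 * ph_ip x x + 2 * a * ph_ip x y + ph_ip y y.
Proof.
move=> mx my; have mxy : ph_mem (a *: x + y) by exact: (ph_memP hE).
have mZ : ph_mem (a *: x) by exact: ph_memZ.
rewrite (ph_ipP hE)// !ph_ipDr// !ph_ipZr// (ph_ipC hE my mx); ring.
Qed.

Lemma cauchy_schwarz_sqr x y : ph_mem x -> ph_mem y ->
  ph_ip x y ^+ 2 <= ph_ip x x * ph_ip y y.
Proof.
move=> mx my; set a := ph_ip x x; set b := ph_ip x y; set c := ph_ip y y.
have a0 : 0 <= a by exact: (ph_ip_ge0 hE).
have c0 : 0 <= c by exact: (ph_ip_ge0 hE).
have H (t : R) : 0 <= t ^+ 2 * a + 2 * t * b + c.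
  by rewrite -ph_sqrD//; apply: (ph_ip_ge0 hE); exact: (ph_memP hE).
have [a00|a00] := eqVneq a 0.
  suff -> : b = 0 by rewrite a00 mul0r expr0n.
  apply/eqP; apply: contraT => b0.
  (* With [a = 0] the nonnegative polynomial is affine in [t]; this [t] gives it the value -1. *)
  have := H (- (c + 1) / (2 * b)); rewrite a00 mulr0 add0r.
  have -> : 2 * (- (c + 1) / (2 * b)) * b + c = -1 by field.
  by rewrite ler0N1.
have a1 : 0 < a by rewrite lt0r a00.
have := H (- b / a).
have -> : (- b / a) ^+ 2 * a + 2 * (- b / a) * b + c = (a * c - b ^+ 2) / a by field.
by rewrite pmulr_lge0 ?invr_gt0// subr_ge0.
Qed.

Lemma cauchy_schwarz x y : ph_mem x -> ph_mem y ->
  `|ph_ip x y| <= phnorm x * phnorm y.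
Proof.
move=> mx my; rewrite -(@ler_pXn2r _ 2)// ?nnegrE//; last first.
  by rewrite mulr_ge0 ?phnorm_ge0.
by rewrite exprMn !phnorm_sqr// real_normK ?num_real// cauchy_schwarz_sqr.
Qed.

Lemma phnormZ (a : R) x : ph_mem x -> phnorm (a *: x) = `|a| * phnorm x.
Proof.
move=> mx; have mZ := ph_memZ a mx.
rewrite /phnorm ph_ipZl// ph_ipZr// mulrA -expr2 sqrtrM ?sqr_ge0//.
by rewrite sqrtr_sqr.
Qed.

Lemma phnormN x : ph_mem x -> phnorm (- x) = phnorm x.
Proof. by move=> mx; rewrite -scaleN1r phnormZ// normrN1 mul1r. Qed.

Lemma phnormD x y : ph_mem x -> ph_mem y -> phnorm (x + y) <= phnorm x + phnorm y.
Proof.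
move=> mx my; have mxy := ph_memD mx my.
rewrite -(@ler_pXn2r _ 2)// ?nnegrE// ?addr_ge0 ?phnorm_ge0//.
rewrite sqrrD !phnorm_sqr// -[in X in ph_ip X _](scale1r x) -[in X in ph_ip _ X](scale1r x).
rewrite ph_sqrD// expr1n mul1r mulr1 lerD2r lerD2l.
have := le_trans (ler_norm _) (cauchy_schwarz mx my); lra.
Qed.

Lemma phnormB x y : ph_mem x -> ph_mem y -> phnorm (x - y) = phnorm (y - x).
Proof. by move=> mx my; rewrite -phnormN ?opprB//; exact: ph_memB. Qed.

Lemma phnorm_trans x y z : ph_mem x -> ph_mem y -> ph_mem z ->
  phnorm (x - z) <= phnorm (x - y) + phnorm (y - z).
Proof.
move=> mx my mz; have -> : x - z = (x - y) + (y - z) by rewrite addrA subrK.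
by apply: phnormD; exact: ph_memB.
Qed.

Lemma phnorm_le x y : ph_mem x -> ph_mem y -> phnorm x <= phnorm (x - y) + phnorm y.
Proof.
move=> mx my; rewrite -[in leLHS](subrK y x); apply: phnormD => //; exact: ph_memB.
Qed.

Lemma phnorm_sum (I : Type) (s : seq I) (P : pred I) (f : I -> E) :
  (forall i, P i -> ph_mem (f i)) ->
  phnorm (\sum_(i <- s | P i) f i) <= \sum_(i <- s | P i) phnorm (f i).
Proof.
move=> h; elim: s => [|i s IH]; first by rewrite !big_nil phnorm0.
rewrite !big_cons; case: ifP => // Pi.
apply: (le_trans (phnormD (h _ Pi) _)); first exact: ph_mem_sum.
by rewrite lerD2l.
Qed.

Lemma cvg_of_dist (u : nat -> R) (l : R) (v : nat -> R) :
  (forall j, `|u j - l| <= v j) -> v j @[j --> \oo] --> (0 : R) ->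
  u j @[j --> \oo] --> l.
Proof.
move=> h v0; apply/cvgrPdistC_le => e e0; near=> j.
apply: (le_trans (h j)); near: j.
have /cvgr_dist_le/(_ _ e0) := v0; apply: filterS => j.
by rewrite sub0r normrN => /(le_trans (ler_norm _)).
Unshelve. all: by end_near. Qed.

Lemma ph_ip_cvg (s : nat -> E) x w :
  (forall j, ph_mem (s j)) -> ph_mem x -> ph_mem w ->
  phnorm (s j - x) @[j --> \oo] --> (0 : R) ->
  ph_ip (s j) w @[j --> \oo] --> ph_ip x w.
Proof.
move=> ms mx mw h; apply: (@cvg_of_dist _ _ (fun j => phnorm (s j - x) * phnorm w)).
  by move=> j; rewrite -ph_ipBl//; apply: cauchy_schwarz => //; exact: ph_memB.
by rewrite -[X in _ --> X](mul0r (phnorm w)); apply: cvgM => //; exact: cvg_cst.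
Qed.

Lemma pheq_ipl x y z : ph_mem x -> ph_mem y -> ph_mem z -> pheq x y -> ph_ip x z = ph_ip y z.
Proof.
move=> mx my mz xy; apply/eqP; rewrite -subr_eq0 -normr_le0 -ph_ipBl//.
by rewrite (le_trans (cauchy_schwarz _ _))// ?xy ?mul0r//; exact: ph_memB.
Qed.

End prehilbert_lemmas.

(** * Riesz representation and weak compactness *)

Section hilbert_space.
Variables (R : realType) (E : prehilbert R).
Hypothesis hE : prehilbert_axioms E.

Definition ph_complete := forall s : nat -> E, ph_cauchy s ->
  exists2 x, ph_mem x & phnorm (s j - x) @[j --> \oo] --> (0 : R).

Hypothesis cE : ph_complete.

Definition ph_subspace (W : set E) :=
  [/\ W `<=` @ph_mem R E, W 0 & forall (a : R) x y, W x -> W y -> W (a *: x + y)].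

(* Minimise |w|^2 - 2 l(w) over W: the parallelogram law makes minimising
   sequences Cauchy. *)
Lemma riesz_subspace (W : set E) (l : E -> R) (C : R) :
  ph_subspace W ->
  (forall (a : R) x y, W x -> W y -> l (a *: x + y) = a * l x + l y) ->
  (forall x, W x -> `|l x| <= C * phnorm x) ->
  exists p, [/\ ph_mem p,
    exists2 s : nat -> E, forall j, W (s j) &
      phnorm (s j - p) @[j --> \oo] --> (0 : R) &
    forall w, W w -> ph_ip p w = l w].
Proof.
move=> [Wm W0 WP] lP lC.
pose J w := ph_ip w w - 2 * l w.
have WZ (a : R) w : W w -> W (a *: w) by move=> Ww; rewrite -[_ *: _]addr0; exact: WP.
have l0 : l 0 = 0.
  by have := lP 1 0 0 W0 W0; rewrite scaler0 addr0 mul1r => /eqP; rewrite -subr_eq subrr => /eqP.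
have lZ (a : R) w : W w -> l (a *: w) = a * l w.
  by move=> Ww; rewrite -[_ *: _]addr0 lP// l0 addr0.
have Jge w : W w -> - C ^+ 2 <= J w.
  move=> Ww; rewrite /J -phnorm_sqr//; last exact: Wm.
  have h := lC w Ww; have := sqr_ge0 (phnorm w - C).
  have h2 := le_trans (ler_norm _) h; nra.
have JW0 : (J @` W) !=set0 by exists (J 0), 0.
have hlb : has_lbound (J @` W) by exists (- C ^+ 2) => _ [w Ww <-]; exact: Jge.
set m := inf (J @` W).
have mle w : W w -> m <= J w by move=> Ww; apply: ge_inf => //; exists w.
have hs j : exists w, W w /\ J w < m + j.+1%:R^-1.
  have [|_ [w Ww <-] h] := @inf_adherent R (J @` W) j.+1%:R^-1 _ (conj JW0 hlb).
    by rewrite invr_gt0.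
  by exists w.
pose s j := projT1 (cid (hs j)).
have sP j : W (s j) /\ J (s j) < m + j.+1%:R^-1 by rewrite /s; case: cid.
have dist i j : phnorm (s i - s j) ^+ 2 <= 2 * i.+1%:R^-1 + 2 * j.+1%:R^-1.
  have [Wi Ji] := sP i; have [Wj Jj] := sP j.
  have mi := Wm _ Wi; have mj := Wm _ Wj.
  have -> : phnorm (s i - s j) ^+ 2 =
      ph_ip (s i) (s i) - 2 * ph_ip (s i) (s j) + ph_ip (s j) (s j).
    rewrite phnorm_sqr//; last exact: ph_memB.
    rewrite ph_ipBl//; last exact: ph_memB.
    rewrite !ph_ipBr// (ph_ipC hE mj mi); ring.
  have Wmid : W (2^-1 *: (s i + s j)).
    by apply: WZ; rewrite -[s i]scale1r; exact: WP.
  have := mle _ Wmid; rewrite /J.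
  have mD : ph_mem (s i + s j) by exact: ph_memD.
  rewrite lZ; last by rewrite -[s i]scale1r; exact: WP.
  rewrite -[X in l (X + _)]scale1r lP// ph_ipZl//; last exact: ph_memZ.
  rewrite ph_ipZr// ph_ipDl// !ph_ipDr// (ph_ipC hE mj mi).
  rewrite /J in Ji Jj; move: Ji Jj; set a := i.+1%:R^-1; set b := j.+1%:R^-1; lra.
have cs : ph_cauchy s.
  split=> [i|e e0]; first exact: Wm (sP i).1.
  have e4 : 0 < e ^+ 2 / 4 by rewrite divr_gt0 ?exprn_gt0.
  have := near_infty_natSinv_lt (PosNum e4) => -[N _ HN].
  exists N => i j Ni Nj; rewrite -(@ltr_pXn2r _ 2)// ?nnegrE ?phnorm_ge0 ?ltW//.
  apply: (le_lt_trans (dist i j)).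
  have := HN i Ni; have := HN j Nj; rewrite /=; set a := i.+1%:R^-1; set b := j.+1%:R^-1; lra.
have [p mp sp] := cE cs.
exists p; split => //; first by exists s => // j; exact: (sP j).1.
move=> w Ww; have mw := Wm _ Ww.
(* First variation at the minimum: m <= J(a w + s_j) and J(s_j) < m + 1/(j+1), expanded in [a], then
   j tends to infinity. *)
have D (a : R) : 0 <= 2 * a * (ph_ip p w - l w) + a ^+ 2 * ph_ip w w.
  have c1 : ph_ip (s j) w @[j --> \oo] --> ph_ip p w.
    by apply: ph_ip_cvg => // j; apply: Wm; exact: (sP j).1.
  have c2 : (j.+1%:R^-1 : R) + (2 * a * (ph_ip (s j) w - l w) + a ^+ 2 * ph_ip w w)
      @[j --> \oo] --> 0 + (2 * a * (ph_ip p w - l w) + a ^+ 2 * ph_ip w w).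
    apply: cvgD; first exact: cvg_harmonic.
    apply: cvgD; last exact: cvg_cst.
    by apply: cvgM; [exact: cvg_cst|apply: cvgB => //; exact: cvg_cst].
  rewrite add0r in c2; apply: (cvgr_to_ge c2); near=> j.
  have [Wj Jj] := sP j; have := mle _ (WP a _ _ Ww Wj).
  rewrite /J lP// ph_sqrD//; last exact: Wm.
  rewrite (ph_ipC hE mw (Wm _ Wj)); rewrite /J in Jj; move: Jj; set b := j.+1%:R^-1; lra.
apply/eqP; rewrite -subr_eq0; apply/eqP; set d := _ - _.
have q0 : 0 <= ph_ip w w by exact: (ph_ip_ge0 hE).
(* Near the minimiser of the quadratic in [a]; the summand 1 keeps the denominator positive when [w]
   has norm 0. *)
have := D (- d / (1 + ph_ip w w)); rewrite -/d.
set q := ph_ip w w in q0 *.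
have -> : 2 * (- d / (1 + q)) * d + (- d / (1 + q)) ^+ 2 * q =
   - (d ^+ 2 * ((2 + q) / (1 + q) ^+ 2)) by field; lra.
rewrite oppr_ge0 => h; apply/eqP; apply: contraT => d0.
have : 0 < d ^+ 2 * ((2 + q) / (1 + q) ^+ 2).
  rewrite mulr_gt0// ?exprn_even_gt0//= divr_gt0 ?exprn_gt0//; lra.
by rewrite ltNge h.
Unshelve. all: by end_near. Qed.

(** Testing the sequence against its own terms leaves countably many scalar sequences to control,
    which is what one diagonal extraction can do, and no dense sequence of [E] has to be
    produced. *)
Lemma bounded_weak_cvg (x : nat -> E) (C : R) :
  (forall i, ph_mem (x i)) -> (forall i, phnorm (x i) <= C) ->
  (forall l, cvgn (fun i => ph_ip (x i) (x l))) ->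
  exists2 z, ph_mem z &
    forall v, ph_mem v -> ph_ip (x i) v @[i --> \oo] --> ph_ip z v.
Proof.
move=> mx xC hx.
pose S := [set v : E | ph_mem v /\ cvgn (fun i => ph_ip (x i) v)].
have ipP (a : R) u v i : ph_mem u -> ph_mem v ->
    ph_ip (x i) (a *: u + v) = a * ph_ip (x i) u + ph_ip (x i) v.
  by move=> mu mv; rewrite ph_ipDr ?ph_ipZr//; exact: ph_memZ.
have sS : ph_subspace S.
  split.
  - by move=> v [].
  - split; first exact: ph_mem0.
    rewrite (_ : (fun i => _) = cst 0); first exact: is_cvg_cst.
    by apply/funext => i; rewrite ph_ip0r.
  - move=> a u v [mu cu] [mv cv]; split; first exact: (ph_memP hE).
    rewrite (_ : (fun i => _) = (fun i => a * ph_ip (x i) u + ph_ip (x i) v)).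
      by apply: is_cvgD => //; apply: is_cvgM => //; exact: is_cvg_cst.
    by apply/funext => i; rewrite ipP.
pose l v := limn (fun i => ph_ip (x i) v).
have lP (a : R) u v : S u -> S v -> l (a *: u + v) = a * l u + l v.
  move=> [mu cu] [mv cv]; rewrite /l.
  apply/cvg_lim => //; rewrite (_ : (fun i => _) = (fun i => a * ph_ip (x i) u + ph_ip (x i) v)).
    by apply: cvgD => //; apply: cvgM => //; exact: cvg_cst.
  by apply/funext => i; rewrite ipP.
have lC v : S v -> `|l v| <= C * phnorm v.
  move=> [mv cv]; rewrite /l -lim_norm//.
  apply: limr_le; first exact: is_cvg_norm.
  apply: nearW => i; apply: (le_trans (cauchy_schwarz hE (mx i) mv)).
  by rewrite ler_wpM2r ?phnorm_ge0.
(* S is closed, contains every x i, and contains whatever is orthogonal to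
   all of them: it is everything. *)
have ST v : ph_mem v -> S v.
  move=> mv.
  have [|y Sy|p [mp [s Ss sp] pP]] := @riesz_subspace S (fun w => ph_ip v w) (phnorm v) sS.
  - move=> a u w [mu _] [mw _]; rewrite ph_ipDr ?ph_ipZr//; exact: ph_memZ.
  - by apply: cauchy_schwarz => //; exact: Sy.1.
  split => //; apply/cauchy_cvgP/cauchy_exP => e e0.
  have ms j : ph_mem (s j) by exact: (Ss j).1.
  have C0 : 0 <= C by apply: le_trans (xC 0%N); exact: phnorm_ge0.
  have [j jP] : exists j, phnorm (s j - p) < e / 3 / (C + 1).
    have e3 : 0 < e / 3 / (C + 1) by rewrite divr_gt0 ?divr_gt0//; lra.
    have /cvgr_dist_lt/(_ _ e3) [N _ /(_ N (leqnn _))] := sp.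
    rewrite sub0r normrN ger0_norm ?phnorm_ge0// => ?; by exists N.
  have xv i : `|ph_ip (x i) v - ph_ip (x i) (s j)| <= e / 3.
    have -> : ph_ip (x i) v = ph_ip (x i) p.
      by rewrite (ph_ipC hE (mx i) mv) (ph_ipC hE (mx i) mp) pP//.
    rewrite -ph_ipBr// (le_trans (cauchy_schwarz hE (mx i) (ph_memB hE mp (ms j))))//.
    rewrite phnormB//.
    have h1 := xC i; have h2 := phnorm_ge0 (x i); have h3 := phnorm_ge0 (s j - p).
    apply: (@le_trans _ _ ((C + 1) * (e / 3 / (C + 1)))); last by rewrite mulrCA divff ?mulr1//; lra.
    by apply: ler_pM => //; [lra|exact: ltW].
  have e30 : 0 < e / 3 by rewrite divr_gt0.
  exists (limn (fun i => ph_ip (x i) (s j))).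
  have /cvgrPdist_lt/(_ _ e30) : ph_ip (x i) (s j) @[i --> \oo] --> limn (fun i => ph_ip (x i) (s j)).
    exact: (Ss j).2.
  apply: filterS => i /= h; rewrite /ball /=; have := xv i.
  rewrite !ler_norml => /andP[? ?]; move: h; rewrite !ltr_norml => /andP[? ?].
  apply/andP; split; lra.
have [z [mz _ zP]] := riesz_subspace sS lP lC.
by exists z => // v mv; rewrite zP; [exact: (ST v mv).2|exact: ST].
Qed.

End hilbert_space.

Lemma weak_sequential_compactness (R : realType) (E : prehilbert R)
  (x : nat -> nat -> E) (C : nat -> R) :
  prehilbert_axioms E -> ph_complete E ->
  (forall k i, ph_mem (x k i)) -> (forall k i, phnorm (x k i) <= C k) ->
  exists2 s : nat -> nat, {homo s : i j / (i < j)%N} &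
  exists2 z : nat -> E, forall k, ph_mem (z k) &
    forall k v, ph_mem v -> ph_ip (x k (s i)) v @[i --> \oo] --> ph_ip (z k) v.
Proof.
move=> hE cE mx xC.
(* For each pair (k, l) the scalars <x k i, x k l> form a bounded sequence in i; numbering the pairs
   lets a single extraction serve all k. *)
pose a n i := if @unpickle (nat * nat)%type n is Some (k, l) then ph_ip (x k i) (x k l) else 0.
pose D n := if @unpickle (nat * nat)%type n is Some (k, l) then C k ^+ 2 else 0.
have [n i|s hs sP] := @diagonal_subsequence R a D.
  rewrite /a /D; case: unpickle => [[k l]|]; last by rewrite normr0.
  apply: (le_trans (cauchy_schwarz hE _ _)) => //.
  by rewrite expr2; apply: ler_pM => //; exact: phnorm_ge0.
exists s => //.
have H k : exists z, ph_mem z /\ forall v, ph_mem v ->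
    ph_ip (x k (s i)) v @[i --> \oo] --> ph_ip z v.
  have [//|//|l|z mz zP] := @bounded_weak_cvg R E hE cE (fun i => x k (s i)) (C k).
    by have := sP (pickle (k, s l)); rewrite /a pickleK.
  by exists z.
exists (fun k => projT1 (cid (H k))) => k; first by case: cid => z [].
by move=> v mv; case: cid => z [mz]; exact.
Qed.

(** * Orthonormal bases *)

Record ph_basis (R : realType) (E : prehilbert R) (eh : nat -> E) : Prop := {
  ph_basis_mem : forall k, ph_mem (eh k) ;
  ph_basis_ortho : forall k l, ph_ip (eh k) (eh l) = (k == l)%:R ;
  ph_basis_total : forall v : E, ph_mem v ->
    phnorm (v - \sum_(k < m) ph_ip v (eh k) *: eh k) @[m --> \oo] --> (0 : R) }.

Section orthonormal.
Variables (R : realType) (E : prehilbert R) (eh : nat -> E).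
Hypothesis hE : prehilbert_axioms E.
Hypothesis meh : forall k, ph_mem (eh k).
Hypothesis oeh : forall k l, ph_ip (eh k) (eh l) = (k == l)%:R.

Lemma ph_mem_comb m (c : nat -> R) : ph_mem (\sum_(k < m) c k *: eh k).
Proof. by apply: ph_mem_sum => // i _; exact: ph_memZ. Qed.

Lemma ph_ip_comb m (c : nat -> R) (v : E) : ph_mem v ->
  ph_ip (\sum_(k < m) c k *: eh k) v = \sum_(k < m) c k * ph_ip v (eh k).
Proof.
move=> mv; rewrite ph_ip_suml//; last by move=> i _; exact: ph_memZ.
by apply: eq_bigr => i _; rewrite ph_ipZl// (ph_ipC hE).
Qed.

Lemma ph_coord_comb m (c : nat -> R) (k : nat) :
  ph_ip (\sum_(l < m) c l *: eh l) (eh k) = if (k < m)%N then c k else 0.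
Proof.
rewrite ph_ip_comb//; case: ifPn => km.
  rewrite (bigD1 (Ordinal km))//= oeh eqxx mulr1 big1 ?addr0// => i ik.
  rewrite oeh; have /negPf -> : k != i.
    by apply: contra ik => /eqP ki; apply/eqP/val_inj.
  by rewrite mulr0.
rewrite big1// => i _; rewrite oeh; have /negPf -> : k != i.
  by apply: contra km => /eqP ->.
by rewrite mulr0.
Qed.

Lemma phnorm_comb m (c : nat -> R) :
  phnorm (\sum_(k < m) c k *: eh k) ^+ 2 = \sum_(k < m) c k ^+ 2.
Proof.
rewrite phnorm_sqr//; last exact: ph_mem_comb.
rewrite ph_ip_comb; last exact: ph_mem_comb.
by apply: eq_bigr => i _; rewrite ph_coord_comb ltn_ord expr2.
Qed.

Lemma phnorm_comb_sub m (c : nat -> R) (v : E) : ph_mem v ->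
  (forall k, (k < m)%N -> ph_ip v (eh k) = c k) ->
  phnorm (v - \sum_(k < m) c k *: eh k) ^+ 2 = phnorm v ^+ 2 - \sum_(k < m) c k ^+ 2.
Proof.
move=> mv hc; have ms := ph_mem_comb m c.
rewrite [LHS]phnorm_sqr//; last exact: ph_memB.
rewrite ph_ipBl//; last exact: ph_memB.
rewrite !ph_ipBr// -!phnorm_sqr// phnorm_comb (ph_ipC hE mv ms) ph_ip_comb//.
rewrite (_ : \sum_(k < m) c k * _ = \sum_(k < m) c k ^+ 2); last first.
  by apply: eq_bigr => i _; rewrite hc// expr2.
ring.
Qed.

Lemma bessel m (v : E) : ph_mem v -> \sum_(k < m) ph_ip v (eh k) ^+ 2 <= phnorm v ^+ 2.
Proof.
move=> mv; rewrite -subr_ge0 -(@phnorm_comb_sub m (fun k => ph_ip v (eh k)))//.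
exact: sqr_ge0.
Qed.

(** By Bessel's identity, subtracting the projection on the first m vectors does not increase the
    norm, so the remainder of [v] exceeds that of a nearby [w] by at most |v - w|. *)
Lemma ph_total_of_dense :
  (forall v : E, ph_mem v -> forall e : R, 0 < e -> exists w : E,
    [/\ ph_mem w, phnorm (v - w) < e &
      phnorm (w - \sum_(k < m) ph_ip w (eh k) *: eh k) @[m --> \oo] --> (0 : R)]) ->
  ph_basis eh.
Proof.
move=> H; split => // v mv; apply/cvgr0Pnorm_le => e e0.
have e20 : 0 < e / 2 by rewrite divr_gt0.
have [w [mw vw wP]] := H v mv _ e20.
move: wP => /cvgr0_norm_le/(_ _ e20); apply: filterS => m.
rewrite !ger0_norm ?phnorm_ge0// => hm.
pose c u := \sum_(k < m) ph_ip u (eh k) *: eh k.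
have mc u : ph_mem (c u) by exact: (ph_mem_comb m (fun k => ph_ip u (eh k))).
have -> : v - c v = (v - w - c (v - w)) + (w - c w).
  have -> : c (v - w) = c v - c w.
    by rewrite /c -sumrB; apply: eq_bigr => i _; rewrite ph_ipBl// scalerBl.
  by rewrite opprB addrACA subrK [c w - _ - _]addrAC subrr add0r.
apply: (le_trans (phnormD hE _ _)); try by do 2?apply: ph_memB => //.
have : phnorm (v - w - c (v - w)) <= phnorm (v - w).
  rewrite -(@ler_pXn2r _ 2)// ?nnegrE ?phnorm_ge0//.
  rewrite (@phnorm_comb_sub m (fun k => ph_ip (v - w) (eh k)))//; last exact: ph_memB.
  by rewrite gerBl sumr_ge0// => i _; exact: sqr_ge0.
rewrite -/(c w) in hm; lra.
Qed.

End orthonormal.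

Section basis_lemmas.
Variables (R : realType) (E : prehilbert R) (eh : nat -> E).
Hypothesis hE : prehilbert_axioms E.
Hypothesis hb : ph_basis eh.

Let meh := ph_basis_mem hb.
Let oeh := ph_basis_ortho hb.

Lemma parseval (u v : E) : ph_mem u -> ph_mem v ->
  \sum_(k < m) ph_ip u (eh k) * ph_ip v (eh k) @[m --> \oo] --> ph_ip u v.
Proof.
move=> mu mv; rewrite (_ : (fun m => _) =
    fun m => ph_ip (\sum_(k < m) ph_ip u (eh k) *: eh k) v); last first.
  by apply/funext => m; rewrite (ph_ip_comb hE meh m (fun k => ph_ip u (eh k)) mv).
apply: ph_ip_cvg => //.
  by move=> m; exact: (ph_mem_comb hE meh m (fun k => ph_ip u (eh k))).
have := ph_basis_total hb mu; apply: cvg_trans; apply: near_eq_cvg.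
by apply: nearW => m; rewrite (phnormB hE)//; exact: (ph_mem_comb hE meh m (fun k => ph_ip u (eh k))).
Qed.

Lemma parseval_norm (v : E) : ph_mem v ->
  \sum_(k < m) ph_ip v (eh k) ^+ 2 @[m --> \oo] --> phnorm v ^+ 2.
Proof. by move=> mv; rewrite phnorm_sqr//; exact: parseval. Qed.

Lemma pheq_coord (u v : E) : ph_mem u -> ph_mem v ->
  (forall k, ph_ip u (eh k) = ph_ip v (eh k)) -> pheq u v.
Proof.
move=> mu mv h; have muv := ph_memB hE mu mv.
have := parseval_norm muv.
rewrite (_ : (fun m => _) = cst 0); last first.
  apply/funext => m; rewrite big1// => i _.
  by rewrite ph_ipBl// h subrr expr0n.
move=> hh; have h0 : cst (0 : R) @ \oo --> (0 : R) by exact: cvg_cst.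
have n0 : phnorm (u - v) ^+ 2 = 0 by exact: (cvg_unique (@Rhausdorff R) hh h0).
by move/eqP : n0; rewrite sqrf_eq0 => /eqP.
Qed.

(** Kept apart from [riesz_fischer_coord] because in a completion this Cauchy sequence is itself the
    vector with coordinates [c]. *)
Lemma comb_cauchy (c : nat -> R) (C : R) : (forall m, \sum_(k < m) c k ^+ 2 <= C) ->
  ph_cauchy (fun m => \sum_(k < m) c k *: eh k).
Proof.
move=> hC; pose s m := \sum_(k < m) c k *: eh k.
have ms m : ph_mem (s m) by exact: (ph_mem_comb hE meh m c).
have sq : cvgn (fun m => \sum_(k < m) c k ^+ 2).
  apply: nondecreasing_is_cvgn; last by exists C => _ [m _ <-].
  apply/nondecreasing_seqP => m; rewrite big_ord_recr /= lerDl; exact: sqr_ge0.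
have dist i j : (i <= j)%N -> phnorm (s i - s j) ^+ 2 =
    \sum_(k < j) c k ^+ 2 - \sum_(k < i) c k ^+ 2.
  move=> ij; rewrite (phnormB hE)// (phnorm_comb_sub hE meh oeh)//.
    by rewrite (phnorm_comb hE meh oeh).
  by move=> k ki; rewrite (ph_coord_comb hE meh oeh) (leq_trans ki ij).
suff : ph_cauchy s by []; split => // e e0.
have e2 : 0 < e ^+ 2 / 2 by rewrite divr_gt0// exprn_gt0.
set L := limn (fun m => \sum_(k < m) c k ^+ 2).
have /cvgrPdist_lt/(_ _ e2) : (fun m => \sum_(k < m) c k ^+ 2) @ \oo --> L by exact: sq.
move=> [N _ NP]; exists N => i j.
wlog ij : i j / (i <= j)%N.
  move=> hw Ni Nj; have [ij|/ltnW ji] := leqP i j; first exact: hw.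
  by rewrite (phnormB hE)//; exact: hw.
move=> Ni Nj; rewrite -(@ltr_pXn2r _ 2)// ?nnegrE ?phnorm_ge0 ?ltW// dist//.
have := NP i Ni; have := NP j Nj; rewrite /= !ltr_norml => /andP[? ?] /andP[? ?]; lra.
Qed.

Lemma riesz_fischer_coord (c : nat -> R) (C : R) : ph_complete E ->
  (forall m, \sum_(k < m) c k ^+ 2 <= C) ->
  exists2 v : E, ph_mem v & forall k, ph_ip v (eh k) = c k.
Proof.
move=> cE hC; pose s m := \sum_(k < m) c k *: eh k.
have ms m : ph_mem (s m) by exact: (ph_mem_comb hE meh m c).
have [v mv sv] := cE _ (comb_cauchy hC); exists v => // k.
have := ph_ip_cvg hE ms mv (meh k) sv.
have : ph_ip (s j) (eh k) @[j --> \oo] --> c k.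
  apply: cvg_near_cst; exists k.+1 => // j /= kj.
  by rewrite (ph_coord_comb hE meh oeh) kj.
by move=> h1 h2; exact: (cvg_unique (@Rhausdorff R) h2 h1).
Qed.

End basis_lemmas.

(** * The completion *)

Section completion_theory.
Variables (R : realType) (E : prehilbert R).
Hypothesis hE : prehilbert_axioms E.

Lemma ph_cauchy_bounded (s : nat -> E) : ph_cauchy s ->
  exists C : R, forall j, phnorm (s j) <= C.
Proof.
move=> [ms hs]; have [N NP] := hs 1 ltr01.
exists (phnorm (s N) + 1 + \sum_(k < N) phnorm (s k)) => j.
have S0 : 0 <= \sum_(k < N) phnorm (s k) by apply: sumr_ge0 => i _; exact: phnorm_ge0.
have [Nj|jN] := leqP N j.
  have := phnorm_le hE (ms j) (ms N); have := NP j N Nj (leqnn N); lra.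
have := phnorm_ge0 (s N); rewrite (bigD1 (Ordinal jN))//= => ?.
have : 0 <= \sum_(i < N | i != Ordinal jN) phnorm (s i).
  by apply: sumr_ge0 => i _; exact: phnorm_ge0.
lra.
Qed.

Lemma completion_ip_cvg (s t : nat -> E) : ph_cauchy s -> ph_cauchy t ->
  cvgn (fun j => ph_ip (s j) (t j)).
Proof.
move=> cs ct; have [C sC] := ph_cauchy_bounded cs; have [D tD] := ph_cauchy_bounded ct.
have C0 : 0 <= C by apply: le_trans (sC 0%N); exact: phnorm_ge0.
have D0 : 0 <= D by apply: le_trans (tD 0%N); exact: phnorm_ge0.
apply/cauchy_cvgP/cauchy_exP => e e0.
have eCD : 0 < e / (C + D + 1) by rewrite divr_gt0//; lra.
have [N1 P1] := cs.2 _ eCD; have [N2 P2] := ct.2 _ eCD.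
pose N := maxn N1 N2; exists (ph_ip (s N) (t N)).
exists N => // j /= Nj; rewrite /ball /=.
have ms := cs.1; have mt := ct.1.
have -> : ph_ip (s N) (t N) - ph_ip (s j) (t j) =
    ph_ip (s N - s j) (t N) + ph_ip (s j) (t N - t j).
  by rewrite ph_ipBl// ph_ipBr//; ring.
apply: (le_lt_trans (ler_normD _ _)).
have N1j : (N1 <= j)%N by apply: leq_trans Nj; exact: leq_maxl.
have N2j : (N2 <= j)%N by apply: leq_trans Nj; exact: leq_maxr.
have h1 := P1 N j (leq_maxl _ _) N1j; have h2 := P2 N j (leq_maxr _ _) N2j.
have i1 := cauchy_schwarz hE (ph_memB hE (ms N) (ms j)) (mt N).
have i2 := cauchy_schwarz hE (ms j) (ph_memB hE (mt N) (mt j)).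
have k1 : phnorm (s N - s j) * phnorm (t N) <= e / (C + D + 1) * D.
  by apply: ler_pM => //; [exact: phnorm_ge0|exact: phnorm_ge0|exact: ltW].
have k2 : phnorm (s j) * phnorm (t N - t j) <= C * (e / (C + D + 1)).
  by apply: ler_pM => //; [exact: phnorm_ge0|exact: phnorm_ge0|exact: ltW].
have : e = e / (C + D + 1) * (C + D + 1) by rewrite divfK//; lra.
move: eCD i1 i2 k1 k2; set q := e / _; move=> *; nra.
Qed.

Lemma completion_axioms : prehilbert_axioms (completion E).
Proof.
split.
- split=> [i|e e0]; first exact: (ph_mem0 hE).
  by exists 0%N => i j _ _; rewrite subrr (phnorm0 hE).
- move=> a s t [ms cs] [mt ct]; split=> [i|e e0].
    exact: (ph_memP hE).
  have ea : 0 < e / 2 / (`|a| + 1) by rewrite divr_gt0 ?divr_gt0// ltr_pwDr.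
  have e2 : 0 < e / 2 by rewrite divr_gt0.
  have [N1 P1] := cs _ ea; have [N2 P2] := ct _ e2.
  exists (maxn N1 N2) => i j; rewrite !geq_max => /andP[i1 i2] /andP[j1 j2].
  have -> : (a *: s + t) i - (a *: s + t) j = a *: (s i - s j) + (t i - t j).
    rewrite scalerBr -addrACA -opprD //.
  have m1 := ph_memB hE (ms i) (ms j); have m2 := ph_memB hE (mt i) (mt j).
  apply: (le_lt_trans (phnormD hE (ph_memZ hE a m1) m2)); rewrite (phnormZ hE)//.
  have := P1 _ _ i1 j1; have := P2 _ _ i2 j2.
  have : e / 2 = e / 2 / (`|a| + 1) * (`|a| + 1).
    by rewrite divfK// gt_eqF// ltr_pwDr.
  set q := e / 2 / _; have := normr_ge0 a; have := phnorm_ge0 (s i - s j).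
  move=> *; nra.
- move=> s t [ms _] [mt _] /=; congr (limn _); apply/funext => j.
  exact: (ph_ipC hE).
- move=> a s t w cs ct cw; rewrite /ph_ip /=.
  have -> : (fun j => ph_ip ((a *: s + t) j) (w j)) =
      (fun j => a * ph_ip (s j) (w j) + ph_ip (t j) (w j)).
    by apply/funext => j; exact: (ph_ipP hE _ (cs.1 j) (ct.1 j) (cw.1 j)).
  have c1 := completion_ip_cvg cs cw; have c2 := completion_ip_cvg ct cw.
  by apply/cvg_lim => //; apply: cvgD => //; apply: cvgM => //; exact: cvg_cst.
- move=> s cs /=; apply: limr_ge; first exact: completion_ip_cvg.
  by apply: nearW => j; apply: (ph_ip_ge0 hE); exact: cs.1.
Qed.

Lemma completion_inj_mem (x : E) : ph_mem x -> ph_mem (completion_inj x).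
Proof.
by move=> mx; split => // e e0; exists 0%N => i j _ _; rewrite subrr (phnorm0 hE).
Qed.

Lemma completion_inj_ip (x y : E) : ph_ip (completion_inj x) (completion_inj y) = ph_ip x y.
Proof.
rewrite /completion_inj /=; apply/cvg_lim; first exact: Rhausdorff.
exact: cvg_cst.
Qed.

Lemma completion_inj_norm (x : E) : phnorm (completion_inj x) = phnorm x.
Proof. by rewrite /phnorm completion_inj_ip. Qed.

Lemma completion_inj_comb m (c : nat -> R) (x : nat -> E) :
  completion_inj (\sum_(k < m) c k *: x k) =
  \sum_(k < m) c k *: (completion_inj (x k) : completion E).
Proof.
apply/funext => j; rewrite /completion_inj.
by elim/big_ind2 : _ => // y1 f1 y2 f2 -> ->.
Qed.

(** Density of [E]: a Cauchy sequence [s] is close to the constant sequence at [s N], whose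
    expansion takes place in [E]. *)
Lemma completion_basis (eh : nat -> E) : ph_basis eh ->
  ph_basis (fun k => completion_inj (eh k) : completion E).
Proof.
move=> hb; have hC := completion_axioms.
apply: ph_total_of_dense => //.
- by move=> k; apply: completion_inj_mem; exact: (ph_basis_mem hb).
- by move=> k l; rewrite completion_inj_ip (ph_basis_ortho hb).
move=> s cs e e0; have e20 : 0 < e / 2 by rewrite divr_gt0.
have [N NP] := cs.2 _ e20.
have mN : ph_mem (completion_inj (s N)) by apply: completion_inj_mem; exact: cs.1.
exists (completion_inj (s N)); split => //.
  have : phnorm (s - completion_inj (s N) : completion E) <= e / 2.
    rewrite -(@ler_pXn2r _ 2)// ?nnegrE ?phnorm_ge0//; last lra.
    rewrite (phnorm_sqr hC); last exact: (ph_memB hC).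
    rewrite [ph_ip _ _]/=; apply: limr_le.
      have cd := ph_memB hC cs mN; exact: (completion_ip_cvg cd cd).
    exists N => // j /= Nj.
    have -> : (s - completion_inj (s N)) j = s j - s N by [].
    rewrite -phnorm_sqr//; last by apply: (ph_memB hE); exact: cs.1.
    rewrite ler_pXn2r ?nnegrE ?phnorm_ge0//; last lra.
    exact/ltW/NP.
  lra.
have := ph_basis_total hb (cs.1 N); apply: cvg_trans; apply: near_eq_cvg.
apply: nearW => m; rewrite -completion_inj_norm; congr phnorm.
have -> : \sum_(k < m) ph_ip (completion_inj (s N)) (completion_inj (eh k)) *:
      (completion_inj (eh k) : completion E) =
    \sum_(k < m) ph_ip (s N) (eh k) *: (completion_inj (eh k) : completion E).
  by apply: eq_bigr => k _; rewrite completion_inj_ip.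
by rewrite -(completion_inj_comb m (fun k => ph_ip (s N) (eh k))).
Qed.

End completion_theory.

(** * Powers of a diagonal operator *)

Section spectral_power.
Variables (R : realType) (E : prehilbert R) (e : nat -> E) (lam : nat -> R).
Hypothesis hL : prehilbert_axioms E.
Hypothesis hb : ph_basis e.
Hypothesis lam0 : forall k, 0 < lam k.
Implicit Types (al : R) (u v w : E).

(* [is_power], [powerA] and [D_power] over an abstract space: [D_power e lam] is
   [spectral_space (E) e lam] up to conversion. *)
Definition is_spectral_power al v w :=
  [/\ ph_mem v, ph_mem w &
    phnorm (\sum_(k < m) (lam k `^ al * ph_ip v (e k)) *: e k - w)
      @[m --> \oo] --> (0 : R)].

Definition spectral_power al v : E := xget 0 [set w | is_spectral_power al v w].

Definition spectral_space al : prehilbert R :=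
  @Prehilbert R E [set v | exists w, is_spectral_power al v w]
    (fun u v => ph_ip (spectral_power al u) (spectral_power al v)).

Let me := ph_basis_mem hb.
Let oe := ph_basis_ortho hb.

Lemma spectral_power_coordP al v w : is_spectral_power al v w ->
  forall k, ph_ip w (e k) = lam k `^ al * ph_ip v (e k).
Proof.
move=> [mv mw h] k.
pose s m := \sum_(k < m) (lam k `^ al * ph_ip v (e k)) *: e k.
have ms m : ph_mem (s m).
  exact: (ph_mem_comb hL me m (fun k => lam k `^ al * ph_ip v (e k))).
have h1 := ph_ip_cvg hL ms mw (me k) h.
have h2 : ph_ip (s m) (e k) @[m --> \oo] --> lam k `^ al * ph_ip v (e k).
  apply: cvg_near_cst; exists k.+1 => // j /= kj.
  have H := ph_coord_comb hL me oe j (fun k => lam k `^ al * ph_ip v (e k)) k.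
  by rewrite kj in H; exact: H.
exact: (cvg_unique (@Rhausdorff R) h1 h2).
Qed.

Lemma spectral_power_of_coord al v w : ph_mem v -> ph_mem w ->
  (forall k, ph_ip w (e k) = lam k `^ al * ph_ip v (e k)) -> is_spectral_power al v w.
Proof.
move=> mv mw h; split=> //; have := ph_basis_total hb mw.
apply: cvg_trans; apply: near_eq_cvg; apply: nearW => m.
rewrite (phnormB hL)//; last exact: (ph_mem_comb hL me m (fun k => ph_ip w (e k))).
by congr (phnorm (_ - _)); apply: eq_bigr => k _; rewrite h.
Qed.

Lemma spectral_powerP al v : @ph_mem R (spectral_space al) v ->
  is_spectral_power al v (spectral_power al v).
Proof. by move=> [w vw]; rewrite /spectral_power; case: xgetP => [y _ //|/(_ w)]. Qed.

Lemma spectral_space_mem al v : @ph_mem R (spectral_space al) v -> @ph_mem R E v.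
Proof. by move=> [w []]. Qed.

Lemma spectral_power_mem al v : @ph_mem R (spectral_space al) v ->
  @ph_mem R E (spectral_power al v).
Proof. by move=> /spectral_powerP[]. Qed.

Lemma spectral_power_coord al v : @ph_mem R (spectral_space al) v ->
  forall k, @ph_ip R E (spectral_power al v) (e k) = lam k `^ al * @ph_ip R E v (e k).
Proof. by move=> /spectral_powerP /spectral_power_coordP. Qed.

Lemma spectral_space_memP al (a : R) u v :
  @ph_mem R (spectral_space al) u -> @ph_mem R (spectral_space al) v ->
  is_spectral_power al (a *: u + v) (a *: spectral_power al u + spectral_power al v).
Proof.
move=> mu mv; have mu2 := spectral_space_mem mu; have mv2 := spectral_space_mem mv.
have mpu := spectral_power_mem mu; have mpv := spectral_power_mem mv.
apply: spectral_power_of_coord; [exact: (ph_memP hL)|exact: (ph_memP hL)|move=> k].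
by rewrite !(ph_ipP hL)// !spectral_power_coord//; ring.
Qed.

(** Only up to norm 0, because [xget] selects an arbitrary representative of the limit. *)
Lemma spectral_power_linear al (a : R) u v :
  @ph_mem R (spectral_space al) u -> @ph_mem R (spectral_space al) v ->
  @pheq R E (spectral_power al (a *: u + v))
    (a *: spectral_power al u + spectral_power al v).
Proof.
move=> mu mv; have h := spectral_space_memP a mu mv.
have mp := spectral_powerP (ex_intro _ _ h : @ph_mem R (spectral_space al) _).
case: (h) => _ m1 _; case: (mp) => _ m2 _.
apply: (pheq_coord hL hb) => // k.
by rewrite (spectral_power_coordP h) (spectral_power_coordP mp).
Qed.

Lemma spectral_space_axioms al : prehilbert_axioms (spectral_space al).
Proof.
split.
- exists 0; apply: spectral_power_of_coord; try exact: (ph_mem0 hL).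
  by move=> k; rewrite (ph_ip0l hL)// mulr0.
- by move=> a u v mu mv; eexists; exact: (spectral_space_memP a mu mv).
- by move=> u v mu mv /=; apply: (ph_ipC hL); exact: spectral_power_mem.
- move=> a u v w mu mv mw /=.
  rewrite -(ph_ipP hL a (spectral_power_mem mu) (spectral_power_mem mv) (spectral_power_mem mw)).
  apply: (pheq_ipl hL) => //.
  + apply: spectral_power_mem; eexists; exact: (spectral_space_memP a mu mv).
  + by apply: (ph_memP hL); exact: spectral_power_mem.
  + exact: spectral_power_mem.
  + exact: spectral_power_linear.
- by move=> u mu /=; apply: (ph_ip_ge0 hL); exact: spectral_power_mem.
Qed.

Lemma powR_oppK al k : lam k `^ al * lam k `^ (- al) = 1.
Proof. by rewrite powRN mulfV// gt_eqF// powR_gt0. Qed.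

Lemma spectral_space_basis_power al k :
  is_spectral_power al (lam k `^ (- al) *: e k) (e k).
Proof.
apply: spectral_power_of_coord => //; first exact: (ph_memZ hL).
move=> l; rewrite (ph_ipZl hL)// oe; case: eqP => [->|_]; last by rewrite !mulr0.
by rewrite mulr1 powR_oppK.
Qed.

Lemma spectral_space_basis_mem al k : @ph_mem R (spectral_space al) (lam k `^ (- al) *: e k).
Proof. by exists (e k); exact: spectral_space_basis_power. Qed.

Lemma spectral_power_basis al k : @pheq R E (spectral_power al (lam k `^ (- al) *: e k)) (e k).
Proof.
have h := spectral_space_basis_power al k; have m1 := spectral_space_basis_mem al k.
apply: (pheq_coord hL hb) => //; first exact: spectral_power_mem.
by move=> l; rewrite spectral_power_coord// (spectral_power_coordP h).
Qed.

Lemma spectral_space_coord al v k : @ph_mem R (spectral_space al) v ->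
  @ph_ip R (spectral_space al) v (lam k `^ (- al) *: e k) =
  lam k `^ al * @ph_ip R E v (e k).
Proof.
move=> mv; have m1 := spectral_space_basis_mem al k.
rewrite -spectral_power_coord// [LHS]/= (ph_ipC hL) ?(spectral_power_mem mv) ?(spectral_power_mem m1)//;
  try exact: spectral_power_mem.
rewrite (pheq_ipl hL _ _ _ (spectral_power_basis al k)); try exact: spectral_power_mem; last exact: me.
by rewrite (ph_ipC hL)//; exact: spectral_power_mem.
Qed.

(** [spectral_power al] is an isometry into [E] that carries lam_k^(-al) e_k to [e k], up to norm 0;
    orthonormality and totality are pulled back along it. *)
Lemma spectral_space_basis al :
  ph_basis (fun k => lam k `^ (- al) *: e k : spectral_space al).
Proof.
have hD := spectral_space_axioms al.
split.
- exact: spectral_space_basis_mem.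
- move=> k l; rewrite spectral_space_coord; last exact: spectral_space_basis_mem.
  by rewrite -spectral_power_coord ?(spectral_power_coordP (spectral_space_basis_power al k)) -?oe;
    try exact: spectral_space_basis_mem; rewrite spectral_power_coord;
    [rewrite -(spectral_power_coordP (spectral_space_basis_power al k))|exact: spectral_space_basis_mem].
move=> v mv; have := ph_basis_total hb (spectral_power_mem mv).
apply: cvg_trans; apply: near_eq_cvg; apply: nearW => m.
cbv beta; pose s : spectral_space al := \sum_(k < m)
  @ph_ip R (spectral_space al) v (lam k `^ (- al) *: e k) *: (lam k `^ (- al) *: e k).
have ms : @ph_mem R (spectral_space al) s.
  apply: (ph_mem_sum hD) => k _; apply: (ph_memZ hD); exact: spectral_space_basis_mem.
have mvs := ph_memB hD mv ms.
pose s' : E := \sum_(k < m) @ph_ip R E (spectral_power al v) (e k) *: e k.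
have ms' : ph_mem s'.
  exact: (ph_mem_comb hL me m (fun k => @ph_ip R E (spectral_power al v) (e k))).
have H : @pheq R E (spectral_power al (v - s)) (spectral_power al v - s').
  apply: (pheq_coord hL hb) => //; first exact: spectral_power_mem.
    by apply: (ph_memB hL) => //; exact: spectral_power_mem.
  move=> k; rewrite spectral_power_coord//.
  have -> : @ph_ip R E (v - s) (e k) = @ph_ip R E v (e k) - @ph_ip R E s (e k).
    exact: (ph_ipBl hL (spectral_space_mem mv) (spectral_space_mem ms) (me k)).
  rewrite (ph_ipBl hL (spectral_power_mem mv) ms' (me k)).
  rewrite spectral_power_coord// mulrBr; congr (_ - _).
  have H1 := ph_coord_comb hL me oe m (fun k => @ph_ip R E (spectral_power al v) (e k)) k.
  have H2 := ph_coord_comb hL me oe m (fun k => @ph_ip R E v (e k)) k.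
  cbv beta in H1, H2; rewrite H1.
  have -> : @ph_ip R E s (e k) = if (k < m)%N then @ph_ip R E v (e k) else 0.
    rewrite -H2; congr (ph_ip _ _).
    by apply: eq_bigr => l _; rewrite spectral_space_coord// scalerA mulrAC powR_oppK mul1r.
  by case: ifP => // _; [rewrite spectral_power_coord|rewrite mulr0].
have m1 := spectral_power_mem mvs.
have m2 : ph_mem (spectral_power al v - s') by apply: (ph_memB hL) => //; exact: spectral_power_mem.
have E1 : @ph_ip R (spectral_space al) (v - s) (v - s) =
    ph_ip (spectral_power al v - s') (spectral_power al v - s').
  rewrite -(pheq_ipl hL m1 m2 m2 H) (ph_ipC hL m1 m2).
  exact: (pheq_ipl hL m1 m2 m1 H).
exact: (congr1 Num.sqrt (esym E1)).
Qed.

End spectral_power.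

Import HBNNSimple.

(** * Integrals of almost everywhere equal functions *)

Section integral_tools.
Context d (T : measurableType d) (R : realType).
Variable mu : {measure set T -> \bar R}.
Implicit Types (D : set T).

(* The sigma-algebras at hand are not complete, so integrands that are only
   a.e. equal to a measurable function do occur. *)
Lemma ge0_integral_eq_off_null (N : set T) (f g : T -> \bar R) :
  measurable N -> mu N = 0%E -> (forall x, 0 <= f x)%E -> (forall x, 0 <= g x)%E ->
  (forall x, ~ N x -> f x = g x) ->
  (\int[mu]_x f x <= \int[mu]_x g x)%E.
Proof.
move=> mN N0 f0 g0 fg; rewrite !ge0_integralTE//.
apply: ge_ereal_sup => _ [h hf <-].
have mNC : measurable (~` N) by exact: measurableC.
(* A simple function below [f], set to 0 on the null set, lies below [g] and keeps its integral. *)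
pose h' := proj_nnsfun h mNC.
have -> : sintegral mu h = sintegral mu h'.
  rewrite -!integralT_nnsfun; apply: ge0_ae_eq_integral => //.
  - exact/measurable_EFinP.
  - exact/measurable_EFinP.
  - by move=> x _; rewrite lee_fin.
  - by move=> x _; rewrite lee_fin.
  exists N; split => // x /= hx; apply: contrapT => Nx; apply: hx => _.
  by rewrite /= mindicE mem_set ?mulr1.
apply: ereal_sup_ubound; exists h' => // x /=; rewrite mindicE.
have [Nx|Nx] := pselect (N x); first by rewrite memNset ?mulr0//; apply.
by rewrite mem_set// mulr1 -fg.
Qed.

Lemma integral_eq_ae D (f g : T -> \bar R) :
  {ae mu, forall x, D x -> f x = g x} ->
  (\int[mu]_(x in D) f x = \int[mu]_(x in D) g x)%E.
Proof.
move=> [N [mN N0 sN]]; rewrite integral_mkcond [RHS]integral_mkcond.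
have fg x : ~ N x -> (f \_ D) x = (g \_ D) x.
  move=> Nx; rewrite /patch; case: ifPn => // /set_mem Dx.
  by apply: contrapT => h; apply: Nx; apply: sN => /=; apply/not_implyP.
rewrite integralE [RHS]integralE; congr (_ - _)%E; apply/eqP; rewrite eq_le;
  apply/andP; split; apply: (ge0_integral_eq_off_null mN N0) => // x Nx;
  by rewrite ?funeposE ?funenegE fg.
Qed.

Lemma Rintegral_eq_ae D (f g : T -> R) :
  {ae mu, forall x, D x -> f x = g x} ->
  \int[mu]_(x in D) f x = \int[mu]_(x in D) g x.
Proof.
move=> h; congr fine; apply: integral_eq_ae; move: h; apply: filterS => x h Dx.
by rewrite h.
Qed.

Lemma Rintegral_dominated D (f_ : nat -> T -> R) (f g : T -> R) :
  measurable D -> (forall n, measurable_fun D (f_ n)) -> measurable_fun D f ->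
  {ae mu, forall x, D x -> f_ n x @[n --> \oo] --> f x} ->
  mu.-integrable D (EFin \o g) ->
  (forall n, {ae mu, forall x, D x -> `|f_ n x| <= g x}) ->
  mu.-integrable D (EFin \o f) /\
  \int[mu]_(x in D) f_ n x @[n --> \oo] --> \int[mu]_(x in D) f x.
Proof.
move=> mD mf_ mf ff ig fg.
have fg' : {ae mu, forall x, forall n, D x -> (`|(f_ n x)%:E| <= (g x)%:E)%E}.
  apply: ae_foralln => n; move: (fg n); apply: filterS => x h Dx.
  by rewrite /= lee_fin; exact: h.
have ff' : {ae mu, forall x, D x -> (f_ n x)%:E @[n --> \oo] --> (f x)%:E}.
  move: ff; apply: filterS => x h Dx; apply: cvg_EFin; first by apply: nearW.
  exact: h.
have mf_' n : measurable_fun D (EFin \o f_ n) by exact/measurable_EFinP.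
have mf' : measurable_fun D (EFin \o f) by exact/measurable_EFinP.
have [If _ H] := dominated_convergence mD mf_' mf' ff' ig fg'.
split => //; apply: fine_cvg.
rewrite fineK//; exact: integrable_fin_num.
Qed.

Lemma le_integrable_R D (f g : T -> R) : measurable D -> measurable_fun D f ->
  (forall x, D x -> `|f x| <= g x) -> mu.-integrable D (EFin \o g) ->
  mu.-integrable D (EFin \o f).
Proof.
move=> mD mf fg ig; apply: le_integrable ig => //; first exact/measurable_EFinP.
by move=> x Dx /=; rewrite lee_fin (le_trans (fg x Dx))// ler_norm.
Qed.

Lemma integrableD_R D (f g : T -> R) : measurable D ->
  mu.-integrable D (EFin \o f) -> mu.-integrable D (EFin \o g) ->
  mu.-integrable D (EFin \o (fun x => f x + g x)).
Proof. by move=> mD h1 h2; have := integrableD mD h1 h2. Qed.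

Lemma integrableZ_R D (a : R) (f : T -> R) : measurable D ->
  mu.-integrable D (EFin \o f) -> mu.-integrable D (EFin \o (fun x => a * f x)).
Proof. by move=> mD h1; have := integrableZl mD a h1. Qed.

Lemma integrable_sum_R D m (f : nat -> T -> R) : measurable D ->
  (forall k, (k < m)%N -> mu.-integrable D (EFin \o f k)) ->
  mu.-integrable D (EFin \o (fun x => \sum_(k < m) f k x)).
Proof.
move=> mD h; elim: m h => [|m IH] h.
  rewrite (_ : _ \o _ = cst 0%E); first exact: integrable0.
  by apply/funext => x /=; rewrite big_ord0.
rewrite (_ : _ \o _ = EFin \o (fun x => \sum_(k < m) f k x + f m x)).
  by apply: integrableD_R => //; [apply: IH => k km; apply: h; exact: ltnW|exact: h].
by apply/funext => x /=; rewrite big_ord_recr.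
Qed.

Lemma Rintegral_sum D m (f : nat -> T -> R) : measurable D ->
  (forall k, (k < m)%N -> mu.-integrable D (EFin \o f k)) ->
  \int[mu]_(x in D) (\sum_(k < m) f k x) = \sum_(k < m) \int[mu]_(x in D) f k x.
Proof.
move=> mD h; elim: m h => [|m IH] h.
  rewrite big_ord0 (_ : (fun x => _) = cst 0); last by apply/funext => x; rewrite big_ord0.
  by rewrite /Rintegral integral0.
rewrite big_ord_recr /= -IH; last by move=> k km; apply: h; exact: ltnW.
rewrite -RintegralD//; last 2 first.
- by apply: integrable_sum_R => // k km; apply: h; exact: ltnW.
- exact: h.
by congr Rintegral; apply/funext => x; rewrite big_ord_recr.
Qed.

Lemma integrable_of_lty D (f : T -> R) : measurable_fun D f ->
  (forall x, D x -> 0 <= f x) -> (\int[mu]_(x in D) (f x)%:E < +oo)%E ->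
  mu.-integrable D (EFin \o f).
Proof.
move=> mf f0 h; apply/integrableP; split; first exact/measurable_EFinP.
move: h; apply: le_lt_trans; rewrite le_eqVlt; apply/orP; left; apply/eqP.
by apply: eq_integral => x /set_mem Dx /=; rewrite ger0_norm ?f0.
Qed.

Lemma integrable_lty_R D (f : T -> R) : measurable D -> mu.-integrable D (EFin \o f) ->
  (\int[mu]_(x in D) (f x)%:E < +oo)%E.
Proof. by move=> mD h; exact: integrable_lty h. Qed.

Lemma EFin_Rintegral D (f : T -> R) : measurable D -> mu.-integrable D (EFin \o f) ->
  ((\int[mu]_(x in D) f x)%:E = \int[mu]_(x in D) (f x)%:E)%E.
Proof. by move=> mD h; rewrite /Rintegral fineK//; exact: integrable_fin_num h. Qed.

Lemma integrable_bounded D (f : T -> R) (C : R) : measurable D -> (mu D < +oo)%E ->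
  measurable_fun D f -> (forall x, D x -> `|f x| <= C) ->
  mu.-integrable D (EFin \o f).
Proof.
move=> mD Doo mf fC; apply: (le_integrable_R (g := fun=> C) mD mf fC); apply/integrableP; split.
  exact: measurable_cst.
by rewrite integral_cst//= lte_mul_pinfty// lee_fin.
Qed.

End integral_tools.

Section integral_limits.
Context d (T : measurableType d) (R : realType).
Variable mu : {measure set T -> \bar R}.
Implicit Types (D : set T).

Lemma limn_einf_le (u : nat -> \bar R) (C : \bar R) :
  (\forall n \near \oo, (u n <= C)%E) -> (limn_einf u <= C)%E.
Proof.
move=> h; rewrite limn_einf_lim; apply: lime_le; first exact: is_cvg_einfs.
move: h; apply: filterS => n h; apply: le_trans h.
by rewrite /einfs; apply: ereal_inf_lbound; exists n => //=.
Qed.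

Lemma fatou_le D (f_ : nat -> T -> R) (f : T -> R) (C : R) :
  measurable D -> (forall n, measurable_fun D (f_ n)) ->
  (forall n x, D x -> 0 <= f_ n x) ->
  {ae mu, forall x, D x -> f_ n x @[n --> \oo] --> f x} ->
  (\forall n \near \oo, (\int[mu]_(x in D) (f_ n x)%:E <= C%:E)%E) ->
  (\int[mu]_(x in D) (f x)%:E <= C%:E)%E.
Proof.
move=> mD mf f0 ff fC.
rewrite (@integral_eq_ae _ _ _ mu D _ (fun x => limn_einf (fun n => (f_ n x)%:E))); last first.
  move: ff; apply: filterS => x h Dx.
  have c : (f_ n x)%:E @[n --> \oo] --> (f x)%:E.
    by apply: cvg_EFin; [apply: nearW|exact: h].
  by have [->] := cvg_limn_einf_sup c.
apply: (le_trans (@fatou _ _ _ mu D mD (fun n => EFin \o f_ n) _ _)).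
- by move=> n; exact/measurable_EFinP.
- by move=> n x Dx; rewrite lee_fin; exact: f0.
exact: limn_einf_le.
Qed.

(** Beppo Levi in real-valued form: the extended-valued sum has integral at most [C], hence is
    finite almost everywhere, and its [fine] is a measurable version of it. *)
Lemma ge0_series_integrable D (f : nat -> T -> R) (C : R) :
  measurable D -> (forall k, measurable_fun D (f k)) ->
  (forall k x, D x -> 0 <= f k x) ->
  (forall m, (\int[mu]_(x in D) (\sum_(k < m) f k x)%:E <= C%:E)%E) ->
  exists g : T -> R, [/\ measurable_fun D g, forall x, D x -> 0 <= g x,
    mu.-integrable D (EFin \o g),
    (\int[mu]_(x in D) (g x)%:E <= C%:E)%E &
    {ae mu, forall x, D x -> \sum_(k < m) f k x @[m --> \oo] --> g x}].
Proof.
move=> mD mf f0 fC.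
pose F x := (\sum_(0 <= k <oo) (f k x)%:E)%E.
have mF : measurable_fun D F.
  apply: ge0_emeasurable_sum => //; last by move=> k _; exact/measurable_EFinP.
  by move=> k x Dx _; rewrite lee_fin f0.
have F0 x : D x -> (0 <= F x)%E by move=> Dx; apply: nneseries_ge0 => k _ _; rewrite lee_fin f0.
have mfE k : measurable_fun D (fun x => (f k x)%:E) by exact/measurable_EFinP.
have fE0 k x : D x -> (0 <= (f k x)%:E)%E by move=> Dx; rewrite lee_fin f0.
have IF : (\int[mu]_(x in D) F x <= C%:E)%E.
  rewrite /F (integral_nneseries mu mD mfE fE0).
  apply: lime_le.
    by apply: is_cvg_ereal_nneg_natsum => k _; apply: integral_ge0 => x Dx; exact: fE0.
  apply: nearW => m; rewrite -(ge0_integral_sum mu mD mfE fE0).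
  apply: le_trans (fC m); rewrite le_eqVlt; apply/orP; left; apply/eqP.
  by apply: eq_integral => x _; rewrite big_mkord sumEFin.
have intF : mu.-integrable D F.
  apply/integrableP; split => //; apply: le_lt_trans (ltry C).
  apply: le_trans IF; rewrite le_eqVlt; apply/orP; left; apply/eqP.
  by apply: eq_integral => x /set_mem Dx; rewrite gee0_abs ?F0.
have finF := integrable_ae mD intF.
have gF : {ae mu, forall x, D x -> (fine (F x))%:E = F x}.
  by move: finF; apply: filterS => x h Dx; rewrite fineK ?h.
have mg : measurable_fun D (fine \o F) by exact: measurableT_comp.
exists (fine \o F); split => //.
- by move=> x Dx /=; rewrite fine_ge0 ?F0.
- apply/integrableP; split; first exact/measurable_EFinP.
  have/integrableP[_] := intF; apply: le_lt_trans.
  rewrite le_eqVlt; apply/orP; left; apply/eqP; apply: integral_eq_ae.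
  by move: gF; apply: filterS => x h Dx; rewrite -[in RHS](h Dx).
- by rewrite (integral_eq_ae gF).
move: finF; apply: filterS => x h Dx; have := h Dx => {}h.
have c : (fun m => (\sum_(0 <= k < m) (f k x)%:E)%E) @ \oo --> F x.
  by apply: is_cvg_ereal_nneg_natsum => k _; rewrite lee_fin f0.
rewrite -(fineK h) in c; have c2 := fine_cvg c.
rewrite (_ : (fun m => \sum_(k < m) f k x) = fine \o (fun m => (\sum_(0 <= k < m) (f k x)%:E)%E)); first exact: c2.
by apply/funext => m /=; rewrite sumEFin /= big_mkord.
Qed.

End integral_limits.

(** * Completeness of L^2 *)

Section L2_general.
Context d (T : measurableType d) (R : realType).
Variables (mu : {measure set T -> \bar R}) (D : set T).
Hypothesis mD : measurable D.

(** [L2 Om] is an instance up to conversion; the same space over a time interval holds the sources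
    and modes. *)
Definition L2_on : prehilbert R :=
  @Prehilbert R (T -> R) [set g | (g \_ D) \in Lfun mu 2%:E]
    (fun g h => \int[mu]_(x in D) (g x * h x)).

Lemma L2_onP (g : T -> R) : @ph_mem R L2_on g <->
  measurable_fun D g /\ mu.-integrable D (EFin \o (fun x => g x ^+ 2)).
Proof.
have sqE : (EFin \o (fun x => (g \_ D) x ^+ 2)) = (EFin \o (fun x => g x ^+ 2)) \_ D.
  by apply/funext => x; rewrite /patch /=; case: ifP => //; rewrite expr0n.
split=> [h|[mg ig]] /=.
  have := Lfun2_integrable_sqr h; rewrite sqE => h2; split.
    apply/(measurable_restrictT _ mD); move: h; rewrite /= inE => /andP[].
    by rewrite inE.
  exact/integrable_mkcond.
have mg' : measurable_fun setT (g \_ D) by apply/(measurable_restrictT _ mD).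
rewrite inE; apply/andP; split; first by rewrite inE.
rewrite inE /finite_norm /= unlock; apply: poweR_lty.
have ih : mu.-integrable setT (EFin \o (fun x => (g \_ D) x ^+ 2)).
  by rewrite sqE; exact: (integrable_mkcond (EFin \o (fun x => g x ^+ 2)) mD).1 ig.
move: ih => {sqE mg'}; set h := g \_ D => ih.
have -> : (\int[mu]_x `|(EFin \o h) x| `^ 2)%E = (\int[mu]_x (h x ^+ 2)%:E)%E.
  apply: eq_integral => x _ /=.
  rewrite powR_mulrn ?normr_ge0// real_normK ?num_real //. 
exact: integrable_lty_R.
Qed.

Lemma L2_on_mulr_integrable (g h : T -> R) : @ph_mem R L2_on g -> @ph_mem R L2_on h ->
  mu.-integrable D (EFin \o (fun x => g x * h x)).
Proof.
move=> /L2_onP[mg ig] /L2_onP[mh ih].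
apply: (@le_integrable_R _ _ _ mu D _ (fun x => g x ^+ 2 + h x ^+ 2)) => //.
- exact: measurable_funM.
- move=> x _; rewrite normrM.
  have := sqr_ge0 (`|g x| - `|h x|); rewrite -(real_normK (num_real (g x))) -(real_normK (num_real (h x))).
  have := normr_ge0 (g x); have := normr_ge0 (h x); nra.
exact: integrableD_R.
Qed.

Lemma L2_on_axioms : prehilbert_axioms L2_on.
Proof.
have memP (a : R) g h : @ph_mem R L2_on g -> @ph_mem R L2_on h -> @ph_mem R L2_on (a *: g + h).
  move=> mg mh; have ip := L2_on_mulr_integrable mg mh.
  move/L2_onP : mg => [mg ig]; move/L2_onP : mh => [mh ih]; apply/L2_onP; split.
    by apply: measurable_funD => //; apply: measurable_funM => //; exact: measurable_cst.
  rewrite (_ : _ \o _ = EFin \o (fun x => a ^+ 2 * g x ^+ 2 + (2 * a * (g x * h x) + h x ^+ 2))).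
    apply: integrableD_R => //; first exact: (@integrableZ_R _ _ _ mu D (a ^+ 2) (fun x => g x ^+ 2)).
    apply: integrableD_R => //.
    exact: (@integrableZ_R _ _ _ mu D (2 * a) (fun x => g x * h x)).
  apply/funext => x /=; congr EFin.
  have -> : (a *: g + h) x = a * g x + h x by [].
  ring.
split => //.
- apply/L2_onP; split; first exact: measurable_cst.
  rewrite (_ : _ \o _ = cst 0%E); first exact: integrable0.
  by apply/funext => x /=; rewrite expr0n.
- by move=> g h _ _ /=; congr Rintegral; apply/funext => x; rewrite mulrC.
- move=> a g h w mg mh mw /=.
  rewrite -RintegralZl//; last exact: L2_on_mulr_integrable.
  rewrite -RintegralD//; last 2 first.
  + by apply: integrableZ_R => //; exact: L2_on_mulr_integrable.
  + exact: L2_on_mulr_integrable.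
  congr Rintegral; apply/funext => x.
  have -> : (a *: g + h) x = a * g x + h x by [].
  ring.
- by move=> g mg /=; apply: Rintegral_ge0 => x _; rewrite -expr2 sqr_ge0.
Qed.

Lemma L2_on_sqr (g : T -> R) : @ph_mem R L2_on g ->
  @phnorm R L2_on g ^+ 2 = \int[mu]_(x in D) (g x ^+ 2).
Proof. by move=> mg; rewrite (phnorm_sqr L2_on_axioms). Qed.

Lemma L2_on_sqrE (g : T -> R) : @ph_mem R L2_on g ->
  ((@phnorm R L2_on g ^+ 2)%:E = \int[mu]_(x in D) (g x ^+ 2)%:E)%E.
Proof. by move=> mg; rewrite L2_on_sqr// EFin_Rintegral//; have /L2_onP[] := mg. Qed.

(* Along a subsequence with |s_(j+1) - s_j|^2 <= 16^-j one has
   |s_(j+1)(x) - s_j(x)| <= C_x 2^-j for almost every x. *)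
Lemma L2_on_complete : ph_complete L2_on.
Proof.
move=> s [ms cs]; have hA := L2_on_axioms.
have [t ht tP] : exists2 t : nat -> nat, {homo t : i j / (i < j)%N} &
    forall j, forall l, (t j <= l)%N -> @phnorm R L2_on (s l - s (t j)) < (4 ^- j).
  have P n N : exists2 i, (N <= i)%N & forall l, (i <= l)%N -> @phnorm R L2_on (s l - s i) < 4 ^- n.
    have [K KP] := cs (4 ^- n) ltac:(by rewrite invr_gt0 exprn_gt0).
    exists (maxn N K); first exact: leq_maxl.
    move=> l hl; apply: KP; last exact: leq_maxr.
    by apply: leq_trans hl; exact: leq_maxr.
  have [t ht tP] := increasing_seq_of_frequently P.
  by exists t.
pose u j := s (t j : nat) : T -> R.
have mu_ j : measurable_fun D (u j) by have /L2_onP[] := ms (t j).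
(* The weight 4^j leaves integrals of size 4^-j, hence a summable series, while a bound q_j(x) <=
   M^2 says that the j-th increment at x is at most M 2^-j. *)
pose q j x := 4 ^+ j * (u j.+1 x - u j x) ^+ 2.
have mq j : measurable_fun D (q j).
  apply: measurable_funM; first exact: measurable_cst.
  by apply: measurable_funX; exact: measurable_funB.
have q0 j x : 0 <= q j x by rewrite mulr_ge0 ?sqr_ge0// exprn_ge0.
have diffm j : @ph_mem R L2_on (s (t j.+1) - s (t j)) by exact: ph_memB.
have iq j : mu.-integrable D (EFin \o q j).
  by have /L2_onP[_] := diffm j; exact: integrableZ_R.
have qle j : \int[mu]_(x in D) q j x <= 4 ^- j.
  rewrite RintegralZl//; last by have /L2_onP[] := diffm j.
  have /= <- := L2_on_sqr (diffm j).
  have := tP j (t j.+1) (ltnW (ht _ _ (ltnSn j))) => h.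
  have p4 : 0 < (4 : R) ^+ j by rewrite exprn_gt0.
  have pa : (4 : R) ^+ j * 4 ^- j = 1 by rewrite mulfV// gt_eqF.
  have n0 : 0 <= @phnorm R L2_on (s (t j.+1) - s (t j)) by exact: phnorm_ge0.
  move: h n0 pa p4; set n := phnorm _; set a := 4 ^- j; set p := 4 ^+ j => h n0 pa p4.
  have : n ^+ 2 <= a ^+ 2 by rewrite ler_pXn2r ?nnegrE//; [exact: ltW|exact: le_trans n0 (ltW h)].
  rewrite -(ler_pM2l p4) => /le_trans; apply.
  by rewrite expr2 mulrA pa mul1r.
have sumq m : (\int[mu]_(x in D) (\sum_(k < m) q k x)%:E <= 2%:E)%E.
  rewrite -EFin_Rintegral//; last exact: integrable_sum_R.
  rewrite lee_fin Rintegral_sum//.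
  have : \sum_(k < m) \int[mu]_(x in D) q k x <= 4 / 3 * (1 - 4 ^- m).
    elim: m => [|m IH]; first by rewrite big_ord0 expr0 invr1 subrr mulr0.
    rewrite big_ord_recr /=; have := qle m.
    have -> : 4 ^- m.+1 = 4 ^- m / 4 :> R by rewrite exprS invfM mulrC.
    have : 0 < (4 : R) ^- m by rewrite invr_gt0 exprn_gt0.
    move: IH; set a := 4 ^- m; set b := \sum_(i < m) _; set c := Rintegral _ _ _.
    lra.
  have : 0 < (4 : R) ^- m by rewrite invr_gt0 exprn_gt0.
  set a := 4 ^- m; lra.
have [g [_ _ _ _ gP]] := ge0_series_integrable mD mq (fun k x _ => q0 k x) sumq.
have uc : {ae mu, forall x, D x -> cvgn (fun j => u j x)}.
  move: gP; apply: filterS => x h Dx; have := h Dx => {}h.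
  have [M MP] : exists M, forall j, q j x <= M ^+ 2.
    have [K [_ KP]] := cvg_seq_bounded (cvgP _ h).
    have K0 : 0 <= `|K| + 1 by rewrite addr_ge0.
    exists (Num.sqrt (`|K| + 1)) => j; rewrite sqr_sqrtr//.
    have /KP : K < `|K| + 1 by rewrite (le_lt_trans (ler_norm _))// ltrDl.
    move=> /(_ j.+1 Logic.I); apply: le_trans; apply: le_trans (ler_norm _).
    by rewrite big_ord_recr /= lerDr sumr_ge0.
  have dle j : `|u j.+1 x - u j x| <= `|M| * 2^-1 ^+ j.
    rewrite -(@ler_pXn2r _ 2)// ?nnegrE ?mulr_ge0 ?exprn_ge0// ?invr_ge0//.
    rewrite exprMn !real_normK ?num_real//.
    have pa : (4 : R) ^+ j * (2^-1 ^+ j) ^+ 2 = 1.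
      by rewrite exprAC -exprMn (_ : 4 * 2^-1 ^+ 2 = 1) ?expr1n//; field.
    have b0 : 0 <= (2^-1 ^+ j) ^+ 2 :> R by exact: sqr_ge0.
    have := ler_wpM2r b0 (MP j); rewrite /q; apply: le_trans.
    by rewrite mulrAC pa mul1r.
  have c1 : cvgn (series (fun j => u j.+1 x - u j x)).
    apply: normed_cvg; apply: (@series_le_cvg _ _ (fun j => `|M| * 2^-1 ^+ j)).
    - by move=> j; exact: normr_ge0.
    - by move=> j; rewrite mulr_ge0 ?exprn_ge0// invr_ge0.
    - exact: dle.
    - by apply: is_cvg_geometric_series; rewrite ger0_norm ?invr_ge0// invf_lt1 // ltr1n.
  have -> : (fun j => u j x) = (fun j => u 0%N x + series (fun j => u j.+1 x - u j x) j).
    apply/funext => j; rewrite /series /=.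
    by rewrite telescope_sumr// addrC subrK.
  by apply: is_cvgD => //; exact: is_cvg_cst.
have [N [mN N0 NP]] := uc.
have ucN x : D x -> ~ N x -> cvgn (fun j => u j x).
  by move=> Dx Nx; apply: contrapT => h; apply: Nx; apply: NP => /= /(_ Dx).
(* The sequence is set to 0 on the exceptional set, so that it converges at every point of [D] and
   the limit is measurable there. *)
pose f x := limn (fun j => u j x * \1_(~` N) x).
have uNc x : D x -> u j x * \1_(~` N) x @[j --> \oo] --> f x.
  move=> Dx; suff : cvgn (fun j => u j x * \1_(~` N) x) by [].
  have [Nx|Nx] := pselect (N x).
    rewrite (_ : (fun j => _) = cst 0); first exact: is_cvg_cst.
    by apply/funext => j; rewrite indicE memNset ?mulr0//; apply.
  rewrite (_ : (fun j => _) = u ^~ x); first exact: ucN.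
  by apply/funext => j; rewrite indicE mem_set ?mulr1.
have mf : measurable_fun D f.
  apply: (@measurable_fun_cvg _ _ _ D (fun j x => u j x * \1_(~` N) x)) => // j.
  apply: measurable_funM => //; apply: measurable_funTS; apply: measurable_indic.
  exact: measurableC.
have uf : {ae mu, forall x, D x -> u j x @[j --> \oo] --> f x}.
  exists N; split => // x /= hx; apply: contrapT => Nx; apply: hx => Dx.
  have := uNc x Dx; rewrite (_ : (fun j => _) = u ^~ x)//.
  by apply/funext => j; rewrite indicE mem_set ?mulr1.
have key i : forall C : R, (\forall l \near \oo, @phnorm R L2_on (s i - s (t l)) <= C) ->
    (\int[mu]_(x in D) ((s i x - f x) ^+ 2)%:E <= (C ^+ 2)%:E)%E.
  move=> C hC; have /L2_onP[mi _] := ms i.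
  apply: (@fatou_le _ _ _ mu D (fun l x => (s i x - u l x) ^+ 2)) => //.
  - by move=> l; apply: measurable_funX; exact: measurable_funB.
  - by move=> l x _; exact: sqr_ge0.
  - move: uf; apply: filterS => x h Dx.
    have c2 : s i x - u l x @[l --> \oo] --> s i x - f x.
      by apply: cvgB; [exact: cvg_cst|exact: h].
    exact: (cvgM c2 c2).
  move: hC; apply: filterS => l hC.
  have C0 : 0 <= C by apply: le_trans hC; exact: phnorm_ge0.
  have := L2_on_sqrE (ph_memB hA (ms i) (ms (t l))) => <-.
  by rewrite lee_fin ler_pXn2r ?nnegrE ?phnorm_ge0.
have cle e : 0 < e -> exists K : nat, forall i, (K <= i)%N ->
    (\int[mu]_(x in D) ((s i x - f x) ^+ 2)%:E <= (e ^+ 2)%:E)%E.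
  move=> e0; have [K KP] := cs e e0; exists K => i Ki; apply: key.
  exists K => // l /= Kl; apply/ltW/KP => //.
  exact: (leq_trans Kl (increasing_seq_ge ht l)).
have [K0 KP0] := cle 1 ltr01.
have intm i : (K0 <= i)%N -> @ph_mem R L2_on (s i - f : T -> R).
  move=> Ki; apply/L2_onP; have /L2_onP[mi _] := ms i; split.
    exact: measurable_funB.
  apply: integrable_of_lty; first by apply: measurable_funX; exact: measurable_funB.
    by move=> x _; exact: sqr_ge0.
  exact: (le_lt_trans (KP0 i Ki) (ltry _)).
have mff : @ph_mem R L2_on f.
  have -> : f = s K0 - (s K0 - f : T -> R) :> (T -> R) by rewrite opprB addrC subrK.
  exact: (ph_memB hA (ms K0) (intm K0 (leqnn _))).
exists f => //; apply/cvgr0Pnorm_le => e e0.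
have [K KP] := cle e e0; exists (maxn K K0) => // i /=; rewrite geq_max => /andP[Ki K0i].
rewrite ger0_norm ?phnorm_ge0// -(@ler_pXn2r _ 2)// ?nnegrE ?phnorm_ge0//; last exact: ltW.
by rewrite -lee_fin (L2_on_sqrE (intm i K0i)); exact: KP.
Qed.

End L2_general.

(** * Strong measurability and coordinates *)

Section quantizer.
Variable R : realType.

(** [N] is the integer part of [y], capped at [K]. *)
Lemma count_le (K : nat) (y : R) : 0 <= y ->
  let N := \sum_(i < K) (i.+1%:R <= y)%R%:R : R in
  [/\ N <= y, N <= K%:R & (K%:R <= N) || (y < N + 1)].
Proof.
move=> y0; elim: K => [|K [IH1 IH2 IH3]] /=.
  by rewrite big_ord0; split => //; rewrite lexx.
rewrite big_ord_recr /=; move: IH1 IH2 IH3; set N := \sum_(i < K) _ => IH1 IH2 IH3.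
have K1 : (K.+1%:R : R) = K%:R + 1 by rewrite -natr1.
have [Ky|yK] := leP K.+1%:R y; rewrite /= ?addr0 ?mulr1n K1; [rewrite K1 in Ky|rewrite K1 in yK].
  split; [by case/orP: IH3 => ?; lra|lra|].
  by case/orP: IH3 => ?; apply/orP; left; lra.
split; [by []|lra|].
by apply/orP; right; case/orP: IH3 => ?; lra.
Qed.

(** Rounds [x] down to a multiple of 1/P between -J and J. Written as a sum over superlevel sets, it
    turns a measurable function into a simple one. *)
Definition quantize (J P : nat) (x : R) : R :=
  - J%:R + \sum_(i < (2 * J * P)%N) (P%:R^-1 * (- J%:R + i.+1%:R / P%:R <= x)%R%:R).

Lemma quantize_err (J P : nat) (x : R) : (0 < P)%N -> `|x| <= J%:R ->
  `|quantize J P x - x| <= P%:R^-1.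
Proof.
move=> P0; rewrite ler_norml => /andP[x1 x2].
have p0 : 0 < P%:R :> R by rewrite ltr0n.
set y := (x + J%:R) * P%:R.
have y0 : 0 <= y by rewrite mulr_ge0//; lra.
have := @count_le (2 * J * P)%N y y0; set N := \sum_(i < _) _ => -[h1 h2 h3].
have -> : quantize J P x = - J%:R + P%:R^-1 * N.
  rewrite /quantize -mulr_sumr; congr (_ + _ * _); apply: eq_bigr => i _.
  by rewrite /y -ler_pdivrMr// addrC -lerBDr opprK [in RHS]addrC; congr ((_ <= _)%R%:R); rewrite addrC.
have xE : x = - J%:R + P%:R^-1 * y by rewrite /y mulrCA mulVf ?gt_eqF//; lra.
have h4 : y - 1 <= N.
  case/orP: h3 => h3; last lra.
  suff : y <= (2 * J * P)%:R by lra.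
  by rewrite /y natrM natrM ler_wpM2r//; lra.
have -> : - J%:R + P%:R^-1 * N - x = P%:R^-1 * (N - y).
  by rewrite mulrBr; move: xE; set z := P%:R^-1 * y; lra.
rewrite normrM gtr0_norm ?invr_gt0//.
rewrite -[leRHS]mulr1 ler_wpM2l ?invr_ge0 ?ler0n// ler_norml; apply/andP; split; lra.
Qed.

End quantizer.

Section simple_functions.
Variables (R : realType) (E : prehilbert R).
Hypothesis hE : prehilbert_axioms E.

Lemma simple_vfun_indic (B : set (measurableTypeR R)) (x : E) :
  measurable B -> ph_mem x -> simple_vfun (fun t => \1_B t *: x).
Proof.
move=> mB mx; exists 1%N, (fun=> B), (fun=> x); split => //.
by apply/funext => t; rewrite big_ord1.
Qed.

Lemma simple_vfun0 : simple_vfun (fun _ : R => 0 : E).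
Proof.
exists 0%N, (fun=> set0), (fun=> 0); split; first by case.
by apply/funext => t; rewrite big_ord0.
Qed.

Lemma simple_vfunD (s t : R -> E) : simple_vfun s -> simple_vfun t ->
  simple_vfun (fun x => s x + t x).
Proof.
move=> [k [B [x [h1 ->]]]] [k' [B' [x' [h2 ->]]]].
exists (k + k')%N,
  (fun i => match fintype.split i with inl j => B j | inr j => B' j end),
  (fun i => match fintype.split i with inl j => x j | inr j => x' j end); split.
  by move=> i; case: fintype.split => j; [exact: h1|exact: h2].
apply/funext => y; rewrite big_split_ord /=; congr (_ + _); apply: eq_bigr => i _.
  by rewrite (unsplitK (inl i)).
by rewrite (unsplitK (inr i)).
Qed.

Lemma simple_vfun_sum m (s : nat -> R -> E) : (forall k, simple_vfun (s k)) ->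
  simple_vfun (fun x => \sum_(k < m) s k x).
Proof.
move=> h; elim: m => [|m IH].
  rewrite (_ : (fun x => _) = fun=> 0); first exact: simple_vfun0.
  by apply/funext => x; rewrite big_ord0.
rewrite (_ : (fun x => _) = (fun x => \sum_(k < m) s k x + s m x)).
  exact: simple_vfunD.
by apply/funext => x; rewrite big_ord_recr.
Qed.

Lemma simple_vfun_quantize J P (c : R -> R) (x : E) :
  measurable_fun setT (c : measurableTypeR R -> R) -> ph_mem x ->
  simple_vfun (fun t => quantize J P (c t) *: x).
Proof.
move=> mc mx.
rewrite (_ : (fun t => _) = fun t => \1_setT t *: (- J%:R *: x) +
   \sum_(i < (2 * J * P)%N) \1_[set t | - J%:R + i.+1%:R / P%:R <= c t] t *:
     (P%:R^-1 *: x)).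
  apply: simple_vfunD.
    by apply: simple_vfun_indic => //; exact: (ph_memZ hE).
  apply: (@simple_vfun_sum _ (fun i t => \1_[set t | - J%:R + i.+1%:R / P%:R <= c t] t *:
     (P%:R^-1 *: x))) => k.
  apply: simple_vfun_indic; last exact: (ph_memZ hE).
  rewrite (_ : [set t | _] = c @^-1` `[- J%:R + k.+1%:R / P%:R, +oo[%classic).
    by rewrite -[X in measurable X]setTI; exact: mc.
  by apply/seteqP; split => t /=; rewrite in_itv /= andbT.
apply/funext => t; rewrite /quantize scalerDl indicT scale1r; congr (_ + _).
rewrite scaler_suml; apply: eq_bigr => i _; rewrite scalerA mulrC; congr (_ * _ *: _).
by rewrite indicE; congr (nat_of_bool _)%:R; apply/idP/idP => [h|/set_mem//]; rewrite inE.
Qed.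

End simple_functions.

(** * Square summable sequences and their pairing *)

Section l2_sequences.
Variable R : realType.
Implicit Types (a c : nat -> R).

Lemma sum_ord_tail (F : nat -> R) m n : (m <= n)%N ->
  \sum_(k < n) F k = \sum_(k < m) F k + \sum_(m <= k < n) F k.
Proof.
by move=> mn; rewrite -!(big_mkord xpredT F) -(big_cat_nat (leq0n m) mn).
Qed.

Definition sqsum a m : R := \sum_(k < m) a k ^+ 2.

Lemma sqsum_le a (A : R) m : sqsum a n @[n --> \oo] --> A -> sqsum a m <= A.
Proof.
move=> h; apply: (cvgr_to_ge h); exists m => // n /= mn.
rewrite /sqsum (@sum_ord_tail (fun k => a k ^+ 2) m n mn).
by rewrite lerDl sumr_ge0// => i _; exact: sqr_ge0.
Qed.

Lemma sqsum_cvg_of_bounded a (C : R) : (forall m, sqsum a m <= C) ->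
  exists A : R, sqsum a n @[n --> \oo] --> A.
Proof.
move=> h; suff : cvgn (sqsum a) by move=> c; exists (limn (sqsum a)).
apply: nondecreasing_is_cvgn; last by exists C => _ [m _ <-].
apply/nondecreasing_seqP => m; rewrite /sqsum big_ord_recr /= lerDl; exact: sqr_ge0.
Qed.

(** Young's inequality with a free parameter, in place of Cauchy-Schwarz: the right side is linear
    in the two sums of squares, so it can be integrated in time. A small [del] takes care of [a], of
    which only a bound is known; the tail of [c] then beats [del^-1]. *)
Lemma pairing_tail_le a c (del : R) m n : 0 < del -> (m <= n)%N ->
  `|\sum_(k < n) a k * c k - \sum_(k < m) a k * c k| <=
  del * sqsum a n + del^-1 * (sqsum c n - sqsum c m).
Proof.
move=> d0 mn.
have sp (F : nat -> R) : \sum_(k < n) F k - \sum_(k < m) F k = \sum_(m <= k < n) F k.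
  by rewrite (sum_ord_tail F mn) addrC addKr.
have sp1 := sp (fun k => a k * c k); have sp2 := sp (fun k => c k ^+ 2).
cbv beta in sp1, sp2; rewrite sp1 /sqsum sp2.
apply: (@le_trans _ _ (del * \sum_(m <= k < n) a k ^+ 2 + del^-1 * \sum_(m <= k < n) c k ^+ 2)).
  rewrite !mulr_sumr -big_split /=; apply: (le_trans (ler_norm_sum _ _ _)).
  apply: ler_sum => k _; rewrite normrM.
  rewrite -(real_normK (num_real (a k))) -(real_normK (num_real (c k))).
  set x := `|a k|; set y := `|c k|.
  have x0 : 0 <= x by exact: normr_ge0.
  have y0 : 0 <= y by exact: normr_ge0.
  have : 0 <= del * (x - del^-1 * y) ^+ 2 by rewrite mulr_ge0 ?sqr_ge0// ltW.
  have -> : del * (x - del^-1 * y) ^+ 2 = del * x ^+ 2 - 2 * (x * y) + del^-1 * y ^+ 2.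
    by field; lra.
  have : 0 <= x * y by exact: mulr_ge0.
  by lra.
rewrite lerD2r ler_pM2l// (@sum_ord_tail (fun k => a k ^+ 2) m n mn).
by rewrite lerDr sumr_ge0// => i _; exact: sqr_ge0.
Qed.

Definition pairing a c : R := limn (fun m => \sum_(k < m) a k * c k).

Section pairing.
Variables (a c : nat -> R) (A C : R).
Hypotheses (aA : sqsum a n @[n --> \oo] --> A) (cC : sqsum c n @[n --> \oo] --> C).

Lemma pairing_cvg : \sum_(k < m) a k * c k @[m --> \oo] --> pairing a c.
Proof.
suff : cvgn (fun m => \sum_(k < m) a k * c k) by [].
apply/cauchy_cvgP/cauchy_exP => e e0.
have A0 : 0 <= A by apply: le_trans (sqsum_le 0%N aA); rewrite /sqsum big_ord0.
pose del := e / 4 / (A + 1).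
have d0 : 0 < del by rewrite !divr_gt0//; lra.
have de0 : 0 < del * e / 4 by rewrite divr_gt0// mulr_gt0.
have /cvgrPdist_lt/(_ _ de0) [N _ NP] := cC.
exists (\sum_(k < N) a k * c k); exists N => // m /= Nm.
rewrite /ball /= distrC (le_lt_trans (pairing_tail_le a c d0 Nm))//.
have h1 := sqsum_le m aA; have h2 := sqsum_le m cC.
have := NP N (leqnn N); rewrite /= ltr_norml => /andP[_ h3].
have h4 : del * sqsum a m <= e / 4.
  have -> : e / 4 = del * (A + 1) by rewrite /del; field; lra.
  by rewrite ler_pM2l//; lra.
have h5 : del^-1 * (sqsum c m - sqsum c N) <= e / 4.
  have -> : e / 4 = del^-1 * (del * e / 4) by rewrite -mulrA mulKf// gt_eqF.
  by rewrite ler_pM2l ?invr_gt0//; lra.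
lra.
Qed.

Lemma pairing_tail (del : R) m : 0 < del ->
  `|pairing a c - \sum_(k < m) a k * c k| <= del * A + del^-1 * (C - sqsum c m).
Proof.
move=> d0.
have h : `|\sum_(k < n) a k * c k - \sum_(k < m) a k * c k| @[n --> \oo] -->
    `|pairing a c - \sum_(k < m) a k * c k|.
  by apply: cvg_norm; apply: cvgB; [exact: pairing_cvg|exact: cvg_cst].
apply: (cvgr_to_le h); exists m => // n /= mn.
apply: (le_trans (pairing_tail_le a c d0 mn)); apply: lerD.
  by rewrite ler_pM2l//; exact: sqsum_le.
by rewrite ler_pM2l ?invr_gt0// lerD2r; exact: sqsum_le.
Qed.

End pairing.
End l2_sequences.

Section ae_combination.
Context d (T : measurableType d) (R : realType) (mu : {measure set T -> \bar R}).
Implicit Types P Q : T -> Prop.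

Lemma aeS2 (P1 P2 Q : T -> Prop) : (forall x, P1 x -> P2 x -> Q x) ->
  {ae mu, forall x, P1 x} -> {ae mu, forall x, P2 x} -> {ae mu, forall x, Q x}.
Proof. by move=> h; exact: (filterS2 _ h). Qed.

Lemma aeS3 (P1 P2 P3 Q : T -> Prop) : (forall x, P1 x -> P2 x -> P3 x -> Q x) ->
  {ae mu, forall x, P1 x} -> {ae mu, forall x, P2 x} -> {ae mu, forall x, P3 x} ->
  {ae mu, forall x, Q x}.
Proof. by move=> h; exact: (filterS3 _ h). Qed.

Lemma aeS4 (P1 P2 P3 P4 Q : T -> Prop) :
  (forall x, P1 x -> P2 x -> P3 x -> P4 x -> Q x) ->
  {ae mu, forall x, P1 x} -> {ae mu, forall x, P2 x} -> {ae mu, forall x, P3 x} ->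
  {ae mu, forall x, P4 x} -> {ae mu, forall x, Q x}.
Proof.
move=> h h1 h2 h3 h4; apply: (aeS3 _ (filterI h1 h2) h3 h4) => x [? ?] ? ?.
exact: h.
Qed.

End ae_combination.

Section bochner_coordinates.
Variables (R : realType) (E : prehilbert R) (eh : nat -> E).
Hypothesis hE : prehilbert_axioms E.
Hypothesis hb : ph_basis eh.
Let mu := @lebesgue_measure R.
Variable I : set (measurableTypeR R).
Hypothesis mI : measurable I.
Implicit Types (u v : R -> E) (c : nat -> R -> R) (M : R -> R).

Let meh := ph_basis_mem hb.
Let oeh := ph_basis_ortho hb.

(** Measurability and square summability are demanded at every time, so that [M] is Borel and
    pairings are defined everywhere; exceptional null sets occur only in [coord_of]. *)
Definition borel_coord c M :=
  (forall k, measurable_fun setT (c k : measurableTypeR R -> R)) /\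
  (forall t, sqsum (c ^~ t) n @[n --> \oo] --> M t).

Definition coord_of v c M := borel_coord c M /\
  {ae mu, forall t, I t -> ph_mem (v t) /\ forall k, ph_ip (v t) (eh k) = c k t}.

Lemma borel_coord_ge0 c M t : borel_coord c M -> 0 <= M t.
Proof. by move=> [_ /(_ t)/(sqsum_le 0)]; rewrite /sqsum big_ord0. Qed.

Lemma borel_coord_measurable c M : borel_coord c M ->
  measurable_fun setT (M : measurableTypeR R -> R).
Proof.
move=> [mc cM]; apply: (@measurable_fun_cvg _ _ _ setT (fun n t => sqsum (c ^~ t) n)) => //.
move=> n; rewrite /sqsum; apply: measurable_sum => k.
exact: (measurable_funX 2 (mc k)).
Qed.

Lemma coord_of_norm v c M : coord_of v c M ->
  {ae mu, forall t, I t -> phnorm (v t) ^+ 2 = M t}.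
Proof.
move=> [[_ cM] h]; move: h; apply: filterS => t h It; have [mv vc] := h It.
have := parseval_norm hE hb mv.
rewrite (_ : (fun m => _) = sqsum (c ^~ t)); last first.
  by apply/funext => m; apply: eq_bigr => k _; rewrite vc.
by move=> h1; exact: (cvg_unique (@Rhausdorff R) h1 (cM t)).
Qed.

(** Half of Pettis' theorem in the presence of a basis: coordinates are pointwise limits of those of
    simple functions, once set to 0 outside [I] and on the null set where convergence may fail. *)
Lemma strongly_measurable_coord v : strongly_measurable I v ->
  exists c M, coord_of v c M.
Proof.
move=> [s [ss [N [mN N0 NP]]]].
have {NP}NP t : I t -> ~ N t -> ph_mem (v t) /\ phnorm (s j t - v t) @[j --> \oo] --> (0 : R).
  move=> It Nt; apply: contrapT => h; apply: Nt; apply: NP => /= H; apply: h.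
  by split; [exact: (H It).1|exact: (H It).2].
have ms j t : ph_mem (s j t).
  have [k [B [x [h ->]]]] := ss j; apply: (ph_mem_sum hE) => i _.
  by apply: (ph_memZ hE); exact: (h i).2.
pose G := I `\` N.
have mG : measurable G by exact: measurableD.
pose a k j t := ph_ip (s j t) (eh k) * \1_G t.
have ma k j : measurable_fun setT (a k j : measurableTypeR R -> R).
  apply: measurable_funM; last exact: measurable_indic.
  have [p [B [x [h ->]]]] := ss j.
  rewrite (_ : (fun t => _) = fun t => \sum_(i < p) (\1_(B i) t * ph_ip (x i) (eh k))).
    apply: measurable_sum => i; apply: measurable_funM; last exact: measurable_cst.
    by apply: measurable_indic; exact: (h i).1.
  apply/funext => t; rewrite (ph_ip_suml hE)//; last first.
    by move=> i _; apply: (ph_memZ hE); exact: (h i).2.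
  by apply: eq_bigr => i _; rewrite (ph_ipZl hE)//; exact: (h i).2.
pose c k t := if t \in G then ph_ip (v t) (eh k) else 0.
have cc k t : a k j t @[j --> \oo] --> c k t.
  rewrite /a /c; case: ifPn => [/set_mem[It Nt]|tG].
    rewrite (_ : (fun j => _) = fun j => ph_ip (s j t) (eh k)); last first.
      by apply/funext => j; rewrite indicE mem_set ?mulr1.
    by have [mv cv] := NP t It Nt; exact: (ph_ip_cvg hE).
  rewrite (_ : (fun j => _) = cst 0); first exact: cvg_cst.
  by apply/funext => j; rewrite indicE (negPf tG) mulr0.
have mc k : measurable_fun setT (c k : measurableTypeR R -> R).
  by apply: (@measurable_fun_cvg _ _ _ setT (a k)) => [j|t _]; [exact: ma|exact: cc].
exists c, (fun t => if t \in G then phnorm (v t) ^+ 2 else 0); split; first split => // t.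
  case: ifPn => [tG|tG].
    have [It Nt] := set_mem tG; have [mv _] := NP t It Nt.
    have := parseval_norm hE hb mv; rewrite (_ : (fun m => _) = sqsum (c ^~ t))//.
    by apply/funext => m; apply: eq_bigr => k _; rewrite /c tG.
  rewrite (_ : (fun n => _) = cst 0); first exact: cvg_cst.
  apply/funext => m; rewrite /sqsum big1// => k _; by rewrite /c (negPf tG) expr0n.
exists N; split => // t /= h; apply: contrapT => Nt; apply: h => It.
have [mv _] := NP t It Nt; split => // k.
by rewrite /c mem_set.
Qed.

Lemma coord_of_strongly_measurable v c M : coord_of v c M -> strongly_measurable I v.
Proof.
move=> [[mc cM] h].
(* The converse half: at stage j, j coordinates are each rounded with error at most (j+1)^-2, so the
   rounding costs less than 1/(j+1) in norm. *)
pose s j t := \sum_(k < j) quantize j (j.+1 ^ 2)%N (c k t) *: eh k.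
exists s; split.
  move=> j; apply: (@simple_vfun_sum _ _ j (fun k t => quantize j (j.+1 ^ 2)%N (c k t) *: eh k)) => k.
  by apply: simple_vfun_quantize.
move: h; apply: filterS => t h It; have [mv vc] := h It; split => //.
pose w j := \sum_(k < j) ph_ip (v t) (eh k) *: eh k.
have mw j : ph_mem (w j) by exact: (ph_mem_comb hE meh j (fun k => ph_ip (v t) (eh k))).
have mst j : ph_mem (s j t) by exact: (ph_mem_comb hE meh j (fun k => quantize j (j.+1 ^ 2)%N (c k t))).
have M0 : 0 <= M t by exact: (@borel_coord_ge0 c M t).
(* Rounding is accurate only on [-j, j]; all coordinates at [t] are at most sqrt(M t) in absolute
   value, so this holds for all of them from some j on. *)
have [J HJ] : exists J : nat, forall j k, (J <= j)%N -> `|c k t| <= j%:R.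
  exists (Num.truncn (Num.sqrt (M t))).+1 => j k Jj.
  apply: (@le_trans _ _ (Num.sqrt (M t))); last first.
    apply: (@le_trans _ _ (Num.truncn (Num.sqrt (M t))).+1%:R); last by rewrite ler_nat.
    by apply/ltW; exact: truncnS_gt.
  rewrite -sqrtr_sqr ler_wsqrtr//; have := sqsum_le k.+1 (cM t).
  rewrite /sqsum big_ord_recr /=; apply: le_trans.
  by rewrite lerDr sumr_ge0// => i _; exact: sqr_ge0.
have d1 j : (J <= j)%N -> phnorm (s j t - w j) <= j.+1%:R^-1.
  move=> Jj; rewrite /s /w -sumrB.
  apply: (le_trans (phnorm_sum hE _ _)).
    by move=> i _; apply: (ph_memB hE); exact: (ph_memZ hE).
  apply: (@le_trans _ _ (\sum_(k < j) (j.+1 ^ 2)%:R^-1)).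
    apply: ler_sum => k _; rewrite -scalerBl (phnormZ hE)//.
    have -> : phnorm (eh k) = 1 by rewrite /phnorm oeh eqxx sqrtr1.
    by rewrite mulr1 vc; apply: quantize_err; [rewrite expn_gt0|exact: HJ].
  rewrite sumr_const card_ord -[_ *+ j]mulr_natl natrX expr2 invfM mulrA.
  rewrite -[leRHS]mul1r ler_wpM2r// ?invr_ge0// ler_pdivrMr ?ltr0n// mul1r ler_nat.
  exact: leqnSn.
have tot := ph_basis_total hb mv.
have z : j.+1%:R^-1 + phnorm (v t - w j) @[j --> \oo] --> (0 : R).
  by rewrite -[X in _ --> X]addr0; apply: cvgD; [exact: cvg_harmonic|exact: tot].
have z0 : (0 : R) @[_ --> \oo] --> (0 : R) by exact: cvg_cst.
apply: (squeeze_cvgr _ z0 z).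
exists J => // j /= Jj; rewrite phnorm_ge0 /=.
apply: (le_trans (phnorm_trans hE (mst j) (mw j) mv)).
by rewrite (phnormB hE (mw j) mv) lerD2r d1.
Qed.

Lemma coord_of_bochner_L2 v c M : coord_of v c M ->
  mu.-integrable I (EFin \o M) <-> bochner_L2 I v.
Proof.
move=> cv; have [bc _] := cv; have mM := borel_coord_measurable bc.
have nM := coord_of_norm cv.
have eqM : (\int[mu]_(t in I) (phnorm (v t) ^+ 2)%:E = \int[mu]_(t in I) (M t)%:E)%E.
  by apply: integral_eq_ae; move: nM; apply: filterS => t h It; rewrite h.
split=> [iM|[_ h]].
  split; first exact: coord_of_strongly_measurable cv.
  by rewrite eqM; exact: integrable_lty_R.
rewrite eqM in h; apply: integrable_of_lty => //; first exact: measurable_funTS.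
by move=> t _; exact: (borel_coord_ge0 _ bc).
Qed.

Lemma coord_of_bochner_L1 v c M : coord_of v c M -> bochner_L1 I v ->
  mu.-integrable I (EFin \o (fun t => Num.sqrt (M t))).
Proof.
move=> cv [_ h]; have [bc _] := cv; have mM := borel_coord_measurable bc.
have nM := coord_of_norm cv.
have eqM : (\int[mu]_(t in I) (phnorm (v t))%:E = \int[mu]_(t in I) (Num.sqrt (M t))%:E)%E.
  apply: integral_eq_ae; move: nM; apply: filterS => t h' It.
  by rewrite -h'// sqrtr_sqr ger0_norm ?phnorm_ge0.
rewrite eqM in h; apply: (integrable_of_lty _ _ h); last by move=> t _; exact: sqrtr_ge0.
apply: measurable_funTS.
have msq : measurable_fun setT (@Num.sqrt R).
  by apply: continuous_measurable_fun; exact: sqrt_continuous.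
exact: (measurableT_comp msq mM).
Qed.

Lemma pairing_measurable c c' M M' : borel_coord c M -> borel_coord c' M' ->
  measurable_fun setT (fun t : measurableTypeR R => pairing (c ^~ t) (c' ^~ t)).
Proof.
move=> [mc cM] [mc' cM'].
apply: (@measurable_fun_cvg _ _ _ setT (fun m t => \sum_(k < m) c k t * c' k t)).
  by move=> m; apply: measurable_sum => k; exact: (measurable_funM (mc k) (mc' k)).
by move=> t _; exact: (pairing_cvg (cM t) (cM' t)).
Qed.

Lemma coord_of_ip u v c M c' M' : coord_of u c M -> coord_of v c' M' ->
  {ae mu, forall t, I t -> ph_ip (u t) (v t) = pairing (c ^~ t) (c' ^~ t) /\
    `|pairing (c ^~ t) (c' ^~ t)| <= Num.sqrt (M t) * Num.sqrt (M' t)}.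
Proof.
move=> cu cv; have nu := coord_of_norm cu; have nv := coord_of_norm cv.
move: cu cv nu nv => [[_ cM] hu] [[_ cM'] hv] nu nv.
apply: (aeS4 _ hu hv nu nv) => t {}hu {}hv {}nu {}nv It.
have [mu_ uc] := hu It; have [mv vc] := hv It.
have e : ph_ip (u t) (v t) = pairing (c ^~ t) (c' ^~ t).
  have := parseval hE hb mu_ mv.
  rewrite (_ : (fun m => _) = fun m => \sum_(k < m) c k t * c' k t); last first.
    by apply/funext => m; apply: eq_bigr => k _; rewrite uc vc.
  by move=> h; exact: (cvg_unique (@Rhausdorff R) h (pairing_cvg (cM t) (cM' t))).
split => //; rewrite -e -nu// -nv// !sqrtr_sqr.
rewrite (ger0_norm (phnorm_ge0 (u t))) (ger0_norm (phnorm_ge0 (v t))).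
exact: cauchy_schwarz.
Qed.

Lemma coord_of_bochner_ip u v c M c' M' : coord_of u c M -> coord_of v c' M' ->
  bochner_ip I u v = \int[mu]_(t in I) pairing (c ^~ t) (c' ^~ t).
Proof.
move=> cu cv; apply: Rintegral_eq_ae; have := coord_of_ip cu cv.
by apply: filterS => t h It; have [] := h It.
Qed.

End bochner_coordinates.

Section convergence_by_tails.
Variable R : realType.

Lemma cvg_sum_ord m (f : nat -> nat -> R) (l : nat -> R) :
  (forall k, (k < m)%N -> f k i @[i --> \oo] --> l k) ->
  \sum_(k < m) f k i @[i --> \oo] --> \sum_(k < m) l k.
Proof.
elim: m => [|m IH] h.
  rewrite big_ord0 (_ : (fun i => _) = cst 0); first exact: cvg_cst.
  by apply/funext => i; rewrite big_ord0.
rewrite big_ord_recr (_ : (fun i => _) = fun i => \sum_(k < m) f k i + f m i).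
  by apply: cvgD; [apply: IH => k km; apply: h; exact: ltnW|exact: h].
by apply/funext => i; rewrite big_ord_recr.
Qed.

(** Order of choices: first [del], making [del * C] small for all i at once, then the cut-off m, and
    only then i. *)
Lemma cvg_by_tails (x : nat -> R) (y : R) (xm : nat -> nat -> R) (ym tau : nat -> R) (C : R) :
  (forall i m del, 0 < del -> `|x i - xm i m| <= del * C + del^-1 * tau m) ->
  (forall m del, 0 < del -> `|y - ym m| <= del * C + del^-1 * tau m) ->
  (forall m, xm i m @[i --> \oo] --> ym m) ->
  tau m @[m --> \oo] --> (0 : R) ->
  x i @[i --> \oo] --> y.
Proof.
move=> hx hy hm ht; apply/cvgrPdistC_le => e e0.
have C1 : 0 < `|C| + 1 by rewrite ltr_pwDr.
pose del := e / 8 / (`|C| + 1).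
have d0 : 0 < del by rewrite !divr_gt0.
have dC : del * C <= e / 8.
  have -> : e / 8 = del * (`|C| + 1) by rewrite /del divfK// gt_eqF.
  by rewrite ler_pM2l// (le_trans (ler_norm _))// lerDl.
have de0 : 0 < del * (e / 8) by rewrite mulr_gt0// divr_gt0.
have /cvgr0Pnorm_le/(_ _ de0) [m _ /(_ m (leqnn m)) /= tm] := ht.
have dt : del^-1 * tau m <= e / 8.
  by rewrite ler_pdivrMl// (le_trans (ler_norm _)).
have e2 : 0 < e / 2 by rewrite divr_gt0.
have /cvgrPdistC_le/(_ _ e2) := hm m; apply: filterS => i hi.
have h1 := hx i m _ d0; have h2 := hy m _ d0.
move: hi h1 h2; rewrite !ler_norml => /andP[? ?] /andP[? ?] /andP[? ?].
apply/andP; split; lra.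
Qed.

Lemma pairing_cvg_seq (a : nat -> nat -> R) (w c : nat -> R) (A : nat -> R) (W M C : R) :
  (forall i, sqsum (a i) n @[n --> \oo] --> A i) -> sqsum w n @[n --> \oo] --> W ->
  sqsum c n @[n --> \oo] --> M -> (forall i, A i <= C) -> W <= C ->
  (forall k, a i k @[i --> \oo] --> w k) ->
  pairing (a i) c @[i --> \oo] --> pairing w c.
Proof.
move=> hA hW hM AC WC aw.
apply: (@cvg_by_tails _ _ (fun i m => \sum_(k < m) a i k * c k)
  (fun m => \sum_(k < m) w k * c k) (fun m => M - sqsum c m) C).
- move=> i m del d0; apply: (le_trans (pairing_tail (hA i) hM m d0)).
  by rewrite lerD2r ler_pM2l.
- move=> m del d0; apply: (le_trans (pairing_tail hW hM m d0)).
  by rewrite lerD2r ler_pM2l.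
- move=> m; apply: (@cvg_sum_ord m (fun k i => a i k * c k) (fun k => w k * c k)) => k _.
  by apply: cvgM; [exact: aw|exact: cvg_cst].
- rewrite -[X in _ --> X](subrr M); apply: cvgB; [exact: cvg_cst|exact: hM].
Qed.

End convergence_by_tails.

(** * Weak convergence and coordinates *)

Section weak_convergence_coordinates.
Variables (R : realType) (E : prehilbert R) (eh : nat -> E).
Hypothesis hE : prehilbert_axioms E.
Hypothesis hb : ph_basis eh.
Let mu := @lebesgue_measure R.
Variable I : set (measurableTypeR R).
Hypothesis mI : measurable I.
Variables (us : nat -> R -> E) (u : R -> E).
Variables (a : nat -> nat -> R -> R) (A : nat -> R -> R) (w : nat -> R -> R) (W : R -> R).
Hypothesis usA : forall i, coord_of eh I (us i) (a i) (A i).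
Hypothesis uW : coord_of eh I u w W.

Lemma coord_L2_on (c : nat -> R -> R) (M : R -> R) k : borel_coord c M ->
  mu.-integrable I (EFin \o M) -> @ph_mem R (L2_on mu I) (c k).
Proof.
move=> [mc cM] iM; apply/(L2_onP _ mI); split; first exact: measurable_funTS.
apply: le_integrable_R iM => //.
  by apply: measurable_funTS; exact: (measurable_funX 2 (mc k)).
move=> t _; rewrite ger0_norm ?sqr_ge0//.
have := sqsum_le k.+1 (cM t); apply: le_trans.
by rewrite /sqsum big_ord_recr /= lerDr sumr_ge0// => i _; exact: sqr_ge0.
Qed.

Lemma pairing_integrable (c c' : nat -> R -> R) (M M' : R -> R) :
  borel_coord c M -> borel_coord c' M' ->
  mu.-integrable I (EFin \o M) -> mu.-integrable I (EFin \o M') ->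
  mu.-integrable I (EFin \o (fun t => pairing (c ^~ t) (c' ^~ t))).
Proof.
move=> bc bc' iM iM'.
apply: (@le_integrable_R _ _ _ mu I _ (fun t => M t + M' t)) => //.
- by apply: measurable_funTS; exact: pairing_measurable bc bc'.
- move=> t _; have := pairing_tail (bc.2 t) (bc'.2 t) 0 ltr01.
  by rewrite big_ord0 subr0 mul1r invr1 mul1r /sqsum big_ord0 subr0.
- exact: integrableD_R.
Qed.

Lemma pairing_tail_integral (c c' : nat -> R -> R) (M M' : R -> R) m del :
  borel_coord c M -> borel_coord c' M' ->
  mu.-integrable I (EFin \o M) -> mu.-integrable I (EFin \o M') -> 0 < del ->
  `|\int[mu]_(t in I) pairing (c ^~ t) (c' ^~ t) -
    \sum_(k < m) \int[mu]_(t in I) (c k t * c' k t)| <=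
  del * (\int[mu]_(t in I) M t) + del^-1 * (\int[mu]_(t in I) (M' t - sqsum (c' ^~ t) m)).
Proof.
move=> bc bc' iM iM' d0.
have ip k : mu.-integrable I (EFin \o (fun t => c k t * c' k t)).
  by apply: (L2_on_mulr_integrable mI); [exact: coord_L2_on bc iM|exact: coord_L2_on bc' iM'].
have isq : mu.-integrable I (EFin \o (fun t => sqsum (c' ^~ t) m)).
  apply: (@integrable_sum_R _ _ _ mu I m (fun k t => c' k t ^+ 2)) => // k _.
  by have /(L2_onP _ mI)[] := coord_L2_on k bc' iM'.
have itail : mu.-integrable I (EFin \o (fun t => M' t - sqsum (c' ^~ t) m)).
  by have := integrableB mI iM' isq.
have iP := pairing_integrable bc bc' iM iM'.
have iS : mu.-integrable I (EFin \o (fun t => \sum_(k < m) c k t * c' k t)).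
  exact: (@integrable_sum_R _ _ _ mu I m (fun k t => c k t * c' k t)).
rewrite -(@Rintegral_sum _ _ _ mu I m (fun k t => c k t * c' k t))//.
rewrite -RintegralB// -RintegralZl// -RintegralZl// -RintegralD//; last 2 first.
- exact: integrableZ_R.
- exact: integrableZ_R.
have iD : mu.-integrable I (EFin \o (fun t => pairing (c ^~ t) (c' ^~ t) - \sum_(k < m) c k t * c' k t)).
  by have := integrableB mI iP iS.
apply: (le_trans (le_normr_Rintegral mI iD)); apply: le_Rintegral => //.
- exact: integrable_norm.
- by apply: integrableD_R => //; exact: integrableZ_R.
by move=> t _; exact: (pairing_tail (bc.2 t) (bc'.2 t) m d0).
Qed.

Lemma sqsum_tail_integral_cvg (c : nat -> R -> R) (M : R -> R) :
  borel_coord c M -> mu.-integrable I (EFin \o M) ->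
  \int[mu]_(t in I) (M t - sqsum (c ^~ t) m) @[m --> \oo] --> (0 : R).
Proof.
move=> bc iM; have mM := borel_coord_measurable bc.
have msq m : measurable_fun setT (fun t : measurableTypeR R => sqsum (c ^~ t) m).
  by apply: measurable_sum => k; exact: (measurable_funX 2 (bc.1 k)).
have [|||||_] := @Rintegral_dominated _ _ _ mu I (fun m t => M t - sqsum (c ^~ t) m)
  (fun=> 0) M mI.
- by move=> m; apply: measurable_funTS; exact: measurable_funB.
- exact: measurable_cst.
- apply: aeW => t _; rewrite -[X in _ --> X](subrr (M t)).
  by apply: cvgB; [exact: cvg_cst|exact: bc.2].
- exact: iM.
- move=> m; apply: aeW => t _; have := sqsum_le m (bc.2 t).
  have : 0 <= sqsum (c ^~ t) m by apply: sumr_ge0 => k _; exact: sqr_ge0.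
  by rewrite ler_norml => *; apply/andP; split; have := borel_coord_ge0 t bc; lra.
by rewrite Rintegral_cst// mul0r.
Qed.

(** The tail of the test function is small uniformly in i thanks to [C]; finitely many coordinates
    remain, and each coordinate of the test function is itself a scalar test function. *)
Lemma weak_cvg_L2_coord (C : R) :
  (forall i, mu.-integrable I (EFin \o A i)) -> mu.-integrable I (EFin \o W) ->
  (forall i, \int[mu]_(t in I) A i t <= C) -> \int[mu]_(t in I) W t <= C ->
  (forall k psi, @ph_mem R (L2_on mu I) psi ->
    \int[mu]_(t in I) (a i k t * psi t) @[i --> \oo] --> \int[mu]_(t in I) (w k t * psi t)) ->
  weak_cvg_L2 I us u.
Proof.
move=> iA iW AC WC aw v vL2.
have [c [M cv]] := strongly_measurable_coord hE hb mI vL2.1.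
have iM := (coord_of_bochner_L2 hE hb mI cv).2 vL2.
have bc := cv.1.
rewrite (coord_of_bochner_ip hE hb uW cv).
rewrite (_ : (fun i => _) = fun i => \int[mu]_(t in I) pairing (a i ^~ t) (c ^~ t)); last first.
  by apply/funext => i; rewrite (coord_of_bochner_ip hE hb (usA i) cv).
apply: (@cvg_by_tails R _ _ (fun i m => \sum_(k < m) \int[mu]_(t in I) (a i k t * c k t))
  (fun m => \sum_(k < m) \int[mu]_(t in I) (w k t * c k t))
  (fun m => \int[mu]_(t in I) (M t - sqsum (c ^~ t) m)) C).
- move=> i m del d0.
  apply: (le_trans (pairing_tail_integral m (usA i).1 bc (iA i) iM d0)).
  by rewrite lerD2r ler_pM2l.
- move=> m del d0.
  apply: (le_trans (pairing_tail_integral m uW.1 bc iW iM d0)).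
  by rewrite lerD2r ler_pM2l.
- move=> m; apply: (@cvg_sum_ord R m (fun k i => \int[mu]_(t in I) (a i k t * c k t))
    (fun k => \int[mu]_(t in I) (w k t * c k t))) => k _.
  by apply: aw; exact: coord_L2_on bc iM.
- exact: sqsum_tail_integral_cvg.
Qed.

(** Here the test function is merely integrable in norm, so its squared norm [M] cannot be
    integrated as in the L^2 case. Instead the pairing converges at each time and is dominated by
    sqrt(C) times the norm of the test function. *)
Lemma weakstar_cvg_Linfty_coord (C : R) :
  (forall i t, I t -> A i t <= C) -> (forall t, I t -> W t <= C) ->
  (forall k t, I t -> a i k t @[i --> \oo] --> w k t) ->
  weakstar_cvg_Linfty I us u.
Proof.
move=> AC WC aw v vL1.
have [c [M cv]] := strongly_measurable_coord hE hb mI vL1.1.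
have iM := coord_of_bochner_L1 hE hb cv vL1.
have bc := cv.1.
rewrite (coord_of_bochner_ip hE hb uW cv).
rewrite (_ : (fun i => _) = fun i => \int[mu]_(t in I) pairing (a i ^~ t) (c ^~ t)); last first.
  by apply/funext => i; rewrite (coord_of_bochner_ip hE hb (usA i) cv).
have [|||||_ //] := @Rintegral_dominated _ _ _ mu I (fun i t => pairing (a i ^~ t) (c ^~ t))
  (fun t => pairing (w ^~ t) (c ^~ t)) (fun t => Num.sqrt C * Num.sqrt (M t)) mI.
- by move=> i; apply: measurable_funTS; exact: pairing_measurable (usA i).1 bc.
- by apply: measurable_funTS; exact: pairing_measurable uW.1 bc.
- apply: aeW => t It; apply: (@pairing_cvg_seq _ (fun i k => a i k t) (w ^~ t) (c ^~ t)
    (fun i => A i t) (W t) (M t) C).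
  + by move=> i; exact: (usA i).1.2.
  + exact: uW.1.2.
  + exact: bc.2.
  + by move=> i; exact: AC.
  + exact: WC.
  + by move=> k; exact: aw.
- exact: integrableZ_R.
move=> i; have := coord_of_ip hE hb (usA i) cv; apply: filterS => t h It.
apply: (le_trans (h It).2); rewrite ler_wpM2r ?sqrtr_ge0//.
by rewrite ler_wsqrtr// AC.
Qed.

(** Weak lower semicontinuity of the norm: integrate a w <= (a^2 + w^2) / 2 and pass to the limit on
    the left, which yields S <= C / 2 + S / 2 with S finite. *)
Lemma weak_limit_bound (C : R) m :
  (forall k i, (k < m)%N -> @ph_mem R (L2_on mu I) (a i k)) ->
  (forall k, (k < m)%N -> @ph_mem R (L2_on mu I) (w k)) ->
  (forall i, \int[mu]_(t in I) sqsum (a i ^~ t) m <= C) ->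
  (forall k psi, @ph_mem R (L2_on mu I) psi ->
    \int[mu]_(t in I) (a i k t * psi t) @[i --> \oo] --> \int[mu]_(t in I) (w k t * psi t)) ->
  \int[mu]_(t in I) sqsum (w ^~ t) m <= C.
Proof.
move=> ma mw aC aw.
have sqE (c : nat -> R -> R) : (forall k, (k < m)%N -> @ph_mem R (L2_on mu I) (c k)) ->
    \int[mu]_(t in I) sqsum (c ^~ t) m = \sum_(k < m) \int[mu]_(t in I) (c k t ^+ 2).
  move=> mc; rewrite -(@Rintegral_sum _ _ _ mu I m (fun k t => c k t ^+ 2))// => k km.
  by have /(L2_onP _ mI)[] := mc k km.
have h : \sum_(k < m) \int[mu]_(t in I) (a i k t * w k t) @[i --> \oo] -->
    \sum_(k < m) \int[mu]_(t in I) (w k t * w k t).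
  apply: (@cvg_sum_ord R m (fun k i => \int[mu]_(t in I) (a i k t * w k t))
    (fun k => \int[mu]_(t in I) (w k t * w k t))) => k km.
  by apply: aw; exact: mw.
set S := \int[mu]_(t in I) sqsum (w ^~ t) m.
have SE : \sum_(k < m) \int[mu]_(t in I) (w k t * w k t) = S.
  by rewrite /S sqE// ; apply: eq_bigr => k _; congr Rintegral; apply/funext => t; rewrite expr2.
rewrite SE in h.
suff : S <= 2^-1 * C + 2^-1 * S by lra.
apply: (cvgr_to_le h); apply: nearW => i.
apply: (@le_trans _ _ (2^-1 * (\int[mu]_(t in I) sqsum (a i ^~ t) m) + 2^-1 * S)); last first.
  by rewrite lerD2r ler_pM2l ?invr_gt0.
rewrite /S (sqE w mw) (sqE (a i) (fun k => ma k i)).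
rewrite !mulr_sumr -big_split /=; apply: ler_sum => k _.
have mak := ma k i (ltn_ord k); have mwk := mw k (ltn_ord k).
have /(L2_onP _ mI)[_ ia] := mak; have /(L2_onP _ mI)[_ iw] := mwk.
rewrite -RintegralZl// -RintegralZl// -RintegralD//; last 2 first.
- exact: (@integrableZ_R _ _ _ mu I 2^-1 (fun t => a i k t ^+ 2)).
- exact: (@integrableZ_R _ _ _ mu I 2^-1 (fun t => w k t ^+ 2)).
apply: le_Rintegral => //.
- exact: (L2_on_mulr_integrable mI).
- apply: integrableD_R => //.
    exact: (@integrableZ_R _ _ _ mu I 2^-1 (fun t => a i k t ^+ 2)).
  exact: (@integrableZ_R _ _ _ mu I 2^-1 (fun t => w k t ^+ 2)).
move=> t _; have := sqr_ge0 (a i k t - w k t); rewrite sqrrB; lra.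
Qed.

End weak_convergence_coordinates.


(** * Translations and reflections *)

Section measure_preserving.
Context d (T : measurableType d) (R : realType) (mu : {measure set T -> \bar R}).
Variables (phi : T -> T).
Hypothesis mphi : measurable_fun setT phi.
Hypothesis muphi : forall A, measurable A -> mu (phi @^-1` A) = mu A.

Lemma ge0_integral_preserving D (f : T -> \bar R) : measurable D ->
  measurable_fun D f -> (forall x, D x -> 0 <= f x)%E ->
  (\int[mu]_(x in phi @^-1` D) f (phi x) = \int[mu]_(x in D) f x)%E.
Proof.
move=> mD mf f0.
rewrite -[LHS](@ge0_integral_pushforward _ _ _ _ _ phi mphi mu D f mD mf); last first.
  by move=> x /set_mem; exact: f0.
by apply: eq_measure_integral => A mA _; exact: muphi.
Qed.

Lemma Rintegral_preserving D (f : T -> R) : measurable D -> measurable_fun D f ->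
  \int[mu]_(x in phi @^-1` D) f (phi x) = \int[mu]_(x in D) f x.
Proof.
move=> mD mf; rewrite /Rintegral integralE [in RHS]integralE; congr (fine (_ - _)%E).
  rewrite -[RHS](@ge0_integral_preserving D (EFin \o f)^\+%E mD).
  - by apply: eq_integral => x _; rewrite !funeposE.
  - by apply: measurable_funepos; exact/measurable_EFinP.
  - by move=> x _; exact: funepos_ge0.
  rewrite -[RHS](@ge0_integral_preserving D (EFin \o f)^\-%E mD).
  - by apply: eq_integral => x _; rewrite !funenegE.
  - by apply: measurable_funeneg; exact/measurable_EFinP.
  - by move=> x _; exact: funeneg_ge0.
Qed.

End measure_preserving.

Section lebesgue_translation.
Variable R : realType.
Let mu := @lebesgue_measure R.

Lemma measurable_translate (t : R) :
  measurable_fun setT (fun x : measurableTypeR R => t + x : measurableTypeR R).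
Proof. by apply: measurable_funD => //; exact: measurable_cst. Qed.

Lemma measurable_reflect (t : R) :
  measurable_fun setT (fun x : measurableTypeR R => t - x : measurableTypeR R).
Proof. by apply: measurable_funB => //; exact: measurable_cst. Qed.

Lemma lebesgue_translate (t : R) (A : set (measurableTypeR R)) : measurable A ->
  mu ((fun x => t + x) @^-1` A) = mu A.
Proof.
move=> mA; pose phi : {mfun measurableTypeR R >-> measurableTypeR R} :=
  HB.pack (fun x : measurableTypeR R => t + x : measurableTypeR R)
    (isMeasurableFun.Build _ _ _ _ _ (measurable_translate t)).
apply/esym; apply: (@lebesgue_measure_unique R (pushforward mu phi)) => // X [[a b]] _ <-.
rewrite /pushforward /=.
rewrite [X in _ = mu X](_ : _ = `]a - t, b - t]%classic); last first.
  by apply/seteqP; split=> x /=; rewrite !in_itv /= ltrBlDl lerBrDl.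
rewrite /mu !lebesgue_measure_itv /= !lte_fin ltrD2r; case: ifP => // _.
by rewrite -!EFinB opprB addrA subrK.
Qed.

Lemma lebesgue_reflect (t : R) (A : set (measurableTypeR R)) : measurable A ->
  mu ((fun x => t - x) @^-1` A) = mu A.
Proof.
move=> mA; rewrite -(lebesgue_translate t mA) -[RHS]lebesgue_measureN //.
by rewrite -[X in measurable X]setTI; exact: measurable_translate.
Qed.

Lemma Rintegral_translate (t a b : R) (f : R -> R) :
  measurable_fun setT (f : measurableTypeR R -> R) ->
  \int[mu]_(x in `[a, b]) f (t + x) = \int[mu]_(x in `[t + a, t + b]) f x.
Proof.
move=> mf; rewrite -[RHS](@Rintegral_preserving _ _ _ mu _ (measurable_translate t)).
- congr (Rintegral _ _ _); apply/seteqP; split => x /=; rewrite !in_itv /= !lerD2l //.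
- exact: lebesgue_translate.
- exact: measurable_itv.
- exact: measurable_funTS.
Qed.

End lebesgue_translation.

Section rV_reflection.
Variable R : realType.

Lemma measurable_rV_reflect n (x : 'rV[R]_n) :
  measurable_fun setT (fun y : 'rV[R]_n => x - y).
Proof.
apply/measurable_fun_rVP => i.
rewrite (_ : _ \o _ = fun y => x 0 i - rV_coord i y); last first.
  by apply/funext => y; rewrite /rV_coord /= !mxE.
apply: measurable_funB; [exact: measurable_cst|exact: measurable_rV_coord].
Qed.

Lemma measurable_rV_sub n :
  measurable_fun setT (fun p : 'rV[R]_n * 'rV[R]_n => p.1 - p.2).
Proof.
apply/measurable_fun_rVP => i.
rewrite (_ : _ \o _ = fun p => (rV_coord i \o fst) p - (rV_coord i \o snd) p); last first.
  by apply/funext => y; rewrite /rV_coord /= !mxE.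
apply: measurable_funB; apply: measurableT_comp => //; exact: measurable_rV_coord.
Qed.

(** Turns null sets in z = x - y into null sets in y, for the convolution kernel. The induction on
    the dimension rests on sections: the one at [a] of the reflected set is the reflection of the
    one at [x 0 0 - a]. *)
Lemma rV_lebesgue_reflect n (x : 'rV[R]_n) (A : set 'rV[R]_n) : measurable A ->
  rV_lebesgue R n ((fun y => x - y) @^-1` A) = rV_lebesgue R n A.
Proof.
elim: n x A => [|n IH] x A mA.
  have x0 : x - 0 = 0 by apply/rowP; case.
  rewrite /= !diracE; congr ((_ : bool)%:R%:E).
  by apply/idP/idP => /set_mem h; apply/mem_set; move: h; rewrite /= x0.
have mB : measurable ((fun y : 'rV[R]_n.+1 => x - y) @^-1` A).
  by rewrite -[X in measurable X]setTI; exact: measurable_rV_reflect.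
rewrite /= /rV_lebesgue_step /pushforward /=.
pose x' : 'rV[R]_n := \row_j x 0 (lift ord0 j).
have sb k (p q : 'rV[R]_k) i : (p - q) 0 i = p 0 i - q 0 i by rewrite !mxE.
have sE (a : R) : xsection (rV_cons (n := n) @^-1` ((fun y => x - y) @^-1` A)) a =
    (fun y => x' - y) @^-1` xsection (rV_cons (n := n) @^-1` A) (x 0 0 - a).
  apply/seteqP; split => y; rewrite /xsection /= !inE /=;
  (suff -> : x - rV_cons ((a : measurableTypeR R), y) = rV_cons ((x 0 0 - a : measurableTypeR R), x' - y) by []);
  apply/rowP => i; rewrite sb; have [j ->|->] := unliftP ord0 i;
  by rewrite ?rV_cons_lift ?rV_cons0 //= sb mxE.
have mA' : measurable (rV_cons (n := n) @^-1` A).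
  by rewrite -[X in measurable X]setTI; exact: measurable_rV_cons.
rewrite /product_measure1 /=.
pose x0 := x 0 0; pose g (a : R) := rV_lebesgue R n (xsection (rV_cons (n := n) @^-1` A) a).
transitivity (\int[@lebesgue_measure R]_a g (x0 - a)%R)%E.
  apply: eq_integral => a _; rewrite [LHS](_ : _ =
     rV_lebesgue R n ((fun y => x' - y) @^-1` xsection (rV_cons (n := n) @^-1` A) (x 0 0 - a))).
    by apply: IH; exact: measurable_xsection.
  by rewrite -sE.
have := @ge0_integral_preserving _ _ _ (@lebesgue_measure R) _ (measurable_reflect (x 0 0))
  (lebesgue_reflect (x 0 0)) setT g measurableT.
rewrite preimage_setT; apply => //.
exact: measurable_fun_xsection.
Qed.

End rV_reflection.

Section parameter_integrals.
Context d1 d2 (T1 : measurableType d1) (T2 : measurableType d2) (R : realType).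
Variable m2 : {sigma_finite_measure set T2 -> \bar R}.

(** Tonelli applied to the positive and the negative part separately; [fine] gives a value where the
    difference is infinite. *)
Lemma measurable_Rintegral_param (D : set T2) (g : T1 * T2 -> R) : measurable D ->
  measurable_fun setT g ->
  measurable_fun setT (fun x => \int[m2]_(y in D) g (x, y)).
Proof.
move=> mD mg.
pose h p := g p * \1_D p.2 : R.
have mh : measurable_fun setT (EFin \o h).
  apply/measurable_EFinP; apply: measurable_funM => //.
  by apply: measurableT_comp; [exact: measurable_indic|exact: measurable_snd].
rewrite (_ : (fun x => _) = fun x => fine (fubini_F m2 (EFin \o h)^\+%E x -
    fubini_F m2 (EFin \o h)^\-%E x)%E).
  apply: measurableT_comp => //; apply: emeasurable_funB.
    apply: measurable_fun_fubini_tonelli_F; first exact: measurable_funepos.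
    by move=> x; exact: funepos_ge0.
  apply: measurable_fun_fubini_tonelli_F; first exact: measurable_funeneg.
  by move=> x; exact: funeneg_ge0.
apply/funext => x; rewrite Rintegral_mkcond /Rintegral integralE /fubini_F.
congr (fine (_ - _)%E); apply: eq_integral => y _; rewrite ?funeposE ?funenegE;
  by rewrite /= /h /patch indicE /=; case: ifP => _; rewrite ?mulr1 ?mulr0.
Qed.

End parameter_integrals.

Section euclidean_domain.
Variables (R : realType) (n : nat).
Let muN := rV_lebesgue R n.
Implicit Type Om : set 'rV[R]_n.

Lemma bounded_rV_lebesgue_lty Om : bounded_set Om -> measurable Om -> (muN Om < +oo)%E.
Proof.
move=> [M [_ hM]] mO.
have {}hM : forall x, Om x -> `|x| <= `|M| + 1.
  by apply: hM; rewrite (le_lt_trans (ler_norm M))// ltrDl.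
pose K := `|M| + 1; have K0 : 0 <= K by rewrite addr_ge0.
pose box := [set x : 'rV[R]_n | forall i, (const_mx (- K) : 'rV[R]_n) 0 i <= x 0 i <=
  (const_mx K : 'rV[R]_n) 0 i].
have bE : muN box = (\prod_(i < n) ((const_mx K : 'rV[R]_n) 0 i - (const_mx (- K) : 'rV[R]_n) 0 i))%:E.
  by apply: rV_lebesgue_box => i; rewrite !mxE; lra.
have mbox : measurable box.
  rewrite (_ : box = \bigcap_(i in [set: 'I_n]) ((@rV_coord R n i) @^-1` `[- K, K]%classic)).
    apply: fin_bigcap_measurable; first exact: finite_finset.
    by move=> i _; rewrite -[X in measurable X]setTI; exact: measurable_rV_coord.
  apply/seteqP; split=> x /= h i; first by move=> _; have := h i; rewrite /rV_coord /= in_itv /= !mxE.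
  by have := h i Logic.I; rewrite /rV_coord /= in_itv /= !mxE.
apply: (@le_lt_trans _ _ (muN box)); last by rewrite bE ltry.
apply: le_measure; rewrite ?inE//.
move=> x Ox i; rewrite !mxE -ler_norml.
have xi : `|x 0 i| <= `|x|.
  rewrite [leRHS]/Num.norm /= mx_normE; exact: (@le_bigmax _ _ _ _ (fun i : 'I_1 * 'I_n => `|x i.1 i.2|%:nng) (0, i)).
by apply: le_trans xi _; exact: hM.
Qed.

Lemma ae_reflect (D : set 'rV[R]_n) (P : set 'rV[R]_n) (x : 'rV[R]_n) :
  muN.-negligible [set z | D z /\ ~ P z] ->
  {ae muN, forall y, D (x - y) -> P (x - y)}.
Proof.
move=> [N [mN N0 hN]]; exists ((fun y => x - y) @^-1` N); split.
- by rewrite -[X in measurable X]setTI; exact: measurable_rV_reflect.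
- by rewrite rV_lebesgue_reflect.
by move=> y /= h; apply: hN => /=; apply/not_implyP.
Qed.

End euclidean_domain.

(** * Truncation and continuity of translations in L^2 *)

Section clamp.
Variable R : realType.
Implicit Types M x y : R.

Definition clamp M x := Num.max (- M) (Num.min M x).

Lemma clamp_norm M x : 0 <= M -> `|clamp M x| <= M.
Proof.
move=> M0; rewrite /clamp ler_norml le_max lexx /= ge_max ge_min lexx /= andbT; lra.
Qed.

Lemma clamp_id M x : `|x| <= M -> clamp M x = x.
Proof. by rewrite ler_norml /clamp => /andP[h1 h2]; rewrite (min_r h2) (max_r h1). Qed.

Lemma clamp_lip M x y : 0 <= M -> `|clamp M x - clamp M y| <= `|x - y|.
Proof.
move=> M0; rewrite /clamp.
have [h1|h1] := leP M x; have [h2|h2] := leP M y;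
 do ?[case: (leP (- M)); move=> ?]; rewrite ler_norml; apply/andP; split;
 have := ler_norm (x - y); have := ler_norm (y - x); rewrite (distrC y x); lra.
Qed.

Lemma clamp_continuous M : 0 <= M -> continuous (clamp M).
Proof.
move=> M0 x; apply/cvgrPdist_le => e e0; near=> y.
apply: (le_trans (clamp_lip x y M0)); near: y.
by have /cvgrPdist_le/(_ _ e0) := @cvg_id _ (nbhs x).
Unshelve. all: by end_near. Qed.

Lemma measurable_clamp d (T : measurableType d) (D : set T) M (g : T -> R) :
  measurable_fun D g -> measurable_fun D (fun z => clamp M (g z)).
Proof.
move=> mg; apply: measurable_maxr; first exact: measurable_cst.
by apply: measurable_minr => //; exact: measurable_cst.
Qed.

End clamp.

Section L2_translation.
Variable R : realType.
Let mu := @lebesgue_measure R.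
Implicit Types (E : set (measurableTypeR R)) (g : R -> R).

Lemma L2_clamp_cvg E g : measurable E -> measurable_fun E g ->
  mu.-integrable E (EFin \o (fun x => g x ^+ 2)) ->
  \int[mu]_(x in E) ((g x - clamp n%:R (g x)) ^+ 2) @[n --> \oo] --> (0 : R).
Proof.
move=> mE mg ig.
have [|||||_] := @Rintegral_dominated _ _ _ mu E (fun n x => (g x - clamp n%:R (g x)) ^+ 2)
  (fun=> 0) (fun x => 4 * g x ^+ 2) mE.
- move=> n; apply: measurable_funX; apply: measurable_funB => //; exact: measurable_clamp.
- exact: measurable_cst.
- apply: aeW => x _; apply: cvg_near_cst.
  have [N hN] : exists N : nat, `|g x| <= N%:R.
    by exists (Num.bound `|g x|); apply/ltW/archi_boundP.
  exists N => // n /= Nn; rewrite clamp_id ?subrr ?expr0n//.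
  by apply: le_trans hN _; rewrite ler_nat.
- exact: integrableZ_R.
- move=> n; apply: aeW => x _; rewrite ger0_norm ?sqr_ge0//.
  have n0 : 0 <= n%:R :> R by [].
  have := clamp_lip (g x) 0 n0; rewrite (_ : clamp _ 0 = 0); last by rewrite clamp_id// normr0.
  rewrite !subr0 => h.
  rewrite -[leLHS](real_normK (num_real _)) -[g x ^+ 2](real_normK (num_real _)).
  have h2 := ler_normB (g x) (clamp n%:R (g x)).
  have : `|g x - clamp n%:R (g x)| <= 2 * `|g x| by lra.
  have := normr_ge0 (g x - clamp n%:R (g x)); have := normr_ge0 (g x).
  move: `|_| `|_| => u v; nra.
by rewrite Rintegral_cst// mul0r.
Qed.

(** Continuous functions are first known to be dense in L^1. Between functions bounded by [K] the
    squared L^2 distance is at most 2K times the L^1 distance, so both [g] and its approximation are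
    truncated at [K]. *)
Lemma L2_continuous_approx E g (e : R) : measurable E -> (mu E < +oo)%E ->
  measurable_fun E g -> mu.-integrable E (EFin \o (fun x => g x ^+ 2)) -> 0 < e ->
  exists (phi : R -> R) (K : R), [/\ continuous phi, forall x, `|phi x| <= K &
    \int[mu]_(x in E) ((g x - phi x) ^+ 2) <= e].
Proof.
move=> mE Eoo mg ig e0.
have e4 : 0 < e / 4 by rewrite divr_gt0.
have /cvgr0Pnorm_le/(_ _ e4)[N _ /(_ N (leqnn N)) /= hN] := L2_clamp_cvg mE mg ig.
set K : R := N%:R in hN *; have K0 : 0 <= K by rewrite /K.
pose gK x := clamp K (g x).
have mgK : measurable_fun E gK by exact: measurable_clamp.
have igK : mu.-integrable E (EFin \o gK).
  by apply: (@integrable_bounded _ _ _ mu E gK K) => // x _; exact: clamp_norm.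
have [p [pc ip pg]] := approximation_continuous_integrable mE Eoo igK.
(* By the pointwise bound [hle] the truncation error contributes 2 (e/4) and the L^1 error 4 K [del]
   <= e/2; the 1 allows for K = 0. *)
pose del := e / (8 * (K + 1)).
have d0 : 0 < del by rewrite divr_gt0// mulr_gt0//; lra.
have [phi [cphi iphi hphi]] : exists phi : R -> R, [/\ continuous phi,
    mu.-integrable E (EFin \o phi) & \int[mu]_(x in E) `|gK x - phi x| <= del].
  have : \int[mu]_(x in E) `|gK x - p n x| @[n --> \oo] --> (0 : R) by exact: (fine_cvg pg).
  move=> /cvgr0Pnorm_le/(_ _ d0)[n _ /(_ n (leqnn n)) /= h].
  exists (p n); split => //.
  by apply: le_trans h; apply: le_trans (ler_norm _).
exists (clamp K \o phi), K; split.
- by move=> x; apply: continuous_comp; [exact: cphi|exact: clamp_continuous].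
- by move=> x; exact: clamp_norm.
have mphi : measurable_fun E phi by apply/measurable_EFinP; exact: measurable_int iphi.
have i1 : mu.-integrable E (EFin \o (fun x => (g x - gK x) ^+ 2)).
  apply: (@le_integrable_R _ _ _ mu E _ (fun x => 4 * g x ^+ 2)) => //.
  - by apply: measurable_funX; exact: measurable_funB.
  - move=> x _; rewrite ger0_norm ?sqr_ge0//.
    have := clamp_lip (g x) 0 K0; rewrite (_ : clamp _ 0 = 0); last by rewrite clamp_id// normr0.
    rewrite !subr0 -/(gK x) => h.
    rewrite -[leLHS](real_normK (num_real _)) -[g x ^+ 2](real_normK (num_real _)).
    have h2 := ler_normB (g x) (gK x).
    have : `|g x - gK x| <= 2 * `|g x| by lra.
    have := normr_ge0 (g x - gK x); have := normr_ge0 (g x).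
    move: `|_| `|_| => u v; nra.
  - exact: integrableZ_R.
have idif : mu.-integrable E (EFin \o (fun x => `|gK x - phi x|)).
  apply: integrable_norm => //; exact: (integrableB mE igK iphi).
have hle x : (g x - clamp K (phi x)) ^+ 2 <= 2 * (g x - gK x) ^+ 2 + 4 * K * `|gK x - phi x|.
  have h1 : `|gK x - clamp K (phi x)| <= `|gK x - phi x|.
    rewrite -[X in `|X - clamp _ _|](@clamp_id _ K (gK x)) ?clamp_norm//; exact: clamp_lip.
  have h2 := le_trans (ler_normB (gK x) (clamp K (phi x)))
    (lerD (clamp_norm (g x) K0) (clamp_norm (phi x) K0)).
  have h3 : (gK x - clamp K (phi x)) ^+ 2 <= 2 * K * `|gK x - phi x|.
    rewrite -(real_normK (num_real (gK x - _))) expr2.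
    by apply: ler_pM => //; lra.
  have := sqr_ge0 ((g x - gK x) - (gK x - clamp K (phi x))).
  move: h3; set u := gK x; set v := clamp K (phi x); set w := `|_|.
  by clear; nra.
have igp : mu.-integrable E (EFin \o (fun x => (g x - (clamp K \o phi) x) ^+ 2)).
  apply: (@le_integrable_R _ _ _ mu E _ (fun x => 2 * (g x - gK x) ^+ 2 + 4 * K * `|gK x - phi x|)) => //.
  - apply: measurable_funX; apply: measurable_funB => //; exact: measurable_clamp.
  - by move=> x _; rewrite ger0_norm ?sqr_ge0//; exact: hle.
  - apply: integrableD_R => //; exact: integrableZ_R.
apply: (@le_trans _ _ (\int[mu]_(x in E) (2 * (g x - gK x) ^+ 2 + 4 * K * `|gK x - phi x|))).
  apply: (le_Rintegral mE igp) => [|x _]; last exact: hle.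
  by apply: integrableD_R; [exact: mE|exact: (integrableZ_R 2 mE i1)|exact: (integrableZ_R (4 * K) mE idif)].
rewrite RintegralD//; [|exact: integrableZ_R|exact: integrableZ_R].
rewrite RintegralZl// RintegralZl//.
have h1 := le_trans (ler_norm _) hN; rewrite -/(gK _) in h1.
have h2 : 4 * K * (\int[mu]_(x in E) `|gK x - phi x|)%R <= e / 2.
  have -> : e / 2 = 4 * (K + 1) * del by rewrite /del; field; rewrite gt_eqF// ltr_pwDr.
  apply: ler_pM => //; [by rewrite mulr_ge0|by apply: Rintegral_ge0|by rewrite ler_pM2l// lerDl].
move: h1 h2; set u := Rintegral _ _ _; set v := 4 * K * _; clear; lra.
Qed.

Lemma translate_le E (q : R -> R) (x a b : R) : measurable E ->
  `[x + a, x + b]%classic `<=` E -> measurable_fun setT (q : measurableTypeR R -> R) ->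
  (forall y, 0 <= q y) -> mu.-integrable E (EFin \o q) ->
  mu.-integrable `[a, b]%classic (EFin \o (fun s => q (x + s))) /\
  \int[mu]_(s in `[a, b]) q (x + s) <= \int[mu]_(y in E) q y.
Proof.
move=> mE sE mq q0 iq.
have mI (c d : R) : measurable (`[c, d]%classic : set (measurableTypeR R)) by exact: measurable_itv.
have iq' : mu.-integrable `[x + a, x + b]%classic (EFin \o q) by exact: integrableS iq.
have it : mu.-integrable `[a, b]%classic (EFin \o (fun s => q (x + s))).
  apply: integrable_of_lty => //.
    by apply: measurable_funTS; exact: (measurableT_comp mq (measurable_translate x)).
  have := integrable_lty_R (mI _ _) iq'; apply: le_lt_trans.
  rewrite le_eqVlt; apply/orP; left; apply/eqP.
  rewrite -[RHS](@ge0_integral_preserving _ _ _ mu _ (measurable_translate x)) //.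
  - by congr integral; apply/seteqP; split => y /=; rewrite !in_itv /= !lerD2l.
  - exact: lebesgue_translate.
  - by apply: measurable_funTS; exact/measurable_EFinP.
  - by move=> y _; rewrite lee_fin.
split => //; rewrite Rintegral_translate//.
rewrite -lee_fin !EFin_Rintegral//; apply: ge0_subset_integral => //.
- by apply/measurable_EFinP; exact: measurable_funTS.
- by move=> y _; rewrite lee_fin.
Qed.

(** For a bounded continuous [phi] this is dominated convergence. Replacing [g] by [phi] costs two
    translated errors, both bounded by the error on [A, B], which contains all the translated
    intervals from some j on. *)
Lemma L2_translation_cvg (g : R -> R) (A B a b x : R) (xs : nat -> R) :
  measurable_fun setT (g : measurableTypeR R -> R) ->
  mu.-integrable `[A, B]%classic (EFin \o (fun y => g y ^+ 2)) ->
  xs j @[j --> \oo] --> x -> A < x + a -> x + b < B ->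
  \int[mu]_(s in `[a, b]) ((g (xs j + s) - g (x + s)) ^+ 2) @[j --> \oo] --> (0 : R).
Proof.
move=> mg ig hx Aa bB.
have mI (c d : R) : measurable (`[c, d]%classic : set (measurableTypeR R)) by exact: measurable_itv.
have Ioo (c d : R) : (mu `[c, d]%classic < +oo)%E.
  by rewrite /mu lebesgue_measure_itv /=; case: ifP => _; rewrite ltry.
apply/cvgr0Pnorm_le => e e0.
(* Three errors of size e/12, each multiplied by the 3 of (p + q + s)^2 <= 3 (p^2 + q^2 + s^2). *)
have e12 : 0 < e / 12 by rewrite divr_gt0.
have [phi [K [cphi phiK le12]]] := L2_continuous_approx (mI A B) (Ioo A B)
  (measurable_funTS mg) ig e12.
have mphi : measurable_fun setT (phi : measurableTypeR R -> R).
  exact: continuous_measurable_fun.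
pose q y := (g y - phi y) ^+ 2.
have mq : measurable_fun setT (q : measurableTypeR R -> R).
  by apply: measurable_funX; exact: measurable_funB.
have q0 y : 0 <= q y by exact: sqr_ge0.
have iphi2 : mu.-integrable `[A, B]%classic (EFin \o (fun y => phi y ^+ 2)).
  apply: (@integrable_bounded _ _ _ mu _ (fun y => phi y ^+ 2) (K ^+ 2)) => //.
    by apply: measurable_funTS; exact: measurable_funX.
  by move=> y _; rewrite ger0_norm ?sqr_ge0// -[leLHS]real_normK ?num_real// ler_pXn2r ?nnegrE// (le_trans _ (phiK y)).
have iq : mu.-integrable `[A, B]%classic (EFin \o q).
  apply: (@le_integrable_R _ _ _ mu _ q (fun y => 2 * g y ^+ 2 + 2 * phi y ^+ 2)) => //.
  - exact: measurable_funTS.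
  - move=> y _; rewrite ger0_norm// /q; have := sqr_ge0 (g y + phi y).
    by move: (g y) (phi y) => u v; clear; nra.
  - by apply: integrableD_R; [exact: mI|exact: (integrableZ_R 2 (mI A B) ig)|exact: (integrableZ_R 2 (mI A B) iphi2)].
pose D j s := (phi (xs j + s) - phi (x + s)) ^+ 2.
have mphix y : measurable_fun setT (fun s : measurableTypeR R => phi (y + s)).
  exact: (measurableT_comp mphi (measurable_translate y)).
have mgx y : measurable_fun setT (fun s : measurableTypeR R => g (y + s)).
  exact: (measurableT_comp mg (measurable_translate y)).
have mD j : measurable_fun setT (D j : measurableTypeR R -> R).
  by apply: measurable_funX; exact: measurable_funB.
have Dle j s : `|D j s| <= 4 * K ^+ 2.
  have := le_trans (ler_normB _ _) (lerD (phiK (xs j + s)) (phiK (x + s))).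
  have := normr_ge0 (phi (xs j + s) - phi (x + s)).
  rewrite /D normrX; set w := `|_|; clear; nra.
have iK : mu.-integrable `[a, b]%classic (EFin \o (fun=> 4 * K ^+ 2)).
  apply: (@integrable_bounded _ _ _ mu _ (fun=> 4 * K ^+ 2) `|4 * K ^+ 2|) => //.
have iD j : mu.-integrable `[a, b]%classic (EFin \o D j).
  by apply: (@integrable_bounded _ _ _ mu _ (D j) (4 * K ^+ 2)) => //; exact: measurable_funTS.
have cD : \int[mu]_(s in `[a, b]) D j s @[j --> \oo] --> (0 : R).
  have [|||||_] := @Rintegral_dominated _ _ _ mu _ D (fun=> 0) (fun=> 4 * K ^+ 2) (mI a b).
  - by move=> j; exact: measurable_funTS.
  - exact: measurable_cst.
  - apply: aeW => s _.
    have c : phi (xs j + s) - phi (x + s) @[j --> \oo] --> (0 : R).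
      rewrite -(subrr (phi (x + s))); apply: cvgB; last exact: cvg_cst.
      by apply: (cvg_comp _ _ (cvgD hx (cvg_cst s))); exact: cphi.
    by rewrite -[X in _ --> X](mul0r (0 : R)); exact: (cvgM c c).
  - exact: iK.
  - by move=> j; apply: aeW.
  by rewrite Rintegral_cst// mul0r.
have sub (y : R) : A <= y + a -> y + b <= B -> `[y + a, y + b]%classic `<=` `[A, B]%classic.
  move=> h1 h2 z /=; rewrite !in_itv /= => /andP[h3 h4].
  by rewrite (le_trans h1 h3) (le_trans h4 h2).
have [ix hxle] := translate_le (mI A B) (sub _ (ltW Aa) (ltW bB)) mq q0 iq.
have e24 : 0 < e / 12 by [].
have a1 : 0 < x + a - A by rewrite subr_gt0.
have b1 : 0 < B - (x + b) by rewrite subr_gt0.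
near=> j.
have hj1 : `|x - xs j| < x + a - A by near: j; move/cvgrPdist_lt : hx; exact.
have hj2 : `|x - xs j| < B - (x + b) by near: j; move/cvgrPdist_lt : hx; exact.
have [ij hjle] : mu.-integrable `[a, b]%classic (EFin \o (fun s => q (xs j + s))) /\
    \int[mu]_(s in `[a, b]) q (xs j + s) <= \int[mu]_(y in `[A, B]) q y.
  move: hj1 hj2; rewrite !ltr_norml => /andP[h1 h2] /andP[h3 h4].
  apply: (translate_le (mI A B) _ mq q0 iq).
  by apply: sub; [move: h1 h2; clear; lra|move: h3 h4; clear; lra].
have hD : `|\int[mu]_(s in `[a, b]) D j s| <= e / 12.
  by near: j; move/cvgr0Pnorm_le : cD; exact.
rewrite ger0_norm; last by apply: Rintegral_ge0 => s _; exact: sqr_ge0.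
pose S s := 3 * (q (xs j + s) + (D j s + q (x + s))).
have i2 : mu.-integrable `[a, b]%classic (EFin \o (fun s => D j s + q (x + s))).
  by apply: integrableD_R; [exact: mI|exact: iD|exact: ix].
have i3 : mu.-integrable `[a, b]%classic (EFin \o (fun s => q (xs j + s) + (D j s + q (x + s)))).
  by apply: integrableD_R; [exact: mI|exact: ij|exact: i2].
have iS : mu.-integrable `[a, b]%classic (EFin \o S) by exact: (integrableZ_R 3 (mI a b) i3).
have leS s : (g (xs j + s) - g (x + s)) ^+ 2 <= S s.
  rewrite /S /q /D; move: (g (xs j + s)) (g (x + s)) (phi (xs j + s)) (phi (x + s)) => u v p p'.
  have := sqr_ge0 ((u - p) - (p - p')); have := sqr_ge0 ((u - p) + (v - p')).
  have := sqr_ge0 ((p - p') + (v - p')); clear; nra.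
have iL : mu.-integrable `[a, b]%classic (EFin \o (fun s => (g (xs j + s) - g (x + s)) ^+ 2)).
  apply: (@le_integrable_R _ _ _ mu _ _ S) => //.
    by apply: measurable_funTS; apply: measurable_funX; exact: measurable_funB.
  by move=> s _; rewrite ger0_norm ?sqr_ge0.
apply: (le_trans (le_Rintegral (mI a b) iL iS (fun s _ => leS s))).
rewrite (RintegralZl _ (mI a b) i3) (RintegralD (mI a b) ij i2) (RintegralD (mI a b) (iD j) ix).
have := le_trans (ler_norm _) hD; move: hjle hxle le12; rewrite /q.
set u := Rintegral _ _ _; set v := Rintegral _ _ _; set w := Rintegral _ _ _; set z := Rintegral _ _ _.
move: e0; clear; lra.
Unshelve. all: by end_near. Qed.

End L2_translation.

(** * Dependence of the state-dependent delay on the history *)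

Section histories.
Variable R : realType.
Let mu := @lebesgue_measure R.
Variables (h : nat -> R -> R) (C r T : R).
Hypothesis ih : forall k, mu.-integrable `[- r - 1, T + 1]%classic (EFin \o (fun s => h k s ^+ 2)).
Hypothesis r0 : 0 < r.
Implicit Types (c : nat -> R -> R) (t : R).

(** The families among which the solution is sought: one fixed, possibly unbounded history for
    negative times, and a common bound afterwards. Two such families can differ only where both are
    bounded. *)
Definition admissible c :=
  [/\ forall k, measurable_fun setT (c k : measurableTypeR R -> R),
      forall k s, s < 0 -> c k s = h k s &
      forall k s, 0 <= s -> `|c k s| <= C].

(** The margin 1 on either side keeps each window [t - r, t] strictly inside, as continuity of
    translations requires. *)
Let E : set (measurableTypeR R) := `[- r - 1, T + 1]%classic.
Let mE : measurable E. Proof. exact: measurable_itv. Qed.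
Let mI (a b : R) : measurable (`[a, b]%classic : set (measurableTypeR R)).
Proof. exact: measurable_itv. Qed.

Lemma lebesgue_itvcc_lty (a b : R) : (mu `[a, b]%classic < +oo)%E.
Proof. by rewrite /mu lebesgue_measure_itv /=; case: ifP => _; rewrite ltry. Qed.

Lemma integrable_cst_itvcc (a b K : R) : mu.-integrable `[a, b]%classic (EFin \o (fun=> K)).
Proof.
by apply: (@integrable_bounded _ _ _ mu _ (fun=> K) `|K|) => //; exact: lebesgue_itvcc_lty.
Qed.

Lemma sub_window t : 0 < t < T -> `[t + - r, t + 0]%classic `<=` E.
Proof.
move=> /andP[t0 tT] s; rewrite /E /= !in_itv /= => /andP[h1 h2].
by move: t0 tT h1 h2 r0; lra.
Qed.

Lemma admissible_sqr_le c k s : admissible c -> c k s ^+ 2 <= h k s ^+ 2 + C ^+ 2.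
Proof.
move=> [_ ch cC]; have [s0|s0] := ltP s 0; first by rewrite ch// lerDl sqr_ge0.
rewrite -[leLHS]add0r lerD ?sqr_ge0// -[leLHS]real_normK ?num_real//.
by rewrite ler_pXn2r ?nnegrE ?cC// (le_trans _ (cC k s s0)).
Qed.

Lemma integrable_admissible_bound k : mu.-integrable E (EFin \o (fun s => h k s ^+ 2 + C ^+ 2)).
Proof.
exact: (integrableD_R mE (ih k) (integrable_cst_itvcc _ _ (C ^+ 2))).
Qed.

Lemma admissible_integrable c k : admissible c ->
  mu.-integrable E (EFin \o (fun s => c k s ^+ 2)).
Proof.
move=> ac; apply: (@le_integrable_R _ _ _ mu E _ (fun s => h k s ^+ 2 + C ^+ 2)) => //.
- by apply: measurable_funTS; apply: measurable_funX; case: ac.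
- by move=> s _; rewrite ger0_norm ?sqr_ge0//; exact: admissible_sqr_le.
- exact: integrable_admissible_bound.
Qed.

Lemma history_integrable c k t : admissible c -> 0 < t < T ->
  mu.-integrable `[- r, 0]%classic (EFin \o (fun s => c k (t + s) ^+ 2)) /\
  \int[mu]_(s in `[- r, 0]) (c k (t + s) ^+ 2) <= \int[mu]_(s in E) (h k s ^+ 2 + C ^+ 2).
Proof.
move=> ac tT; have ic := admissible_integrable k ac.
have mc : measurable_fun setT (fun s : measurableTypeR R => c k s ^+ 2).
  by apply: measurable_funX; case: ac.
have [i1 i2] := translate_le mE (sub_window tT) mc (fun s => sqr_ge0 _) ic.
split => //; apply: (le_trans i2); apply: le_Rintegral => //.
  exact: integrable_admissible_bound.
by move=> s _; exact: admissible_sqr_le.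
Qed.

Variables (cs : nat -> nat -> R -> R) (c : nat -> R -> R) (ts : nat -> R) (t : R).
Hypotheses (acs : forall j, admissible (cs j)) (ac : admissible c).
Hypothesis csc : forall k s, 0 <= s -> cs j k s @[j --> \oo] --> c k s.
Hypotheses (tsT : forall j, 0 < ts j < T) (tT : 0 < t < T).
Hypothesis tst : ts j @[j --> \oo] --> t.

Lemma history_dist_integrable k j :
  mu.-integrable `[- r, 0]%classic (EFin \o (fun s => (cs j k (ts j + s) - c k (t + s)) ^+ 2)).
Proof.
have [i1 _] := history_integrable k (acs j) (tsT j).
have [i2 _] := history_integrable k ac tT.
apply: (@le_integrable_R _ _ _ mu _ _ (fun s => 2 * cs j k (ts j + s) ^+ 2 + 2 * c k (t + s) ^+ 2)) => //.
- apply: measurable_funTS; apply: measurable_funX; apply: measurable_funB.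
    by case: (acs j) => m _ _; exact: (measurableT_comp (m k) (measurable_translate (ts j))).
  by case: ac => m _ _; exact: (measurableT_comp (m k) (measurable_translate t)).
- move=> s _; rewrite ger0_norm ?sqr_ge0//.
  by have := sqr_ge0 (cs j k (ts j + s) + c k (t + s)); move: (cs _ _ _) (c _ _) => u v; nra.
- apply: integrableD_R => //; first exact: (integrableZ_R 2 (mI _ _) i1).
  exact: (integrableZ_R 2 (mI _ _) i2).
Qed.

(** Two changes are separated: replacing [cs j] by [c], which is invisible for negative times and
    settled by bounded convergence for the others, and translating the fixed function [c k], which
    is continuous in L^2. *)
Lemma history_cvg k :
  \int[mu]_(s in `[- r, 0]) ((cs j k (ts j + s) - c k (t + s)) ^+ 2) @[j --> \oo] --> (0 : R).
Proof.
have mc := let: And3 m _ _ := ac in m k.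
have mcs j := let: And3 m _ _ := acs j in m k.
pose q j s := (cs j k s - c k s) ^+ 2.
have mq j : measurable_fun setT (q j : measurableTypeR R -> R).
  by apply: measurable_funX; exact: measurable_funB.
have q0 j s : 0 <= q j s by exact: sqr_ge0.
have qC j s : q j s <= 4 * C ^+ 2.
  rewrite /q; have [s0|s0] := ltP s 0.
    case: ac => _ -> // _; case: (acs j) => _ -> // _.
    by rewrite subrr expr0n /= mulr_ge0// sqr_ge0.
  have h1 : `|cs j k s| <= C by case: (acs j) => _ _; exact.
  have h2 : `|c k s| <= C by case: ac => _ _; exact.
  have := le_trans (ler_normB _ _) (lerD h1 h2); have := normr_ge0 (cs j k s - c k s).
  by rewrite -[X in X <= _ * _](real_normK (num_real _)); set w := `|_|; nra.
have iC : mu.-integrable E (EFin \o (fun=> 4 * C ^+ 2)).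
  exact: integrable_cst_itvcc.
have iq j : mu.-integrable E (EFin \o q j).
  apply: (@le_integrable_R _ _ _ mu E _ (fun=> 4 * C ^+ 2)) => //; first exact: measurable_funTS.
  by move=> s _; rewrite ger0_norm.
have c1 : \int[mu]_(s in E) q j s @[j --> \oo] --> (0 : R).
  have [|||||_] := @Rintegral_dominated _ _ _ mu E q (fun=> 0) (fun=> 4 * C ^+ 2) mE.
  - by move=> j; exact: measurable_funTS.
  - exact: measurable_cst.
  - apply: aeW => s _; have [s0|s0] := ltP s 0.
      rewrite (_ : (fun j => _) = cst 0); first exact: cvg_cst.
      apply/funext => j; rewrite /q; case: ac => _ -> // _; case: (acs j) => _ -> // _.
      by rewrite subrr expr0n.
    have c0 : cs j k s - c k s @[j --> \oo] --> (0 : R).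
      by rewrite -(subrr (c k s)); apply: cvgB; [exact: csc|exact: cvg_cst].
    by rewrite -[X in _ --> X](mul0r (0 : R)); exact: (cvgM c0 c0).
  - exact: iC.
  - by move=> j; apply: aeW => s _; rewrite ger0_norm.
  by rewrite Rintegral_cst// mul0r.
have [h1 h2] : - r - 1 < t + - r /\ t + 0 < T + 1 by have /andP[] := tT; split; lra.
have c2 := @L2_translation_cvg R (c k) (- r - 1) (T + 1) (- r) 0 t ts mc (admissible_integrable k ac) tst
  h1 h2.
have c3 : 2 * (\int[mu]_(s in E) q j s)%R + 2 * (\int[mu]_(s in `[- r, 0]) ((c k (ts j + s) - c k (t + s)) ^+ 2))%R
    @[j --> \oo] --> (0 : R).
  have z : 2 * 0 + 2 * 0 = 0 :> R by rewrite mulr0 addr0.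
  rewrite -[X in _ --> X]z.
  apply: cvgD.
    exact: (cvgM (cvg_cst (2 : R)) c1).
  exact: (cvgM (cvg_cst (2 : R)) c2).
apply: (cvg_of_dist _ c3) => j.
rewrite subr0 ger0_norm; last by apply: Rintegral_ge0 => s _; exact: sqr_ge0.
have [i1 h3] := translate_le mE (sub_window (tsT j)) (mq j) (q0 j) (iq j).
have i2 : mu.-integrable `[- r, 0]%classic (EFin \o (fun s => (c k (ts j + s) - c k (t + s)) ^+ 2)).
  have [k1 _] := history_integrable k ac (tsT j).
  have [k2 _] := history_integrable k ac tT.
  apply: (@le_integrable_R _ _ _ mu _ _ (fun s => 2 * c k (ts j + s) ^+ 2 + 2 * c k (t + s) ^+ 2)) => //.
  - apply: measurable_funTS; apply: measurable_funX; apply: measurable_funB.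
      exact: (measurableT_comp mc (measurable_translate (ts j))).
    exact: (measurableT_comp mc (measurable_translate t)).
  - move=> s _; rewrite ger0_norm ?sqr_ge0//.
    by have := sqr_ge0 (c k (ts j + s) + c k (t + s)); move: (c _ _) (c _ _) => u v; nra.
  - apply: integrableD_R => //; first exact: (integrableZ_R 2 (mI _ _) k1).
    exact: (integrableZ_R 2 (mI _ _) k2).
apply: (@le_trans _ _ (\int[mu]_(s in `[- r, 0]) (2 * q j (ts j + s) + 2 * (c k (ts j + s) - c k (t + s)) ^+ 2))).
  apply: (le_Rintegral (mI _ _) (history_dist_integrable k j)).
    by apply: integrableD_R; [exact: mI|exact: (integrableZ_R 2 (mI _ _) i1)|exact: (integrableZ_R 2 (mI _ _) i2)].
  move=> s _; rewrite /q.
  have := sqr_ge0 (cs j k (ts j + s) - c k (ts j + s) - (c k (ts j + s) - c k (t + s))).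
  move: (cs _ _ _) (c k (ts j + s)) (c k (t + s)) => u v w; nra.
rewrite (RintegralD (mI _ _) (integrableZ_R 2 (mI _ _) i1) (integrableZ_R 2 (mI _ _) i2)).
by rewrite (RintegralZl _ (mI _ _) i1) (RintegralZl _ (mI _ _) i2) lerD2r ler_pM2l.
Qed.

End histories.

Section finite_combinations.
Variables (R : realType) (E : prehilbert R) (eh : nat -> E).
Hypothesis hE : prehilbert_axioms E.
Hypothesis hb : ph_basis eh.
Let mu := @lebesgue_measure R.
Variable m : nat.
Implicit Types (c : nat -> R -> R).

Let meh := ph_basis_mem hb.
Let oeh := ph_basis_ortho hb.

Definition basis_comb c (t : R) : E := \sum_(k < m) c k t *: eh k.

Lemma basis_comb_mem c t : ph_mem (basis_comb c t).
Proof. exact: (ph_mem_comb hE meh m (fun k => c k t)). Qed.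

Lemma basis_comb_coord c t k :
  ph_ip (basis_comb c t) (eh k) = if (k < m)%N then c k t else 0.
Proof. exact: (ph_coord_comb hE meh oeh m (fun k => c k t)). Qed.

Lemma basis_comb_norm c t : phnorm (basis_comb c t) ^+ 2 = \sum_(k < m) c k t ^+ 2.
Proof. exact: (phnorm_comb hE meh oeh m (fun k => c k t)). Qed.

Lemma basis_comb_dist c c' t t' :
  phnorm (basis_comb c t - basis_comb c' t') ^+ 2 = \sum_(k < m) (c k t - c' k t') ^+ 2.
Proof.
rewrite /basis_comb -sumrB -(phnorm_comb hE meh oeh m (fun k => c k t - c' k t')).
by congr (phnorm _ ^+ 2); apply: eq_bigr => k _; rewrite scalerBl.
Qed.

Lemma basis_comb_coord_of I c : (forall k, measurable_fun setT (c k : measurableTypeR R -> R)) ->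
  coord_of eh I (basis_comb c) (fun k t => if (k < m)%N then c k t else 0)
    (fun t => \sum_(k < m) c k t ^+ 2).
Proof.
move=> mc; split; first split.
- by move=> k; case: (k < m)%N; [exact: mc|exact: measurable_cst].
- move=> t; apply: cvg_near_cst; exists m => // n /= mn; rewrite /sqsum.
  rewrite (sum_ord_tail (fun k => (if (k < m)%N then c k t else 0) ^+ 2) mn).
  have -> : \sum_(m <= k < n) (if (k < m)%N then c k t else 0) ^+ 2 = 0.
    apply: big1_seq => k; rewrite mem_index_iota => /andP[_ /andP[mk _]].
    by rewrite ltnNge mk /= expr0n.
  rewrite addr0.
  by apply: eq_bigr => k _; rewrite ltn_ord.
- by apply: aeW => t _; split; [exact: basis_comb_mem|move=> k; exact: basis_comb_coord].
Qed.

Lemma basis_comb_bochner_L2 (I : set (measurableTypeR R)) c : measurable I ->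
  (forall k, measurable_fun setT (c k : measurableTypeR R -> R)) ->
  (forall k, mu.-integrable I (EFin \o (fun t => c k t ^+ 2))) ->
  bochner_L2 I (basis_comb c).
Proof.
move=> mI mc ic; apply/(coord_of_bochner_L2 hE hb mI (basis_comb_coord_of I mc)).
exact: (@integrable_sum_R _ _ _ mu I m (fun k t => c k t ^+ 2)).
Qed.

End finite_combinations.

Section delay_continuity.
Variables (R : realType) (E : prehilbert R) (eh : nat -> E).
Hypothesis hE : prehilbert_axioms E.
Hypothesis hb : ph_basis eh.
Let mu := @lebesgue_measure R.
Variables (m : nat) (h : nat -> R -> R) (C r T : R).
Hypothesis ih : forall k, mu.-integrable `[- r - 1, T + 1]%classic (EFin \o (fun s => h k s ^+ 2)).
Hypothesis r0 : 0 < r.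

(** This and [history_sqnorm] are [in_H] and [normH2] over an abstract space; at [L2 Om] they agree
    up to conversion. *)
Definition history_space (v : E) (psi : R -> E) :=
  ph_mem v /\ bochner_L2 `]- r, 0[%classic psi.

Definition history_sqnorm (v : E) (psi : R -> E) : R :=
  phnorm v ^+ 2 + \int[mu]_(s in `]- r, 0[) (phnorm (psi s) ^+ 2).

Variable eta : E -> (R -> E) -> R.
Hypothesis eta_lip : forall M : R, 0 < M -> exists L : R,
  forall v1 psi1 v2 psi2, history_space v1 psi1 -> history_space v2 psi2 ->
  history_sqnorm v1 psi1 <= M ^+ 2 -> history_sqnorm v2 psi2 <= M ^+ 2 ->
  `|eta v1 psi1 - eta v2 psi2| <=
    L * Num.sqrt (history_sqnorm (v1 - v2) (fun s => psi1 s - psi2 s)).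

Let gal := basis_comb eh m.
Let mIo : measurable (`]- r, 0[%classic : set (measurableTypeR R)).
Proof. exact: measurable_itv. Qed.
Let mIc : measurable (`[- r, 0]%classic : set (measurableTypeR R)).
Proof. exact: measurable_itv. Qed.

Let oc : (`]- r, 0[%classic : set R) `<=` `[- r, 0]%classic.
Proof. by apply: subset_itv; rewrite bnd_simp. Qed.

Lemma le_Rintegral_oc (q : R -> R) : (forall s, 0 <= q s) ->
  mu.-integrable `[- r, 0]%classic (EFin \o q) ->
  \int[mu]_(s in `]- r, 0[) q s <= \int[mu]_(s in `[- r, 0]) q s.
Proof.
move=> q0 iq; have iqo : mu.-integrable `]- r, 0[%classic (EFin \o q) by exact: integrableS iq.
rewrite -lee_fin !EFin_Rintegral//; apply: ge0_subset_integral => //.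
- exact: measurable_int iq.
- by move=> s _; rewrite lee_fin.
Qed.

Lemma admissible_history_space c t : admissible h C c -> 0 < t < T ->
  history_space (gal c t) (fun s => gal c (t + s)).
Proof.
move=> ac tT; split; first exact: basis_comb_mem.
apply: (@basis_comb_bochner_L2 R E eh hE hb m _ (fun k s => c k (t + s)) mIo) => k.
  case: ac => mc _ _; exact: (measurableT_comp (mc k) (measurable_translate t)).
have [i1 _] := history_integrable ih r0 k ac tT.
exact: integrableS i1.
Qed.

(** One ball contains the histories of all admissible families at all times, so a single local
    Lipschitz constant of [eta] serves throughout. *)
Lemma admissible_history_sqnorm : exists2 M : R, 0 < M & forall c t,
  admissible h C c -> 0 < t < T ->
  history_sqnorm (gal c t) (fun s => gal c (t + s)) <= M ^+ 2.
Proof.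
pose H k := \int[mu]_(s in `[- r - 1, T + 1]) (h k s ^+ 2 + C ^+ 2).
have H0 k : 0 <= H k by apply: Rintegral_ge0 => s _; rewrite addr_ge0// sqr_ge0.
pose B := \sum_(k < m) (C ^+ 2 + H k).
have B0 : 0 <= B by apply: sumr_ge0 => k _; rewrite addr_ge0// sqr_ge0.
(* [B] bounds the squared norm, and B <= (B + 1)^2 with B + 1 positive even when [B] is 0. *)
exists (B + 1); first by rewrite ltr_wpDl.
move=> c t ac tT; apply: (@le_trans _ _ B); last by move: B0; set b := B; nra.
rewrite /history_sqnorm basis_comb_norm// /B big_split /=; apply: lerD.
  apply: ler_sum => k _; rewrite -[leLHS]real_normK ?num_real//.
  have t0 : 0 <= t by case/andP: tT => /ltW.
  case: ac => _ _ cC.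
  by rewrite ler_pXn2r ?nnegrE ?cC// (le_trans _ (cC k t t0)).
have ic k : mu.-integrable `[- r, 0]%classic (EFin \o (fun s => c k (t + s) ^+ 2)).
  by have [] := history_integrable ih r0 k ac tT.
rewrite (_ : (fun s => _) = fun s => \sum_(k < m) c k (t + s) ^+ 2); last first.
  by apply/funext => s; rewrite basis_comb_norm.
apply: (le_trans (le_Rintegral_oc _ _)).
- by move=> s; apply: sumr_ge0 => k _; exact: sqr_ge0.
- exact: (@integrable_sum_R _ _ _ mu _ m (fun k s => c k (t + s) ^+ 2)).
rewrite (@Rintegral_sum _ _ _ mu _ m (fun k s => c k (t + s) ^+ 2))//.
by apply: ler_sum => k _; have [] := history_integrable ih r0 k ac tT.
Qed.

Variables (cs : nat -> nat -> R -> R) (c : nat -> R -> R) (ts : nat -> R) (t : R).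
Hypotheses (acs : forall j, admissible h C (cs j)) (ac : admissible h C c).
Hypothesis csc : forall k s, 0 <= s -> cs j k s @[j --> \oo] --> c k s.
Hypotheses (tsT : forall j, 0 < ts j < T) (tT : 0 < t < T).
Hypothesis tst : ts j @[j --> \oo] --> t.
Hypothesis cst : forall k, cs j k (ts j) @[j --> \oo] --> c k t.

(** [eta] sees the present value, whose modes converge by hypothesis, and the history, whose modes
    converge in L^2(-r, 0) by [history_cvg]. *)
Lemma delay_cvg : eta (gal (cs j) (ts j)) (fun s => gal (cs j) (ts j + s)) @[j --> \oo] -->
  eta (gal c t) (fun s => gal c (t + s)).
Proof.
have [M M0 hM] := admissible_history_sqnorm.
have [L hL] := eta_lip M0.
pose D j := \sum_(k < m) (cs j k (ts j) - c k t) ^+ 2 +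
  \sum_(k < m) \int[mu]_(s in `[- r, 0]) ((cs j k (ts j + s) - c k (t + s)) ^+ 2).
have cD : D j @[j --> \oo] --> (0 : R).
  have z : \sum_(k < m) (0 : R) + \sum_(k < m) (0 : R) = 0 by rewrite !big1 ?addr0.
  rewrite -[X in _ --> X]z; apply: cvgD.
    apply: (@cvg_sum_ord R m (fun k j => (cs j k (ts j) - c k t) ^+ 2) (fun=> 0)) => k _.
    have c0 : cs j k (ts j) - c k t @[j --> \oo] --> (0 : R).
      by rewrite -(subrr (c k t)); apply: cvgB; [exact: cst|exact: cvg_cst].
    by rewrite -[X in _ --> X](mul0r (0 : R)); exact: (cvgM c0 c0).
  apply: (@cvg_sum_ord R m (fun k j => \int[mu]_(s in `[- r, 0])
    ((cs j k (ts j + s) - c k (t + s)) ^+ 2)) (fun=> 0)) => k _.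
  exact: history_cvg.
have cS' : `|L| * Num.sqrt (D j) @[j --> \oo] --> (0 : R).
  have z : `|L| * Num.sqrt 0 = 0 by rewrite sqrtr0 mulr0.
  rewrite -[X in _ --> X]z.
  apply: cvgM; first exact: cvg_cst.
  by apply: (cvg_comp _ _ cD); exact: sqrt_continuous.
apply: (cvg_of_dist _ cS') => j.
apply: (le_trans (hL _ _ _ _ (admissible_history_space (acs j) (tsT j))
  (admissible_history_space ac tT) (hM _ _ (acs j) (tsT j)) (hM _ _ ac tT))).
apply: (le_trans (ler_wpM2r (sqrtr_ge0 _) (ler_norm L))).
rewrite ler_wpM2l// ler_wsqrtr// /history_sqnorm basis_comb_dist// lerD2l.
have ic k := history_dist_integrable ih r0 acs ac tsT tT k j.
rewrite (_ : (fun s => _) = fun s => \sum_(k < m) (cs j k (ts j + s) - c k (t + s)) ^+ 2); last first.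
  by apply/funext => s; rewrite basis_comb_dist.
apply: (le_trans (le_Rintegral_oc _ _)).
- by move=> s; apply: sumr_ge0 => k _; exact: sqr_ge0.
- exact: (@integrable_sum_R _ _ _ mu _ m (fun k s => (cs j k (ts j + s) - c k (t + s)) ^+ 2)).
by rewrite (@Rintegral_sum _ _ _ mu _ m (fun k s => (cs j k (ts j + s) - c k (t + s)) ^+ 2)).
Qed.

End delay_continuity.

(** * The averaged delay term *)

Section delayed_averages.
Variable R : realType.
Let mu := @lebesgue_measure R.
Implicit Types (w : R -> R) (t eta ep r K : R).

(* theta |-> xi^n(theta, a, phi), for eta = eta(a, phi) and ep = eps_n *)
Definition window ep eta (theta : R) : R :=
  if - eta - ep <= theta <= - eta then ep^-1 else 0.

Definition delayed r ep w t eta : R :=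
  \int[mu]_(theta in `[- r, 0]) (w (t + theta) * window ep eta theta).

Lemma window_indic ep eta : window ep eta = fun theta => ep^-1 * \1_(`[- eta - ep, - eta]%classic) theta.
Proof.
apply/funext => theta; rewrite /window indicE; case: ifP => h.
  by rewrite mem_set ?mulr1//= in_itv.
by rewrite memNset ?mulr0//= in_itv /= h.
Qed.

Lemma measurable_window ep eta : measurable_fun setT (window ep eta : measurableTypeR R -> R).
Proof.
rewrite window_indic; apply: measurable_funM; first exact: measurable_cst.
by apply: measurable_indic; exact: measurable_itv.
Qed.

Lemma window_ge0 ep eta theta : 0 < ep -> 0 <= window ep eta theta.
Proof. by move=> e0; rewrite /window; case: ifP => // _; rewrite invr_ge0 ltW. Qed.

Lemma window_le ep eta theta : 0 < ep -> window ep eta theta <= ep^-1.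
Proof. by move=> e0; rewrite /window; case: ifP => // _; rewrite invr_ge0 ltW. Qed.

Lemma delayed_integrable r ep w t eta K : 0 < ep ->
  measurable_fun setT (w : measurableTypeR R -> R) -> (forall s, `|w s| <= K) ->
  mu.-integrable `[- r, 0]%classic (EFin \o (fun theta => w (t + theta) * window ep eta theta)).
Proof.
move=> e0 mw wK; have mr : measurable (`[- r, 0]%classic : set (measurableTypeR R)) by exact: measurable_itv.
apply: (@integrable_bounded _ _ _ mu _ (fun theta => w (t + theta) * window ep eta theta) (K * ep^-1)) => //.
- exact: lebesgue_itvcc_lty.
- apply: measurable_funTS; apply: measurable_funM; last exact: measurable_window.
  exact: (measurableT_comp mw (measurable_translate t)).
- move=> s _; rewrite normrM (ger0_norm (window_ge0 _ _ e0)).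
  by apply: ler_pM => //; [exact: window_ge0|exact: window_le].
Qed.

(** The window has mass 1, or less when it sticks out of [-r, 0]. The bound is therefore free of
    [ep], which is what makes the estimates uniform in n. *)
Lemma delayed_le r ep w t eta K : 0 < ep ->
  measurable_fun setT (w : measurableTypeR R -> R) -> (forall s, `|w s| <= K) ->
  `|delayed r ep w t eta| <= K.
Proof.
move=> e0 mw wK; have mr : measurable (`[- r, 0]%classic : set (measurableTypeR R)) by exact: measurable_itv.
have K0 : 0 <= K by exact: le_trans (wK 0).
have ii := delayed_integrable r t eta e0 mw wK.
have iw : mu.-integrable `[- r, 0]%classic (EFin \o window ep eta).
  apply: (@integrable_bounded _ _ _ mu _ (window ep eta) ep^-1) => //.
  - exact: lebesgue_itvcc_lty.
  - by apply: measurable_funTS; exact: measurable_window.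
  - by move=> s _; rewrite ger0_norm ?window_ge0 ?window_le.
apply: (le_trans (le_normr_Rintegral mr ii)).
apply: (@le_trans _ _ (\int[mu]_(theta in `[- r, 0]) (K * window ep eta theta))).
  apply: (le_Rintegral mr); [exact: integrable_norm|exact: integrableZ_R|move=> s _].
  by rewrite normrM (ger0_norm (window_ge0 _ _ e0)) ler_wpM2r// window_ge0.
rewrite RintegralZl// -[leRHS]mulr1 ler_wpM2l//.
rewrite -lee_fin EFin_Rintegral// window_indic.
under eq_integral do rewrite EFinM.
have mJ : measurable (`[- eta - ep, - eta]%classic : set (measurableTypeR R)) by exact: measurable_itv.
rewrite ge0_integralZl//; last 2 first.
- by apply/measurable_EFinP; apply: measurable_funTS; exact: measurable_indic.
- by rewrite lee_fin invr_ge0 ltW.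
rewrite integral_indic//.
pose J : set (measurableTypeR R) := `[- eta - ep, - eta]%classic.
pose I : set (measurableTypeR R) := `[- r, 0]%classic.
have : (mu (J `&` I) <= ep%:E)%E.
  apply: (@le_trans _ _ (mu J)).
    by apply: le_measure; rewrite ?inE//; exact: measurableI.
  rewrite /J /mu lebesgue_measure_itv /= lte_fin gtrBl e0 -EFinB lee_fin.
  by rewrite opprB addrC addrNK.
move=> /(lee_wpmul2l (x := ep^-1%:E)) => /(_ _)/le_trans; apply.
  by rewrite lee_fin invr_ge0 ltW.
by rewrite -EFinM mulVf ?gt_eqF.
Qed.

Lemma ae_neq (a : R) : {ae mu, forall s : measurableTypeR R, s != a}.
Proof.
exists [set a]; split; [exact: measurable_set1|exact: lebesgue_measure_set1|].
by move=> s /= /negP; rewrite negbK => /eqP.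
Qed.

Lemma eventually_cmp (a : nat -> R) (l s : R) : a j @[j --> \oo] --> l -> s != l ->
  \forall j \near \oo, (a j <= s) = (l <= s) /\ (s <= a j) = (s <= l).
Proof.
move=> al sl; have d0 : 0 < `|s - l| by rewrite normr_gt0 subr_eq0.
have /cvgrPdist_lt/(_ _ d0) := al; apply: filterS => j; rewrite ltr_norml => /andP[h1 h2].
move: sl; rewrite neq_lt => /orP[sl|sl].
  rewrite ltr0_norm ?subr_lt0// in h1 h2; rewrite !(ltW sl).
  have h : s < a j by lra.
  by rewrite (ltW h) !leNgt h sl.
rewrite gtr0_norm ?subr_gt0// in h1 h2; have h : a j < s by lra.
by rewrite (ltW h) (ltW sl) !leNgt h sl.
Qed.

(** The substitution s = t + theta removes [t] from the argument of [w], which need not be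
    continuous, and leaves it in the ends of the window and of the interval of integration. Away
    from these four points the indicators are eventually constant. *)
Lemma delayed_cvg r ep K A B (ws : nat -> R -> R) w (ts es : nat -> R) t eta : 0 < ep ->
  (forall j, measurable_fun setT (ws j : measurableTypeR R -> R)) ->
  measurable_fun setT (w : measurableTypeR R -> R) ->
  (forall j s, `|ws j s| <= K) -> (forall s, `|w s| <= K) ->
  (forall s, ws j s @[j --> \oo] --> w s) ->
  ts j @[j --> \oo] --> t -> es j @[j --> \oo] --> eta ->
  (forall j, A <= ts j - r /\ ts j <= B) -> A <= t - r /\ t <= B ->
  delayed r ep (ws j) (ts j) (es j) @[j --> \oo] --> delayed r ep w t eta.
Proof.
move=> e0 mws mw wsK wK wsw tst ese tsAB tAB.
have mE : measurable (`[A, B]%classic : set (measurableTypeR R)) by exact: measurable_itv.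
pose g (w : R -> R) (t eta s : R) := w s * (window ep eta (- t + s) * \1_(`[t - r, t]%classic) s).
have mg w' t' eta' : measurable_fun setT (w' : measurableTypeR R -> R) ->
    measurable_fun setT (g w' t' eta' : measurableTypeR R -> R).
  move=> mw'; apply: measurable_funM => //; apply: measurable_funM.
    exact: (measurableT_comp (measurable_window ep eta') (measurable_translate (- t'))).
  by apply: measurable_indic; exact: measurable_itv.
have gE w' t' eta' : measurable_fun setT (w' : measurableTypeR R -> R) ->
    A <= t' - r /\ t' <= B -> delayed r ep w' t' eta' = \int[mu]_(s in `[A, B]) g w' t' eta' s.
  move=> mw' [h1 h2]; pose f s := w' s * window ep eta' (- t' + s).
  have mf : measurable_fun setT (f : measurableTypeR R -> R).
    apply: measurable_funM => //.
    exact: (measurableT_comp (measurable_window ep eta') (measurable_translate (- t'))).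
  transitivity (\int[mu]_(theta in `[- r, 0]) f (t' + theta)).
    by congr Rintegral; apply/funext => s; rewrite /f addKr.
  rewrite Rintegral_translate// addr0 Rintegral_mkcond [RHS]Rintegral_mkcond.
  congr Rintegral; apply/funext => s; rewrite /patch /g /f indicE.
  have -> : (s \in `[t' - r, t']%classic) = (t' - r <= s <= t').
    by apply/idP/idP => [/set_mem|h]; [|apply/mem_set]; rewrite /= in_itv.
  have -> : (s \in `[A, B]%classic) = (A <= s <= B).
    by apply/idP/idP => [/set_mem|h]; [|apply/mem_set]; rewrite /= in_itv.
  have [/andP[h3 h4]|_] := boolP (t' - r <= s <= t'); last by rewrite !mulr0; case: ifP.
  by rewrite (le_trans h1 h3) (le_trans h4 h2) !mulr1.
rewrite gE// (_ : (fun j => _) = fun j => \int[mu]_(s in `[A, B]) g (ws j) (ts j) (es j) s); last first.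
  by apply/funext => j; rewrite gE.
have K0 : 0 <= K by exact: le_trans (wK 0).
have [|||||_ //] := @Rintegral_dominated _ _ _ mu _ (fun j => g (ws j) (ts j) (es j)) (g w t eta)
   (fun=> K * ep^-1) mE.
- by move=> j; apply: measurable_funTS; exact: mg.
- by apply: measurable_funTS; exact: mg.
- apply: (aeS4 _ (ae_neq (t - eta - ep)) (ae_neq (t - eta)) (ae_neq (t - r)) (ae_neq t)).
  move=> s n1 n2 n3 n4 _; apply: cvgM; first exact: wsw.
  apply: cvg_near_cst.
  have c1 : ts j - es j - ep @[j --> \oo] --> t - eta - ep.
    by apply: cvgB; [exact: cvgB|exact: cvg_cst].
  have c2 : ts j - es j @[j --> \oo] --> t - eta by exact: cvgB.
  have c3 : ts j - r @[j --> \oo] --> t - r by apply: cvgB => //; exact: cvg_cst.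
  have E1 (t' eta' : R) : window ep eta' (- t' + s) * \1_(`[t' - r, t']%classic) s =
      (if (t' - eta' - ep <= s) && (s <= t' - eta') then ep^-1 else 0) *
      ((t' - r <= s) && (s <= t'))%:R.
    rewrite /window indicE; congr ((if _ then _ else _) * (nat_of_bool _)%:R).
      by congr andb; apply/idP/idP => ?; lra.
    by apply/idP/idP => [/set_mem|h]; [|apply/mem_set]; rewrite /= in_itv.
  rewrite E1; near=> j; rewrite E1.
  have [-> _] : (ts j - es j - ep <= s) = (t - eta - ep <= s) /\ (s <= ts j - es j - ep) = (s <= t - eta - ep).
    by near: j; exact: eventually_cmp.
  have [_ ->] : (ts j - es j <= s) = (t - eta <= s) /\ (s <= ts j - es j) = (s <= t - eta).
    by near: j; exact: eventually_cmp.
  have [-> _] : (ts j - r <= s) = (t - r <= s) /\ (s <= ts j - r) = (s <= t - r).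
    by near: j; exact: eventually_cmp.
  have [_ ->] : (ts j <= s) = (t <= s) /\ (s <= ts j) = (s <= t).
    by near: j; exact: eventually_cmp.
  by [].
- exact: integrable_cst_itvcc.
- move=> j; apply: aeW => s _; rewrite /g normrM; apply: ler_pM => //.
  rewrite normrM (ger0_norm (window_ge0 _ _ e0)) -[leRHS]mulr1.
  apply: ler_pM => //; [exact: window_ge0|exact: window_le|].
  by rewrite indicE; case: (_ \in _); rewrite ?normr1 ?normr0.
Unshelve. all: by end_near. Qed.

End delayed_averages.

(** * The nonlocal term and its kernel *)

Section nonlocal_field.
Context d (X : measurableType d) (R : realType).
Variables (nu : {sigma_finite_measure set X -> \bar R}) (D : set X).
Hypotheses (mD : measurable D) (Doo : (nu D < +oo)%E).
Variables (b : R -> R) (Cb : R) (ker : X * X -> R) (Cf : R).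
Hypotheses (cb : continuous b) (bC : forall w, `|b w| <= Cb).
Hypotheses (mker : measurable_fun setT ker) (kerC : forall p, `|ker p| <= Cf).
Variables (e : nat -> X -> R) (m : nat).
Hypothesis me : forall k, @ph_mem R (L2_on nu D) (e k).
Let mu := @lebesgue_measure R.
Let E := L2_on nu D.
Implicit Types (c : nat -> R -> R).

Definition combination c (s : R) (y : X) : R := \sum_(k < m) c k s * e k y.

Definition nonlocal c (s : R) (x : X) : R :=
  \int[nu]_(y in D) (b (combination c s y) * ker (x, y)).

Let K := Cb * Cf * fine (nu D).

Let Cb0 : 0 <= Cb. Proof. exact: le_trans (bC 0). Qed.

Let mb : measurable_fun setT (b : measurableTypeR R -> R).
Proof. exact: continuous_measurable_fun. Qed.

Lemma measurable_combination c s : measurable_fun D (combination c s).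
Proof.
apply: measurable_sum => k; apply: measurable_funM; first exact: measurable_cst.
by have /(L2_onP _ mD)[] := me k.
Qed.

Lemma nonlocal_integrand_measurable c s x :
  measurable_fun D (fun y => b (combination c s y) * ker (x, y)).
Proof.
apply: measurable_funM.
  by apply: (measurableT_comp mb); exact: measurable_combination.
by apply: measurable_funTS; apply: (measurableT_comp mker); exact: measurable_pair1.
Qed.

Lemma nonlocal_integrand_le c s x y : `|b (combination c s y) * ker (x, y)| <= Cb * Cf.
Proof. by rewrite normrM; apply: ler_pM. Qed.

Lemma nonlocal_le c s x : `|nonlocal c s x| <= K.
Proof.
have ii : nu.-integrable D (EFin \o (fun y => b (combination c s y) * ker (x, y))).
  apply: (@integrable_bounded _ _ _ nu D _ (Cb * Cf) mD Doo).
    exact: nonlocal_integrand_measurable.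
  by move=> y _; exact: nonlocal_integrand_le.
apply: (le_trans (le_normr_Rintegral mD ii)).
rewrite /K -Rintegral_cst//; apply: le_Rintegral => //.
- exact: integrable_norm.
- by apply: (@integrable_bounded _ _ _ nu D (fun=> Cb * Cf) `|Cb * Cf|).
- by move=> y _; exact: nonlocal_integrand_le.
Qed.

Lemma measurable_nonlocal c : (forall k, measurable_fun setT (c k : measurableTypeR R -> R)) ->
  measurable_fun setT (fun p : measurableTypeR R * X => nonlocal c p.1 p.2).
Proof.
move=> mc.
(* [e k] is measurable on [D] only; extended by 0 it makes the integrand measurable on the whole
   product, as joint measurability in (s, x) demands. *)
pose g (p : (measurableTypeR R * X) * X) : R :=
  b (\sum_(k < m) c k p.1.1 * (e k \_ D) p.2) * ker (p.1.2, p.2).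
have mg : measurable_fun setT g.
  apply: measurable_funM.
    apply: (measurableT_comp mb); apply: measurable_sum => k; apply: measurable_funM.
      apply: (measurableT_comp (mc k)).
      by apply: measurableT_comp; [exact: measurable_fst|exact: measurable_fst].
    apply: measurableT_comp; last exact: measurable_snd.
    by apply/(measurable_restrictT _ mD); have /(L2_onP _ mD)[] := me k.
  apply: (measurableT_comp mker); apply: measurable_fun_pair; last exact: measurable_snd.
  by apply: measurableT_comp; [exact: measurable_snd|exact: measurable_fst].
have := @measurable_Rintegral_param _ _ _ _ R nu D g mD mg.
congr measurable_fun; apply/funext => -[s x]; apply: eq_Rintegral => y yD.
by rewrite /g /combination; congr (b _ * _); apply: eq_bigr => k _; rewrite /patch yD.
Qed.

Lemma nonlocal_cvg (cs : nat -> nat -> R -> R) c s x :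
  (forall k, cs j k s @[j --> \oo] --> c k s) ->
  nonlocal (cs j) s x @[j --> \oo] --> nonlocal c s x.
Proof.
move=> csc.
have [|||||_ //] := @Rintegral_dominated _ _ _ nu D
  (fun j y => b (combination (cs j) s y) * ker (x, y))
  (fun y => b (combination c s y) * ker (x, y)) (fun=> Cb * Cf) mD.
- by move=> j; exact: nonlocal_integrand_measurable.
- exact: nonlocal_integrand_measurable.
- apply: aeW => y _; apply: cvgM; last exact: cvg_cst.
  have c1 : combination (cs j) s y @[j --> \oo] --> combination c s y.
    apply: (@cvg_sum_ord R m (fun k j => cs j k s * e k y) (fun k => c k s * e k y)) => k _.
    by apply: cvgM; [exact: csc|exact: cvg_cst].
  by apply: (cvg_comp _ _ c1); exact: cb.
- by apply: (@integrable_bounded _ _ _ nu D (fun=> Cb * Cf) `|Cb * Cf|).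
- by move=> j; apply: aeW => y _; exact: nonlocal_integrand_le.
Qed.

Variables (r ep : R).
Hypothesis ep0 : 0 < ep.

Definition field c (t eta : R) (x : X) : R := delayed r ep (fun s => nonlocal c s x) t eta.

Lemma measurable_nonlocal_time c x :
  (forall k, measurable_fun setT (c k : measurableTypeR R -> R)) ->
  measurable_fun setT (fun s : measurableTypeR R => nonlocal c s x).
Proof.
move=> mc; exact: (measurableT_comp (measurable_nonlocal mc) (measurable_pair2 x)).
Qed.

Lemma field_le c t eta x : (forall k, measurable_fun setT (c k : measurableTypeR R -> R)) ->
  `|field c t eta x| <= K.
Proof.
by move=> mc; apply: delayed_le => //; [exact: measurable_nonlocal_time|move=> s; exact: nonlocal_le].
Qed.

Lemma measurable_field c t eta : (forall k, measurable_fun setT (c k : measurableTypeR R -> R)) ->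
  measurable_fun setT (field c t eta).
Proof.
move=> mc; rewrite /field /delayed.
pose g (p : X * measurableTypeR R) : R := nonlocal c (t + p.2) p.1 * window ep eta p.2.
apply: (@measurable_Rintegral_param _ _ _ _ R mu `[- r, 0]%classic g).
  exact: measurable_itv.
apply: measurable_funM.
  have mf : measurable_fun setT (fun p : X * measurableTypeR R => (t + p.2 : measurableTypeR R, p.1)).
    apply: measurable_fun_pair; last exact: measurable_fst.
    exact: (measurableT_comp (measurable_translate t) measurable_snd).
  exact: (measurableT_comp (measurable_nonlocal mc) mf).
exact: (measurableT_comp (measurable_window ep eta) measurable_snd).
Qed.

Lemma field_mem c t eta : (forall k, measurable_fun setT (c k : measurableTypeR R -> R)) ->
  @ph_mem R E (field c t eta).
Proof.
move=> mc; apply/(L2_onP _ mD); split; first by apply: measurable_funTS; exact: measurable_field.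
apply: (@integrable_bounded _ _ _ nu D _ (K ^+ 2) mD Doo).
  by apply: measurable_funX; apply: measurable_funTS; exact: measurable_field.
move=> x _; rewrite normrX ler_pXn2r ?nnegrE//; first exact: field_le.
exact: le_trans (field_le t eta x mc).
Qed.

Lemma field_norm c t eta : (forall k, measurable_fun setT (c k : measurableTypeR R -> R)) ->
  @phnorm R E (field c t eta) ^+ 2 <= K ^+ 2 * fine (nu D).
Proof.
move=> mc; rewrite (L2_on_sqr mD (field_mem t eta mc)) -Rintegral_cst//.
have /(L2_onP _ mD)[_ i1] := field_mem t eta mc.
apply: le_Rintegral => //; first by apply: (@integrable_bounded _ _ _ nu D (fun=> K ^+ 2) `|K ^+ 2|).
move=> x _; rewrite -[leLHS]real_normK ?num_real// ler_pXn2r ?nnegrE//; first exact: field_le.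
exact: le_trans (field_le t eta x mc).
Qed.

(** Dominated convergence in three layers: in y for [nonlocal_cvg], in the delay variable for
    [delayed_cvg], in x here. *)
Lemma field_ip_cvg (cs : nat -> nat -> R -> R) c (ts es : nat -> R) t eta A B (v : E) :
  @ph_mem R E v ->
  (forall j k, measurable_fun setT (cs j k : measurableTypeR R -> R)) ->
  (forall k, measurable_fun setT (c k : measurableTypeR R -> R)) ->
  (forall k s, cs j k s @[j --> \oo] --> c k s) ->
  ts j @[j --> \oo] --> t -> es j @[j --> \oo] --> eta ->
  (forall j, A <= ts j - r /\ ts j <= B) -> A <= t - r /\ t <= B ->
  @ph_ip R E (field (cs j) (ts j) (es j)) v @[j --> \oo] --> @ph_ip R E (field c t eta) v.
Proof.
move=> /(L2_onP _ mD)[mv iv] mcs mc csc tst ese hA hA'.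
have K0 : 0 <= K by rewrite /K !mulr_ge0// ?fine_ge0//; exact: le_trans (kerC (point, point)).
have [|||||_ //] := @Rintegral_dominated _ _ _ nu D
  (fun j x => field (cs j) (ts j) (es j) x * v x)
  (fun x => field c t eta x * v x) (fun x => K * `|v x|) mD.
- by move=> j; apply: measurable_funM => //; apply: measurable_funTS; exact: measurable_field.
- by apply: measurable_funM => //; apply: measurable_funTS; exact: measurable_field.
- apply: aeW => x _; apply: cvgM; last exact: cvg_cst.
  apply: (@delayed_cvg R r ep K A B) => //.
  + by move=> j; exact: measurable_nonlocal_time.
  + exact: measurable_nonlocal_time.
  + by move=> j s; exact: nonlocal_le.
  + by move=> s; exact: nonlocal_le.
  + by move=> s; apply: nonlocal_cvg.
- apply: integrableZ_R => //; apply: integrable_norm => //.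
  apply: (@le_integrable_R _ _ _ nu D v (fun x => 1 + v x ^+ 2) mD mv).
    move=> x _; have := sqr_ge0 (`|v x| - 1); rewrite -[v x ^+ 2]real_normK ?num_real//.
    by have := normr_ge0 (v x); set w := `|v x|; nra.
  apply: integrableD_R => //.
  by apply: (@integrable_bounded _ _ _ nu D (fun=> 1) 1) => // x _; rewrite normr1.
- move=> j; apply: aeW => x _; rewrite normrM ler_wpM2r//; exact: field_le.
Qed.

End nonlocal_field.

Lemma continuous_of_locally_lipschitz (R : realType) (b : R -> R) :
  [locally [lipschitz b w | w in [set: R]]] -> continuous b.
Proof.
move=> lb x; have [M [_ hM]] := lb (x, x) (conj Logic.I Logic.I).
have M0 : 0 < `|M| + 1 by rewrite ltr_pwDr.
have {hM} := hM (`|M| + 1) ltac:(by rewrite (le_lt_trans (ler_norm M))// ltrDl).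
move=> [[U V] /= [/= Ux Vx] UV]; apply/cvgrPdist_le => e e0.
have hV : \forall y \near x, `|x - y| < e / (`|M| + 1).
  have d0 : 0 < e / (`|M| + 1) by rewrite divr_gt0.
  by have /cvgrPdist_lt/(_ _ d0) := @cvg_id _ (nbhs x).
near=> y.
have Vy : V y by near: y.
have := UV (x, y) (conj (nbhs_singleton Ux) Vy) (conj Logic.I Logic.I) => /=.
move=> /le_trans; apply; rewrite mulrC -ler_pdivlMr//.
by apply/ltW; near: y.
Unshelve. all: by end_near. Qed.

Section convolution_kernel.
Variables (R : realType) (n : nat) (Om : set 'rV[R]_n).
Let muN := rV_lebesgue R n.

(** [f] agrees with a Borel function only almost everywhere on the difference set. For fixed x the
    exceptional z = x - y form a null set in y, so the Borel function may take its place under the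
    integral; clamping makes it bounded everywhere. *)
Lemma convolution_kernel (f : 'rV[R]_n -> R) :
  (exists Cf : R, forall z, difference_set Om z -> `|f z| <= Cf) ->
  lebesgue_measurable_on (difference_set Om) f ->
  exists (ker : 'rV[R]_n * 'rV[R]_n -> R) (Cf : R), [/\ measurable_fun setT ker,
    forall p, `|ker p| <= Cf &
    forall (w : 'rV[R]_n -> R) x, Om x ->
      \int[muN]_(y in Om) (w y * f (x - y)) = \int[muN]_(y in Om) (w y * ker (x, y))].
Proof.
move=> [Cf fC] [h mh hN]; have C0 : 0 <= `|Cf| by [].
exists (fun p => clamp `|Cf| (h (p.1 - p.2))), `|Cf|; split.
- apply: measurable_clamp; exact: (measurableT_comp mh (@measurable_rV_sub R n)).
- by move=> p; exact: clamp_norm.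
move=> w x Ox; apply: Rintegral_eq_ae.
have := @ae_reflect R n (difference_set Om) [set z | f z = h z] x.
have sN : muN.-negligible [set z | difference_set Om z /\ ~ f z = h z].
  move: hN; congr (negligible _ _); apply/seteqP; split => z /= [dz] => [/eqP|fz]; split => //.
  exact/eqP.
move=> /(_ sN); apply: filterS => y hy Oy.
have dxy : difference_set Om (x - y) by exists x => //; exists y.
by rewrite /= -hy// clamp_id// (le_trans (fC _ dxy))// ler_norm.
Qed.

End convolution_kernel.

(** * The forcing of the modes *)

Section delay_causality.
Variables (R : realType) (E : prehilbert R) (eh : nat -> E).
Hypothesis hE : prehilbert_axioms E.
Hypothesis hb : ph_basis eh.
Variables (m : nat) (h : nat -> R -> R) (C r T : R).
Hypothesis ih : forall k, (@lebesgue_measure R).-integrable `[- r - 1, T + 1]%classic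
  (EFin \o (fun s => h k s ^+ 2)).
Hypothesis r0 : 0 < r.
Variable eta : E -> (R -> E) -> R.
Hypothesis eta_lip : forall M : R, 0 < M -> exists L : R,
  forall v1 psi1 v2 psi2, history_space r v1 psi1 -> history_space r v2 psi2 ->
  history_sqnorm r v1 psi1 <= M ^+ 2 -> history_sqnorm r v2 psi2 <= M ^+ 2 ->
  `|eta v1 psi1 - eta v2 psi2| <=
    L * Num.sqrt (history_sqnorm r (v1 - v2) (fun s => psi1 s - psi2 s)).
Let gal := basis_comb eh m.

(** The two arguments of [eta] are at distance 0 in H, and the Lipschitz estimate forces equal
    values. *)
Lemma delay_causal c c' t : admissible h C c -> admissible h C c' -> 0 < t < T ->
  (forall k s, s <= t -> c k s = c' k s) ->
  eta (gal c t) (fun s => gal c (t + s)) = eta (gal c' t) (fun s => gal c' (t + s)).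
Proof.
move=> ac ac' tT cc'.
have [M M0 hM] := admissible_history_sqnorm hE hb m C ih r0.
have [L hL] := eta_lip M0.
apply/eqP; rewrite -subr_eq0 -normr_le0.
apply: (le_trans (hL _ _ _ _ (admissible_history_space hE hb m ih r0 ac tT)
  (admissible_history_space hE hb m ih r0 ac' tT) (hM _ _ ac tT) (hM _ _ ac' tT))).
have ce s : s <= t -> gal c s = gal c' s.
  by move=> st; apply: eq_bigr => k _; rewrite cc'.
suff -> : history_sqnorm r (gal c t - gal c' t) (fun s => gal c (t + s) - gal c' (t + s)) = 0.
  by rewrite sqrtr0 mulr0.
rewrite /history_sqnorm ce// subrr (phnorm0 hE) expr0n /= add0r.
rewrite (@eq_Rintegral _ _ _ _ _ (fun=> 0)); first by rewrite Rintegral_cst ?mul0r//; exact: measurable_itv.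
move=> s /set_mem /=; rewrite in_itv /= => /andP[_ s0].
by rewrite ce ?subrr ?(phnorm0 hE) ?expr0n// gerDl ltW.
Qed.

End delay_causality.

(** The interface between the delay term and the scalar equations: a bound that does not grow with
    the number of modes, causality, and continuity. The latter allows the times to vary with j, so
    it also contains continuity in time along a fixed family. *)
Record forcing_axioms (R : realType) (h : nat -> R -> R) (C T K : R)
    (G : (nat -> R -> R) -> nat -> R -> R) : Prop := {
  forcing_sum_le : forall c t n, admissible h C c -> 0 < t < T ->
    \sum_(k < n) G c k t ^+ 2 <= K ^+ 2 ;
  forcing_causal : forall c c' t k, admissible h C c -> admissible h C c' -> 0 < t < T ->
    (forall k s, s <= t -> c k s = c' k s) -> G c k t = G c' k t ;
  forcing_cvg : forall (cs : nat -> nat -> R -> R) c (ts : nat -> R) t k,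
    (forall j, admissible h C (cs j)) -> admissible h C c ->
    (forall k s, 0 <= s -> cs j k s @[j --> \oo] --> c k s) ->
    (forall j, 0 < ts j < T) -> 0 < t < T -> ts j @[j --> \oo] --> t ->
    (forall k, cs j k (ts j) @[j --> \oo] --> c k t) ->
    G (cs j) k (ts j) @[j --> \oo] --> G c k t }.

Lemma L2_on_mem_eq d (X : measurableType d) (R : realType) (nu : {measure set X -> \bar R})
  (D : set X) (g g' : X -> R) : measurable D -> (forall x, D x -> g x = g' x) ->
  @ph_mem R (L2_on nu D) g -> @ph_mem R (L2_on nu D) g'.
Proof.
move=> mD gg' /(L2_onP _ mD)[mg ig]; apply/(L2_onP _ mD); split.
  by apply: eq_measurable_fun mg => x /set_mem Dx; exact: gg'.
by apply: eq_integrable ig => // x /set_mem Dx /=; rewrite gg'.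
Qed.

Section galerkin_forcing.
Variables (R : realType) (n : nat) (Om : set 'rV[R]_n).
Let nu := rV_lebesgue R n.
Hypotheses (mOm : measurable Om) (Omoo : (nu Om < +oo)%E).
Let E := L2 Om.
Variables (e : nat -> E).
Hypothesis hb : ph_basis e.
Variables (r : R) (eps : nat -> R) (b : R -> R) (f : 'rV[R]_n -> R).
Variable eta : E -> (R -> E) -> R.
Hypotheses (r0 : 0 < r) (eps0 : forall N, 0 < eps N).
Variables (Cb Cf : R) (ker : 'rV[R]_n * 'rV[R]_n -> R).
Hypotheses (cb : continuous b) (bC : forall w, `|b w| <= Cb).
Hypotheses (mker : measurable_fun setT ker) (kerC : forall p, `|ker p| <= Cf).
Hypothesis kerE : forall (w : 'rV[R]_n -> R) x, Om x ->
  \int[nu]_(y in Om) (w y * f (x - y)) = \int[nu]_(y in Om) (w y * ker (x, y)).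
Hypothesis eta_lip : locally_lipschitz_H r eta.

Let hE : prehilbert_axioms E. Proof. exact: (L2_on_axioms nu mOm). Qed.
Let me k : @ph_mem R (L2_on nu Om) (e k). Proof. exact: (ph_basis_mem hb). Qed.

Let eta_of m c t := eta (basis_comb e m c t) (fun s => basis_comb e m c (t + s)).

(** Restricted to [Om], where the Borel kernel may replace [f]; the inner product of [L2 Om] sees no
    other points. *)
Lemma F_field N m c t x : Om x ->
  F r eps b f eta N (galerkin_fun e m c) t x =
  field nu Om b ker e m r (eps N) c t (eta_of m c t) x.
Proof.
move=> Ox; rewrite /F /field /delayed; apply: eq_Rintegral => s _.
rewrite kerE//; congr (_ * _); apply: eq_Rintegral => y _; congr (b _ * _).
by rewrite /galerkin_fun fct_sumE.
Qed.

Lemma F_mem N m c t : (forall k, measurable_fun setT (c k : measurableTypeR R -> R)) ->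
  @ph_mem R E (F r eps b f eta N (galerkin_fun e m c) t).
Proof.
move=> mc.
apply: (L2_on_mem_eq mOm _ (field_mem mOm Omoo cb bC mker kerC m me r (eps0 N) t (eta_of m c t) mc)).
by move=> x Ox; rewrite F_field.
Qed.

(** Only the modes below [m] enter the delay term, but its coordinate [k] is arbitrary: the modes
    from [m] on become scalar equations driven by the source without acting on it. *)
Definition forcing N m c k t : R := ph_ip (F r eps b f eta N (galerkin_fun e m c) t) (e k).

Lemma forcing_field N m c k t : forcing N m c k t =
  @ph_ip R (L2_on nu Om) (field nu Om b ker e m r (eps N) c t (eta_of m c t)) (e k).
Proof.
by apply: eq_Rintegral => x /set_mem Ox; rewrite F_field.
Qed.

(** [Cb * Cf * |Om|] bounds the delay term pointwise, the factor sqrt |Om| turns this into a bound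
    of the L^2 norm, and Bessel's inequality distributes it over the modes. *)
Lemma forcing_axiomsP h C T N m :
  (forall k, (@lebesgue_measure R).-integrable `[- r - 1, T + 1]%classic
    (EFin \o (fun s => h k s ^+ 2))) ->
  forcing_axioms h C T (Cb * Cf * fine (nu Om) * Num.sqrt (fine (nu Om))) (forcing N m).
Proof.
move=> ih; split.
- move=> c t p ac tT; have mc := let: And3 mc _ _ := ac in mc.
  under eq_bigr do rewrite forcing_field.
  have mF := field_mem mOm Omoo cb bC mker kerC m me r (eps0 N) t (eta_of m c t) mc.
  apply: (le_trans (bessel hE (ph_basis_mem hb) (ph_basis_ortho hb) p mF)).
  rewrite exprMn [X in _ <= _ * X]sqr_sqrtr ?fine_ge0//.
  exact: (field_norm mOm Omoo cb bC mker kerC m me r (eps0 N) t (eta_of m c t) mc).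
- move=> c c' t k ac ac' tT cc'; rewrite !forcing_field.
  have -> : eta_of m c t = eta_of m c' t.
    exact: (delay_causal hE hb m ih r0 eta_lip ac ac' tT cc').
  apply: eq_Rintegral => x _; congr (_ * _); apply: eq_Rintegral => s /set_mem /=.
  rewrite in_itv /= => /andP[_ s0]; congr (_ * _); apply: eq_Rintegral => y _.
  congr (b _ * _); apply: eq_bigr => l _; congr (_ * _); apply: cc'; by rewrite gerDl.
move=> cs c ts t k acs ac csc tsT tT tst cst.
rewrite forcing_field (_ : (fun j => _) = fun j => @ph_ip R (L2_on nu Om)
  (field nu Om b ker e m r (eps N) (cs j) (ts j) (eta_of m (cs j) (ts j))) (e k)); last first.
  by apply/funext => j; rewrite forcing_field.
apply: (@field_ip_cvg _ _ R nu Om mOm Omoo b Cb ker Cf cb bC mker kerC e m me r (eps N) (eps0 N)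
  cs c ts (fun j => eta_of m (cs j) (ts j)) t (eta_of m c t) (- r) T).
- exact: me.
- by move=> j l; case: (acs j).
- by move=> l; case: ac.
- move=> l s; have [s0|s0] := ltP s 0; last exact: csc.
  rewrite (_ : (fun j => _) = fun=> c l s); first exact: cvg_cst.
  by apply/funext => j; case: (acs j) => _ -> // _; case: ac => _ ->.
- exact: tst.
- exact: (delay_cvg hE hb (m := m) ih r0 eta_lip acs ac csc tsT tT tst cst).
- by move=> j; have /andP[h1 h2] := tsT j; split; lra.
- by have /andP[h1 h2] := tT; split; lra.
Qed.

End galerkin_forcing.

(** * Mild solutions and Tonelli's scheme *)

Section primitive.
Variables (R : realType) (T : R).
Let mu := @lebesgue_measure R.
Let I : set (measurableTypeR R) := `]0, T[%classic.
Implicit Types (v : R -> R) (V : R).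

Let mI : measurable I. Proof. exact: measurable_itv. Qed.

Lemma lebesgue_itvoo_lty (a b : R) : (mu `]a, b[%classic < +oo)%E.
Proof. by rewrite /mu lebesgue_measure_itv /=; case: ifP => _; rewrite ltry. Qed.

(** The integral of [v] from 0 to [a], cut off at 0 and at [T]. Written against a step function on a
    fixed domain, it is a pairing with an element of L^2(0, T), to which weak convergence
    applies. *)
Definition primitive v (a : R) : R := \int[mu]_(s in I) (v s * (s < a)%R%:R).

Lemma step_indic (a : R) : (fun s : R => (s < a)%R%:R : R) = \1_(`]-oo, a[%classic).
Proof.
by apply/funext => s; rewrite indicE; congr (nat_of_bool _)%:R; apply/idP/idP => [h|/set_mem];
  [apply/mem_set|]; rewrite /= in_itv.
Qed.

Lemma measurable_step (a : R) :
  measurable_fun setT (fun s : measurableTypeR R => (s < a)%R%:R : R).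
Proof. by rewrite step_indic; apply: measurable_indic; exact: measurable_itv. Qed.

Lemma integrable_bounded_itvoo v V : measurable_fun I v -> (forall s, I s -> `|v s| <= V) ->
  mu.-integrable I (EFin \o v).
Proof. by move=> mv vV; apply: (integrable_bounded mI _ mv vV); exact: lebesgue_itvoo_lty. Qed.

Lemma primitive_integrable v a : mu.-integrable I (EFin \o v) ->
  mu.-integrable I (EFin \o (fun s => v s * (s < a)%R%:R)).
Proof.
move=> iv; apply: (@le_integrable_R _ _ _ mu I _ (fun s => `|v s|) mI); last exact: integrable_norm.
  apply: measurable_funM; first by apply/measurable_EFinP; exact: measurable_int iv.
  by apply: measurable_funTS; exact: measurable_step.
by move=> s _; rewrite normrM; case: (s < a); rewrite ?normr1 ?normr0 ?mulr1 ?mulr0.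
Qed.

Lemma eq_primitive v v' a : (forall s, 0 < s < T -> s < a -> v s = v' s) ->
  primitive v a = primitive v' a.
Proof.
move=> vv'; apply: eq_Rintegral => s /set_mem; rewrite /I /= in_itv /= => sT.
by case: (ltP s a) => [sa|_]; rewrite ?mulr0// vv'.
Qed.

Lemma primitive0 v a : a <= 0 -> primitive v a = 0.
Proof.
move=> a0; rewrite /primitive (@eq_Rintegral _ _ _ _ _ (fun=> 0)) ?Rintegral_cst ?mul0r//.
move=> s /set_mem; rewrite /I /= in_itv /= => /andP[s0 _].
by rewrite ltNge (le_trans a0 (ltW s0)) mulr0.
Qed.

Lemma primitive_lip v V a a' : measurable_fun I v -> (forall s, I s -> `|v s| <= V) -> 0 <= V ->
  `|primitive v a - primitive v a'| <= V * `|a - a'|.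
Proof.
move=> mv vV V0; wlog aa' : a a' / a' <= a.
  move=> H; have [/H//|/ltW/H] := leP a' a.
  by rewrite distrC (distrC a').
have iv := integrable_bounded_itvoo mv vV.
have ia := primitive_integrable a iv; have ia' := primitive_integrable a' iv.
rewrite /primitive -RintegralB//.
have mJ : measurable (`[a', a]%classic : set (measurableTypeR R)) by exact: measurable_itv.
have i1 : mu.-integrable I (EFin \o (\1_(`[a', a]%classic) : R -> R)).
  apply: (integrable_bounded_itvoo (V := 1)).
    by apply: measurable_funTS; exact: measurable_indic.
  by move=> s _; rewrite indicE; case: (_ \in _); rewrite ?normr1 ?normr0.
apply: (@le_trans _ _ (\int[mu]_(s in I) (V * \1_(`[a', a]%classic) s))).
  have iB := integrableB mI ia ia'.
  apply: (le_trans (le_normr_Rintegral mI iB)); apply: le_Rintegral => //.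
  - exact: integrable_norm.
  - exact: integrableZ_R.
  move=> s Is; rewrite -mulrBr normrM; apply: ler_pM => //; first exact: vV.
  rewrite indicE; case: (ltP s a) => [sa|]; case: (ltP s a') => [sa'|a's]; rewrite ?subrr ?subr0 ?normr0 ?normr1//.
    by rewrite mem_set//= in_itv /= a's ltW.
  by move=> h; move: (lt_le_trans sa' (le_trans aa' h)); rewrite ltxx.
rewrite RintegralZl//; apply: ler_wpM2l => //.
rewrite -lee_fin EFin_Rintegral// integral_indic//.
apply: (@le_trans _ _ (mu (`[a', a]%classic : set (measurableTypeR R)))).
  by apply: le_measure; rewrite ?inE//; exact: measurableI.
rewrite /mu lebesgue_measure_itv /= lte_fin; case: ifP => _; last by rewrite lee_fin.
by rewrite -EFinB lee_fin ler_norm.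
Qed.

Lemma primitive_le v V a : measurable_fun I v -> (forall s, I s -> s < a -> `|v s| <= V) -> 0 <= V ->
  0 <= T -> `|primitive v a| <= V * T.
Proof.
move=> mv vV V0 T0.
have b : forall s, I s -> `|v s * (s < a)%R%:R| <= V.
  move=> s Is; case: (ltP s a) => sa; rewrite ?mulr0 ?mulr1 ?normr0//; exact: vV.
have mva : measurable_fun I (fun s => v s * (s < a)%R%:R).
  by apply: measurable_funM => //; apply: measurable_funTS; exact: measurable_step.
have ii := integrable_bounded_itvoo mva b.
apply: (le_trans (le_normr_Rintegral mI ii)).
apply: (@le_trans _ _ (\int[mu]_(s in I) V)).
  apply: le_Rintegral => //; first exact: integrable_norm.
  by apply: (integrable_bounded_itvoo (V := `|V|)).
rewrite Rintegral_cst//; apply: ler_wpM2l => //.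
rewrite [X in fine X](_ : _ = (if (0%:E < T%:E)%E then (T%:E - 0%:E)%E else 0%E)); last first.
  exact: lebesgue_measure_itv.
by rewrite lte_fin; case: ifP => //= _; rewrite subr0.
Qed.

Lemma primitive_derivable v V t : measurable_fun I v -> (forall s, I s -> `|v s| <= V) ->
  0 < t < T -> {for t, continuous v} -> is_derive t 1 (primitive v) (v t).
Proof.
move=> mv vV /andP[t0 tT] cv; pose f := v \_ I.
have mf : measurable_fun setT (f : measurableTypeR R -> R) by apply/(measurable_restrictT _ mI).
have iv := integrable_bounded_itvoo mv vV.
have iF : mu.-integrable setT (EFin \o f).
  rewrite (_ : EFin \o f = (EFin \o v) \_ I); first exact: (integrable_mkcond _ mI).1 iv.
  by apply/funext => s; rewrite /f /patch /=; case: ifP.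
have pE : primitive v = fun a => \int[mu]_(s in `]0, a]) f s.
  apply/funext => a; rewrite /primitive Rintegral_mkcond [RHS]Rintegral_mkcond.
  apply: Rintegral_eq_ae; have := @ae_neq R a; apply: filterS => s sa _.
  rewrite /patch /f /patch.
  have -> : (s \in I) = (0 < s < T).
    by apply/idP/idP => [/set_mem|h]; [|apply/mem_set]; rewrite /I /= in_itv.
  have -> : (s \in `]0, a]%classic) = (0 < s <= a).
    by apply/idP/idP => [/set_mem|h]; [|apply/mem_set]; rewrite /= in_itv.
  rewrite le_eqVlt (negPf sa) /=.
  by case: (0 < s); case: (s < T); case: (s < a); rewrite ?mulr1 ?mulr0.
have ft : f t = v t by rewrite /f patchE mem_set// /I /= in_itv /= t0.
have cf : {for t, continuous f}.
  rewrite /prop_for /continuous_at ft; apply: cvg_trans cv; apply: near_eq_cvg.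
  near=> s; rewrite /f patchE mem_set// /I /= in_itv /=; apply/andP; split.
    by near: s; exact: lt_nbhsr.
  by near: s; exact: lt_nbhsl.
have iT : mu.-integrable `]0, T]%classic (EFin \o f).
  by apply: integrableS iF => //; exact: measurable_itv.
have [] := @continuous_FTC1 R f (BRight 0) t T tT iT.
- by rewrite lte_fin.
- exact: cf.
rewrite ft pE => d1 d2; apply: DeriveDef => //; by rewrite -derive1E.
Unshelve. all: by end_near. Qed.

End primitive.

Section duhamel.
Variables (R : realType) (T : R).
Hypothesis T0 : 0 < T.
Let mu := @lebesgue_measure R.
Let I : set (measurableTypeR R) := `]0, T[%classic.
Let mI : measurable I. Proof. exact: measurable_itv. Qed.
Implicit Types (w z : R -> R) (ga K t : R).

Definition exp_weight ga w (s : R) : R := expR (ga * s) * w s.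

(* The mild solution of c' = - ga c + w, c(0) = u0, with the source delayed by del. *)
Definition duhamel ga u0 w (del t : R) : R :=
  expR (- ga * t) * (u0 + primitive T (exp_weight ga w) (t - del)).

Lemma measurable_expR_lin ga : measurable_fun setT (fun s : measurableTypeR R => expR (ga * s)).
Proof.
apply: continuous_measurable_fun => s.
apply: (continuous_comp (f := fun s => ga * s)); last exact: continuous_expR.
by apply: cvgM; [exact: cvg_cst|exact: cvg_id].
Qed.

Lemma measurable_exp_weight ga w : measurable_fun I w -> measurable_fun I (exp_weight ga w).
Proof. by move=> mw; apply: measurable_funM => //; apply: measurable_funTS; exact: measurable_expR_lin. Qed.

Lemma exp_weight_le ga w K s : 0 < ga -> (forall s, I s -> `|w s| <= K) -> I s ->
  `|exp_weight ga w s| <= expR (ga * T) * K.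
Proof.
move=> ga0 wK Is; rewrite /exp_weight normrM (ger0_norm (expR_ge0 _)).
apply: ler_pM; rewrite ?expR_ge0// ?wK// ler_expR ler_pM2l//.
by move: Is; rewrite /I /= in_itv /= => /andP[_ /ltW].
Qed.

(** Stated for any Lipschitz [p]: it also serves the weak limit of sources, where the Lipschitz
    bound is inherited and does not come from a bound on the source. *)
Lemma duhamel_primitive_cont ga u0 (p : R -> R) V : (forall a a', `|p a - p a'| <= V * `|a - a'|) ->
  continuous (fun t => expR (- ga * t) * (u0 + p t)).
Proof.
move=> pV t; apply: cvgM.
  apply: (continuous_comp (f := fun s => - ga * s)); last exact: continuous_expR.
  by apply: cvgM; [exact: cvg_cst|exact: cvg_id].
apply: cvgD; first exact: cvg_cst.
apply/cvgrPdist_le => e e0.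
have d0 : 0 < e / (`|V| + 1) by rewrite divr_gt0// ltr_pwDr.
have /cvgrPdist_le/(_ _ d0) := @cvg_id _ (nbhs t); apply: filterS => s hs.
apply: (le_trans (pV _ _)); apply: (@le_trans _ _ ((`|V| + 1) * `|t - s|)).
  by rewrite ler_wpM2r// (le_trans (ler_norm V))// lerDl.
by rewrite mulrC -ler_pdivlMr// ltr_pwDr.
Qed.

Section bounded_source.
Variables (ga u0 : R) (w : R -> R) (K : R).
Hypotheses (ga0 : 0 < ga) (mw : measurable_fun I w) (wK : forall s, I s -> `|w s| <= K).

Let K0 : 0 <= K.
Proof.
have : I (T / 2) by rewrite /I /= in_itv /=; move: T0 => ?; apply/andP; split; lra.
by move/wK; apply: le_trans.
Qed.

Lemma duhamel_source_lip a a' :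
  `|primitive T (exp_weight ga w) a - primitive T (exp_weight ga w) a'| <=
  expR (ga * T) * K * `|a - a'|.
Proof.
apply: primitive_lip; first exact: measurable_exp_weight.
  by move=> s; exact: exp_weight_le.
by rewrite mulr_ge0// expR_ge0.
Qed.

Lemma duhamel_continuous del : continuous (duhamel ga u0 w del).
Proof.
apply: (@duhamel_primitive_cont ga u0 (fun t => primitive T (exp_weight ga w) (t - del))
  (expR (ga * T) * K)) => a a'.
have -> : a - a' = (a - del) - (a' - del) by ring.
exact: duhamel_source_lip.
Qed.

(** The source is read at times below t - [del] <= t, where its weight is at most exp(ga t); the
    factor exp(-ga t) absorbs it. The bound is thus free of [ga], hence usable for all modes at
    once. *)
Lemma duhamel_le del t : 0 <= del -> 0 <= t -> `|duhamel ga u0 w del t| <= `|u0| + K * T.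
Proof.
move=> d0 t0; rewrite /duhamel mulrDr; apply: (le_trans (ler_normD _ _)); apply: lerD.
  rewrite normrM (ger0_norm (expR_ge0 _)) ler_piMl// -expR0 ler_expR mulNr oppr_le0 mulr_ge0//.
  exact: ltW.
rewrite normrM (ger0_norm (expR_ge0 _)) mulNr expRN ler_pdivrMl ?expR_gt0// mulrA.
apply: primitive_le => //; [exact: measurable_exp_weight| |by rewrite mulr_ge0// expR_ge0|exact: ltW].
move=> s Is sa; rewrite /exp_weight normrM (ger0_norm (expR_ge0 _)).
apply: ler_pM; rewrite ?expR_ge0// ?wK// ler_expR ler_pM2l//.
by rewrite ltW// (lt_le_trans sa)// gerBl.
Qed.

Lemma duhamel_derive t : 0 < t < T -> {for t, continuous w} ->
  is_derive t 1 (duhamel ga u0 w 0) (- ga * duhamel ga u0 w 0 t + w t).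
Proof.
move=> tT cw.
have cv : {for t, continuous (exp_weight ga w)}.
  apply: cvgM => //.
  apply: (continuous_comp (f := fun s => ga * s)); last exact: continuous_expR.
  by apply: cvgM; [exact: cvg_cst|exact: cvg_id].
have dp : is_derive t 1 (primitive T (exp_weight ga w)) (exp_weight ga w t).
  apply: (primitive_derivable (V := expR (ga * T) * K) (measurable_exp_weight ga mw) _ tT cv).
  by move=> s; exact: exp_weight_le.
have -> : duhamel ga u0 w 0 = (expR \o ( *%R (- ga))) * (cst u0 + primitive T (exp_weight ga w)).
  by apply/funext => s; rewrite /duhamel subr0.
have dl : is_derive t 1 ( *%R (- ga)) (- ga).
  by apply: (is_derive_eq (is_deriveZ _ _)); rewrite /GRing.scale /= mulr1.
have de : is_derive t 1 (expR \o ( *%R (- ga))) (- ga * expR (- ga * t)).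
  apply: (is_derive_eq (is_derive1_comp _ _)); by rewrite mulrC.
apply: is_derive_eq.
rewrite /GRing.scale /= !fctE /= add0r /exp_weight.
have e1 : expR (- ga * t) * expR (ga * t) = 1 by rewrite -expRD mulNr addNr expR0.
set p := primitive _ _ _; rewrite mulrA e1 mul1r; ring.
Qed.

End bounded_source.

Lemma duhamel0 ga u0 w del : 0 <= del -> duhamel ga u0 w del 0 = u0.
Proof. by move=> d0; rewrite /duhamel mulr0 expR0 mul1r primitive0 ?addr0// sub0r oppr_le0. Qed.

Lemma eq_duhamel ga u0 w w' del t : (forall s, 0 < s < T -> s < t - del -> w s = w' s) ->
  duhamel ga u0 w del t = duhamel ga u0 w' del t.
Proof.
by move=> ww'; rewrite /duhamel (@eq_primitive _ _ _ (exp_weight ga w'))// => s sT st; rewrite /exp_weight ww'.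
Qed.

Section source_limit.
Variables (ga u0 : R) (ws : nat -> R -> R) (z : R -> R) (K : R) (del : nat -> R).
Hypotheses (ga0 : 0 < ga) (mws : forall j, measurable_fun I (ws j)).
Hypothesis wsK : forall j s, I s -> `|ws j s| <= K.
Hypothesis wsz : forall psi, @ph_mem R (L2_on mu I) psi ->
  \int[mu]_(t in I) (ws j t * psi t) @[j --> \oo] --> \int[mu]_(t in I) (z t * psi t).
Hypothesis del0 : del j @[j --> \oo] --> (0 : R).

(** The weight exp(ga s) cut off at [a] is a fixed element of L^2(0, T), so weak convergence handles
    the limit at [a]; moving the end by [del j] costs a Lipschitz constant common to all j. *)
Lemma primitive_weak_cvg a :
  primitive T (exp_weight ga (ws j)) (a - del j) @[j --> \oo] --> primitive T (exp_weight ga z) a.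
Proof.
have mpsi : @ph_mem R (L2_on mu I) (fun s => expR (ga * s) * (s < a)%R%:R).
  apply/(L2_onP _ mI).
  have m1 : measurable_fun I (fun s : R => expR (ga * s) * (s < a)%R%:R).
    by apply: measurable_funM; apply: measurable_funTS; [exact: measurable_expR_lin|exact: measurable_step].
  split => //; apply: (integrable_bounded_itvoo (V := expR (ga * T) ^+ 2)).
    exact: measurable_funX.
  move=> s Is; rewrite normrX ler_pXn2r ?nnegrE ?expR_ge0// normrM (ger0_norm (expR_ge0 _)).
  have : expR (ga * s) <= expR (ga * T).
    by rewrite ler_expR ler_pM2l//; move: Is; rewrite /I /= in_itv /= => /andP[_ /ltW].
  by case: (s < a) => h; rewrite ?normr1 ?normr0 ?mulr1 ?mulr0 ?expR_ge0.
have pE w : primitive T (exp_weight ga w) a = \int[mu]_(t in I) (w t * (expR (ga * t) * (t < a)%R%:R)).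
  by congr Rintegral; apply/funext => s; rewrite /exp_weight; ring.
have c1 : primitive T (exp_weight ga (ws j)) a @[j --> \oo] --> primitive T (exp_weight ga z) a.
  rewrite pE (_ : (fun j => _) = fun j => \int[mu]_(t in I) (ws j t * (expR (ga * t) * (t < a)%R%:R))).
    exact: wsz.
  by apply/funext => j; rewrite pE.
have c2 : `|expR (ga * T) * K * del j| + `|primitive T (exp_weight ga (ws j)) a - primitive T (exp_weight ga z) a|
    @[j --> \oo] --> (0 : R).
  have z0 : `|expR (ga * T) * K * 0| + `|primitive T (exp_weight ga z) a - primitive T (exp_weight ga z) a| = 0.
    by rewrite mulr0 subrr normr0 addr0.
  rewrite -[X in _ --> X]z0; apply: cvgD; apply: cvg_norm.
    by apply: cvgM => //; exact: cvg_cst.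
  by apply: cvgB => //; exact: cvg_cst.
apply: (cvg_of_dist _ c2) => j.
set x := primitive _ _ _; set y := primitive _ _ _; set u := primitive _ _ _.
have -> : x - y = (x - u) + (u - y) by ring.
apply: (le_trans (ler_normD _ _)); rewrite lerD2r.
apply: (le_trans (duhamel_source_lip ga0 (mws j) (wsK j) _ _)).
have -> : a - del j - a = - del j by ring.
by rewrite normrN [leRHS]normrM ler_wpM2r ?ler_norm.
Qed.

Lemma duhamel_weak_cvg t : duhamel ga u0 (ws j) (del j) t @[j --> \oo] --> duhamel ga u0 z 0 t.
Proof.
rewrite /duhamel subr0; apply: cvgM; first exact: cvg_cst.
by apply: cvgD; [exact: cvg_cst|exact: primitive_weak_cvg].
Qed.

(** No pointwise bound on [z] is available: the common Lipschitz bound of the primitives is carried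
    to the limit. *)
Lemma duhamel_weak_limit_continuous : continuous (duhamel ga u0 z 0).
Proof.
have -> : duhamel ga u0 z 0 = fun t => expR (- ga * t) * (u0 + primitive T (exp_weight ga z) t).
  by apply/funext => t; rewrite /duhamel subr0.
apply: (@duhamel_primitive_cont ga u0 _ (expR (ga * T) * K)) => a a'.
have c : `|primitive T (exp_weight ga (ws j)) (a - del j) - primitive T (exp_weight ga (ws j)) (a' - del j)|
   @[j --> \oo] --> `|primitive T (exp_weight ga z) a - primitive T (exp_weight ga z) a'|.
  by apply: cvg_norm; apply: cvgB; exact: primitive_weak_cvg.
apply: (cvgr_to_le c); apply: nearW => j.
apply: (le_trans (duhamel_source_lip ga0 (mws j) (wsK j) _ _)).
by have -> : a - del j - (a' - del j) = a - a' by ring.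
Qed.

End source_limit.

Lemma duhamel_compactness (ga u0 : nat -> R) (w : nat -> nat -> R -> R) (K : R) (del : nat -> R) :
  (forall k, 0 < ga k) -> (forall k j, measurable_fun I (w k j)) ->
  (forall k j s, I s -> `|w k j s| <= K) -> del j @[j --> \oo] --> (0 : R) ->
  exists2 s : nat -> nat, {homo s : i j / (i < j)%N} &
  exists z : nat -> R -> R, [/\ forall k, @ph_mem R (L2_on mu I) (z k),
    forall k psi, @ph_mem R (L2_on mu I) psi ->
      \int[mu]_(t in I) (w k (s j) t * psi t) @[j --> \oo] --> \int[mu]_(t in I) (z k t * psi t),
    forall k t, duhamel (ga k) (u0 k) (w k (s j)) (del (s j)) t @[j --> \oo] -->
      duhamel (ga k) (u0 k) (z k) 0 t &
    forall k, continuous (duhamel (ga k) (u0 k) (z k) 0)].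
Proof.
move=> ga0 mw wK del0.
have mL k j : @ph_mem R (L2_on mu I) (w k j).
  apply/(L2_onP _ mI); split => //.
  apply: (integrable_bounded_itvoo (V := K ^+ 2)); first exact: measurable_funX.
  move=> s Is; rewrite normrX ler_pXn2r ?nnegrE ?wK//; exact: le_trans (wK k j s Is).
have nL k j : @phnorm R (L2_on mu I) (w k j) <= Num.sqrt (K ^+ 2 * fine (mu I)).
  rewrite ler_wsqrtr// /= -Rintegral_cst//; apply: le_Rintegral => //.
  - exact: (L2_on_mulr_integrable mI (mL k j) (mL k j)).
  - by apply: (integrable_bounded_itvoo (V := `|K ^+ 2|)).
  - move=> s Is; rewrite -expr2 -[leLHS]real_normK ?num_real// ler_pXn2r ?nnegrE ?wK//.
    exact: le_trans (wK k j s Is).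
have [s hs [z mz zP]] := weak_sequential_compactness (L2_on_axioms mu mI) (L2_on_complete mI) mL
  (fun k j => nL k j).
exists s => //; exists z.
have dels : del (s j) @[j --> \oo] --> (0 : R) by exact: (cvg_comp _ _ (increasing_seq_cvg hs) del0).
have wP k psi : @ph_mem R (L2_on mu I) psi ->
    \int[mu]_(t in I) (w k (s j) t * psi t) @[j --> \oo] --> \int[mu]_(t in I) (z k t * psi t).
  exact: zP.
split => //.
- move=> k t.
  exact: (duhamel_weak_cvg (ga0 k) (fun j => mw k (s j)) (fun j => wK k (s j)) (wP k) dels).
- move=> k.
  exact: (duhamel_weak_limit_continuous (ga0 k) (fun j => mw k (s j)) (fun j => wK k (s j)) (wP k) dels).
Qed.

End duhamel.

Section tonelli.
Variables (R : realType) (T C K : R) (h : nat -> R -> R) (ga u0 : nat -> R).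
Variable G : (nat -> R -> R) -> nat -> R -> R.
Hypotheses (T0 : 0 < T) (K0 : 0 <= K) (ga0 : forall k, 0 < ga k).
Hypothesis mh : forall k, measurable_fun setT (h k : measurableTypeR R -> R).
Hypothesis u0C : forall k, `|u0 k| + K * T <= C.
Hypothesis hG : forcing_axioms h C T K G.
Let mu := @lebesgue_measure R.
Let I : set (measurableTypeR R) := `]0, T[%classic.
Let mI : measurable I. Proof. exact: measurable_itv. Qed.
Implicit Types (c g : nat -> R -> R).

Definition glue g k (t : R) : R := if t < 0 then h k t else g k t.

Lemma glue_admissible g : (forall k, measurable_fun setT (g k : measurableTypeR R -> R)) ->
  (forall k t, 0 <= t -> `|g k t| <= C) -> admissible h C (glue g).
Proof.
move=> mg gC; split.
- move=> k; rewrite (_ : glue g k = fun t => h k t * (t < 0)%R%:R + g k t * (1 - (t < 0)%R%:R)).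
    apply: measurable_funD; apply: measurable_funM => //; first exact: measurable_step.
    by apply: measurable_funB; [exact: measurable_cst|exact: measurable_step].
  apply/funext => t; rewrite /glue; case: (ltP t 0) => _;
    by rewrite ?mulr1 ?mulr0 ?subrr ?subr0 ?mulr0 ?mulr1 ?addr0 ?add0r.
- by move=> k s s0; rewrite /glue s0.
- by move=> k s s0; rewrite /glue ltNge s0 /=; exact: gC.
Qed.

(** Over the open interval, since at 0 the glued family may jump from the history to the initial
    value. *)
Definition continuous_inside c := forall k t, 0 < t < T -> {for t, continuous (c k)}.

Lemma glue_continuous_inside g : (forall k, continuous (g k)) -> continuous_inside (glue g).
Proof.
move=> cg k t /andP[t0 tT]; have ct := cg k t.
rewrite /prop_for /continuous_at /glue ltNge (ltW t0) /=.
apply: cvg_trans ct; apply: near_eq_cvg; near=> s.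
suff -> : (s < 0) = false by [].
by apply/negbTE; rewrite -leNgt; apply/ltW; near: s; exact: lt_nbhsr.
Unshelve. all: by end_near. Qed.

Lemma forcing_continuous c : admissible h C c -> continuous_inside c ->
  continuous_inside (G c).
Proof.
move=> ac cc k t tT; rewrite /prop_for /continuous_at; apply/(@cvg_nbhsP R R^o) => ts tst.
(* [forcing_cvg] wants all times inside ]0, T[; the finitely many exceptions are replaced by [t]. *)
pose ts' j := if 0 < ts j < T then ts j else t.
have ev : \forall j \near \oo, ts' j = ts j.
  have /andP[t0 tT'] := tT.
  have d1 : 0 < T - t by rewrite subr_gt0.
  have /cvgrPdist_lt/(_ _ t0) h1 := tst; have /cvgrPdist_lt/(_ _ d1) h2 := tst.
  apply: filterS2 h1 h2 => j; rewrite !ltr_norml => /andP[? ?] /andP[? ?].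
  rewrite /ts'; suff -> : 0 < ts j < T by [].
  by apply/andP; split; lra.
have ts'T j : 0 < ts' j < T by rewrite /ts'; case: ifP.
have ts't : ts' j @[j --> \oo] --> t.
  by apply: cvg_trans tst; apply: near_eq_cvg; apply: filterS ev => j ->.
suff : G c k (ts' j) @[j --> \oo] --> G c k t.
  move=> h1; apply: cvg_trans h1; apply: near_eq_cvg.
  by apply: filterS ev => j ->.
apply: (forcing_cvg hG) => //.
- by move=> l s _; exact: cvg_cst.
- by move=> l; apply: (cvg_comp _ _ ts't); exact: cc.
Qed.

Lemma forcing_measurable c k : admissible h C c -> continuous_inside c ->
  measurable_fun I (G c k).
Proof.
move=> ac cc; apply: open_continuous_measurable_fun; first exact: interval_open.
move=> t /set_mem; rewrite /I /= in_itv /= => tT.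
exact: (forcing_continuous ac cc).
Qed.

Lemma forcing_le c k s : admissible h C c -> I s -> `|G c k s| <= K.
Proof.
move=> ac; rewrite /I /= in_itv /= => sT.
have := forcing_sum_le hG k.+1 ac sT; rewrite big_ord_recr /= => hs.
rewrite -(@ler_pXn2r _ 2)// ?nnegrE// real_normK ?num_real//; apply: le_trans hs.
by rewrite lerDr; apply: sumr_ge0 => i _; exact: sqr_ge0.
Qed.

Definition tonelli_map del c := glue (fun k => duhamel T (ga k) (u0 k) (G c k) del).

Definition regular c := admissible h C c /\ continuous_inside c.

Lemma tonelli_map_regular del c : 0 <= del -> regular c -> regular (tonelli_map del c).
Proof.
move=> d0 [ac cc].
have cd k : continuous (duhamel T (ga k) (u0 k) (G c k) del).
  have mw := @forcing_measurable c k ac cc.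
  exact: (duhamel_continuous T0 (ga0 k) mw (fun s => @forcing_le c k s ac)).
split; last exact: glue_continuous_inside.
apply: glue_admissible => [k|k t t0]; first exact: continuous_measurable_fun.
apply: le_trans (u0C k).
exact: (duhamel_le T0 (u0 k) (ga0 k) (@forcing_measurable c k ac cc) (fun s => @forcing_le c k s ac) d0 t0).
Qed.

Let c0 := glue (fun k _ => u0 k).

Let c0_regular : regular c0.
Proof.
split; last by apply: glue_continuous_inside => k t; exact: cvg_cst.
apply: glue_admissible => [k|k t _]; first exact: measurable_cst.
by apply: le_trans (u0C k); rewrite lerDl mulr_ge0// ltW.
Qed.

Let iterate del p := iter p (tonelli_map del) c0.

Let iterate_regular del p : 0 <= del -> regular (iterate del p).
Proof.
by move=> d0; elim: p => [|p IH]; [exact: c0_regular|exact: tonelli_map_regular].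
Qed.

(* Each application of the map extends the interval of agreement by del. *)
Let iterate_stable del p k t : 0 < del -> t <= p%:R * del ->
  iterate del p.+1 k t = iterate del p k t.
Proof.
move=> d0; elim: p k t => [|p IH] k t.
  rewrite mul0r /= /tonelli_map /c0 /glue => t0; case: ltP => // t0'.
  have -> : t = 0 by apply/eqP; rewrite eq_le t0.
  by rewrite duhamel0// ltW.
move=> tp; rewrite [LHS]/= [RHS]/= /tonelli_map /glue; case: ifP => // _.
apply: eq_duhamel => s sT st.
apply: (forcing_causal hG) => //.
- exact: (iterate_regular p.+1 (ltW d0)).1.
- exact: (iterate_regular p (ltW d0)).1.
move=> l s' s's; apply: IH.
by move: tp st s's; rewrite -natr1 mulrDl mul1r; move: (p%:R * del) => q; lra.
Qed.

Lemma tonelli_delayed del : 0 < del -> exists2 c, regular c & tonelli_map del c = c.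
Proof.
move=> d0; have [p hp] : exists p : nat, T <= p%:R * del.
  exists (Num.bound `|T / del|); rewrite -ler_pdivrMr//.
  by apply: (le_trans (ler_norm _)); apply/ltW; apply: archi_boundP.
exists (iterate del p.+1); first exact: iterate_regular (ltW d0).
apply/funext => k; apply/funext => t; rewrite [RHS]/= /tonelli_map /glue.
(* [duhamel] reads the source on ]0, T[ only, so agreement of two iterates up to [T] gives the fixed
   point equation at every time. *)
case: ifP => // _; apply: eq_duhamel => s sT _.
apply: (forcing_causal hG) => //.
- exact: (iterate_regular p.+1 (ltW d0)).1.
- exact: (iterate_regular p (ltW d0)).1.
move=> l s' s's; apply: iterate_stable => //.
by apply: (le_trans s's); case/andP: sT => _ /ltW /le_trans; apply.
Qed.

(** The limit is taken twice. Weak convergence of the sources to some [z] gives pointwise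
    convergence of the delayed solutions; continuity of [G] then makes the sources converge
    pointwise, boundedly, to those of the limit. Uniqueness of limits closes the equation. *)
Lemma mild_solution_exists : exists c, [/\ regular c,
  continuous_inside (G c) & forall k t, 0 <= t -> c k t = duhamel T (ga k) (u0 k) (G c k) 0 t].
Proof.
have dj j : 0 < j.+1%:R^-1 :> R by rewrite invr_gt0.
have hc j := tonelli_delayed (dj j).
pose cs j := projT1 (cid2 (hc j)).
have csP j : regular (cs j) /\ tonelli_map j.+1%:R^-1 (cs j) = cs j.
  by rewrite /cs; case: (cid2 _).
have mw k j : measurable_fun I (G (cs j) k) by apply: forcing_measurable; have [[]] := csP j.
have wK k j s : I s -> `|G (cs j) k s| <= K by apply: forcing_le; have [[]] := csP j.
have [s hs [z [mz zw zc zcont]]] := duhamel_compactness T0 u0 ga0 mw wK (@cvg_harmonic R).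
pose c := glue (fun k => duhamel T (ga k) (u0 k) (z k) 0).
have csc k t : 0 <= t -> cs (s j) k t @[j --> \oo] --> c k t.
  move=> t0; have := zc k t; rewrite /c /glue ltNge t0 /=.
  rewrite (_ : (fun j => cs (s j) k t) = fun j => duhamel T (ga k) (u0 k) (G (cs (s j)) k) (s j).+1%:R^-1 t)//.
  by apply/funext => j; rewrite -[in LHS](csP (s j)).2 /tonelli_map /glue ltNge t0.
have ac : admissible h C c.
  apply: glue_admissible => [k|k t t0]; first exact: continuous_measurable_fun.
  apply: (cvgr_to_le (cvg_norm (zc k t))); apply: nearW => j.
  apply: le_trans (u0C k).
  by apply: (duhamel_le T0 (u0 k) (ga0 k) (mw k (s j)) (fun x => @wK k (s j) x) _ t0).
have cc : continuous_inside c by exact: glue_continuous_inside.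
exists c; split => //; first exact: forcing_continuous.
move=> k t t0.
have c1 := csc k t t0.
have c2 : duhamel T (ga k) (u0 k) (G (cs (s j)) k) (s j).+1%:R^-1 t @[j --> \oo] -->
    duhamel T (ga k) (u0 k) (G c k) 0 t.
  apply: (@duhamel_weak_cvg R T T0 (ga k) (u0 k) (fun j => G (cs (s j)) k) (G c k) K
    (fun j => (s j).+1%:R^-1)) => //.
  - by move=> j x; exact: wK.
  - move=> psi /(L2_onP _ mI)[mpsi ipsi].
    have [|||||_ //] := @Rintegral_dominated _ _ _ mu I (fun j t => G (cs (s j)) k t * psi t)
      (fun t => G c k t * psi t) (fun t => K * `|psi t|) mI.
    + by move=> j; apply: measurable_funM.
    + by apply: measurable_funM => //; exact: forcing_measurable.
    + apply: aeW => x; rewrite /I /= in_itv /= => xT; apply: cvgM; last exact: cvg_cst.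
      have x0 : 0 <= x by case/andP: xT => /ltW.
      apply: (forcing_cvg hG (ts := fun=> x)) => //.
      * by move=> j; have [[]] := csP (s j).
      * exact: cvg_cst.
      * by move=> l; exact: csc.
    + apply: integrableZ_R => //; apply: integrable_norm => //.
      apply: (@le_integrable_R _ _ _ mu I psi (fun x => 1 + psi x ^+ 2) mI mpsi).
        move=> x _; have := sqr_ge0 (`|psi x| - 1); rewrite -[psi x ^+ 2]real_normK ?num_real//.
        by have := normr_ge0 (psi x); set w := `|psi x|; nra.
      apply: integrableD_R => //.
      by apply: (integrable_bounded_itvoo (V := 1)) => // x _; rewrite normr1.
    + by move=> j; apply: aeW => x Ix; rewrite normrM ler_wpM2r//; exact: wK.
  - exact: (cvg_comp _ _ (increasing_seq_cvg hs) (@cvg_harmonic R)).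
rewrite (_ : (fun j => cs (s j) k t) = fun j => duhamel T (ga k) (u0 k) (G (cs (s j)) k) (s j).+1%:R^-1 t) in c1; last first.
  by apply/funext => j; rewrite -[in LHS](csP (s j)).2 /tonelli_map /glue ltNge t0.
exact: (cvg_unique (@Rhausdorff R) c1 c2).
Qed.

End tonelli.

(** * Energy estimates *)

Section mode_estimates.
Variables (R : realType) (T : R).
Hypothesis T0 : 0 < T.
Let mu := @lebesgue_measure R.
Let I : set (measurableTypeR R) := `]0, T[%classic.
Let mI : measurable I. Proof. exact: measurable_itv. Qed.

Lemma lipschitz_continuous (p : R -> R) V : (forall a a', `|p a - p a'| <= V * `|a - a'|) ->
  continuous p.
Proof.
move=> pV t; apply/cvgrPdist_le => e e0.
have d0 : 0 < e / (`|V| + 1) by rewrite divr_gt0// ltr_pwDr.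
have /cvgrPdist_le/(_ _ d0) := @cvg_id _ (nbhs t); apply: filterS => s hs.
apply: (le_trans (pV _ _)); apply: (@le_trans _ _ ((`|V| + 1) * `|t - s|)).
  by rewrite ler_wpM2r// (le_trans (ler_norm V))// lerDl.
by rewrite mulrC -ler_pdivlMr// ltr_pwDr.
Qed.

Lemma bound_ge0 (f : R -> R) V : (forall s, I s -> `|f s| <= V) -> 0 <= V.
Proof.
move=> fV; have : I (T / 2) by rewrite /I /= in_itv /=; move: T0 => ?; apply/andP; split; lra.
by move/fV; apply: le_trans.
Qed.

Lemma primitive_unique (F f : R -> R) V t : continuous F ->
  (forall s, 0 < s < T -> is_derive s 1 F (f s)) ->
  measurable_fun I f -> (forall s, I s -> `|f s| <= V) ->
  (forall s, 0 < s < T -> {for s, continuous f}) ->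
  0 <= t <= T -> F t = F 0 + primitive T f t.
Proof.
move=> cF dF mf fV cf /andP[t0 tT].
pose D : R -> R := F - primitive T f.
have cD : continuous D.
  move=> s; apply: cvgB; first exact: cF.
  apply: (@lipschitz_continuous _ V) => a a'; apply: primitive_lip => //.
  exact: bound_ge0 fV.
have dD s : 0 < s < T -> is_derive s 1 D 0.
  move=> sT; have h1 := dF s sT; have h2 := primitive_derivable mf fV sT (cf s sT).
  by apply: is_derive_eq; rewrite subrr.
have wD : {within `[0, T], continuous D} by exact: continuous_subspaceT.
have d1 s : s \in `]0, T[ -> derivable D s 1.
  by rewrite in_itv /= => sT; have := dD s sT => ?; exact: ex_derive.
have d2 s : s \in `]0, T[ -> derive1 D s = 0.
  by rewrite in_itv /= => sT; have := dD s sT => ?; rewrite derive1E derive_val.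
have m0 : (0 : R) \in `[0, T] by rewrite in_itv /= lexx ltW.
have mt : t \in `[0, T] by rewrite in_itv /= t0 tT.
have le1 : D 0 <= D t.
  by apply: (@ger0_derive1_le _ D 0 T d1 _ true false wD) => // s /d2 ->.
have le2 : D t <= D 0.
  by apply: (@ler0_derive1_le _ D 0 T d1 _ true false wD) => // s /d2 ->.
have DE s : D s = F s - primitive T f s by [].
have p0 : primitive T f 0 = 0 by exact: primitive0.
by move: le1 le2; rewrite !DE p0; lra.
Qed.

Lemma primitiveT (f : R -> R) : primitive T f T = \int[mu]_(s in I) f s.
Proof.
by apply: eq_Rintegral => s /set_mem; rewrite /I /= in_itv /= => /andP[_ ->]; rewrite mulr1.
Qed.

Lemma continuous_bounded_itvoo (f : R -> R) : continuous f ->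
  exists V : R, forall s, I s -> `|f s| <= V.
Proof.
move=> cf; have [] := @EVT_max R (fun s => `|f s|) 0 T (ltW T0).
  by apply: continuous_subspaceT => s; apply: cvg_norm; exact: cf.
move=> x _ hx; exists `|f x| => s; rewrite /I /= in_itv /= => /andP[s0 sT]; apply: hx.
by rewrite in_itv /= !ltW.
Qed.

Lemma test_function_continuous (a b : R) (psi : R -> R) : test_function a b psi ->
  continuous psi /\ continuous (derive1 psi).
Proof.
move=> [dpsi _]; split=> s; apply: differentiable_continuous; apply/derivable1_diffP.
  exact: (dpsi 0%N s).
exact: (dpsi 1%N s).
Qed.

Section mode.
Variables (ga u0 : R) (w : R -> R) (K : R).
Hypotheses (ga0 : 0 < ga) (mw : measurable_fun I w) (wK : forall s, I s -> `|w s| <= K).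
Hypothesis cw : forall s, 0 < s < T -> {for s, continuous w}.
Let c := duhamel T ga u0 w 0.
Let C := `|u0| + K * T.

Definition mode_derivative (s : R) : R := - ga * c s + w s.
Let dc := mode_derivative.

Let cc : continuous c. Proof. exact: (duhamel_continuous T0 ga0 mw wK). Qed.

Let cC s : 0 <= s -> `|c s| <= C.
Proof. exact: (duhamel_le T0 u0 ga0 mw wK (lexx _)). Qed.

Let mc : measurable_fun I c.
Proof. by apply: measurable_funTS; exact: continuous_measurable_fun. Qed.

Let mdc : measurable_fun I dc.
Proof. by apply: measurable_funD => //; apply: measurable_funM => //; exact: measurable_cst. Qed.

Let II s : I s -> 0 < s < T. Proof. by rewrite /I /= in_itv. Qed.

Lemma mode_derivative_le s : I s -> `|dc s| <= ga * C + K.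
Proof.
move=> Is; apply: (le_trans (ler_normD _ _)); apply: lerD; last exact: wK.
rewrite normrM normrN (gtr0_norm ga0) ler_pM2l//; apply: cC.
by have /andP[/ltW] := II Is.
Qed.

Lemma mode_derivative_continuous s : 0 < s < T -> {for s, continuous dc}.
Proof.
move=> sT; apply: cvgD; last exact: cw.
by apply: cvgM; [exact: cvg_cst|exact: cc].
Qed.

Lemma mode_is_derive s : 0 < s < T -> is_derive s 1 c (dc s).
Proof. by move=> sT; exact: (duhamel_derive u0 ga0 mw wK sT (cw sT)). Qed.

Lemma mode_integral t : 0 <= t <= T -> c t = u0 + primitive T dc t.
Proof.
move=> tT; have -> : u0 + primitive T dc t = c 0 + primitive T dc t.
  by congr (_ + _); rewrite /c duhamel0.
apply: (@primitive_unique c dc (ga * C + K)) => //.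
- exact: mode_is_derive.
- exact: mode_derivative_le.
- exact: mode_derivative_continuous.
Qed.

Lemma mode_lipschitz t t' : 0 <= t <= T -> 0 <= t' <= T ->
  `|c t - c t'| <= (ga * C + K) * `|t - t'|.
Proof.
move=> tT tT'; rewrite !mode_integral//.
have -> : u0 + primitive T dc t - (u0 + primitive T dc t') = primitive T dc t - primitive T dc t' by ring.
apply: primitive_lip => //; first exact: mode_derivative_le.
exact: (bound_ge0 mode_derivative_le).
Qed.

Let i_sq (f : R -> R) V : measurable_fun I f -> (forall s, I s -> `|f s| <= V) ->
  mu.-integrable I (EFin \o (fun s => f s ^+ 2)).
Proof.
move=> mf fV; have V0 := bound_ge0 fV.
apply: (integrable_bounded_itvoo (V := V ^+ 2)); first exact: measurable_funX.
by move=> s Is; rewrite normrX ler_pXn2r ?nnegrE// fV.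
Qed.

Let cCI s : I s -> `|c s| <= C. Proof. by move=> /II /andP[/ltW s0 _]; exact: cC. Qed.

Lemma mode_energy t : 0 <= t <= T ->
  c t ^+ 2 + ga * primitive T (fun s => c s ^+ 2) t <= u0 ^+ 2 + ga^-1 * primitive T (fun s => w s ^+ 2) t.
Proof.
move=> tT; pose f s := 2 * c s * dc s.
have fV s : I s -> `|f s| <= 2 * C * (ga * C + K).
  move=> Is; rewrite /f (normrM (2 * c s)) (normrM 2) normr_nat; apply: ler_pM; rewrite ?mulr_ge0//.
    by rewrite ler_pM2l// cCI.
  exact: mode_derivative_le.
have mf : measurable_fun I f.
  by apply: measurable_funM => //; apply: measurable_funM => //; exact: measurable_cst.
have -> : c t ^+ 2 = u0 ^+ 2 + primitive T f t.
  have -> : u0 ^+ 2 + primitive T f t = c 0 * c 0 + primitive T f t.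
    by rewrite expr2 /c duhamel0.
  apply: (@primitive_unique (fun s => c s * c s) f (2 * C * (ga * C + K))) => //.
  - by move=> s; apply: cvgM; exact: cc.
  - move=> s sT; have h := mode_is_derive sT; apply: (is_derive_eq (is_deriveM h h)).
    by rewrite /GRing.scale /= /f; ring.
  - move=> s sT; apply: cvgM; last exact: mode_derivative_continuous.
    by apply: cvgM; [exact: cvg_cst|exact: cc].
rewrite -addrA lerD2l.
have if_ := primitive_integrable t (integrable_bounded_itvoo mf fV).
have ic := primitive_integrable t (i_sq mc cCI).
have iw := primitive_integrable t (i_sq mw wK).
rewrite /primitive -(RintegralZl ga mI ic) -(RintegralZl ga^-1 mI iw).
have ic2 := integrableZ_R ga mI ic; have iw2 := integrableZ_R ga^-1 mI iw.
rewrite -(RintegralD mI if_ ic2); apply: (le_Rintegral mI _ iw2); first exact: integrableD_R.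
(* Half of the dissipation 2 ga x^2 absorbs the source: 2 x y <= ga x^2 + y^2 / ga. The factor 1 /
   ga is what makes the tails of high modes small. *)
have key (x y : R) : 2 * x * (- ga * x + y) + ga * x ^+ 2 <= ga^-1 * y ^+ 2.
  have -> : ga^-1 * y ^+ 2 = ga^-1 * (ga * x - y) ^+ 2 + (2 * x * (- ga * x + y) + ga * x ^+ 2).
    by field; rewrite gt_eqF.
  by rewrite lerDr mulr_ge0 ?sqr_ge0// invr_ge0 ltW.
move=> s _; rewrite (mulrA ga) (mulrA ga^-1) -mulrDl; apply: ler_wpM2r => //.
exact: key (c s) (w s).
Qed.

Let Wint := \int[mu]_(s in I) (w s ^+ 2).

Let primitive_sq_le (f : R -> R) V t : measurable_fun I f -> (forall s, I s -> `|f s| <= V) ->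
  0 <= primitive T (fun s => f s ^+ 2) t <= \int[mu]_(s in I) (f s ^+ 2).
Proof.
move=> mf fV; apply/andP; split; first by apply: Rintegral_ge0 => s _; rewrite mulr_ge0// sqr_ge0.
apply: le_Rintegral => //; [exact: primitive_integrable (i_sq mf fV)|exact: i_sq fV|].
by move=> s _; case: (s < t); rewrite ?mulr1 ?mulr0// sqr_ge0.
Qed.

Lemma mode_sqr_le t : 0 <= t <= T -> c t ^+ 2 <= u0 ^+ 2 + ga^-1 * Wint.
Proof.
move=> tT; have := mode_energy tT.
have /andP[p0 _] := primitive_sq_le t mc cCI; have /andP[_ p1] := primitive_sq_le t mw wK.
have h1 : 0 <= ga * primitive T (fun s => c s ^+ 2) t by rewrite mulr_ge0// ltW.
have h2 : ga^-1 * primitive T (fun s => w s ^+ 2) t <= ga^-1 * Wint by rewrite ler_pM2l ?invr_gt0.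
by move: h1 h2; set x := ga * _; set y := ga^-1 * _; set z := ga^-1 * _; lra.
Qed.

Lemma mode_energy_le : ga * (\int[mu]_(s in I) (c s ^+ 2))%R <= u0 ^+ 2 + ga^-1 * Wint.
Proof.
have := @mode_energy T; rewrite lexx ltW// => /(_ erefl); rewrite !primitiveT.
by apply: le_trans; rewrite lerDr sqr_ge0.
Qed.

(** The weight 1 / ga matches the norm of D(A^{-1/2}): it turns (ga c)^2 into ga c^2, which the
    energy estimate controls. *)
Lemma mode_derivative_energy_le :
  ga^-1 * (\int[mu]_(s in I) (dc s ^+ 2))%R <= 2 * u0 ^+ 2 + 4 * (ga^-1 * Wint).
Proof.
have ic := i_sq mc cCI; have iw := i_sq mw wK.
have ic2 := integrableZ_R (2 * ga ^+ 2) mI ic; have iw2 := integrableZ_R 2 mI iw.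
have h : \int[mu]_(s in I) (dc s ^+ 2) <= 2 * ga ^+ 2 * (\int[mu]_(s in I) (c s ^+ 2))%R + 2 * Wint.
  rewrite /Wint -(RintegralZl _ mI ic) -(RintegralZl _ mI iw) -(RintegralD mI ic2 iw2).
  apply: le_Rintegral => //; first exact: i_sq mode_derivative_le.
    exact: integrableD_R.
  move=> s _; rewrite /dc /mode_derivative; have := sqr_ge0 (ga * c s + w s).
  by move: (c s) (w s) => x y; nra.
have h1 : 0 <= ga^-1 by rewrite invr_ge0 ltW.
apply: (le_trans (ler_wpM2l h1 h)).
have -> : ga^-1 * (2 * ga ^+ 2 * (\int[mu]_(s in I) (c s ^+ 2))%R + 2 * Wint) =
  2 * (ga * (\int[mu]_(s in I) (c s ^+ 2))%R) + 2 * (ga^-1 * Wint) by field; rewrite gt_eqF.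
by have := mode_energy_le; set x := ga * _; set y := ga^-1 * _; lra.
Qed.

Lemma mode_integration_by_parts (psi : R -> R) : test_function 0 T psi ->
  \int[mu]_(s in I) (c s * derive1 psi s) = - \int[mu]_(s in I) (dc s * psi s).
Proof.
move=> [dpsi [a [b [a0 bT psi0]]]].
have d0 s : derivable psi s 1 by exact: (dpsi 0%N s).
have [cpsi cdpsi] : continuous psi /\ continuous (derive1 psi).
  by apply: (@test_function_continuous 0 T); split => //; exists a, b.
have [V1 hV1] := continuous_bounded_itvoo cpsi; have [V2 hV2] := continuous_bounded_itvoo cdpsi.
have mpsi : measurable_fun I psi by apply: measurable_funTS; exact: continuous_measurable_fun.
have mdpsi : measurable_fun I (derive1 psi).
  by apply: measurable_funTS; exact: continuous_measurable_fun.
have psiE s : (s <= 0) || (T <= s) -> psi s = 0.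
  move=> hs; apply: psi0; rewrite in_itv /=; apply/negP => /andP[h1 h2].
  by case/orP: hs => hs; move: a0 bT h1 h2 hs; lra.
pose f s := dc s * psi s + c s * derive1 psi s.
have b1 s : I s -> `|dc s * psi s| <= (ga * C + K) * V1.
  by move=> Is; rewrite normrM; apply: ler_pM => //; [exact: mode_derivative_le|exact: hV1].
have b2 s : I s -> `|c s * derive1 psi s| <= C * V2.
  by move=> Is; rewrite normrM; apply: ler_pM => //; [exact: cCI|exact: hV2].
have m1 : measurable_fun I (fun s => dc s * psi s) by exact: measurable_funM.
have m2 : measurable_fun I (fun s => c s * derive1 psi s) by exact: measurable_funM.
have i1 := integrable_bounded_itvoo m1 b1; have i2 := integrable_bounded_itvoo m2 b2.
have fV s : I s -> `|f s| <= (ga * C + K) * V1 + C * V2.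
  by move=> Is; apply: (le_trans (ler_normD _ _)); apply: lerD; [exact: b1|exact: b2].
have cF : continuous (fun s => c s * psi s) by move=> s; apply: cvgM; [exact: cc|exact: cpsi].
have dF s : 0 < s < T -> is_derive s 1 (fun s => c s * psi s) (f s).
  move=> sT; have h := mode_is_derive sT; have h2 := derivableP (d0 s).
  apply: (is_derive_eq (is_deriveM h h2)).
  by rewrite /GRing.scale /= /f derive1E; ring.
have cf s : 0 < s < T -> {for s, continuous f}.
  move=> sT; apply: cvgD; apply: cvgM; [exact: mode_derivative_continuous|exact: cpsi|exact: cc|exact: cdpsi].
have TT : 0 <= T <= T by rewrite lexx ltW.
have := primitive_unique cF dF (measurable_funD m1 m2) fV cf TT.
rewrite (psiE T) ?lexx ?orbT// (psiE 0) ?lexx// !mulr0 add0r primitiveT.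
rewrite (RintegralD mI i1 i2) => H.
by apply/eqP; rewrite -addr_eq0 addrC -H.
Qed.

End mode.
End mode_estimates.

Lemma ph_ip_residual (R : realType) (E : prehilbert R) (hE : prehilbert_axioms E)
  (d : R) (x y z v w : E) :
  ph_mem x -> ph_mem y -> ph_mem z -> ph_mem v -> ph_mem w ->
  ph_ip (x + y + d *: z - v) w = ph_ip x w + ph_ip y w + d * ph_ip z w - ph_ip v w.
Proof.
move=> mx my mz mv mw; have mdz := ph_memZ hE d mz; have mxy := ph_memD hE mx my.
rewrite (ph_ipBl hE (ph_memD hE mxy mdz) mv mw) (ph_ipDl hE mxy mdz mw) (ph_ipDl hE mx my mw).
by rewrite (ph_ipZl hE d mz mw).
Qed.

Lemma lipschitz_absolutely_continuous (R : realType) (a b V : R) (g : R -> R) : 0 <= V ->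
  (forall t t', a <= t <= b -> a <= t' <= b -> `|g t - g t'| <= V * `|t - t'|) ->
  absolutely_continuous a b g.
Proof.
move=> V0 gV e e0; exists (e / (V + 1)); first by rewrite divr_gt0// ltr_wpDl.
move=> l al _ hl.
have : \sum_(p <- l) `|g p.2 - g p.1| <= V * \sum_(p <- l) (p.2 - p.1).
  rewrite mulr_sumr; elim: l al {hl} => [|p l IH] /=; first by rewrite !big_nil.
  move=> /andP[/andP[/andP[h1 h2] h3] al]; rewrite !big_cons; apply: lerD; last exact: IH.
  rewrite -[X in _ <= V * X]ger0_norm ?subr_ge0//; apply: gV.
    by rewrite (le_trans h1 h2) h3.
  by rewrite h1 (le_trans h2 h3).
have s0 : 0 <= \sum_(p <- l) (p.2 - p.1).
  elim: l al {hl} => [|p l IH] /=; first by rewrite big_nil.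
  move=> /andP[/andP[/andP[h1 h2] h3] al]; rewrite big_cons addr_ge0 ?subr_ge0//; exact: IH.
move=> /le_lt_trans; apply.
have hV : 0 < V + 1 by rewrite ltr_wpDl.
move: hl; rewrite ltr_pdivlMr// mulrC; apply: le_lt_trans.
by rewrite ler_wpM2r// lerDl.
Qed.

(** * From mild solutions to Galerkin solutions *)

Section mild_modes.
Variables (R : realType) (T K C r : R) (h : nat -> R -> R) (ga u0 : nat -> R).
Variable G : (nat -> R -> R) -> nat -> R -> R.
Hypotheses (T0 : 0 < T) (r0 : 0 < r) (ga0 : forall k, 0 < ga k).
Hypothesis hG : forcing_axioms h C T K G.
Hypothesis K0 : 0 <= K.
Variable c : nat -> R -> R.
Hypothesis rc : regular T C h c.
Hypothesis cG : continuous_inside T (G c).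
Hypothesis cE : forall k t, 0 <= t -> c k t = duhamel T (ga k) (u0 k) (G c k) 0 t.
Let mu := @lebesgue_measure R.
Let I : set (measurableTypeR R) := `]0, T[%classic.

Let mw k : measurable_fun I (G c k).
Proof. by apply: (forcing_measurable hG); case: rc. Qed.

Let wK k s : I s -> `|G c k s| <= K.
Proof. by apply: (forcing_le K0 hG); case: rc. Qed.

(** Duhamel's formula gives [c k] for nonnegative times only, so derivatives are compared through a
    neighbourhood of an interior time. *)
Let near_duhamel k t : 0 < t < T ->
  \forall s \near t, duhamel T (ga k) (u0 k) (G c k) 0 s = c k s.
Proof.
move=> /andP[t0 _]; near=> s; rewrite cE//; apply/ltW; near: s; exact: lt_nbhsr.
Unshelve. all: by end_near. Qed.

Lemma mild_is_derive k t : 0 < t < T ->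
  is_derive t 1 (c k) (- ga k * c k t + G c k t).
Proof.
move=> tT; have t0 : 0 <= t by case/andP: tT => /ltW.
have hd := mode_is_derive (u0 k) (ga0 k) (mw k) (@wK k) (@cG k) tT.
apply: DeriveDef.
  by apply: (near_eq_derivable (near_duhamel k tT)); exact: ex_derive.
rewrite -(near_eq_derive _ (near_duhamel k tT)) derive_val /mode_derivative.
by rewrite -cE.
Qed.

Lemma mild_derive1 k t : 0 < t < T -> derive1 (c k) t = - ga k * c k t + G c k t.
Proof. by move=> tT; have hd := mild_is_derive k tT; rewrite derive1E derive_val. Qed.

Lemma mild_C1 k : C1_on 0 T (c k).
Proof.
move=> t; rewrite in_itv /= => tT; split.
  by have hd := mild_is_derive k tT; exact: ex_derive.
rewrite /prop_for /continuous_at mild_derive1//.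
have ct : (fun s => - ga k * c k s + G c k s) s @[s --> t] --> - ga k * c k t + G c k t.
  apply: cvgD; last exact: cG.
  by apply: cvgM; [exact: cvg_cst|case: rc => _; exact].
apply: cvg_trans ct; apply: near_eq_cvg; have /andP[t0 tT'] := tT.
near=> s; rewrite mild_derive1//; apply/andP; split; near: s; [exact: lt_nbhsr|exact: lt_nbhsl].
Unshelve. all: by end_near. Qed.

Lemma mild_absolutely_continuous k : absolutely_continuous 0 T (c k).
Proof.
have V0 : 0 <= ga k * (`|u0 k| + K * T) + K.
  apply: addr_ge0 => //; apply: mulr_ge0; first exact: ltW.
  by apply: addr_ge0 => //; apply: mulr_ge0 => //; exact: ltW.
apply: (lipschitz_absolutely_continuous V0) => t t' tT tT'.
rewrite !cE; [|by case/andP: tT'|by case/andP: tT].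
exact: (mode_lipschitz T0 (u0 k) (ga0 k) (mw k) (@wK k) (@cG k)).
Qed.

Lemma mild_initial k : c k t @[t --> 0^'+] --> u0 k.
Proof.
have cd := duhamel_continuous T0 (u0 := u0 k) (ga0 k) (mw k) (@wK k) (del := 0) (x := 0).
have h1 : duhamel T (ga k) (u0 k) (G c k) 0 t @[t --> 0^'+] --> u0 k.
  rewrite -[X in _ --> X](duhamel0 T (ga k) (u0 k) (G c k) (lexx 0)).
  exact: cvg_at_right_filter.
apply: cvg_trans h1; apply: near_eq_cvg; near=> t; rewrite cE//.
Unshelve. all: by end_near. Qed.

Lemma mild_L2 k : (forall k, mu.-integrable `[- r - 1, T + 1]%classic (EFin \o (fun s => h k s ^+ 2))) ->
  @ph_mem R (L2_on mu (`]- r, T[%classic : set (measurableTypeR R))) (c k).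
Proof.
move=> ih; have mJ : measurable (`]- r, T[%classic : set (measurableTypeR R)) by exact: measurable_itv.
apply/(L2_onP _ mJ); case: rc => -[mc ch cC] _; split; first exact: measurable_funTS.
have := admissible_integrable ih k (And3 mc ch cC); apply: integrableS => //.
by move=> s /=; rewrite !in_itv /= => /andP[h1 h2]; move: r0 h1 h2 => *; apply/andP; split; lra.
Qed.

End mild_modes.

Section galerkin.
Variables (R : realType) (n : nat) (Om : set 'rV[R]_n).
Let nu := rV_lebesgue R n.
Hypotheses (mOm : measurable Om).
Let E := L2 Om.
Variables (DA : set E) (A : E -> E) (e : nat -> E) (lam : nat -> R) (d : R).
Hypothesis hb : ph_basis e.
Hypotheses (lA : linear_operator DA A) (sA : self_adjoint DA A) (eA : eigenpairs DA A e lam).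

Let hE : prehilbert_axioms E. Proof. exact: (L2_on_axioms nu mOm). Qed.
Let me := ph_basis_mem hb.

Lemma galerkin_domain m g t : DA (galerkin_fun e m g t).
Proof.
have [_ _ D0 DP _] := lA; rewrite /galerkin_fun; elim: m => [|m IH]; first by rewrite big_ord0.
by rewrite big_ord_recr /= addrC; apply: DP => //; exact: (eA m).1.
Qed.

(** Self-adjointness moves [A] onto the eigenvector, so the finite sum inside [A] never has to be
    expanded. *)
Lemma ip_eigenvector u k : DA u -> ph_ip (A u) (e k) = lam k * ph_ip u (e k).
Proof.
move=> Du; have mu_ : ph_mem u by case: lA => h _ _ _ _; exact: h.
rewrite -(ph_ipZr hE (lam k) (me k) mu_).
exact: ((sA (me k) (ph_memZ hE (lam k) (me k))).1 (eA k) u Du).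
Qed.

Variables (r : R) (eps : nat -> R) (b : R -> R) (f : 'rV[R]_n -> R).
Variable eta : E -> (R -> E) -> R.
Variables (T K C : R) (h : nat -> R -> R) (u0 : E) (phi : R -> E) (N m : nat).
Let ga k := lam k + d.
Let u0k k := ph_ip u0 (e k).
Let G := forcing e r eps b f eta N m.
Hypotheses (T0 : 0 < T) (r0 : 0 < r) (K0 : 0 <= K) (ga0 : forall k, 0 < ga k).
Hypothesis hG : forcing_axioms h C T K G.
Hypothesis ih : forall k, (@lebesgue_measure R).-integrable `[- r - 1, T + 1]%classic
  (EFin \o (fun s => h k s ^+ 2)).
Hypothesis hphi : {ae @lebesgue_measure R, forall s, s \in `]- r, 0[ ->
  forall k, ph_ip (phi s) (e k) = h k s}.
Variable c : nat -> R -> R.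
Hypothesis rc : regular T C h c.
Hypothesis cG : continuous_inside T (G c).
Hypothesis cE : forall k t, 0 <= t -> c k t = duhamel T (ga k) (u0k k) (G c k) 0 t.
Hypothesis mF : forall t, ph_mem (F r eps b f eta N (galerkin_fun e m c) t).

Let galerkin_coord (g : nat -> R -> R) t k : (k < m)%N -> ph_ip (galerkin_fun e m g t) (e k) = g k t.
Proof. by move=> km; have := basis_comb_coord hE hb m g t k; rewrite km. Qed.

Lemma galerkin_solution_of_mild :
  galerkin_solution A r eps b f eta e d T u0 phi N m c.
Proof.
move=> k km; split.
- split; [exact: (mild_C1 ga0 hG K0 rc cG cE)|exact: (mild_L2 r0 rc k ih)|].
  exact: (mild_absolutely_continuous T0 ga0 hG K0 rc cG cE).
- move=> t; rewrite in_itv /= => tT.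
  have mu_ : ph_mem (galerkin_fun e m c t) by exact: (basis_comb_mem hE hb m c t).
  have mdu : ph_mem (galerkin_fun e m (fun k => derive1 (c k)) t).
    exact: (basis_comb_mem hE hb m _ t).
  have Du := galerkin_domain m c t.
  have mA : ph_mem (A (galerkin_fun e m c t)) by case: lA => _ hA _ _ _; exact: hA.
  apply: (etrans (ph_ip_residual hE d mdu mA mu_ (mF t) (me k))).
  rewrite (ip_eigenvector k Du) !galerkin_coord//.
  rewrite (mild_derive1 ga0 hG K0 rc cG cE k tT).
  by rewrite -[X in _ - X]/(G c k t) /ga; ring.
- have h1 := mild_initial T0 ga0 hG K0 rc cE (k := k).
  rewrite (_ : (fun t => _) = c k)//.
  by apply/funext => t; exact: galerkin_coord.
- have [Z [mZ Z0 hZ]] := hphi; exists Z; split => // s hs; apply: hZ => hs'; apply: hs => sr.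
  rewrite (galerkin_coord c s km) (hs' sr k); case: rc => -[_ ch _] _; apply: ch.
  by move: sr; rewrite in_itv /= => /andP[].
Qed.

End galerkin.

(** * From modes to Bochner spaces *)

Section coordinate_families.
Variables (R : realType) (E : prehilbert R) (eh : nat -> E).
Hypothesis hE : prehilbert_axioms E.
Hypothesis hb : ph_basis eh.
Let mu := @lebesgue_measure R.
Variable I : set (measurableTypeR R).
Hypothesis mI : measurable I.
Implicit Types (v : R -> E) (ga : nat -> R -> R).

(* membership and coordinates of v t are only asked where the family is square
   summable *)
Definition represents v ga := forall t, I t ->
  (exists B : R, forall n, sqsum (ga ^~ t) n <= B) ->
  ph_mem (v t) /\ forall k, ph_ip (v t) (eh k) = ga k t.

Lemma measurable_restrict_indic (f : R -> R) (D : set (measurableTypeR R)) : measurable D ->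
  D `<=` I -> measurable_fun I f -> measurable_fun setT (f \_ D : measurableTypeR R -> R).
Proof.
move=> mD DI mf; apply/(measurable_restrictT _ mD); exact: measurable_funS mf.
Qed.

Lemma bounded_coord_of v ga (C : R) : (forall k, measurable_fun I (ga k)) -> 0 <= C ->
  (forall t n, I t -> sqsum (ga ^~ t) n <= C) -> represents v ga ->
  exists M : R -> R, [/\ coord_of eh I v (fun k => ga k \_ I) M & forall t, M t <= C].
Proof.
move=> mg C0 gC hv.
have bnd t n : sqsum (fun k => (ga k \_ I) t) n <= C.
  have [It|It] := pselect (I t).
    rewrite (_ : sqsum _ n = sqsum (ga ^~ t) n); first exact: gC.
    by apply: eq_bigr => k _; rewrite patchE mem_set.
  rewrite /sqsum big1// => k _; by rewrite patchE memNset// expr0n.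
have hM t := sqsum_cvg_of_bounded (bnd t).
exists (fun t => projT1 (cid (hM t))); split; last first.
  by move=> t; case: cid => x /= hx; apply: (cvgr_to_le hx); apply: nearW => n; exact: bnd.
split; first split.
- by move=> k; apply: measurable_restrict_indic.
- by move=> t; case: cid.
apply: aeW => t It; have [//|mv vc] := hv t It _; first by exists C => n; exact: gC.
by split => // k; rewrite patchE mem_set.
Qed.

(** Finite energy gives square summability at almost every time only. The coordinates are set to 0
    at the remaining times, which turns them into everywhere summable Borel coordinates. *)
Lemma square_integrable_coord_of v ga (C : R) : (forall k, measurable_fun I (ga k)) ->
  (forall n, (\int[mu]_(t in I) (sqsum (ga ^~ t) n)%:E <= C%:E)%E) -> represents v ga ->
  exists ga' M, [/\ coord_of eh I v ga' M, mu.-integrable I (EFin \o M),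
    \int[mu]_(t in I) M t <= C & {ae mu, forall t, I t -> forall k, ga' k t = ga k t}].
Proof.
move=> mg gC hv.
have [g [mgg g0 ig gleC [Z [mZ Z0 hZ]]]] := @ge0_series_integrable _ _ _ mu I (fun k t => ga k t ^+ 2) C
  mI (fun k => measurable_funX 2 (mg k)) (fun k x _ => sqr_ge0 _) gC.
pose D := I `\` Z; have mD : measurable D by exact: measurableD.
have DI : D `<=` I by move=> t [].
have cD t : D t -> sqsum (ga ^~ t) n @[n --> \oo] --> g t.
  by move=> [It Zt]; apply: contrapT => H; apply: Zt; apply: hZ => /= /(_ It).
pose ga' k := ga k \_ D; pose M := g \_ D.
have bc : borel_coord ga' M.
  split=> [k|t]; first exact: measurable_restrict_indic.
  have [Dt|Dt] := pselect (D t).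
    rewrite /M patchE mem_set// (_ : sqsum _ = sqsum (ga ^~ t)); first exact: cD.
    by apply/funext => n; apply: eq_bigr => k _; rewrite /ga' patchE mem_set.
  rewrite /M patchE memNset// (_ : sqsum _ = fun=> 0); first exact: cvg_cst.
  by apply/funext => n; rewrite /sqsum big1// => k _; rewrite /ga' patchE memNset// expr0n.
have aeD : {ae mu, forall t, I t -> D t}.
  exists Z; split => // t /= h; apply: contrapT => Zt; apply: h => It.
  by split.
have aeM : {ae mu, forall t, I t -> M t = g t}.
  by move: aeD; apply: filterS => t h It; rewrite /M patchE mem_set//; exact: h.
exists ga', M; split.
- split=> //; move: aeD; apply: filterS => t h It; have Dt := h It.
  have [|mv vc] := hv t It.
    by exists (g t) => n; exact: sqsum_le (cD t Dt).
  by split => // k; rewrite /ga' patchE mem_set.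
- apply: integrable_of_lty.
  + by apply: measurable_funTS; exact: borel_coord_measurable bc.
  + by move=> t _; exact: borel_coord_ge0 bc.
  + rewrite (@integral_eq_ae _ _ _ mu I _ (fun t => (g t)%:E)); first exact: (le_lt_trans gleC (ltry _)).
    by move: aeM; apply: filterS => t h It; rewrite h.
- rewrite (Rintegral_eq_ae aeM) -lee_fin EFin_Rintegral//.
- by move: aeD; apply: filterS => t h It k; rewrite /ga' patchE mem_set//; exact: h.
Qed.

Lemma represents_bochner_L2 v ga (C : R) : (forall k, measurable_fun I (ga k)) ->
  (forall n, (\int[mu]_(t in I) (sqsum (ga ^~ t) n)%:E <= C%:E)%E) -> represents v ga ->
  bochner_L2 I v.
Proof.
move=> mg gC hv; have [ga' [M [h1 h2 _ _]]] := square_integrable_coord_of mg gC hv.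
exact: (coord_of_bochner_L2 hE hb mI h1).1 h2.
Qed.

Lemma represents_bochner_Linfty v ga (C : R) : (forall k, measurable_fun I (ga k)) -> 0 <= C ->
  (forall t n, I t -> sqsum (ga ^~ t) n <= C) -> represents v ga -> bochner_Linfty I v.
Proof.
move=> mg C0 gC hv; have [M [h1 MC]] := bounded_coord_of mg C0 gC hv.
split; first exact: (coord_of_strongly_measurable hE hb h1).
exists (Num.sqrt C); have := coord_of_norm hE hb h1; apply: filterS => t h It.
by rewrite -[phnorm _]ger0_norm ?phnorm_ge0// -sqrtr_sqr h// ler_wsqrtr.
Qed.

Lemma weak_cvg_of_coordinates (us : nat -> R -> E) v (gas : nat -> nat -> R -> R) ga (C : R) :
  (forall i k, measurable_fun I (gas i k)) -> (forall k, measurable_fun I (ga k)) ->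
  (forall i n, (\int[mu]_(t in I) (sqsum (gas i ^~ t) n)%:E <= C%:E)%E) ->
  (forall n, (\int[mu]_(t in I) (sqsum (ga ^~ t) n)%:E <= C%:E)%E) ->
  (forall i, represents (us i) (gas i)) -> represents v ga ->
  (forall k psi, @ph_mem R (L2_on mu I) psi ->
    \int[mu]_(t in I) (gas i k t * psi t) @[i --> \oo] --> \int[mu]_(t in I) (ga k t * psi t)) ->
  weak_cvg_L2 I us v.
Proof.
move=> mgs mg gsC gC hus hv gw.
have [ga' [M [cv iM MC aeg]]] := square_integrable_coord_of mg gC hv.
have H i : exists p : (nat -> R -> R) * (R -> R), [/\ coord_of eh I (us i) p.1 p.2,
    mu.-integrable I (EFin \o p.2), \int[mu]_(t in I) p.2 t <= C &
    {ae mu, forall t, I t -> forall k, p.1 k t = gas i k t}].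
  by have [g' [M' [? ? ? ?]]] := square_integrable_coord_of (mgs i) (gsC i) (hus i); exists (g', M').
pose p i := projT1 (cid (H i)).
have hp i : [/\ coord_of eh I (us i) (p i).1 (p i).2,
    mu.-integrable I (EFin \o (p i).2), \int[mu]_(t in I) (p i).2 t <= C &
    {ae mu, forall t, I t -> forall k, (p i).1 k t = gas i k t}].
  by rewrite /p; case: cid.
apply: (@weak_cvg_L2_coord R E eh hE hb I mI us v (fun i => (p i).1) (fun i => (p i).2) ga' M _ cv C) => //.
- by move=> i; have [] := hp i.
- by move=> i; have [] := hp i.
- by move=> i; have [] := hp i.
move=> k psi mpsi.
have -> : \int[mu]_(t in I) (ga' k t * psi t) = \int[mu]_(t in I) (ga k t * psi t).
  by apply: Rintegral_eq_ae; move: aeg; apply: filterS => t h It; rewrite h.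
rewrite (_ : (fun i => _) = fun i => \int[mu]_(t in I) (gas i k t * psi t)); first exact: gw.
apply/funext => i; have [_ _ _ h] := hp i.
by apply: Rintegral_eq_ae; move: h; apply: filterS => t h It; rewrite h.
Qed.

Lemma weakstar_cvg_of_coordinates (us : nat -> R -> E) v (gas : nat -> nat -> R -> R) ga (C : R) :
  (forall i k, measurable_fun I (gas i k)) -> (forall k, measurable_fun I (ga k)) -> 0 <= C ->
  (forall i t n, I t -> sqsum (gas i ^~ t) n <= C) ->
  (forall t n, I t -> sqsum (ga ^~ t) n <= C) ->
  (forall i, represents (us i) (gas i)) -> represents v ga ->
  (forall k t, I t -> gas i k t @[i --> \oo] --> ga k t) ->
  weakstar_cvg_Linfty I us v.
Proof.
move=> mgs mg C0 gsC gC hus hv gp.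
have [M [cv MC]] := bounded_coord_of mg C0 gC hv.
have H i := bounded_coord_of (mgs i) C0 (gsC i) (hus i).
pose Ms i := projT1 (cid (H i)).
have hM i : coord_of eh I (us i) (fun k => gas i k \_ I) (Ms i) /\ forall t, Ms i t <= C.
  by rewrite /Ms; case: cid => x [].
apply: (@weakstar_cvg_Linfty_coord R E eh hE hb I mI us v (fun i k => gas i k \_ I) Ms
  (fun k => ga k \_ I) M _ cv C) => //.
- by move=> i; have [] := hM i.
- by move=> i t _; have [_ h] := hM i; exact: h.
move=> k t It; rewrite patchE mem_set//.
rewrite (_ : (fun i => _) = fun i => gas i k t); first exact: gp.
by apply/funext => i; rewrite patchE mem_set.
Qed.

End coordinate_families.

(** * Coordinates in the scale of spaces D(A^al) and the time derivative *)

Section spectral_coordinates.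
Variables (R : realType) (E : prehilbert R) (e : nat -> E) (lam : nat -> R).
Hypothesis hE : prehilbert_axioms E.
Hypothesis cE : ph_complete E.
Hypothesis hb : ph_basis e.
Hypothesis lam0 : forall k, 0 < lam k.
Variable I : set (measurableTypeR R).
Hypothesis mI : measurable I.
Implicit Types (u : R -> E) (a : nat -> R -> R) (al : R).

Let me := ph_basis_mem hb.
Let oe := ph_basis_ortho hb.

Definition has_coordinates u a := forall t, I t ->
  @ph_mem R E (u t) /\ forall k, @ph_ip R E (u t) (e k) = a k t.

Lemma represents_plain u a : has_coordinates u a -> represents e I u a.
Proof. by move=> h t It _; exact: h. Qed.

Lemma spectral_space_mem_of_bounded al (v : E) (B : R) : ph_mem v ->
  (forall n, \sum_(k < n) (lam k `^ al * ph_ip v (e k)) ^+ 2 <= B) ->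
  @ph_mem R (spectral_space e lam al) v.
Proof.
move=> mv hB; have [w mw wc] := @riesz_fischer_coord _ _ _ hE hb (fun k => lam k `^ al * ph_ip v (e k)) B cE hB.
by exists w; exact: (spectral_power_of_coord hE hb).
Qed.

(** The coordinates in the orthonormal basis lam_k^(-al) e_k of D(A^al), when [a] gives those in the
    basis [e]. *)
Definition scaled al a (k : nat) (t : R) : R := lam k `^ al * a k t.

Lemma measurable_scaled al a k : measurable_fun I (a k) -> measurable_fun I (scaled al a k).
Proof. by move=> ma; apply: measurable_funM => //; exact: measurable_cst. Qed.

Definition spectral_basis al k : spectral_space e lam al := lam k `^ (- al) *: e k.

Lemma represents_spectral al u a : has_coordinates u a ->
  @represents R (spectral_space e lam al) (spectral_basis al) I u (scaled al a).
Proof.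
move=> h t It [B hB]; have [mv vc] := h t It.
have mS : @ph_mem R (spectral_space e lam al) (u t).
  apply: (@spectral_space_mem_of_bounded al (u t) B mv) => n.
  by apply: le_trans (hB n); rewrite /sqsum le_eqVlt; apply/orP; left; apply/eqP;
    apply: eq_bigr => k _; rewrite vc.
by split => // k; rewrite (spectral_space_coord hE hb lam0)// vc.
Qed.

Definition completion_basis_vec al k : completion (spectral_space e lam al) :=
  completion_inj (spectral_basis al k).

Lemma comb_spectral al a t n :
  \sum_(k < n) a k t *: e k = \sum_(k < n) scaled al a k t *: spectral_basis al k :> E.
Proof.
apply: eq_bigr => k _; rewrite /scaled /spectral_basis scalerA mulrAC.
by rewrite (powR_oppK lam0) mul1r.
Qed.

(* a(t) is represented in the completion by the sequence of its partial sums *)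
Lemma represents_partial_sums al a :
  @represents R (completion (spectral_space e lam al)) (completion_basis_vec al) I
    (fun t j => \sum_(k < j) a k t *: e k) (scaled al a).
Proof.
move=> t It [B hB].
have hS := spectral_space_axioms lam hE hb al.
have hbS := spectral_space_basis hE hb lam0 al.
rewrite (_ : (fun j => \sum_(k < j) a k t *: e k) =
  (fun j => \sum_(k < j) scaled al a k t *: spectral_basis al k) :> (nat -> E)); last first.
  by apply/funext => j; exact: comb_spectral.
have cs := @comb_cauchy _ _ _ hS hbS (fun k => scaled al a k t) B hB.
split; first exact: cs.
move=> k; apply/cvg_lim; first exact: Rhausdorff.
apply: cvg_near_cst; exists k.+1 => // j /= kj.
have := ph_coord_comb hS (ph_basis_mem hbS) (ph_basis_ortho hbS) j (fun k => scaled al a k t) k.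
by rewrite kj.
Qed.

Lemma represents_finite_sum al a m :
  @represents R (completion (spectral_space e lam al)) (completion_basis_vec al) I
    (fun t => completion_inj (\sum_(k < m) a k t *: e k : spectral_space e lam al))
    (scaled al (fun k t => if (k < m)%N then a k t else 0)).
Proof.
move=> t It _.
have hS := spectral_space_axioms lam hE hb al.
have hbS := spectral_space_basis hE hb lam0 al.
rewrite (_ : (\sum_(k < m) a k t *: e k : E) =
  (\sum_(k < m) scaled al a k t *: spectral_basis al k : E)); last exact: comb_spectral.
split.
  apply: (completion_inj_mem hS).
  exact: (ph_mem_comb hS (ph_basis_mem hbS) m (fun k => scaled al a k t)).
move=> k; rewrite (completion_inj_ip).
have := ph_coord_comb hS (ph_basis_mem hbS) (ph_basis_ortho hbS) m (fun k => scaled al a k t) k.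
by rewrite /scaled => ->; case: ifP => // _; rewrite mulr0.
Qed.

Lemma has_coordinates_finite_sum a m :
  has_coordinates (fun t => \sum_(k < m) a k t *: e k) (fun k t => if (k < m)%N then a k t else 0).
Proof.
move=> t It; split; first exact: (ph_mem_comb hE me m (fun k => a k t)).
by move=> k; exact: (ph_coord_comb hE me oe m (fun k => a k t)).
Qed.

End spectral_coordinates.

Section weak_time_derivative.
Variables (R : realType) (E : prehilbert R) (e : nat -> E) (lam : nat -> R) (T : R).
Hypothesis hE : prehilbert_axioms E.
Hypothesis hb : ph_basis e.
Hypothesis lam0 : forall k, 0 < lam k.
Hypothesis T0 : 0 < T.
Let mu := @lebesgue_measure R.
Let I : set (measurableTypeR R) := `]0, T[%classic.
Let mI : measurable I. Proof. exact: measurable_itv. Qed.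
Variables (u : R -> E) (a b : nat -> R -> R) (C1 C2 : R).
Hypothesis ua : has_coordinates e I u a.
Hypotheses (ma : forall k, measurable_fun I (a k)) (mb : forall k, measurable_fun I (b k)).
Hypothesis aC : forall t n, I t -> sqsum (a ^~ t) n <= C1.
Hypothesis bC : forall n, (\int[mu]_(t in I) (sqsum (scaled lam (- 2^-1) b ^~ t) n)%:E <= C2%:E)%E.
Hypothesis abE : forall k psi, test_function 0 T psi ->
  \int[mu]_(t in I) (a k t * derive1 psi t) = - \int[mu]_(t in I) (b k t * psi t).

(** The [limn] is [duality] unfolded. Hypothesis [abE] is the identity tested with [e k]; linearity
    gives it for the partial sums of [v], and dominated convergence lets their number grow on both
    sides. *)
Lemma weak_derivative_coordinates (v : E) (psi : R -> R) :
  @ph_mem R (spectral_space e lam 2^-1) v -> test_function 0 T psi ->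
  \int[mu]_(t in I) (@ph_ip R E (u t) v * derive1 psi t) =
  - \int[mu]_(t in I) (limn (fun j => @ph_ip R E (\sum_(k < j) b k t *: e k) v) * psi t).
Proof.
move=> mvS hpsi; have mv := spectral_space_mem mvS.
have [cpsi cdpsi] := test_function_continuous hpsi.
have [V1 hV1] := continuous_bounded_itvoo T0 cpsi.
have [V2 hV2] := continuous_bounded_itvoo T0 cdpsi.
have mpsi : measurable_fun I psi by apply: measurable_funTS; exact: continuous_measurable_fun.
have mdpsi : measurable_fun I (derive1 psi).
  by apply: measurable_funTS; exact: continuous_measurable_fun.
pose vk k := ph_ip v (e k).
have V10 := bound_ge0 T0 hV1; have V20 := bound_ge0 T0 hV2.
have hv : sqsum vk n @[n --> \oo] --> phnorm v ^+ 2 by exact: parseval_norm.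
have iab k : mu.-integrable I (EFin \o (fun t => a k t * derive1 psi t)).
  apply: (integrable_bounded_itvoo (V := Num.sqrt C1 * V2)); first exact: measurable_funM.
  move=> t It; rewrite normrM; apply: ler_pM => //; last exact: hV2.
  rewrite -sqrtr_sqr ler_wsqrtr//; apply: le_trans (aC k.+1 It).
  by rewrite /sqsum big_ord_recr /= lerDr; apply: sumr_ge0 => i _; exact: sqr_ge0.
have [g [mg g0 ig _ [Z [mZ Z0 hZ]]]] := @ge0_series_integrable _ _ _ mu I
  (fun k t => scaled lam (- 2^-1) b k t ^+ 2) C2 mI
  (fun k => measurable_funX 2 (measurable_scaled lam (- 2^-1) (mb k))) (fun k x _ => sqr_ge0 _) bC.
have gZ : {ae mu, forall t, I t -> sqsum (scaled lam (- 2^-1) b ^~ t) n @[n --> \oo] --> g t}.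
  by exists Z; split.
pose vS k := lam k `^ 2^-1 * vk k.
have [W hW] : exists W : R, sqsum vS n @[n --> \oo] --> W.
  have hS := spectral_space_axioms lam hE hb 2^-1.
  have h := parseval_norm hS (spectral_space_basis hE hb lam0 2^-1) mvS.
  rewrite (_ : (fun m => _) = sqsum vS) in h; first by eexists; exact: h.
  by apply/funext => n; apply: eq_bigr => k _; rewrite (spectral_space_coord hE hb lam0).
(* [b] is controlled only after multiplication by lam_k^(-1/2); since [v] belongs to D(A^{1/2}), the
   opposite power can be put on its coordinates. *)
have prodE k t : b k t * vk k = scaled lam (- 2^-1) b k t * vS k.
  have p := powR_oppK lam0 2^-1 k.
  transitivity (lam k `^ 2^-1 * lam k `^ (- 2^-1) * (b k t * vk k)); first by rewrite p mul1r.
  by rewrite /scaled /vS; ring.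
pose S n t := \sum_(k < n) b k t * vk k.
have SE n t : S n t = \sum_(k < n) scaled lam (- 2^-1) b k t * vS k.
  by apply: eq_bigr => k _; exact: prodE.
have Sle n t : I t -> sqsum (scaled lam (- 2^-1) b ^~ t) n <= g t -> `|S n t| <= g t + W.
  move=> It hg; rewrite SE.
  have := pairing_tail_le (scaled lam (- 2^-1) b ^~ t) vS ltr01 (leq0n n).
  rewrite big_ord0 subr0 mul1r invr1 mul1r {3}/sqsum big_ord0 subr0 => /le_trans; apply.
  by apply: lerD => //; exact: sqsum_le.
have mS n : measurable_fun I (S n).
  by apply: measurable_sum => k; apply: measurable_funM => //; exact: measurable_cst.
have lS t : limn (fun j => @ph_ip R E (\sum_(k < j) b k t *: e k) v) = limn (S ^~ t).
  suff -> : (fun j => @ph_ip R E (\sum_(k < j) b k t *: e k) v) = S ^~ t by []; apply/funext => j.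
  exact: (ph_ip_comb hE (ph_basis_mem hb) j (fun k => b k t) mv).
have Scv t : I t -> ~ Z t -> cvgn (S ^~ t).
  move=> It Zt; have h : sqsum (scaled lam (- 2^-1) b ^~ t) n @[n --> \oo] --> g t.
    by apply: contrapT => H; apply: Zt; apply: hZ => /= /(_ It).
  apply/cvg_ex; exists (pairing (scaled lam (- 2^-1) b ^~ t) vS).
  rewrite (_ : S ^~ t = fun n => \sum_(k < n) scaled lam (- 2^-1) b k t * vS k).
    exact: (pairing_cvg h hW).
  by apply/funext => n; exact: SE.
(* The pointwise limit need not exist on [Z]; with the value 0 there it becomes a measurable
   function fit for dominated convergence. *)
pose Soo := (fun t => limn (S ^~ t)) \_ (I `\` Z).
have mIZ : measurable (I `\` Z) by exact: measurableD.
have mSoo : measurable_fun I Soo.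
  apply: measurable_funTS; apply/(measurable_restrictT _ mIZ).
  apply: (@measurable_fun_cvg _ _ _ (I `\` Z) S) => [n|t [It Zt]]; last exact: Scv.
  by apply: measurable_funS (mS n) => // t [].
have SooE t : I t -> ~ Z t -> Soo t = limn (S ^~ t).
  by move=> It Zt; rewrite /Soo patchE mem_set.
have Sc : {ae mu, forall t, I t -> S n t @[n --> \oo] --> Soo t}.
  exists Z; split => // t /= h; apply: contrapT => Zt; apply: h => It.
  by rewrite SooE//; exact: Scv.
have Sl : {ae mu, forall t, I t -> limn (S ^~ t) * psi t = Soo t * psi t}.
  by exists Z; split => // t /= h; apply: contrapT => Zt; apply: h => It; rewrite SooE.
have aeD : {ae mu, forall t, I t -> forall n, sqsum (scaled lam (- 2^-1) b ^~ t) n <= g t}.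
  by move: gZ; apply: filterS => t h It n; apply: sqsum_le; exact: h.
have b2 k : (\int[mu]_(t in I) (scaled lam (- 2^-1) b k t ^+ 2)%:E < +oo)%E.
  apply: le_lt_trans (ltry C2); apply: le_trans (bC k.+1).
  apply: ge0_le_integral => //.
  - by move=> t _; rewrite lee_fin sqr_ge0.
  - by apply/measurable_EFinP; apply: measurable_funX; exact: measurable_scaled.
  - apply/measurable_EFinP; apply: measurable_sum => i.
    by apply: measurable_funX; exact: measurable_scaled.
  - move=> t _; rewrite lee_fin /sqsum big_ord_recr /= lerDr; apply: sumr_ge0 => i _; exact: sqr_ge0.
have mpsi2 : @ph_mem R (L2_on mu I) psi.
  apply/(L2_onP _ mI); split => //; apply: (integrable_bounded_itvoo (V := V1 ^+ 2)).
    exact: measurable_funX.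
  by move=> t It; rewrite normrX ler_pXn2r ?nnegrE// hV1.
have ibs k : mu.-integrable I (EFin \o (fun t => b k t * psi t)).
  have mbs : @ph_mem R (L2_on mu I) (scaled lam (- 2^-1) b k).
    apply/(L2_onP _ mI); split; first exact: measurable_scaled.
    apply: integrable_of_lty (b2 k) => [|t _]; last exact: sqr_ge0.
    by apply: measurable_funX; exact: measurable_scaled.
  have := integrableZ_R (lam k `^ 2^-1) mI (L2_on_mulr_integrable mI mbs mpsi2).
  congr integrable; apply/funext => t; congr EFin; rewrite /scaled !mulrA.
  by rewrite (powR_oppK lam0) mul1r.
have E1 n : \int[mu]_(t in I) ((\sum_(k < n) a k t * vk k) * derive1 psi t) =
    \sum_(k < n) vk k * (\int[mu]_(t in I) (a k t * derive1 psi t))%R.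
  under [RHS]eq_bigr do rewrite -(RintegralZl _ mI (iab _)).
  rewrite -(@Rintegral_sum _ _ _ mu I n (fun k t => vk k * (a k t * derive1 psi t)))//; last first.
    by move=> k _; exact: (integrableZ_R (vk k) mI (iab k)).
  by congr Rintegral; apply/funext => t; rewrite mulr_suml; apply: eq_bigr => k _; ring.
have E2 n : \int[mu]_(t in I) (S n t * psi t) =
    \sum_(k < n) vk k * (\int[mu]_(t in I) (b k t * psi t))%R.
  under [RHS]eq_bigr do rewrite -(RintegralZl _ mI (ibs _)).
  rewrite -(@Rintegral_sum _ _ _ mu I n (fun k t => vk k * (b k t * psi t)))//; last first.
    by move=> k _; exact: (integrableZ_R (vk k) mI (ibs k)).
  by congr Rintegral; apply/funext => t; rewrite mulr_suml; apply: eq_bigr => k _; ring.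
have E3 n : \int[mu]_(t in I) ((\sum_(k < n) a k t * vk k) * derive1 psi t) =
    - \int[mu]_(t in I) (S n t * psi t).
  by rewrite E1 E2 -sumrN; apply: eq_bigr => k _; rewrite abE// mulrN.
have L1 : \int[mu]_(t in I) ((\sum_(k < n) a k t * vk k) * derive1 psi t) @[n --> \oo] -->
    \int[mu]_(t in I) (@ph_ip R E (u t) v * derive1 psi t).
  have uc t : I t -> \sum_(k < n) a k t * vk k @[n --> \oo] --> @ph_ip R E (u t) v.
    move=> It; have [mut uct] := ua It; have := parseval hE hb mut mv.
    rewrite (_ : (fun m => _) = fun n => \sum_(k < n) a k t * vk k)//.
    by apply/funext => n; apply: eq_bigr => k _; rewrite uct.
  have msum n : measurable_fun I (fun t => \sum_(k < n) a k t * vk k).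
    by apply: measurable_sum => k; apply: measurable_funM => //; exact: measurable_cst.
  have [|||||_ //] := @Rintegral_dominated _ _ _ mu I
    (fun n t => (\sum_(k < n) a k t * vk k) * derive1 psi t)
    (fun t => @ph_ip R E (u t) v * derive1 psi t) (fun=> (C1 + phnorm v ^+ 2) * V2) mI.
  - by move=> n; exact: measurable_funM.
  - apply: measurable_funM => //; exact: (@measurable_fun_cvg _ _ _ I _ _ msum uc).
  - by apply: aeW => t It; apply: cvgM; [exact: uc|exact: cvg_cst].
  - by apply: (integrable_bounded_itvoo (V := `|(C1 + phnorm v ^+ 2) * V2|)).
  - move=> n; apply: aeW => t It; rewrite normrM; apply: ler_pM => //; last exact: hV2.
    have := pairing_tail_le (a ^~ t) vk ltr01 (leq0n n).
    rewrite big_ord0 subr0 mul1r invr1 mul1r {3}/sqsum big_ord0 subr0 => /le_trans; apply.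
    by apply: lerD; [exact: aC|exact: sqsum_le].
have L2 : \int[mu]_(t in I) (S n t * psi t) @[n --> \oo] -->
    \int[mu]_(t in I) (limn (S ^~ t) * psi t).
  rewrite (Rintegral_eq_ae Sl).
  have [|||||_ //] := @Rintegral_dominated _ _ _ mu I (fun n t => S n t * psi t)
    (fun t => Soo t * psi t) (fun t => (g t + W) * V1) mI.
  - by move=> n; exact: measurable_funM.
  - exact: measurable_funM.
  - by move: Sc; apply: filterS => t h It; apply: cvgM; [exact: h|exact: cvg_cst].
  - have ig1 : mu.-integrable I (EFin \o (fun t => g t + W)).
      apply: integrableD_R => //.
      by apply: (integrable_bounded_itvoo (V := `|W|)).
    have := integrableZ_R V1 mI ig1; congr integrable; apply/funext => t; congr EFin; exact: mulrC.
  - move=> n; move: aeD; apply: filterS => t h It; rewrite normrM; apply: ler_pM => //; last exact: hV1.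
    by apply: Sle => //; exact: h.
transitivity (- \int[mu]_(t in I) (limn (S ^~ t) * psi t)); last first.
  by congr (- _); congr Rintegral; apply/funext => t; rewrite lS.
have L3 : \int[mu]_(t in I) ((\sum_(k < n) a k t * vk k) * derive1 psi t) @[n --> \oo] -->
    - \int[mu]_(t in I) (limn (S ^~ t) * psi t).
  rewrite (_ : (fun n => _) = fun n => - \int[mu]_(t in I) (S n t * psi t)); last first.
    by apply/funext => n; rewrite E3.
  exact: cvgN.
exact: (cvg_unique (@Rhausdorff R) L1 L3).
Qed.

End weak_time_derivative.

(** * The weak limit *)

Section mode_family.
Variables (R : realType) (T K d : R) (lam x : nat -> R) (X : R).
Hypotheses (T0 : 0 < T) (K0 : 0 <= K) (d0 : 0 < d) (lam0 : forall k, 0 < lam k).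
Hypothesis lam_mono : {homo lam : i j / (i <= j)%N >-> i <= j}.
Hypothesis xX : sqsum x n @[n --> \oo] --> X.
Let mu := @lebesgue_measure R.
Let I : set (measurableTypeR R) := `]0, T[%classic.
Let mI : measurable I. Proof. exact: measurable_itv. Qed.
Let ga k := lam k + d.
Let ga0 k : 0 < ga k. Proof. by rewrite addr_gt0. Qed.

Definition mode (w : nat -> R -> R) k := duhamel T (ga k) (x k) (w k) 0.
Definition mode_dot (w : nat -> R -> R) k := mode_derivative T (ga k) (x k) (w k).

(** [X] is the energy of the initial value, [K ^+ 2 * T] that of all source modes together, and 1 /
    ga_k <= 1 / lam_0 for every k. *)
Definition mode_bound : R := X + (lam 0%N)^-1 * (K ^+ 2 * T).
(** The numbers 2 and 4 are those of [mode_derivative_energy_le]; the first factor bounds ga_k /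
    lam_k = 1 + d / lam_k, because the space uses the weight 1 / lam_k and the estimate 1 / ga_k. *)
Definition mode_dot_bound : R :=
  (1 + d / lam 0%N) * (2 * X + 4 * ((lam 0%N)^-1 * (K ^+ 2 * T))).

(* Bounds the energy of the modes of index at least m, uniformly in the source. *)
Definition mode_tail m : R := (X - sqsum x m) + (lam m)^-1 * (K ^+ 2 * T).

Lemma mode_tail_cvg : lam k @[k --> \oo] --> +oo -> mode_tail m @[m --> \oo] --> (0 : R).
Proof.
move=> lamoo; have z : (X - X) + 0 * (K ^+ 2 * T) = 0 by rewrite subrr mul0r addr0.
rewrite -[X in _ --> X]z; apply: cvgD; first by apply: cvgB => //; exact: cvg_cst.
apply: cvgM; last exact: cvg_cst.
apply/cvgr0Pnorm_le => e e0; have /cvgryPge/(_ e^-1) := lamoo.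
apply: filterS => k hk; rewrite ger0_norm; last by rewrite invr_ge0 ltW.
by rewrite -[leRHS]invrK lef_pV2 ?posrE ?invr_gt0.
Qed.

Section one_source.
Variable w : nat -> R -> R.
Hypothesis mw : forall k, measurable_fun I (w k).
Hypothesis wK : forall n s, I s -> sqsum (w ^~ s) n <= K ^+ 2.
Hypothesis cw : forall k s, 0 < s < T -> {for s, continuous (w k)}.

Lemma source_le k s : I s -> `|w k s| <= K.
Proof.
move=> Is; rewrite -(@ler_pXn2r _ 2)// ?nnegrE// real_normK ?num_real//.
apply: le_trans (wK k.+1 Is).
by rewrite /sqsum big_ord_recr /= lerDr; apply: sumr_ge0 => i _; exact: sqr_ge0.
Qed.

Let Wint k := \int[mu]_(s in I) (w k s ^+ 2).

Let Wint0 k : 0 <= Wint k. Proof. by apply: Rintegral_ge0 => s _; exact: sqr_ge0. Qed.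

Let i_sq (f : R -> R) V : measurable_fun I f -> (forall s, I s -> `|f s| <= V) ->
  mu.-integrable I (EFin \o (fun s => f s ^+ 2)).
Proof.
move=> mf fV; have V0 := bound_ge0 T0 fV.
apply: (integrable_bounded_itvoo (V := V ^+ 2)); first exact: measurable_funX.
by move=> s Is; rewrite normrX ler_pXn2r ?nnegrE// fV.
Qed.

Lemma source_energy_le n : \sum_(k < n) Wint k <= K ^+ 2 * T.
Proof.
have iw k : mu.-integrable I (EFin \o (fun s => w k s ^+ 2)) by exact: (i_sq (mw k) (@source_le k)).
rewrite -(@Rintegral_sum _ _ _ mu I n (fun k s => w k s ^+ 2))//.
have -> : K ^+ 2 * T = \int[mu]_(s in I) (K ^+ 2).
  have IT : mu I = (if (0%:E < T%:E)%E then (T%:E - 0%:E)%E else 0%E).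
    exact: lebesgue_measure_itv.
  have fIT : fine (mu I) = T by rewrite IT lte_fin T0 /= subr0.
  by rewrite Rintegral_cst// -[in LHS]fIT.
apply: le_Rintegral => //.
- exact: (@integrable_sum_R _ _ _ mu I n (fun k s => w k s ^+ 2)).
- by apply: (integrable_bounded_itvoo (V := `|K ^+ 2|)).
- by move=> s Is; exact: wK.
Qed.

Lemma source_energy_tail_le m n : (m <= n)%N -> \sum_(m <= k < n) Wint k <= K ^+ 2 * T.
Proof.
move=> mn; apply: le_trans (source_energy_le n).
by rewrite (sum_ord_tail Wint mn) lerDr sumr_ge0.
Qed.

Let lamV m k : (m <= k)%N -> (ga k)^-1 <= (lam m)^-1.
Proof.
by move=> mk; rewrite lef_pV2 ?posrE// (le_trans (lam_mono mk))// lerDl ltW.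
Qed.

Lemma mode_sqr_tail_le m n t : 0 <= t <= T -> (m <= n)%N ->
  \sum_(m <= k < n) mode w k t ^+ 2 <= mode_tail m.
Proof.
move=> tT mn; apply: (@le_trans _ _ (\sum_(m <= k < n) (x k ^+ 2 + (lam m)^-1 * Wint k))).
  rewrite big_nat_cond [leRHS]big_nat_cond; apply: ler_sum => k /andP[/andP[mk _] _].
  apply: (le_trans (mode_sqr_le T0 (x k) (ga0 k) (mw k) (@source_le k) (@cw k) tT)).
  by rewrite lerD2l; exact: (ler_wpM2r (Wint0 k) (lamV mk)).
rewrite big_split /= -mulr_sumr; apply: lerD; last first.
  by rewrite ler_pM2l ?invr_gt0//; exact: source_energy_tail_le.
have := sqsum_le n xX; rewrite /sqsum (sum_ord_tail (fun k => x k ^+ 2) mn); lra.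
Qed.

Lemma mode_sqsum_le n t : 0 <= t <= T -> sqsum (mode w ^~ t) n <= mode_bound.
Proof.
move=> tT; have := mode_sqr_tail_le tT (leq0n n).
by rewrite /mode_tail big_mkord {1}/sqsum big_ord0 subr0.
Qed.

Lemma measurable_mode k : measurable_fun I (mode w k).
Proof.
apply: measurable_funTS; apply: continuous_measurable_fun.
exact: (duhamel_continuous T0 (ga0 k) (mw k) (@source_le k)).
Qed.

Lemma measurable_mode_dot k : measurable_fun I (mode_dot w k).
Proof.
apply: measurable_funD => //; apply: measurable_funM; [exact: measurable_cst|exact: measurable_mode].
Qed.

Let mode_abs k s : I s -> `|mode w k s| <= `|x k| + K * T.
Proof.
rewrite /I /= in_itv /= => /andP[/ltW s0 _].
exact: (duhamel_le T0 (x k) (ga0 k) (mw k) (@source_le k) (lexx _)).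
Qed.

Lemma mode_integrable_sqr k : mu.-integrable I (EFin \o (fun s => mode w k s ^+ 2)).
Proof. exact: (i_sq (measurable_mode k) (@mode_abs k)). Qed.

Lemma mode_dot_integrable_sqr k : mu.-integrable I (EFin \o (fun s => mode_dot w k s ^+ 2)).
Proof.
exact: (i_sq (measurable_mode_dot k) (mode_derivative_le T0 (x k) (ga0 k) (mw k) (@source_le k))).
Qed.

Let scaled_energy al (f : nat -> R -> R) (B : R) n : (forall k, measurable_fun I (f k)) ->
  (forall k, mu.-integrable I (EFin \o (fun s => f k s ^+ 2))) ->
  \sum_(k < n) (lam k `^ al) ^+ 2 * (\int[mu]_(s in I) (f k s ^+ 2))%R <= B ->
  (\int[mu]_(s in I) (sqsum (scaled lam al f ^~ s) n)%:E <= B%:E)%E.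
Proof.
move=> mf if2 hB.
have is2 k : mu.-integrable I (EFin \o (fun s => scaled lam al f k s ^+ 2)).
  have := integrableZ_R ((lam k `^ al) ^+ 2) mI (if2 k).
  by congr integrable; apply/funext => s; congr EFin; rewrite /scaled exprMn.
rewrite -EFin_Rintegral//; last exact: (@integrable_sum_R _ _ _ mu I n (fun k s => scaled lam al f k s ^+ 2)).
rewrite lee_fin (@Rintegral_sum _ _ _ mu I n (fun k s => scaled lam al f k s ^+ 2))//.
apply: le_trans hB; rewrite le_eqVlt; apply/orP; left; apply/eqP; apply: eq_bigr => k _.
rewrite -(RintegralZl _ mI (if2 k)); congr Rintegral; apply/funext => s.
by rewrite /scaled exprMn.
Qed.

Let powR_half_sqr k : (lam k `^ 2^-1) ^+ 2 = lam k.
Proof. by rewrite powR12_sqrt ?sqr_sqrtr// ltW. Qed.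

Lemma mode_energy_bound n :
  (\int[mu]_(s in I) (sqsum (scaled lam 2^-1 (mode w) ^~ s) n)%:E <= mode_bound%:E)%E.
Proof.
apply: scaled_energy => [k|k|]; [exact: measurable_mode|exact: mode_integrable_sqr|].
apply: (@le_trans _ _ (\sum_(k < n) (x k ^+ 2 + (lam 0%N)^-1 * Wint k))).
  apply: ler_sum => k _; rewrite powR_half_sqr.
  have h := mode_energy_le T0 (x k) (ga0 k) (mw k) (@source_le k) (@cw k).
  apply: (@le_trans _ _ (ga k * (\int[mu]_(s in I) (mode w k s ^+ 2))%R)).
    rewrite ler_wpM2r//; last by rewrite lerDl ltW.
    by apply: Rintegral_ge0 => s _; exact: sqr_ge0.
  by apply: (le_trans h); rewrite lerD2l; exact: (ler_wpM2r (Wint0 k) (lamV (leq0n k))).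
rewrite big_split /= -mulr_sumr; apply: lerD; first exact: sqsum_le.
by rewrite ler_pM2l ?invr_gt0//; exact: source_energy_le.
Qed.

Lemma mode_dot_energy_bound n :
  (\int[mu]_(s in I) (sqsum (scaled lam (- 2^-1) (mode_dot w) ^~ s) n)%:E <= mode_dot_bound%:E)%E.
Proof.
apply: scaled_energy => [k|k|]; [exact: measurable_mode_dot|exact: mode_dot_integrable_sqr|].
have ka0 : 0 < 1 + d / lam 0%N by rewrite addr_gt0// divr_gt0.
apply: (@le_trans _ _ (\sum_(k < n) (1 + d / lam 0%N) * (2 * x k ^+ 2 + 4 * ((lam 0%N)^-1 * Wint k)))).
  apply: ler_sum => k _; rewrite powRN exprVn powR_half_sqr.
  have h := mode_derivative_energy_le T0 (x k) (ga0 k) (mw k) (@source_le k) (@cw k).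
  set J := \int[mu]_(s in I) (mode_dot w k s ^+ 2).
  have J0 : 0 <= J by apply: Rintegral_ge0 => s _; exact: sqr_ge0.
  apply: (@le_trans _ _ ((1 + d / lam 0%N) * ((ga k)^-1 * J))).
    rewrite mulrA ler_wpM2r// ler_pdivlMr// mulrC ler_pdivrMr// /ga.
    have -> : (1 + d / lam 0%N) * lam k = lam k + d * (lam k / lam 0%N) by field; rewrite gt_eqF.
    rewrite lerD2l -[leLHS]mulr1 ler_pM2l// ler_pdivlMr// mul1r; exact: lam_mono.
  rewrite ler_pM2l//; apply: (le_trans h); rewrite lerD2l ler_pM2l//.
  exact: (ler_wpM2r (Wint0 k) (lamV (leq0n k))).
rewrite -mulr_sumr /mode_dot_bound ler_pM2l// big_split /= -!mulr_sumr; apply: lerD.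
  by rewrite ler_pM2l//; exact: sqsum_le.
by rewrite ler_pM2l// ler_pM2l ?invr_gt0//; exact: source_energy_le.
Qed.

Lemma mode_dot_parts k (psi : R -> R) : test_function 0 T psi ->
  \int[mu]_(s in I) (mode w k s * derive1 psi s) = - \int[mu]_(s in I) (mode_dot w k s * psi s).
Proof. exact: (mode_integration_by_parts T0 (x k) (ga0 k) (mw k) (@source_le k) (@cw k)). Qed.

End one_source.

Variable w : nat -> nat -> R -> R.
Hypothesis mw : forall i k, measurable_fun I (w i k).
Hypothesis wK : forall i n s, I s -> sqsum (w i ^~ s) n <= K ^+ 2.
Hypothesis cw : forall i k s, 0 < s < T -> {for s, continuous (w i k)}.

(** Compactness of the sources, without delay, settles everything: pointwise limits keep the tail
    estimate, weak lower semicontinuity keeps the energies, and integration by parts only pairs with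
    fixed test functions. Weak convergence of the derivatives follows from [mode_dot] being the
    linear expression -ga c + w. *)
Lemma mode_limit : exists2 s : nat -> nat, {homo s : i j / (i < j)%N} &
  exists z : nat -> R -> R,
  [/\ (forall k, measurable_fun I (mode z k)) /\ (forall k, measurable_fun I (mode_dot z k)),
      (forall k, continuous (mode z k)) /\
        (forall k t, mode (w (s j)) k t @[j --> \oo] --> mode z k t),
      (forall m n t, 0 <= t <= T -> (m <= n)%N -> \sum_(m <= k < n) mode z k t ^+ 2 <= mode_tail m) /\
      (forall k psi, @ph_mem R (L2_on mu I) psi ->
        \int[mu]_(t in I) (mode (w (s j)) k t * psi t) @[j --> \oo] -->
        \int[mu]_(t in I) (mode z k t * psi t)),
      (forall k psi, @ph_mem R (L2_on mu I) psi ->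
        \int[mu]_(t in I) (mode_dot (w (s j)) k t * psi t) @[j --> \oo] -->
        \int[mu]_(t in I) (mode_dot z k t * psi t)) /\
      (forall k psi, test_function 0 T psi ->
        \int[mu]_(t in I) (mode z k t * derive1 psi t) = - \int[mu]_(t in I) (mode_dot z k t * psi t)) &
      (forall n, (\int[mu]_(t in I) (sqsum (scaled lam 2^-1 (mode z) ^~ t) n)%:E <= mode_bound%:E)%E) /\
      (forall n, (\int[mu]_(t in I) (sqsum (scaled lam (- 2^-1) (mode_dot z) ^~ t) n)%:E <=
        mode_dot_bound%:E)%E)].
Proof.
have wK1 k j t : I t -> `|w j k t| <= K by exact: (@source_le (w j) (wK j) k t).
have [s hs [z [mz zw zc zcont]]] := @duhamel_compactness R T T0 ga x (fun k j => w j k) K (fun=> 0)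
  ga0 (fun k j => mw j k) wK1 (cvg_cst 0).
exists s => //; exists z.
have mal k : measurable_fun I (mode z k).
  by apply: measurable_funTS; apply: continuous_measurable_fun; exact: zcont.
have mbe k : measurable_fun I (mode_dot z k).
  apply: measurable_funD; first by apply: measurable_funM; [exact: measurable_cst|exact: mal].
  by have /(L2_onP _ mI)[] := mz k.
have tails m n t : 0 <= t <= T -> (m <= n)%N -> \sum_(m <= k < n) mode z k t ^+ 2 <= mode_tail m.
  move=> tT mn.
  have h : \sum_(m <= k < n) mode (w (s j)) k t ^+ 2 @[j --> \oo] --> \sum_(m <= k < n) mode z k t ^+ 2.
    rewrite (_ : (fun j => _) = fun j => \sum_(k < n) (mode (w (s j)) k t ^+ 2) - \sum_(k < m) (mode (w (s j)) k t ^+ 2)); last first.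
      by apply/funext => j; rewrite (sum_ord_tail (fun k => mode (w (s j)) k t ^+ 2) mn) addrC addKr.
    have -> : \sum_(m <= k < n) mode z k t ^+ 2 = \sum_(k < n) (mode z k t ^+ 2) - \sum_(k < m) (mode z k t ^+ 2).
      by rewrite (sum_ord_tail (fun k => mode z k t ^+ 2) mn) addrC addKr.
    apply: cvgB; apply: (@cvg_sum_ord R _ (fun k j => mode (w (s j)) k t ^+ 2) (fun k => mode z k t ^+ 2)) => k _;
      by exact: (cvgM (zc k t) (zc k t)).
  apply: (cvgr_to_le h); apply: nearW => j.
  exact: (mode_sqr_tail_le (mw (s j)) (wK (s j)) (@cw (s j)) tT mn).
have wal k psi : @ph_mem R (L2_on mu I) psi ->
    \int[mu]_(t in I) (mode (w (s j)) k t * psi t) @[j --> \oo] --> \int[mu]_(t in I) (mode z k t * psi t).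
  move=> /(L2_onP _ mI)[mpsi ipsi].
  have [|||||_ //] := @Rintegral_dominated _ _ _ mu I (fun j t => mode (w (s j)) k t * psi t)
    (fun t => mode z k t * psi t) (fun t => (`|x k| + K * T) * `|psi t|) mI.
  - by move=> j; apply: measurable_funM => //; exact: (measurable_mode (mw (s j)) (wK (s j))).
  - exact: measurable_funM.
  - by apply: aeW => t _; apply: cvgM; [exact: zc|exact: cvg_cst].
  - apply: integrableZ_R => //; apply: integrable_norm => //.
    apply: (@le_integrable_R _ _ _ mu I psi (fun x => 1 + psi x ^+ 2) mI mpsi).
      move=> t _; have := sqr_ge0 (`|psi t| - 1); rewrite -[psi t ^+ 2]real_normK ?num_real//.
      by have := normr_ge0 (psi t); set q := `|psi t|; nra.
    apply: integrableD_R => //.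
    by apply: (integrable_bounded_itvoo (V := 1)) => // t _; rewrite normr1.
  - move=> j; apply: aeW => t It; rewrite normrM ler_wpM2r//.
    have t0 : 0 <= t by move: It; rewrite /I /= in_itv /= => /andP[/ltW].
    exact: (duhamel_le T0 (x k) (ga0 k) (mw (s j) k) (fun t => @wK1 k (s j) t) (lexx _) t0).
have mal2 k : @ph_mem R (L2_on mu I) (mode z k).
  apply/(L2_onP _ mI); split => //; apply: (integrable_bounded_itvoo (V := mode_bound)).
    exact: measurable_funX.
  move=> t; rewrite /I /= in_itv /= => /andP[/ltW t0 /ltW tT].
  rewrite ger0_norm ?sqr_ge0//.
  have := tails 0%N k.+1 t; rewrite t0 tT big_mkord => /(_ erefl erefl).
  rewrite /mode_tail {1}/sqsum big_ord0 subr0; apply: le_trans.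
  by rewrite big_ord_recr /= lerDr; apply: sumr_ge0 => i _; exact: sqr_ge0.
have mbe2 k : @ph_mem R (L2_on mu I) (mode_dot z k).
  exact: (ph_memP (L2_on_axioms mu mI) (- ga k) (mal2 k) (mz k)).
have mm2 j k : @ph_mem R (L2_on mu I) (mode (w j) k).
  apply/(L2_onP _ mI); split; first exact: (measurable_mode (mw j) (wK j)).
  exact: (mode_integrable_sqr (mw j) (wK j)).
have mw2 j k : @ph_mem R (L2_on mu I) (w j k).
  apply/(L2_onP _ mI); split => //; apply: (integrable_bounded_itvoo (V := K ^+ 2)).
    exact: measurable_funX.
  by move=> t It; rewrite normrX ler_pXn2r ?nnegrE//; exact: wK1.
have wbe k psi : @ph_mem R (L2_on mu I) psi ->
    \int[mu]_(t in I) (mode_dot (w (s j)) k t * psi t) @[j --> \oo] --> \int[mu]_(t in I) (mode_dot z k t * psi t).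
  move=> mpsi.
  have E (f g : R -> R) : @ph_mem R (L2_on mu I) f -> @ph_mem R (L2_on mu I) g ->
      \int[mu]_(t in I) ((- ga k * f t + g t) * psi t) =
      - ga k * (\int[mu]_(t in I) (f t * psi t))%R + (\int[mu]_(t in I) (g t * psi t))%R.
    by move=> mf mg; exact: (ph_ipP (L2_on_axioms mu mI) (- ga k) mf mg mpsi).
  rewrite (_ : \int[mu]_(t in I) (mode_dot z k t * psi t) = - ga k * (\int[mu]_(t in I) (mode z k t * psi t))%R +
    (\int[mu]_(t in I) (z k t * psi t))%R); last exact: (E _ _ (mal2 k) (mz k)).
  rewrite (_ : (fun j => _) = fun j => - ga k * (\int[mu]_(t in I) (mode (w (s j)) k t * psi t))%R +
    (\int[mu]_(t in I) (w (s j) k t * psi t))%R); last by apply/funext => j; exact: (E _ _ (mm2 (s j) k) (mw2 (s j) k)).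
  apply: cvgD; last exact: zw.
  by apply: cvgM; [exact: cvg_cst|exact: wal].
have fin_bound al (f : nat -> nat -> R -> R) (g : nat -> R -> R) (B : R) n :
    (forall j k, @ph_mem R (L2_on mu I) (f j k)) -> (forall k, @ph_mem R (L2_on mu I) (g k)) ->
    (forall k psi, @ph_mem R (L2_on mu I) psi ->
      \int[mu]_(t in I) (f j k t * psi t) @[j --> \oo] --> \int[mu]_(t in I) (g k t * psi t)) ->
    (forall j, (\int[mu]_(t in I) (sqsum (scaled lam al (f j) ^~ t) n)%:E <= B%:E)%E) ->
    (\int[mu]_(t in I) (sqsum (scaled lam al g ^~ t) n)%:E <= B%:E)%E.
  move=> mf mg fg fB.
  have msc (h : nat -> R -> R) k : @ph_mem R (L2_on mu I) (h k) -> @ph_mem R (L2_on mu I) (scaled lam al h k).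
    exact: (ph_memZ (L2_on_axioms mu mI)).
  have isc (h : nat -> R -> R) : (forall k, @ph_mem R (L2_on mu I) (h k)) ->
      mu.-integrable I (EFin \o (fun t => sqsum (scaled lam al h ^~ t) n)).
    move=> mh; apply: (@integrable_sum_R _ _ _ mu I n (fun k t => scaled lam al h k t ^+ 2)) => // k _.
    by have /(L2_onP _ mI)[] := msc h k (mh k).
  rewrite -EFin_Rintegral//; last exact: isc.
  rewrite lee_fin; apply: (@weak_limit_bound R I mI (fun j => scaled lam al (f j)) (scaled lam al g) B n).
  - by move=> k j _; exact: msc.
  - by move=> k _; exact: msc.
  - by move=> j; rewrite -lee_fin EFin_Rintegral; [exact: fB|exact: mI|exact: (isc (f j) (mf j))].
  - move=> k psi mpsi.
    have E (h : nat -> R -> R) : (forall k, @ph_mem R (L2_on mu I) (h k)) ->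
        \int[mu]_(t in I) (scaled lam al h k t * psi t) = lam k `^ al * (\int[mu]_(t in I) (h k t * psi t))%R.
      by move=> mh; exact: (ph_ipZl (L2_on_axioms mu mI) (lam k `^ al) (mh k) mpsi).
    rewrite E// (_ : (fun j => _) = fun j => lam k `^ al * (\int[mu]_(t in I) (f j k t * psi t))%R); last first.
      by apply/funext => j; exact: (E _ (mf j)).
    by apply: cvgM; [exact: cvg_cst|exact: fg].
split.
- by split.
- by split.
- by split.
- split=> // k psi hpsi.
  have [cpsi cdpsi] := test_function_continuous hpsi.
  have L2c (f : R -> R) : continuous f -> @ph_mem R (L2_on mu I) f.
    move=> cf; have [V hV] := continuous_bounded_itvoo T0 cf.
    have mf : measurable_fun I f by apply: measurable_funTS; exact: continuous_measurable_fun.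
    apply/(L2_onP _ mI); split => //; apply: (integrable_bounded_itvoo (V := V ^+ 2)).
      exact: measurable_funX.
    by move=> t It; rewrite normrX ler_pXn2r ?nnegrE// ?hV//; exact: le_trans (hV t It).
  have h1 := wal k _ (L2c _ cdpsi).
  have h2 : \int[mu]_(t in I) (mode (w (s j)) k t * derive1 psi t) @[j --> \oo] -->
      - \int[mu]_(t in I) (mode_dot z k t * psi t).
    rewrite (_ : (fun j => _) = fun j => - \int[mu]_(t in I) (mode_dot (w (s j)) k t * psi t)).
      by apply: cvgN; exact: wbe (L2c _ cpsi).
    by apply/funext => j; exact: (mode_dot_parts (mw (s j)) (wK (s j)) (@cw (s j)) k hpsi).
  exact: (cvg_unique (@Rhausdorff R) h1 h2).
- split=> n.
    apply: (fin_bound 2^-1 (fun j => mode (w (s j)))) => // j.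
    exact: (mode_energy_bound (mw (s j)) (wK (s j)) (@cw (s j))).
  apply: (fin_bound (- 2^-1) (fun j => mode_dot (w (s j)))) => // j.
    by move=> k; exact: (ph_memP (L2_on_axioms mu mI) (- ga k) (mm2 (s j) k) (mw2 (s j) k)).
  exact: (mode_dot_energy_bound (mw (s j)) (wK (s j)) (@cw (s j))).
Qed.

End mode_family.

Lemma mulrCA_scale (R : realType) (a c : R) (psi : R -> R) t :
  a * (c *: psi) t = c * a * psi t.
Proof. by rewrite -[(c *: psi) t]/(c * psi t) mulrA [a * c]mulrC. Qed.

Lemma cvg_sum_ord_filter (R : realType) (X : Type) (F : set_system X) (FF : Filter F) n
    (f : nat -> X -> R) (l : nat -> R) :
  (forall k, f k x @[x --> F] --> l k) -> \sum_(k < n) f k x @[x --> F] --> \sum_(k < n) l k.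
Proof.
move=> h; elim: n => [|n IH].
  by rewrite big_ord0; under eq_fun do rewrite big_ord0; exact: cvg_cst.
by rewrite big_ord_recr; under eq_fun do rewrite big_ord_recr; exact: cvgD.
Qed.

Section bochner_cover.
Variables (R : realType) (E : prehilbert R) (eh : nat -> E).
Hypotheses (hE : prehilbert_axioms E) (hb : ph_basis eh).
Let mu := @lebesgue_measure R.

Lemma bochner_L2_eq (I : set R) (v v' : R -> E) : (forall t, I t -> v' t = v t) ->
  bochner_L2 I v -> bochner_L2 I v'.
Proof.
move=> vv' [[q [sq hq]] iv]; split.
  exists q; split => //; apply: (aeS2 _ hq hq) => t h _ It; rewrite vv'//; exact: h.
rewrite (@eq_integral _ _ _ mu I (fun t => (phnorm (v t) ^+ 2)%:E))// => t.
by rewrite inE => It; rewrite vv'.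
Qed.

(** For the solution on ]-r, T[, glued from the history and the limit. Sequences of simple functions
    on the two pieces need not be merged: it suffices to glue Borel coordinates. The null exception
    allows for the junction time 0. *)
Lemma bochner_L2_cover (I1 I2 J : set (measurableTypeR R)) (v : R -> E) :
  measurable I1 -> measurable I2 -> measurable J ->
  bochner_L2 I1 v -> bochner_L2 I2 v -> {ae mu, forall t, J t -> I1 t \/ I2 t} ->
  bochner_L2 J v.
Proof.
move=> m1 m2 mJ v1 v2 cover.
have [c1 [M1 k1]] := strongly_measurable_coord hE hb m1 v1.1.
have [c2 [M2 k2]] := strongly_measurable_coord hE hb m2 v2.1.
have iM1 := (coord_of_bochner_L2 hE hb m1 k1).2 v1.
have iM2 := (coord_of_bochner_L2 hE hb m2 k2).2 v2.
pose D := I2 `\` I1; have mD : measurable D by exact: measurableD.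
pose sel (f1 f2 : R -> R) t := (f1 \_ I1) t + (f2 \_ D) t.
have sel1 f1 f2 t : I1 t -> sel f1 f2 t = f1 t.
  by move=> It; rewrite /sel !patchE mem_set// memNset ?addr0//; move=> [].
have sel2 f1 f2 t : ~ I1 t -> I2 t -> sel f1 f2 t = f2 t.
  by move=> It I2t; rewrite /sel !patchE memNset// mem_set ?add0r.
have sel0 f1 f2 t : ~ I1 t -> ~ I2 t -> sel f1 f2 t = 0.
  by move=> It I2t; rewrite /sel !patchE !memNset ?add0r//; move=> [].
have k : coord_of eh J v (fun k => sel (c1 k) (c2 k)) (sel M1 M2).
  split; first split.
  - move=> k; apply: measurable_funD.
      by apply/(measurable_restrictT _ m1); apply: measurable_funTS; exact: k1.1.1.
    by apply/(measurable_restrictT _ mD); apply: measurable_funTS; exact: k2.1.1.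
  - move=> t; have [It|It] := pselect (I1 t).
      rewrite sel1// (_ : sqsum _ = sqsum (c1 ^~ t)); first exact: k1.1.2.
      by apply/funext => n; apply: eq_bigr => k _; rewrite sel1.
    have [I2t|I2t] := pselect (I2 t).
      rewrite sel2// (_ : sqsum _ = sqsum (c2 ^~ t)); first exact: k2.1.2.
      by apply/funext => n; apply: eq_bigr => k _; rewrite sel2.
    rewrite sel0// (_ : sqsum _ = fun=> 0); first exact: cvg_cst.
    by apply/funext => n; rewrite /sqsum big1// => k _; rewrite sel0// expr0n.
  apply: (aeS3 _ cover k1.2 k2.2) => t hc h1 h2 Jt.
  have [It|It] := pselect (I1 t).
    by have [mv vc] := h1 It; split => // k; rewrite vc sel1.
  have I2t : I2 t by have [] := hc Jt.
  by have [mv vc] := h2 I2t; split => // k; rewrite vc sel2.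
apply: (coord_of_bochner_L2 hE hb mJ k).1.
have ext (A : set (measurableTypeR R)) (f : R -> R) : measurable A ->
    mu.-integrable A (EFin \o f) -> mu.-integrable setT (EFin \o (f \_ A)).
  by move=> mA /(integrable_mkcond _ mA); rewrite restrict_EFin.
have iD : mu.-integrable D (EFin \o M2) by apply: (integrableS m2 mD _ iM2) => t [].
exact: (integrableS measurableT mJ (@subsetT _ _) (integrableD_R measurableT (ext _ _ m1 iM1) (ext _ _ mD iD))).
Qed.

End bochner_cover.

(** * Convergence of the approximants in X_T *)

Section limit_in_spaces.
Variables (R : realType) (E : prehilbert R) (e : nat -> E) (lam : nat -> R) (T K d r : R).
Hypotheses (hE : prehilbert_axioms E) (cE : ph_complete E) (hb : ph_basis e).
Hypotheses (T0 : 0 < T) (K0 : 0 <= K) (d0 : 0 < d) (lam0 : forall k, 0 < lam k).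
Hypothesis lam_mono : {homo lam : i j / (i <= j)%N >-> i <= j}.
Hypothesis lamoo : lam k @[k --> \oo] --> +oo.
Variables (x0 : E) (phi : R -> E).
Hypotheses (mx0 : ph_mem x0) (phiL2 : bochner_L2 `]- r, 0[%classic phi).
Let mu := @lebesgue_measure R.
Let I : set (measurableTypeR R) := `]0, T[%classic.
Let mI : measurable I. Proof. exact: measurable_itv. Qed.
Let x k := ph_ip x0 (e k).
Let X := phnorm x0 ^+ 2.
Let xX : sqsum x n @[n --> \oo] --> X. Proof. exact: parseval_norm. Qed.
Let IT t : I t -> 0 <= t <= T.
Proof. by rewrite /I /= in_itv /= => /andP[/ltW -> /ltW ->]. Qed.

Let V := spectral_space e lam 2^-1.
Let V' := completion (spectral_space e lam (- 2^-1)).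

(** The scalar modes exist for every k, while the approximant of order [m] contains only the first
    [m] of them. *)
Definition truncation m (a : nat -> R -> R) k t : R := if (k < m)%N then a k t else 0.

Lemma measurable_truncation m a : (forall k, measurable_fun I (a k)) ->
  forall k, measurable_fun I (truncation m a k).
Proof.
by move=> ma k; rewrite /truncation; case: (k < m)%N; [exact: ma|exact: measurable_cst].
Qed.

Lemma sqsum_truncation_le m a al t n :
  sqsum (scaled lam al (truncation m a) ^~ t) n <= sqsum (scaled lam al a ^~ t) n.
Proof.
apply: ler_sum => k _; rewrite /scaled /truncation; case: (k < m)%N => //.
by rewrite mulr0 expr0n sqr_ge0.
Qed.

Lemma truncation_energy_le m a al B n : (forall k, measurable_fun I (a k)) ->
  (\int[mu]_(t in I) (sqsum (scaled lam al a ^~ t) n)%:E <= B%:E)%E ->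
  (\int[mu]_(t in I) (sqsum (scaled lam al (truncation m a) ^~ t) n)%:E <= B%:E)%E.
Proof.
move=> ma; apply: le_trans; apply: ge0_le_integral => //.
- by move=> t _; rewrite lee_fin; apply: sumr_ge0 => k _; exact: sqr_ge0.
- apply/measurable_EFinP; apply: measurable_sum => k; apply: measurable_funX.
  by apply: measurable_scaled; exact: measurable_truncation.
- apply/measurable_EFinP; apply: measurable_sum => k; apply: measurable_funX.
  exact: measurable_scaled.
- by move=> t _; rewrite lee_fin; exact: sqsum_truncation_le.
Qed.

Variables (w : nat -> nat -> R -> R) (c dc : nat -> nat -> R -> R) (m : nat -> nat).
Hypothesis mw : forall i k, measurable_fun I (w i k).
Hypothesis wK : forall i n s, I s -> sqsum (w i ^~ s) n <= K ^+ 2.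
Hypothesis cw : forall i k s, 0 < s < T -> {for s, continuous (w i k)}.
Hypothesis cm : forall i k t, 0 <= t -> c i k t = mode T d lam x (w i) k t.
Hypothesis dcm : forall i k t, 0 < t < T -> dc i k t = mode_dot T d lam x (w i) k t.
Hypothesis mi : forall i, (i <= m i)%N.

Definition approximant i (t : R) : E := \sum_(k < m i) c i k t *: e k.
Definition approximant_dot i (t : R) : V' :=
  completion_inj (\sum_(k < m i) dc i k t *: e k : spectral_space e lam (- 2^-1)).

Let al i := mode T d lam x (w i).
Let be i := mode_dot T d lam x (w i).
Let B1 := mode_bound T K lam X.
Let B2 := mode_dot_bound T K d lam X.

Let mal i k : measurable_fun I (al i k).
Proof. exact: (measurable_mode x T0 K0 d0 lam0 (mw i) (wK i)). Qed.
Let mbe i k : measurable_fun I (be i k).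
Proof. exact: (measurable_mode_dot x T0 K0 d0 lam0 (mw i) (wK i)). Qed.

Let B10 : 0 <= B1.
Proof.
have := mode_sqsum_le T0 K0 d0 lam0 lam_mono xX (mw 0) (wK 0) (@cw 0) 0 (t := 0).
by rewrite lexx ltW// /sqsum big_ord0; exact.
Qed.

Lemma approximant_coordinates i : has_coordinates e I (approximant i) (truncation (m i) (al i)).
Proof.
move=> t It; have [h1 h2] := has_coordinates_finite_sum hE hb (c i) (m i) It.
split => // k; rewrite h2 /truncation; case: ifP => // _; apply: cm.
by have /andP[] := IT It.
Qed.

Lemma approximant_dot_represents i :
  represents (@completion_basis_vec R E e lam (- 2^-1)) I (approximant_dot i)
    (scaled lam (- 2^-1) (truncation (m i) (be i))).
Proof.
move=> t It [B hB].
have dE k : scaled lam (- 2^-1) (truncation (m i) (be i)) k t =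
    scaled lam (- 2^-1) (fun k t => if (k < m i)%N then dc i k t else 0) k t.
  by rewrite /scaled /truncation; case: ifP => // _; rewrite dcm.
have [|h1 h2] := represents_finite_sum (al := - 2^-1) hE hb lam0 (a := dc i) (m := m i) It.
  exists B => n; apply: le_trans (hB n); rewrite le_eqVlt; apply/orP; left; apply/eqP.
  by apply: eq_bigr => k _; rewrite dE.
by split => // k; rewrite h2 dE.
Qed.

Lemma approximant_in_XT i : [/\ bochner_Linfty I (approximant i),
  @bochner_L2 R V I (approximant i) & bochner_L2 I (approximant_dot i)].
Proof.
have hcoord := approximant_coordinates i.
split.
- apply: (represents_bochner_Linfty hE hb mI (C := B1) (measurable_truncation (m i) (mal i)) B10 _ (represents_plain hcoord)).
  move=> t n It; apply: (@le_trans _ _ (sqsum (al i ^~ t) n)).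
    apply: ler_sum => k _; rewrite /truncation; case: (k < m i)%N => //.
    by rewrite expr0n sqr_ge0.
  exact: (mode_sqsum_le T0 K0 d0 lam0 lam_mono xX (mw i) (wK i) (@cw i) n (IT It)).
- have hr := represents_spectral (al := 2^-1) hE cE hb lam0 hcoord.
  have hS := spectral_space_axioms lam hE hb 2^-1; have hbS := spectral_space_basis hE hb lam0 2^-1.
  apply: (@represents_bochner_L2 R V (@spectral_basis R E e lam 2^-1) hS hbS I mI (approximant i)
    (scaled lam 2^-1 (truncation (m i) (al i))) B1) hr.
    by move=> k; apply: measurable_scaled; exact: measurable_truncation.
  move=> n; apply: truncation_energy_le => //.
  exact: (mode_energy_bound T0 K0 d0 lam0 lam_mono xX (mw i) (wK i) (@cw i)).
- have hr := @approximant_dot_represents i.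
  have hS := spectral_space_axioms lam hE hb (- 2^-1); have hbS := spectral_space_basis hE hb lam0 (- 2^-1).
  apply: (@represents_bochner_L2 R V' (@completion_basis_vec R E e lam (- 2^-1)) (completion_axioms hS)
    (completion_basis hS hbS) I mI (approximant_dot i)
    (scaled lam (- 2^-1) (truncation (m i) (be i))) B2) hr.
    by move=> k; apply: measurable_scaled; exact: measurable_truncation.
  move=> n; apply: truncation_energy_le => //.
  exact: (mode_dot_energy_bound T0 K0 d0 lam0 lam_mono xX (mw i) (wK i) (@cw i)).
Qed.

Section limit_function.
Variables (s : nat -> nat) (z : nat -> R -> R).
Hypothesis hs : {homo s : i j / (i < j)%N}.
Let ah := mode T d lam x z.
Let bh := mode_dot T d lam x z.
Hypotheses (mah : forall k, measurable_fun I (ah k)) (mbh : forall k, measurable_fun I (bh k)).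
Hypothesis cah : forall k, continuous (ah k).
Hypothesis al_ah : forall k t, al (s j) k t @[j --> \oo] --> ah k t.
Hypothesis ah_tail : forall n1 n2 t, 0 <= t <= T -> (n1 <= n2)%N ->
  \sum_(n1 <= k < n2) ah k t ^+ 2 <= mode_tail T K lam x X n1.
Hypothesis al_ah_weak : forall k psi, @ph_mem R (L2_on mu I) psi ->
  \int[mu]_(t in I) (al (s j) k t * psi t) @[j --> \oo] --> \int[mu]_(t in I) (ah k t * psi t).
Hypothesis be_bh_weak : forall k psi, @ph_mem R (L2_on mu I) psi ->
  \int[mu]_(t in I) (be (s j) k t * psi t) @[j --> \oo] --> \int[mu]_(t in I) (bh k t * psi t).
Hypothesis ah_parts : forall k psi, test_function 0 T psi ->
  \int[mu]_(t in I) (ah k t * derive1 psi t) = - \int[mu]_(t in I) (bh k t * psi t).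
Hypothesis ah_energy : forall n,
  (\int[mu]_(t in I) (sqsum (scaled lam 2^-1 ah ^~ t) n)%:E <= B1%:E)%E.
Hypothesis bh_energy : forall n,
  (\int[mu]_(t in I) (sqsum (scaled lam (- 2^-1) bh ^~ t) n)%:E <= B2%:E)%E.

Let ah_bound t n : 0 <= t <= T -> sqsum (ah ^~ t) n <= B1.
Proof.
move=> tT; have := ah_tail tT (leq0n n).
by rewrite /mode_tail big_mkord {1}/sqsum big_ord0 subr0.
Qed.

(** Riesz-Fischer is applied at every time of [0, T], not almost every one: the tail estimate holds
    pointwise, and continuity needs a definite value at each time. *)
Lemma limit_function : exists u : R -> E,
  (forall t, 0 <= t <= T -> ph_mem (u t) /\ forall k, ph_ip (u t) (e k) = ah k t) /\
  (forall t, t < 0 -> u t = phi t).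
Proof.
have H t : exists v : E, (0 <= t <= T -> ph_mem v /\ forall k, ph_ip v (e k) = ah k t) /\
    (t < 0 -> v = phi t).
  have [t0|t0] := ltP t 0; first by exists (phi t); split => //; rewrite leNgt t0.
  (* Beyond [T] the value 0 is a filler. *)
  have [tT|tT] := leP t T; last first.
    by exists 0; split=> // /andP[_]; rewrite leNgt tT.
  have [v mv hv] := @riesz_fischer_coord _ _ _ hE hb (ah ^~ t) B1 cE
    (fun n => @ah_bound t n (introT andP (conj t0 tT))).
  by exists v; split.
have [u hu] := choice H.
by exists u; split => t; [exact: (hu t).1|exact: (hu t).2].
Qed.

Variable u : R -> E.
Hypothesis u_ah : forall t, 0 <= t <= T -> ph_mem (u t) /\ forall k, ph_ip (u t) (e k) = ah k t.
Hypothesis u_phi : forall t, t < 0 -> u t = phi t.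

(** A member of the completion whenever the scaled coordinates at [t] are square summable, thus at
    almost every t of ]0, T[. *)
Definition limit_dot (t : R) : V' := fun j => \sum_(k < j) bh k t *: e k.

Let u_coord : has_coordinates e I u ah.
Proof. by move=> t It; exact: u_ah (IT It). Qed.

Lemma limit_in_XT : [/\ bochner_Linfty I u, @bochner_L2 R V I u & bochner_L2 I limit_dot].
Proof.
have hcoord := u_coord.
split.
- apply: (represents_bochner_Linfty hE hb mI (C := B1) mah B10 _ (represents_plain hcoord)).
  by move=> t n It; exact: ah_bound (IT It).
- have hr := represents_spectral (al := 2^-1) hE cE hb lam0 hcoord.
  have hS := spectral_space_axioms lam hE hb 2^-1; have hbS := spectral_space_basis hE hb lam0 2^-1.
  apply: (@represents_bochner_L2 R V (@spectral_basis R E e lam 2^-1) hS hbS I mI u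
    (scaled lam 2^-1 ah) B1) hr => //.
  by move=> k; exact: measurable_scaled.
- have hr := @represents_partial_sums R E e lam hE hb lam0 I (- 2^-1) bh.
  have hS := spectral_space_axioms lam hE hb (- 2^-1); have hbS := spectral_space_basis hE hb lam0 (- 2^-1).
  apply: (@represents_bochner_L2 R V' (@completion_basis_vec R E e lam (- 2^-1)) (completion_axioms hS)
    (completion_basis hS hbS) I mI limit_dot (scaled lam (- 2^-1) bh) B2) hr => //.
  by move=> k; exact: measurable_scaled.
Qed.

Lemma limit_time_derivative (v : E) (psi : R -> R) :
  @ph_mem R V v -> test_function 0 T psi ->
  \int[mu]_(t in I) (ph_ip (u t) v * derive1 psi t) =
  - \int[mu]_(t in I) (limn (fun j => @ph_ip R E (limit_dot t j) v) * psi t).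
Proof.
exact: (weak_derivative_coordinates hE hb lam0 T0 u_coord mah mbh
  (fun t n It => @ah_bound t n (IT It)) bh_energy ah_parts).
Qed.

(** Since m_i >= i and s_j >= j, truncation eventually spares each fixed mode, so it does not affect
    limits taken mode by mode. *)
Let sm j k : (k < j)%N -> (k < m (s j))%N.
Proof.
by move=> kj; apply: leq_trans (mi _); apply: leq_trans kj (increasing_seq_ge hs j).
Qed.

Let mtrunc (a : nat -> nat -> R -> R) : (forall i k, measurable_fun I (a i k)) ->
  forall be j k, measurable_fun I (scaled lam be (truncation (m (s j)) (a (s j))) k).
Proof. by move=> ma q j k; apply: measurable_scaled; exact: measurable_truncation. Qed.

Let weak_truncation q (a : nat -> nat -> R -> R) (a' : nat -> R -> R) k psi :
  (forall psi, @ph_mem R (L2_on mu I) psi ->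
    \int[mu]_(t in I) (a (s j) k t * psi t) @[j --> \oo] --> \int[mu]_(t in I) (a' k t * psi t)) ->
  @ph_mem R (L2_on mu I) psi ->
  \int[mu]_(t in I) (scaled lam q (truncation (m (s j)) (a (s j))) k t * psi t) @[j --> \oo] -->
  \int[mu]_(t in I) (scaled lam q a' k t * psi t).
Proof.
move=> h mpsi.
have mpsi' : @ph_mem R (L2_on mu I) (lam k `^ q *: psi).
  exact: (ph_memZ (L2_on_axioms mu mI)).
have := h _ mpsi'.
have -> : \int[mu]_(t in I) (a' k t * (lam k `^ q *: psi) t) =
    \int[mu]_(t in I) (scaled lam q a' k t * psi t).
  by congr Rintegral; apply/funext => t; rewrite /scaled; exact: mulrCA_scale.
apply: cvg_trans; apply: near_eq_cvg; exists k.+1 => // j /= kj.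
congr Rintegral; apply/funext => t; rewrite /scaled /truncation sm//; exact: mulrCA_scale.
Qed.

Lemma approximant_cvg : [/\ weakstar_cvg_Linfty I (fun j => approximant (s j)) u,
  @weak_cvg_L2 R V I (fun j => approximant (s j)) u &
  weak_cvg_L2 I (fun j => approximant_dot (s j)) limit_dot].
Proof.
have hcoord j := approximant_coordinates (s j).
split.
- apply: (weakstar_cvg_of_coordinates hE hb mI (C := B1)
    (gas := fun j => truncation (m (s j)) (al (s j))) (ga := ah)) => //.
  + by move=> j; exact: measurable_truncation.
  + move=> j t n It; apply: (@le_trans _ _ (sqsum (al (s j) ^~ t) n)).
      apply: ler_sum => k _; rewrite /truncation; case: (k < m (s j))%N => //.
      by rewrite expr0n sqr_ge0.
    exact: (mode_sqsum_le T0 K0 d0 lam0 lam_mono xX (mw (s j)) (wK (s j)) (@cw (s j)) n (IT It)).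
  + by move=> t n It; exact: ah_bound (IT It).
  + by move=> j; exact: represents_plain.
  + exact: represents_plain u_coord.
  + move=> k t It; have := @al_ah k t; apply: cvg_trans; apply: near_eq_cvg.
    by exists k.+1 => // j /= kj; rewrite /truncation sm.
- have hS := spectral_space_axioms lam hE hb 2^-1; have hbS := spectral_space_basis hE hb lam0 2^-1.
  apply: (@weak_cvg_of_coordinates R V (@spectral_basis R E e lam 2^-1) hS hbS I mI
    (fun j => approximant (s j)) u (fun j => scaled lam 2^-1 (truncation (m (s j)) (al (s j))))
    (scaled lam 2^-1 ah) B1 (mtrunc mal 2^-1)).
  + by move=> k; exact: measurable_scaled.
  + move=> j n; apply: truncation_energy_le => //.
    exact: (mode_energy_bound T0 K0 d0 lam0 lam_mono xX (mw (s j)) (wK (s j)) (@cw (s j))).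
  + exact: ah_energy.
  + by move=> j; exact: (represents_spectral (al := 2^-1) hE cE hb lam0 (hcoord j)).
  + exact: (represents_spectral (al := 2^-1) hE cE hb lam0 u_coord).
  + move=> k psi; exact: (@weak_truncation 2^-1 al ah k psi (@al_ah_weak k)).
- have hS := spectral_space_axioms lam hE hb (- 2^-1); have hbS := spectral_space_basis hE hb lam0 (- 2^-1).
  apply: (@weak_cvg_of_coordinates R V' (@completion_basis_vec R E e lam (- 2^-1)) (completion_axioms hS)
    (completion_basis hS hbS) I mI (fun j => approximant_dot (s j)) limit_dot
    (fun j => scaled lam (- 2^-1) (truncation (m (s j)) (be (s j))))
    (scaled lam (- 2^-1) bh) B2 (mtrunc mbe (- 2^-1))).
  + by move=> k; exact: measurable_scaled.
  + move=> j n; apply: truncation_energy_le => //.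
    exact: (mode_dot_energy_bound T0 K0 d0 lam0 lam_mono xX (mw (s j)) (wK (s j)) (@cw (s j))).
  + exact: bh_energy.
  + by move=> j; exact: approximant_dot_represents.
  + exact: represents_partial_sums.
  + move=> k psi; exact: (@weak_truncation (- 2^-1) be bh k psi (@be_bh_weak k)).
Qed.

Lemma limit_bochner_L2 : bochner_L2 `]- r, T[%classic u.
Proof.
have mh : measurable (`]- r, 0[%classic : set (measurableTypeR R)) by exact: measurable_itv.
have mJ : measurable (`]- r, T[%classic : set (measurableTypeR R)) by exact: measurable_itv.
apply: (bochner_L2_cover hE hb mh mI mJ).
- apply: bochner_L2_eq phiL2 => t; rewrite /= in_itv /= => /andP[_]; exact: u_phi.
- apply: (represents_bochner_L2 hE hb mI mah (C := B1 * T) _ (represents_plain u_coord)).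
  move=> n.
  have -> : (B1 * T)%:E = (\int[mu]_(t in I) B1%:E)%E.
    have muI : mu I = (if (0%:E < T%:E)%E then (T%:E - 0%:E)%E else 0%E).
      exact: lebesgue_measure_itv.
    have -> : (B1 * T)%:E = (B1%:E * mu I)%E by rewrite muI lte_fin T0 sube0.
    by rewrite -(integral_cst mu mI).
  apply: ge0_le_integral => //.
  + by move=> t _; rewrite lee_fin; apply: sumr_ge0 => k _; exact: sqr_ge0.
  + by apply/measurable_EFinP; apply: measurable_sum => k; exact: measurable_funX.
  + by move=> t It; rewrite lee_fin; exact: ah_bound (IT It).
- exists [set 0]; split => //; first exact: lebesgue_measure_set1.
  move=> t /= h; apply: contrapT => t0; apply: h; rewrite /= in_itv /= => /andP[rt tT].
  have [tn|tp|te] := ltgtP t 0.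
  + by left; rewrite in_itv /= rt tn.
  + by right; rewrite /I /= in_itv /= tp tT.
  + by case: t0.
Qed.

Lemma limit_continuous : continuous_on_segment 0 T u.
Proof.
move=> t; rewrite in_itv /= => tT; have [mut ut] := u_ah tT; split => //.
(* Parseval for the difference, cut at n: beyond n, (a - b)^2 <= 2 a^2 + 2 b^2 and both tails are at
   most [mode_tail], which does not depend on the time. *)
have key q n : 0 <= q <= T -> phnorm (u q - u t) ^+ 2 <=
    \sum_(k < n) (ah k q - ah k t) ^+ 2 + 4 * mode_tail T K lam x X n.
  move=> qT; have [muq uq] := u_ah qT.
  have mm : ph_mem (u q - u t) by exact: (ph_memB hE).
  have pc k : ph_ip (u q - u t) (e k) = ah k q - ah k t.
    by rewrite (ph_ipBl hE)// ?uq ?ut//; exact: (ph_basis_mem hb).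
  apply: (cvgr_to_le (parseval_norm hE hb mm)); exists n => // n' /= nn'.
  rewrite (eq_bigr (fun k : 'I_n' => (ah k q - ah k t) ^+ 2)); last by move=> k _; rewrite pc.
  rewrite (sum_ord_tail (fun k => (ah k q - ah k t) ^+ 2) nn') lerD2l.
  apply: (@le_trans _ _ (\sum_(n <= k < n') (2 * ah k q ^+ 2 + 2 * ah k t ^+ 2))).
    apply: ler_sum => k _; have := sqr_ge0 (ah k q + ah k t).
    by move: (ah k q) (ah k t) => a1 a2; nra.
  rewrite big_split /= -!mulr_sumr.
  have h1 := ah_tail qT nn'; have h2 := ah_tail tT nn'.
  by move: h1 h2; set p1 := \sum_(_ <= _ < _) _; set p2 := \sum_(_ <= _ < _) _; lra.
apply/cvgr0Pnorm_le => ep ep0.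
(* One eighth for the first n modes and four eighths for the tails add up to less than ep^2. *)
have ep2 : 0 < ep ^+ 2 / 8 by rewrite divr_gt0// exprn_gt0.
have tail0 : mode_tail T K lam x X n @[n --> \oo] --> (0 : R) by exact: mode_tail_cvg.
have /cvgr0Pnorm_le/(_ _ ep2)[n _ /(_ n (leqnn n)) hn] := tail0.
have hc : \sum_(k < n) (ah k q - ah k t) ^+ 2 @[q --> t] --> \sum_(k < n) (ah k t - ah k t) ^+ 2.
  apply: (@cvg_sum_ord_filter R _ _ _ n (fun k q => (ah k q - ah k t) ^+ 2)
    (fun k => (ah k t - ah k t) ^+ 2)) => k.
  have h : ah k q - ah k t @[q --> t] --> ah k t - ah k t.
    by apply: cvgB; [exact: cah|exact: cvg_cst].
  by rewrite expr2; apply: cvg_trans (cvgM h h); apply: near_eq_cvg; apply: nearW => q; rewrite expr2.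
have c0 : \sum_(k < n) (ah k t - ah k t) ^+ 2 = 0.
  by rewrite big1// => k _; rewrite subrr expr0n.
rewrite c0 in hc.
have /cvgr0Pnorm_le/(_ _ ep2) hc' := hc.
rewrite near_withinE; apply: filterS hc' => q hq; rewrite /= in_itv /= => qT.
rewrite ger0_norm ?phnorm_ge0// -(@ler_pXn2r _ 2)// ?nnegrE ?phnorm_ge0 ?(ltW ep0)//.
apply: le_trans (key q n qT) _.
have := le_trans (ler_norm _) hq; have := le_trans (ler_norm _) hn.
set p1 := mode_tail _ _ _ _ _ _; set p2 := \sum_(_ < _) _; lra.
Qed.

End limit_function.

Lemma approximants_subsequence_cvg : exists (s : nat -> nat) (u : R -> E) (du : R -> V'),
  [/\ {homo s : i j / (i < j)%N} /\ (forall t, t < 0 -> u t = phi t),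
      [/\ bochner_Linfty I u, @bochner_L2 R V I u & bochner_L2 I du] /\
        bochner_L2 `]- r, T[%classic u,
      forall (v : E) (psi : R -> R), @ph_mem R V v -> test_function 0 T psi ->
        \int[mu]_(t in I) (ph_ip (u t) v * derive1 psi t) =
        - \int[mu]_(t in I) (limn (fun j => @ph_ip R E (du t j) v) * psi t),
      [/\ weakstar_cvg_Linfty I (fun j => approximant (s j)) u,
        @weak_cvg_L2 R V I (fun j => approximant (s j)) u &
        weak_cvg_L2 I (fun j => approximant_dot (s j)) du] &
      continuous_on_segment 0 T u].
Proof.
have [s hs [z [[mah mbh] [cah al_ah] [tails wal] [wbe parts] [en end_]]]] :=
  mode_limit T0 K0 d0 lam0 lam_mono xX mw wK cw.
have [u [uah uphi]] := limit_function tails.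
exists s, u, (limit_dot z); split.
- by split.
- split; first exact: (@limit_in_XT z mah mbh tails en end_ u uah).
  exact: (@limit_bochner_L2 z mah tails u uah uphi).
- move=> v psi; exact: (@limit_time_derivative z mah mbh tails parts end_ u uah).
- exact: (@approximant_cvg s z hs mah mbh al_ah tails wal wbe en end_ u uah).
- exact: (@limit_continuous z cah tails u uah).
Qed.

End limit_in_spaces.

(** * The initial history and the existence theorem *)

(** The equation is solved with Borel versions of the coordinates of [phi], extended by 0; they are
    right at almost every time, in keeping with the initial condition of a Galerkin solution. *)
Lemma history_coordinates (R : realType) (E : prehilbert R) (e : nat -> E) (r : R) (phi : R -> E)
    (J : set (measurableTypeR R)) :
  prehilbert_axioms E -> ph_basis e -> measurable J -> bochner_L2 `]- r, 0[%classic phi ->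
  exists h : nat -> R -> R,
  [/\ forall k, measurable_fun setT (h k : measurableTypeR R -> R),
      forall k, (@lebesgue_measure R).-integrable J (EFin \o (fun s => h k s ^+ 2)) &
      {ae @lebesgue_measure R, forall s, s \in `]- r, 0[ -> forall k, ph_ip (phi s) (e k) = h k s}].
Proof.
move=> hE hb mJ phiL2.
have mI : measurable (`]- r, 0[%classic : set (measurableTypeR R)) by exact: measurable_itv.
have [c [M cM]] := strongly_measurable_coord hE hb mI phiL2.1.
have iM := (coord_of_bochner_L2 hE hb mI cM).2 phiL2.
have bc := cM.1.
pose h k : R -> R := c k \_ `]- r, 0[.
have mh k : measurable_fun setT (h k : measurableTypeR R -> R).
  by apply/(measurable_restrictT _ mI); apply: measurable_funTS; exact: bc.1.
exists h; split => // [k|].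
- have iM0 : (@lebesgue_measure R).-integrable J (EFin \o (M \_ `]- r, 0[)).
    apply: (integrableS measurableT mJ (@subsetT _ _)).
    by move: iM => /(integrable_mkcond _ mI); rewrite restrict_EFin.
  apply: (le_integrable_R mJ _ _ iM0); first by apply: measurable_funTS; exact: measurable_funX.
  move=> s _; rewrite ger0_norm ?sqr_ge0// /h !patchE; case: ifPn => _; last by rewrite expr0n.
  by have := sqsum_le k.+1 (bc.2 s); apply: le_trans; rewrite /sqsum big_ord_recr /= lerDr;
    apply: sumr_ge0 => i _; exact: sqr_ge0.
- move: cM.2; apply: filterS => s hs sr k; rewrite /h patchE mem_set//.
  by have [_ ->] := hs sr.
Qed.

Theorem theorem4 (R : realType) (n0 : nat) (Om : set 'rV[R]_n0)
  (DA : set (L2 Om)) (A : L2 Om -> L2 Om)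
  (e : nat -> L2 Om) (lam : nat -> R) (d r : R) (eps : nat -> R)
  (b : R -> R) (f : 'rV[R]_n0 -> R) (eta : L2 Om -> (R -> L2 Om) -> R) :
  (0 < n0)%N -> smooth_bounded_domain Om ->
  linear_operator DA A -> densely_defined DA -> self_adjoint DA A ->
  positive_operator DA A -> compact_resolvent DA A ->
  orthonormal_basis e -> eigenpairs DA A e lam ->
  (forall k, 0 < lam k) -> {homo lam : i j / (i <= j)%N >-> i <= j} ->
  lam k @[k --> \oo] --> +oo ->
  0 < d -> 0 < r ->
  (forall N, 0 < eps N) -> eps N @[N --> \oo] --> (0 : R) ->
  (* (i) *)
  [locally [lipschitz b w | w in [set: R]]] ->
  (exists Cb : R, forall w, `|b w| <= Cb) ->
  (* (ii) *)
  (exists Cf : R, forall z, difference_set Om z -> `|f z| <= Cf) ->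
  lebesgue_measurable_on (difference_set Om) f ->
  (* (iii) *)
  (forall v psi, in_H r v psi -> 0 <= eta v psi <= r) ->
  locally_lipschitz_H r eta ->
  forall (u0 : L2 Om) (phi : R -> L2 Om), in_H r u0 phi ->
  forall T : R, 0 < T ->
  exists u : R -> L2 Om,
    weak_limiting_solution A r eps b f eta e lam d T u0 phi u /\
    continuous_on_segment 0 T u.
Proof.
move=> _ [oOm _ _ bOm _] lA _ sA _ _ [me oe te] eA lam0 lam_mono lamoo d0 r0 eps0 _ blip
  [Cb bC] fb fm _ eta_lip u0 phi [mu0 phiL2] T T0.
have mOm : measurable Om by exact: open_measurable_rV.
have Omoo := bounded_rV_lebesgue_lty bOm mOm.
have hE : prehilbert_axioms (L2 Om) by exact: (L2_on_axioms (rV_lebesgue R n0) mOm).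
have cE : ph_complete (L2 Om) by exact: (@L2_on_complete _ _ R (rV_lebesgue R n0) Om mOm).
have hb : ph_basis e by split.
have cb := continuous_of_locally_lipschitz blip.
have [ker [Cf [mker kerC kerE]]] := convolution_kernel fb fm.
have mJ : measurable (`[- r - 1, T + 1]%classic : set (measurableTypeR R)) by exact: measurable_itv.
have [h [mh ih hphi]] := history_coordinates hE hb mJ phiL2.
pose K := Cb * Cf * fine (rV_lebesgue R n0 Om) * Num.sqrt (fine (rV_lebesgue R n0 Om)).
(* The bound of [duhamel_le], common to all modes because each coordinate of [u0] is at most its
   norm. *)
pose C := phnorm u0 + K * T.
have hG N m : forcing_axioms h C T K (forcing e r eps b f eta N m).
  exact: (forcing_axiomsP mOm Omoo hb r0 eps0 cb bC mker kerC kerE eta_lip C N m ih).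
have K0 : 0 <= K.
  have Cb0 : 0 <= Cb by apply: le_trans (normr_ge0 _) (bC 0).
  have Cf0 : 0 <= Cf by apply: le_trans (normr_ge0 _) (kerC (0, 0)).
  by rewrite /K !mulr_ge0 ?sqrtr_ge0 ?fine_ge0.
pose ga k := lam k + d; pose x k := ph_ip u0 (e k).
have ga0 k : 0 < ga k by rewrite addr_gt0.
have u0C k : `|x k| + K * T <= C.
  rewrite lerD2r; apply: le_trans (cauchy_schwarz hE mu0 (me k)) _.
  by rewrite {2}/phnorm oe eqxx sqrtr1 mulr1.
have /choice[c hc] : forall i, exists c, [/\ regular T C h c,
    continuous_inside T (forcing e r eps b f eta i i c) & forall k t, 0 <= t ->
    c k t = duhamel T (ga k) (x k) (forcing e r eps b f eta i i c k) 0 t].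
  by move=> i; exact: (mild_solution_exists T0 K0 ga0 mh u0C (hG i i)).
have gal i : galerkin_solution A r eps b f eta e d T u0 phi i i (c i).
  have [rc cG cmild] := hc i.
  apply: (galerkin_solution_of_mild mOm hb lA sA eA T0 r0 K0 ga0 (hG i i) ih hphi rc cG cmild).
  have [[mc _ _] _] := rc; move=> t.
  exact: (F_mem mOm Omoo hb r eta eps0 cb bC mker kerC kerE).
pose w i := forcing e r eps b f eta i i (c i).
pose dc i k := derive1 (c i k).
have mw i k : measurable_fun `]0, T[%classic (w i k : measurableTypeR R -> R).
  by have [[ac cc] _ _] := hc i; exact: (forcing_measurable (hG i i)).
have wK i n s : `]0, T[%classic s -> sqsum (w i ^~ s) n <= K ^+ 2.
  rewrite /= in_itv /= => sT; have [[ac _] _ _] := hc i.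
  exact: (forcing_sum_le (hG i i) n ac sT).
have cw i k s : 0 < s < T -> {for s, continuous (w i k)}.
  by have [_ cG _] := hc i; exact: cG.
have cm i k t : 0 <= t -> c i k t = mode T d lam x (w i) k t.
  by have [_ _ h3] := hc i; exact: h3.
have dcm i k t : 0 < t < T -> dc i k t = mode_dot T d lam x (w i) k t.
  have [rc cG cmild] := hc i => tT.
  rewrite /dc (mild_derive1 ga0 (hG i i) K0 rc cG cmild k tT).
  by rewrite /mode_dot /mode_derivative (cmild k t)//; have /andP[/ltW] := tT.
have inXT i := approximant_in_XT hE cE hb T0 K0 d0 lam0 lam_mono mu0 id mw wK cw cm dcm i.
have [s [u [du [[hs uphi] [uXT uL2] uder ucvg ucont]]]] :=
  approximants_subsequence_cvg hE cE hb T0 K0 d0 lam0 lam_mono lamoo mu0 phiL2 mw wK cw cm dcm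
    (m := id) (fun i => leqnn i).
exists u; split; last exact: ucont.
exists du; split.
- by split.
- exact: uder.
- apply: aeW => t; rewrite in_itv /= => /andP[_ t0]; rewrite uphi// /pheq subrr.
  exact: (phnorm0 hE).
- exists s, s, (fun j => c (s j)); split.
  + by under eq_fun do rewrite minnn; exact: increasing_seq_cvg.
  + by move=> i; exact: gal.
  + by move=> i; exact: inXT.
  + exact: ucvg.
Qed.
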